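(* 0-1-Knapsack on $n$ items with distinct profit-to-weight ratios can be solved in time $\widetilde{O}(n + w_{\max}^2)$, where $w_{\max} = \max_i w_i$.
   Context: 0-1-Knapsack: given profits $p \in \mathbb{N}^n$, weights $w \in \mathbb{N}^n$ and budget $W \in \mathbb{N}$, compute $\max\{p^T x : w^T x \le W,\ x \in \{0,1\}^n\}$. Distinct profit-to-weight ratios means $p_i/w_i \ne p_j/w_j$ for $i \ne j$. $\widetilde{O}(T) = \bigcup_{c\ge0} O(T\log^c T)$. *)

(* Defs.v *)
From mathcomp Require Import all_boot all_order all_algebra.

Set Implicit Arguments.
Unset Strict Implicit.
Unset Printing Implicit Defensive.

(** * 0-1-Knapsack *)

Record knapsack := Knapsack {
  nitems : nat;
  profit : 'I_nitems -> nat;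
  weight : 'I_nitems -> nat;
  budget : nat }.

(* The all-zero selection is always feasible, so the default value 0 of \max
   never matters. *)
Definition knapsack_opt (I : knapsack) : nat :=
  \max_(x : {ffun 'I_(nitems I) -> bool} |
          \sum_(i < nitems I) weight i * x i <= budget I)
     \sum_(i < nitems I) profit i * x i.

Definition wmax (I : knapsack) : nat := \max_(i < nitems I) weight i.
Definition pmax (I : knapsack) : nat := \max_(i < nitems I) profit i.

(* In rat, x / 0 = 0: this is meant for instances with positive weights. *)
Definition ratio (I : knapsack) (i : 'I_(nitems I)) : rat :=
  ((profit i)%:R / (weight i)%:R)%R.

Definition positive_weights (I : knapsack) : Prop :=
  forall i : 'I_(nitems I), 0 < weight i.

Definition distinct_ratios (I : knapsack) : Prop :=
  forall i j : 'I_(nitems I), i != j -> ratio i != ratio j.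

(** * Asymptotic notation *)

Definition bigO (g f : nat -> nat) : Prop :=
  exists C T0, forall T, T0 <= T -> f T <= C * g T.

(* The base and the rounding of the logarithm only affect constant factors. *)
Definition softO_id (f : nat -> nat) : Prop :=
  exists c, bigO (fun T => T * trunc_log 2 T ^ c) f.

(** * The word RAM *)

(* Programs are structured (while) programs over registers and memory banks.
   Register and bank names are literals of the program, so a program uses only
   finitely many of them; cells inside a bank are addressed indirectly by
   computed words. Finitely many banks can be interleaved into one memory, and
   jumps can be traded for loops, with constant-factor overhead.

   For word length b, words are the naturals below 2 ^ b. There is no
   wrap-around: a program whose literals or intermediate results do not fit in
   a word, or which divides by 0, gets stuck and has no execution. Hence
   increasing b never changes the outcome or the running time of an
   execution. *)

Variant binop := OpAdd | OpSub | OpMul | OpDiv | OpMod | OpEq | OpLt.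

Inductive expr :=
  | Lit of nat
  | Reg of nat
  | Get of nat & expr               (* bank, address *)
  | Bin of binop & expr & expr.

Inductive prog :=
  | Skip
  | Assign of nat & expr            (* register, value *)
  | Put of nat & expr & expr        (* bank, address, value *)
  | Seq of prog & prog
  | If of expr & prog & prog
  | While of expr & prog.

Record state := State { regs : nat -> nat; mem : nat -> nat -> nat }.

Definition update (A : Type) (f : nat -> A) (k : nat) (v : A) : nat -> A :=
  fun j => if j == k then v else f j.

Definition set_reg (s : state) (r v : nat) : state :=
  State (update (regs s) r v) (mem s).

Definition set_mem (s : state) (a i v : nat) : state :=
  State (regs s) (update (mem s) a (update (mem s a) i v)).

(* OpSub is truncated at 0. *)
Definition apply_binop (o : binop) (x y : nat) : option nat :=
  match o with
  | OpAdd => Some (x + y)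
  | OpSub => Some (x - y)
  | OpMul => Some (x * y)
  | OpDiv => if y == 0 then None else Some (x %/ y)
  | OpMod => if y == 0 then None else Some (x %% y)
  | OpEq => Some (nat_of_bool (x == y))
  | OpLt => Some (nat_of_bool (x < y))
  end.

Definition as_word (b v : nat) : option nat :=
  if v < 2 ^ b then Some v else None.

Fixpoint eval (b : nat) (s : state) (e : expr) : option nat :=
  match e with
  | Lit k => as_word b k
  | Reg r => Some (regs s r)
  | Get a e1 => omap (mem s a) (eval b s e1)
  | Bin o e1 e2 =>
      obind (fun x => obind (fun y => obind (as_word b) (apply_binop o x y))
                            (eval b s e2))
            (eval b s e1)
  end.

(* Every literal, register access, memory access and operation costs 1. *)
Fixpoint cost (e : expr) : nat :=
  match e with
  | Lit _ | Reg _ => 1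
  | Get _ e1 => (cost e1).+1
  | Bin _ e1 e2 => (cost e1 + cost e2).+1
  end.

(* exec b c s s' t: with word length b, c started in s halts in s' after t
   steps. *)
Inductive exec (b : nat) : prog -> state -> state -> nat -> Prop :=
  | ExecSkip s : exec b Skip s s 1
  | ExecAssign r e s v :
      eval b s e = Some v ->
      exec b (Assign r e) s (set_reg s r v) (cost e).+1
  | ExecPut a e1 e2 s i v :
      eval b s e1 = Some i -> eval b s e2 = Some v ->
      exec b (Put a e1 e2) s (set_mem s a i v) (cost e1 + cost e2).+1
  | ExecSeq c1 c2 s s1 s2 t1 t2 :
      exec b c1 s s1 t1 -> exec b c2 s1 s2 t2 ->
      exec b (Seq c1 c2) s s2 (t1 + t2)
  | ExecIf e c1 c2 s s1 v t :
      eval b s e = Some v ->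
      exec b (if v != 0 then c1 else c2) s s1 t ->
      exec b (If e c1 c2) s s1 (cost e + t).+1
  | ExecWhileF e c s :
      eval b s e = Some 0 ->
      exec b (While e c) s s (cost e).+1
  | ExecWhileT e c s s1 s2 v t1 t2 :
      eval b s e = Some v -> v != 0 ->
      exec b c s s1 t1 -> exec b (While e c) s1 s2 t2 ->
      exec b (While e c) s s2 (cost e + t1 + t2).+1.

Lemma exec_det b c s s1 s2 t1 t2 :
  exec b c s s1 t1 -> exec b c s s2 t2 -> s1 = s2 /\ t1 = t2.
Proof.
move=> H; elim: H s2 t2 => {c s s1 t1};
  [ move=> s | move=> r e s v Ev | move=> a e1 e2 s i v E1 E2
  | move=> c1 c2 s s1 s2 t1 t2 _ IH1 _ IH2 | move=> e c1 c2 s s1 v t Ev _ IH1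
  | move=> e c s Ev | move=> e c s s1 s2 v t1 t2 Ev vN0 _ IH1 _ IH2 ];
  move=> s' t' H; inversion H; subst;
  repeat match goal with
  | E : eval ?b ?s ?e = Some _, F : eval ?b ?s ?e = Some _ |- _ =>
      move: F; rewrite E => -[?]; subst
  end; rewrite //=;
  repeat match goal with
  | IH : forall s t, exec ?b ?c ?s0 s t -> _, E : exec ?b ?c ?s0 _ _ |- _ =>
      case: (IH _ _ E) => ? ?; subst; clear E
  end; by [].
Qed.

(** * Solving Knapsack on the word RAM *)

(* Input: registers 0 and 1 hold n and W, banks 0 and 1 hold p and w (indexed
   from 0); everything else is 0. *)
Definition input_array (n : nat) (f : 'I_n -> nat) (k : nat) : nat :=
  if insub k is Some i then f i else 0.

Definition init_state (I : knapsack) : state :=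
  State (fun r => match r with
                  | 0 => nitems I
                  | 1 => budget I
                  | _ => 0
                  end)
        (fun a => match a with
                  | 0 => input_array (@profit I)
                  | 1 => input_array (@weight I)
                  | _ => fun=> 0
                  end).

(* Number of bits needed to store any single input number or item index; the
   + 2 makes it at least 1. *)
Definition input_bits (I : knapsack) : nat :=
  up_log 2 (nitems I + budget I + pmax I + wmax I + 2).

(* Knapsack restricted to the instances in D can be solved in time Otilde(T):
   one fixed program outputs the optimum in register 0, on every word RAM whose
   word length is at least a constant multiple of input_bits. *)
Definition solvable_in_softO (D : knapsack -> Prop) (T : knapsack -> nat) :
    Prop :=
  exists (c : prog) (kappa : nat) (f : nat -> nat),
    softO_id f /\
    forall (I : knapsack) (b : nat),
      D I -> kappa * input_bits I <= b ->
      exists (s : state) (t : nat),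
        [/\ exec b c (init_state I) s t,
            regs s 0 = knapsack_opt I
          & t <= f (T I)].

(* Main.v *)
Require Import Defs.
From mathcomp Require Import all_boot all_order all_algebra zify.

Set Implicit Arguments.
Unset Strict Implicit.
Unset Printing Implicit Defensive.

(* Sort the items by decreasing ratio and let the greedy solution be the longest
   fitting prefix.  Items that an optimum drops from the prefix and items that
   it adds beyond the break have no common nonempty subset sum, since swapping
   two sets of equal weight would gain profit (the ratios are distinct).  On the
   other hand, a set with many different, often repeated weights has a long
   arithmetic progression of subset sums (by an argument of Olson on translates
   in cyclic groups), and then shares a subset sum with every heavy set.  So,
   up to logarithmic factors, for every j all but about w_max / 2^j weights,
   namely those that occur often next to the break, change in total by at most
   2^j w_max.

   Accordingly, weights are sorted into levels, and a table of profits, indexed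
   by the change of weight relative to the greedy solution, is updated weight by
   weight, within a window of about 2^j w_max entries for a weight of level j.
   Items of one weight are used in order of profit, so that one update is a
   max-plus convolution with a concave sequence, which takes nearly linear time
   because the maximizers are monotone.  Each of the logarithmically many levels
   costs about (w_max / 2^j) (2^j w_max) = w_max^2. *)

(** * Translates in finite abelian groups *)

(** Copies of a value run out, so each growth step may rely only on a subset of [Y] that has lost a
    fraction 1/(8l) of its values. Hence [Y] is first made extremal: it lies in one class mod [g],
    and no finer class contains almost all of it; then every such subset still generates the
    multiples of [g]. Passing from a progression of difference [d] to one of difference [g] needs a
    first progression. Two values with many copies give one at once. With many values of few copies,
    one takes the differences of disjoint pairs of close values: they are so small that some occur
    often. Thus only the product of the number of values and the multiplicity has to be large. The
    arithmetic assumes [l >= 256], so that a numerical factor up to 256 costs one more factor [l];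
    the large exponents collect such losses. The supply of items of one weight is finite at both
    ends. Their profits are continued with slopes [BIG] and [-BIG], where [BIG] exceeds the total
    profit: the sequence stays concave, and an entry built from missing items falls below [BIG], so
    it is never mistaken for a gain. *)

Section Olson.
Variable G : finZmodType.
Import GRing.Theory.
Local Open Scope ring_scope.

Definition translate (B : {set G}) (x : G) : {set G} := [set b + x | b in B].
Definition escape (B : {set G}) (x : G) : nat := #|translate B x :\: B|.

Lemma card_translate B x : #|translate B x| = #|B|.
Proof. by apply: card_imset; apply: addIr. Qed.

Lemma mem_translate B x z : (z \in translate B x) = (z - x \in B).
Proof.
apply/imsetP/idP => [[b bB ->]|zB]; first by rewrite addrK.
by exists (z - x) => //; rewrite subrK.
Qed.

(** An element of [B + x + y] outside [B] either lies in [B + y], and escapes under [y], or is the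
    translate by [y] of an element that escapes under [x]. *)
Lemma escapeD B x y : (escape B (x + y)%R <= escape B x + escape B y)%N.
Proof.
rewrite /escape -(card_translate (translate B x :\: B) y) -cardsUI.
apply: leq_trans (leq_addr _ _); apply: subset_leq_card; apply/subsetP => z.
rewrite !inE !mem_translate !inE !mem_translate opprD addrA => /andP[zB].
rewrite (addrAC z) => zxy; rewrite zB zxy /= andbT.
by case: (z - y \in B).
Qed.


Lemma card_translateU B x y :
  #|translate B x :|: translate B y| = (#|B| + escape B (x - y)%R)%N.
Proof.
have -> : translate B x :|: translate B y =
          translate B y :|: (translate B x :\: translate B y).
  by apply/setP=> z; rewrite !inE; case: (z \in translate B y); rewrite ?orbT ?orbF.
rewrite cardsU card_translate (_ : _ :&: _ = set0) ?cards0 ?subn0; last first.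
  by apply/setP=> z; rewrite !inE; case: (z \in translate B y).
congr (_ + _)%N; rewrite /escape -(card_translate (translate B (x - y) :\: B) y).
congr #|pred_of_set _|; apply/setP => z.
by rewrite !inE !mem_translate !inE !mem_translate opprB addrA subrK.
Qed.

(** Differences instead of elements of [R]: since 0 is a difference, these sets increase with [j],
    and they depend on [R] only up to translation. *)
Fixpoint dspan (R : {set G}) (j : nat) : {set G} :=
  if j is i.+1 then
    [set t + d | t in dspan R i, d in [set x - y | x in R, y in R]]
  else [set 0].

Variables R H : {set G}.
Hypothesis R_gt0 : (0 < #|R|)%N.
(** This puts [H] inside the subgroup generated by the differences of [R], phrased as an induction
    principle so that no subgroup has to be constructed. *)
Hypothesis genH : forall Q : {set G}, 0 \in Q ->
  (forall q x y, q \in Q -> x \in R -> y \in R -> q + (x - y) \in Q) ->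
  H \subset Q.

Lemma dspanS j t x y : t \in dspan R j -> x \in R -> y \in R ->
  t + (x - y) \in dspan R j.+1.
Proof. by move=> tj xR yR; apply: imset2_f => //; apply: imset2_f. Qed.

Lemma dspanS_inv j z : z \in dspan R j.+1 ->
  exists t x y, [/\ t \in dspan R j, x \in R, y \in R & z = t + (x - y)].
Proof.
case/imset2P => t d tj /imset2P[x y xR yR ->] ->.
by exists t, x, y.
Qed.

Lemma dspan_subS j : dspan R j \subset dspan R j.+1.
Proof.
case/card_gt0P: R_gt0 => r rR; apply/subsetP => z zj.
by rewrite -[z]addr0 -(subrr r); apply: dspanS.
Qed.

Lemma dspan_sub i j : (i <= j)%N -> dspan R i \subset dspan R j.
Proof.
move=> /subnK <-; elim: (j - i)%N => // n IH.
by apply: subset_trans IH _; rewrite addSn; apply: dspan_subS.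
Qed.

Lemma dspan0 j : 0 \in dspan R j.
Proof. by apply: (subsetP (dspan_sub (leq0n j))); rewrite inE. Qed.

Lemma dspan_stuck j : dspan R j.+1 \subset dspan R j -> H \subset dspan R j.
Proof.
move=> /subsetP st; apply: genH; first exact: dspan0.
by move=> q x y qj xR yR; apply: st; apply: dspanS.
Qed.

(** Unless growth has stopped, three steps add a whole new copy of [R]: an element [z] of step
    [3j+2] missing from step [3j+1] yields the translate [z + (R - r)], which lies in step [3j+3]
    and avoids step [3j], since otherwise [z] would be reached in step [3j+1]. *)
Lemma card_dspan j :
  (H \subset dspan R (3 * j)) \/ (j * #|R| <= #|dspan R (3 * j)|)%N.
Proof.
elim: j => [|j [IH|IH]]; first by right; rewrite mul0n.
  by left; apply: subset_trans IH (dspan_sub _); lia.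
case: (boolP (dspan R (3 * j).+2 \subset dspan R (3 * j).+1)) => [st|/subsetPn[z zin znot]].
  by left; apply: subset_trans (dspan_stuck st) (dspan_sub _); lia.
right; case/card_gt0P: R_gt0 => r rR.
have -> : (3 * j.+1 = (3 * j).+3)%N by lia.
pose S := [set z + (x - r) | x in R].
have cS : #|S| = #|R|.
  by apply: card_imset => x y /addrI /addIr.
have dis : [disjoint dspan R (3 * j) & S].
  rewrite disjoint_sym; apply/pred0P => u /=; apply/negP => /andP[/imsetP[x xR ->] u0].
  case/negP: znot.
  by rewrite -[z](addrK (x - r)) opprB; apply: dspanS.
have sub : dspan R (3 * j) :|: S \subset dspan R (3 * j).+3.
  rewrite subUset dspan_sub; last by lia.
  by apply/subsetP => u /imsetP[x xR ->]; apply: dspanS.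
apply: leq_trans (subset_leq_card sub).
rewrite cardsU disjoint_setI0 // cards0 subn0 cS mulSn; lia.
Qed.

Lemma escape_dspan B M c j z : (forall x y, x \in R -> y \in R ->
  c * escape B (x - y)%R <= M)%N -> z \in dspan R j -> (c * escape B z <= j * M)%N.
Proof.
move=> le; elim: j z => [|j IH] z.
  rewrite inE => /eqP ->; rewrite /escape (_ : _ :\: _ = set0) ?cards0 ?muln0 //.
  by apply/setP => u; rewrite !inE mem_translate subr0 andNb.
case/dspanS_inv => t [x [y [tj xR yR ->]]].
apply: leq_trans (_ : c * (escape B t + escape B (x - y)%R) <= _)%N.
  by rewrite leq_mul2l escapeD orbT.
by rewrite mulnDr mulSn addnC leq_add ?IH ?le.
Qed.

(** Double counting: a pair [(a, z)] with [a] and [a - z] in [B] is determined by the pair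
    [(a, a - z)] of elements of [B]. *)
Lemma sum_overlap (B Z : {set G}) :
  (\sum_(z in Z) #|B :&: translate B z| <= #|B| ^ 2)%N.
Proof.
have -> : (#|B| ^ 2 = #|setX B B|)%N by rewrite cardsX.
rewrite -(card_imset (mem (setX B B)) (f := fun u : G * G => (u.1, u.1 - u.2))); last first.
  by move=> [a b] [a' b'] /= [-> /addrI/oppr_inj ->].
apply: leq_trans (_ : #|[set u | (u.2 \in Z) && (u.1 \in B :&: translate B u.2)]| <= _)%N; last first.
  apply: subset_leq_card; apply/subsetP => -[a z]; rewrite !inE /= mem_translate.
  case/and3P => _ aB azB; apply/imsetP; exists (a, a - z); rewrite ?inE ?aB //=.
  by rewrite subKr.
rewrite -sum1_card (eq_bigl (fun u : G * G => (u.2 \in Z) && (u.1 \in B :&: translate B u.2))); last first.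
  by move=> u; rewrite inE.

rewrite (eq_bigr (fun z => \sum_(a in B :&: translate B z) 1)%N); last by move=> z _; rewrite sum1_card.
rewrite pair_big_dep /=.
rewrite (reindex (fun u : G * G => (u.2, u.1))) /=; last first.
  by exists (fun u : G * G => (u.2, u.1)) => -[].
by [].
Qed.

(** If every difference of [R] moved few elements out of [B], so would every sum of [3 * i]
    differences. There are at least [2 * #|B|] such sums, and each translate by one would keep more
    than half of [B], which contradicts [sum_overlap]. *)
Lemma olson (B : {set G}) : (0 < #|B|)%N -> (2 * #|B| <= #|H|)%N ->
  exists x y, [/\ x \in R, y \in R &
    (#|B| * #|R| <= (12 * #|B| + 6 * #|R|) *
       (#|translate B x :|: translate B y| - #|B|))%N].
Proof.
move=> B_gt0 BH; set b := #|B| in B_gt0 BH *; set rho := #|R|.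
case: (boolP [exists x in R, [exists y in R,
   (b * rho <= (12 * b + 6 * rho) * escape B (x - y)%R)%N]]).
  move=> /exists_inP[x xR /exists_inP[y yR le]]; exists x, y; split=> //.
  by rewrite card_translateU addKn.
rewrite negb_exists_in => /forall_inP no; exfalso.
have lt x y : x \in R -> y \in R -> ((12 * b + 6 * rho) * escape B (x - y)%R <= b * rho - 1)%N.
  move=> xR yR; have := no _ xR; rewrite negb_exists_in => /forall_inP /(_ _ yR).
  lia.
(* The least number with [i * rho > 2 * b]. Since [12 * b + 6 * rho] is 6 times [2 * b + rho], an
   upper bound of [i * rho], multiplying the assumed escape by [3 * i] stays below [b / 2]. *)
pose i := ((2 * b) %/ rho).+1.
have rho0 : (0 < rho)%N by [].
have irho : (i * rho <= 2 * b + rho)%N.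
  by rewrite /i mulSn addnC leq_add2r leq_divM.
have irho2 : (2 * b <= i * rho)%N by rewrite ltnW // /i ltn_ceil.
have big : (2 * b <= #|dspan R (3 * i)|)%N.
  case: (card_dspan i) => [sub|le]; first exact: leq_trans BH (subset_leq_card sub).
  exact: leq_trans le.
have half z : z \in dspan R (3 * i) -> (b < 2 * #|B :&: translate B z|)%N.
  move=> zT; have := escape_dspan lt zT.
  have := cardsID B (translate B z); rewrite card_translate setIC -/(escape B z) -/b.
  move=> e1 e2.
  have : (3 * i * (b * rho - 1) < 3 * (i * rho) * b)%N.
    rewrite -[ltnRHS]mulnA [in ltnRHS](mulnC (i * rho)) -!mulnA ltn_mul2l /=.
    rewrite (mulnCA b) ltn_mul2l /=; have : (0 < b * rho)%N by rewrite muln_gt0 B_gt0.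
    lia.
  move=> e3.
  have e4 : ((12 * b + 6 * rho) * escape B z < (6 * b + 3 * rho) * b)%N.
    apply: leq_ltn_trans e2 _; apply: leq_trans e3 _; rewrite leq_mul2r; apply/orP; right; lia.
  have : (2 * escape B z < b)%N.
    rewrite -(ltn_pmul2l (_ : 0 < 6 * b + 3 * rho)%N); last by lia.
    by apply: leq_ltn_trans e4; rewrite mulnA leq_mul2r; apply/orP; right; lia.
  lia.
have := sum_overlap B (dspan R (3 * i)).
have : (\sum_(z in dspan R (3 * i)) b.+1 <= 2 * \sum_(z in dspan R (3 * i)) #|B :&: translate B z|)%N.
  by rewrite big_distrr /=; apply: leq_sum => z; apply: half.
rewrite sum_nat_const -/b => e1 e2.
have : (2 * b * b.+1 <= 2 * b ^ 2)%N.
  apply: leq_trans (_ : _ <= #|dspan R (3 * i)| * b.+1)%N _; first by rewrite leq_mul2r big orbT.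
  by apply: leq_trans e1 _; rewrite leq_mul2l e2 orbT.
nia.
Qed.
End Olson.

(** * Arithmetic progressions of subset sums *)

(** Below [c] the size doubles within [a] steps, so [a * l] steps reach [c]; afterwards every [a]
    steps gain [c]. Here [P n x] stands for a size [x] reached after [n] steps; the same count
    serves sets of residues and lengths of progressions. *)
Lemma grow_until (P : nat -> nat -> Prop) (a c l x0 tau : nat) :
  0 < a -> 0 < c -> c <= 2 ^ l -> 0 < x0 -> P 0 x0 ->
  (forall n x, P n x -> x0 <= x -> x < tau ->
     exists x', P n.+1 x' /\ minn x c <= a * (x' - x)) ->
  exists n x, [/\ n <= a * (l + tau %/ c + 2), P n x, tau <= x & x0 <= x].
Proof.
move=> a0 c0 cl x00 P0 step.
have many n x i : P n x -> x0 <= x ->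
    (exists n' x', [/\ n' <= n + i, P n' x', tau <= x' & x0 <= x']) \/
    (exists x', P (n + i) x' /\ a * x + i * minn x c <= a * x').
  move=> Px lex; elim: i => [|i [|[x' [Px' le]]]].
  - by right; exists x; rewrite addn0 mul0n addn0.
  - by case=> n' [x' [? ? ? ?]]; left; exists n', x'; split=> //; lia.
  have xx' : x <= x' by rewrite -(leq_pmul2l a0); lia.
  case: (leqP tau x') => [lt|lt].
    by left; exists (n + i), x'; split=> //; lia.
  have [|x'' [Px'' le'']] := step _ _ Px' _ lt; first by lia.
  right; exists x''; rewrite addnS; split=> //.
  have : minn x c <= minn x' c by lia.
  rewrite mulSn mulnBr in le'' *; lia.
have dbl n x : P n x -> x0 <= x ->
    (exists n' x', [/\ n' <= n + a, P n' x', tau <= x' & x0 <= x']) \/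
    (exists x', P (n + a) x' /\ x + minn x c <= x').
  move=> Px lex; case: (many n x a Px lex) => [|[x' [Px' le]]]; first by left.
  by right; exists x'; split=> //; rewrite -(leq_pmul2l a0) mulnDr.
have ph1 i : (exists n' x', [/\ n' <= a * i, P n' x', tau <= x' & x0 <= x']) \/
    (exists x', [/\ P (a * i) x', x0 <= x' & minn (2 ^ i) c <= x']).
  elim: i => [|i [|[x [Px lex le]]]].
  - by right; exists x0; rewrite muln0; split=> //; lia.
  - by case=> n' [x' [? ? ? ?]]; left; exists n', x'; split=> //; lia.
  rewrite mulnS addnC; case: (dbl _ _ Px lex) => [|[x' [Px' le']]]; first by left.
  by right; exists x'; split=> //; rewrite ?expnS; lia.
have ph2 j : (exists n' x', [/\ n' <= a * (l + j), P n' x', tau <= x' & x0 <= x']) \/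
    (exists x', [/\ P (a * (l + j)) x', x0 <= x' & c * j.+1 <= x']).
  elim: j => [|j [|[x [Px lex le]]]].
  - rewrite addn0; case: (ph1 l) => [|[x [Px lex le]]]; first by left.
    by right; exists x; split=> //; lia.
  - by case=> n' [x' [? ? ? ?]]; left; exists n', x'; split=> //; lia.
  rewrite addnS mulnS addnC; case: (dbl _ _ Px lex) => [|[x' [Px' le']]]; first by left.
  by right; exists x'; split=> //; lia.
case: (ph2 (tau %/ c)) => [[n [x [? ? ? ?]]]|[x [Px lex le]]].
  by exists n, x; split=> //; lia.
exists (a * (l + tau %/ c)), x; split=> //; first by lia.
by apply: leq_trans le; rewrite mulnC ltnW // ltn_ceil.
Qed.

(** * Multisets of values with bounded multiplicities *)

Section Multisets.
Variable w : nat.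
Implicit Types (c u : 'I_w.+1 -> nat) (X Y Z : {set 'I_w.+1}).

Definition msize c := \sum_v c v.
Definition mweight c := \sum_v c v * v.
Definition mle c u := forall v, c v <= u v.
Definition madd c u := fun v => c v + u v.
Definition mcopies k (x : 'I_w.+1) := fun v => (v == x) * k.

Lemma msize_add c u : msize (madd c u) = msize c + msize u.
Proof. exact: big_split. Qed.

Lemma mweight_add c u : mweight (madd c u) = mweight c + mweight u.
Proof. by rewrite -big_split; apply: eq_bigr => v _; rewrite mulnDl. Qed.

Lemma msize_copies k x : msize (mcopies k x) = k.
Proof.
rewrite /msize (bigD1 x) //= /mcopies eqxx mul1n big1 ?addn0 // => v /negPf ->.
by [].
Qed.

Lemma mweight_copies k x : mweight (mcopies k x) = k * x.
Proof.
rewrite /mweight (bigD1 x) //= /mcopies eqxx mul1n big1 ?addn0 // => v /negPf ->.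
by [].
Qed.

Lemma mweight_le c : mweight c <= msize c * w.
Proof.
rewrite /msize big_distrl /=; apply: leq_sum => v _.
by rewrite leq_mul2l -ltnS ltn_ord orbT.
Qed.

Lemma mle_add c1 c2 u1 u2 : mle c1 u1 -> mle c2 u2 -> mle (madd c1 c2) (madd u1 u2).
Proof. by move=> h1 h2 v; apply: leq_add. Qed.

Lemma mle_size c u : mle c u -> msize c <= msize u.
Proof. by move=> h; apply: leq_sum. Qed.

Definition usable Y m u := forall v, u v <= (v \in Y) * m.

Lemma usable_le Y m c u : mle c u -> usable Y m u -> usable Y m c.
Proof. by move=> h1 h2 v; apply: leq_trans (h2 v). Qed.

Lemma mweight_mod Y m u g r : (forall x, x \in Y -> x = r %[mod g]) ->
  usable Y m u -> mweight u = msize u * r %[mod g].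
Proof.
move=> Yr uY; rewrite /mweight /msize big_distrl /=.
elim/big_ind2: _ => // [x1 x2 y1 y2 e1 e2|v _].
  by rewrite -modnDm e1 e2 modnDm.
case: (boolP (v \in Y)) => [vY|/negPf vY].
  by rewrite -modnMmr (Yr _ vY) modnMmr.
by have := uY v; rewrite vY mul0n leqn0 => /eqP ->.
Qed.

(* Values that still have a copy to spare. *)
Definition spare Y m u := [set v in Y | u v < m].

Lemma card_spare Y m u : #|Y :\: spare Y m u| * m <= msize u.
Proof.
rewrite -sum_nat_const.
apply: leq_trans (_ : \sum_(v in Y :\: spare Y m u) u v <= _).
  by apply: leq_sum => v; rewrite !inE; case: (v \in Y) => //=; lia.
rewrite /msize [leqRHS](bigID (mem (Y :\: spare Y m u))) /=; exact: leq_addr.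
Qed.

Lemma usable_copy2 Y m u x y : usable Y m u -> x \in spare Y m u ->
  y \in spare Y m u -> x != y ->
  usable Y m (madd u (madd (mcopies 1 x) (mcopies 1 y))).
Proof.
move=> uY; rewrite !inE => /andP[xY xm] /andP[yY ym] xy v; rewrite /madd /mcopies !muln1.
case: (eqVneq v x) => [->|vx].
  by rewrite (negPf xy) xY mul1n; lia.
case: (eqVneq v y) => [->|vy]; first by rewrite yY; lia.
by rewrite !addn0.
Qed.

Definition apr u s d L := forall t, t <= L ->
  exists c, mle c u /\ mweight c = s + d * t.

(** Choosing [x] keeps the old progression and choosing [y] shifts it by [del] terms; the two
    overlap or abut because [del <= L + 1]. *)
Lemma apr_pair u s d L (x y : 'I_w.+1) del : apr u s d L -> y = x + d * del :> nat ->
  del <= L.+1 ->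
  apr (madd u (madd (mcopies 1 x) (mcopies 1 y))) (s + x) d (L + del).
Proof.
move=> ap yx delL t tL.
have mx : mle (mcopies 1 x) (madd (mcopies 1 x) (mcopies 1 y)) by move=> v; apply: leq_addr.
have my : mle (mcopies 1 y) (madd (mcopies 1 x) (mcopies 1 y)) by move=> v; apply: leq_addl.
case: (leqP t L) => tL'.
  have [c [cu cw]] := ap _ tL'; exists (madd c (mcopies 1 x)); split.
    exact: mle_add.
  by rewrite mweight_add mweight_copies cw; lia.
have [|c [cu cw]] := ap (t - del); first by lia.
exists (madd c (mcopies 1 y)); split; first exact: mle_add.
rewrite mweight_add mweight_copies cw yx mul1n.
have -> : t = (t - del) + del by lia.
by rewrite addnK mulnDr; lia.
Qed.

(** While some finer class keeps a fraction [1 - 1/(4l)] of the current set, pass to it. Each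
    passage at least doubles the modulus, so fewer than [l] of them occur before the modulus exceeds
    [w], and by Bernoulli's inequality three quarters of [X] survive. *)
Lemma extremal_class l X : 0 < l -> w < 2 ^ l -> 1 < #|X| ->
  exists g r Y, [/\ 0 < g, Y \subset X, 3 * #|X| <= 4 * #|Y|,
     (forall x, x \in Y -> x %% g = r) &
     forall h r', 1 < h ->
       4 * l * #|[set x in Y | x %% (g * h) == r']| < (4 * l - 1) * #|Y|].
Proof.
move=> l0 wl X1.
have gen i g r Y : i <= l -> 2 ^ (l - i) <= g -> Y \subset X ->
    #|X| * (4 * l - (l - i)) <= 4 * l * #|Y| -> (forall x, x \in Y -> x %% g = r) ->
    exists g r Y, [/\ 0 < g, Y \subset X, 3 * #|X| <= 4 * #|Y|,
     (forall x, x \in Y -> x %% g = r) &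
     forall h r', 1 < h ->
       4 * l * #|[set x in Y | x %% (g * h) == r']| < (4 * l - 1) * #|Y|].
  elim: i g r Y => [|i IH] g r Y il gi YX cY Yr.
    exfalso; rewrite subn0 in gi cY.
    have : #|Y| <= 1.
      apply/card_le1_eqP => x y /Yr xr /Yr yr; apply: val_inj => /=.
      move: xr yr; rewrite !modn_small; first by move=> -> ->.
      - by apply: leq_trans gi; apply: leq_ltn_trans wl; rewrite -ltnS.
      - by apply: leq_trans gi; apply: leq_ltn_trans wl; rewrite -ltnS.
    nia.
  (* A finite search is enough: for larger [h] or [r'] the class has at most one element. *)
  case: (boolP [exists h : 'I_(w.+2), [exists r' : 'I_w.+2, (1 < h) &&
     ((4 * l - 1) * #|Y| <= 4 * l * #|[set x in Y | x %% (g * h) == r']|)]]).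
    case/existsP => h /existsP[r' /andP[h1 cl]].
    apply: (IH (g * h) r' [set x in Y | x %% (g * h) == r']); first by lia.
    - have -> : l - i = (l - i.+1).+1 by lia.
      by rewrite expnSr leq_mul.
    - by apply: subset_trans YX; apply/subsetP => x; rewrite inE => /andP[].
    - have E : l - i = (l - i.+1).+1 by lia.
      rewrite E; set e := l - i.+1 in cY E *.
      have le1 : 4 * l * (#|X| * (4 * l - e.+1)) <= #|X| * ((4 * l - 1) * (4 * l - e)).
        rewrite mulnCA leq_mul2l; apply/orP; right.
        have : e <= l by lia.
        nia.
      rewrite -(leq_pmul2l (_ : 0 < 4 * l)); last by lia.
      apply: leq_trans le1 _.
      rewrite mulnCA; apply: leq_trans (_ : (4 * l - 1) * (4 * l * #|Y|) <= _).
        by rewrite leq_mul2l cY orbT.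
      by rewrite mulnCA leq_mul2l cl orbT.
    - by move=> x; rewrite inE => /andP[_ /eqP].
  move=> /existsPn no; exists g, r, Y; split=> //.
  - by apply: leq_trans gi; rewrite expn_gt0.
  - have : l - i.+1 <= l by lia.
    nia.
  move=> h r' h1.
  have Y1 : 1 < #|Y|.
    have e1 : 3 * l <= 4 * l - (l - i.+1) by lia.
    have : #|X| * (3 * l) <= 4 * l * #|Y| by apply: leq_trans cY; rewrite leq_mul2l e1 orbT.
    nia.
  case: (ltnP h w.+2) => hw; last first.
    apply: leq_ltn_trans (_ : 4 * l * 1 < _); last by nia.
    rewrite leq_mul2l; apply/orP; right; apply/card_le1_eqP => x y.
    have sm (z : 'I_w.+1) : z %% (g * h) = z.
      rewrite modn_small //; have := ltn_ord z; have : 0 < g by apply: leq_trans gi; rewrite expn_gt0.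
      nia.
    by rewrite !inE !sm => /andP[_ /eqP xr] /andP[_ /eqP yr]; apply: val_inj; rewrite /= xr yr.
  case: (ltnP r' w.+2) => rw; last first.
    rewrite (_ : [set _ in _ | _] = set0) ?cards0 ?muln0; first by nia.
    apply/setP => x; rewrite !inE; apply/negP => /andP[_ /eqP xr].
    by have := leq_mod x (g * h); have := ltn_ord x; lia.
  have := no (Ordinal hw); rewrite negb_exists => /forallP /(_ (Ordinal rw)).
  by rewrite h1 /= -ltnNge.
have := gen l 1 0 X (leqnn l); rewrite subnn => /(_ isT (subxx X)).
apply; first by rewrite subn0 mulnC.
by move=> x _; rewrite modn1.
Qed.
End Multisets.

Lemma pigeonhole (T T' : finType) (f : T -> T') (Z : {set T}) (B : {set T'}) :
  (forall x, x \in Z -> f x \in B) -> 0 < #|Z| ->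
  exists2 b, b \in B & #|Z| <= #|B| * #|[set x in Z | f x == b]|.
Proof.
move=> fB Z0; case: (boolP [exists b in B, #|Z| <= #|B| * #|[set x in Z | f x == b]|]).
  by case/exists_inP => b bB le; exists b.
rewrite negb_exists_in => /forall_inP no; exfalso.
have B0 : 0 < #|B|.
  by case/card_gt0P: Z0 => x /fB xB; apply/card_gt0P; exists (f x).
have eZ : #|Z| = \sum_(b in B) #|[set x in Z | f x == b]|.
  rewrite -sum1_card (partition_big f (mem B)) //=.
  by apply: eq_bigr => b _; rewrite -sum1_card; apply: eq_bigl => x; rewrite inE.
have : \sum_(b in B) (#|B| * #|[set x in Z | f x == b]|).+1 <= \sum_(b in B) #|Z|.
  by apply: leq_sum => b /no; rewrite -ltnNge.
rewrite sum_nat_const (eq_bigr (fun b => #|B| * #|[set x in Z | f x == b]| + 1)); last first.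
  by move=> b _; rewrite addn1.
rewrite big_split /= -big_distrr /= -eZ sum1_card; lia.
Qed.

(** * Residues modulo the difference of a progression *)

Section Residues.
Variables (w d' : nat).
Notation d := d'.+1.
Implicit Types (Z : {set 'I_w.+1}).

Definition resid Z : {set 'I_d} := [set inZp (val x) | x in Z].

Lemma mem_resid Z x : x \in Z -> inZp (val x) \in resid Z.
Proof. by move=> xZ; apply: imset_f. Qed.

Lemma fiber_card Z (S : {set 'I_w.+1}) lo hi : S \subset Z -> (forall x, x \in S -> lo <= x) ->
  (forall x y, x \in S -> y \in S -> x = y %[mod d]) -> (forall x, x \in S -> x < lo + d * hi) ->
  #|S| <= hi.
Proof.
move=> _ lox xy xhi; rewrite -[leqRHS]card_ord.
case: hi xhi => [|hi] xhi.
  rewrite card_ord leqn0 cards_eq0; apply/eqP/setP => x; rewrite inE; apply/negP => xS.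
  by have := xhi _ xS; have := lox _ xS; lia.
have inj : {in S &, injective (fun x : 'I_w.+1 => inord ((x - lo) %/ d) : 'I_hi.+1)}.
  move=> x y xS yS /(congr1 val) /=.
  have bnd z : z \in S -> (z - lo) %/ d < hi.+1.
    move=> zS; rewrite ltn_divLR //; have := xhi _ zS; have := lox _ zS; lia.
  rewrite !inordK ?bnd // => e; apply: val_inj => /=.
  have em : x - lo = y - lo %[mod d].
    apply/eqP; rewrite -(eqn_modDr lo) !subnK ?lox //; apply/eqP; exact: xy.
  have : x - lo = y - lo by rewrite (divn_eq (x - lo) d) e em -divn_eq.
  by have := lox _ xS; have := lox _ yS; lia.
by rewrite -(card_in_imset inj); apply: max_card.
Qed.

Lemma card_resid Z : #|Z| <= #|resid Z| * (w %/ d).+1.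
Proof.
case: (posnP #|Z|) => [-> //|Z0].
case: (pigeonhole (fun x => @mem_resid Z x) Z0) => b bB le.
apply: leq_trans le _; rewrite leq_mul2l; apply/orP; right.
apply: (@fiber_card Z _ 0).
- by apply/subsetP => x; rewrite inE => /andP[].
- by [].
- by move=> x y; rewrite !inE => /andP[_ /eqP <-] /andP[_ /eqP /(congr1 val)/= ->].
- move=> x _; rewrite add0n mulnC; apply: leq_ltn_trans (_ : w < _); first by rewrite -ltnS.
  by rewrite ltn_ceil.
Qed.

(** Cut the range into boxes of length [d * L]. Some box and residue together contain a large part
    of [Z]. Its extreme elements differ by [d * del], and the part has at most [del + 1 <= 2 * del]
    elements. *)
Lemma box_pair Z L : 0 < L -> #|resid Z| * (w %/ (d * L)).+1 < #|Z| ->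
  exists (x y : 'I_w.+1) del, [/\ x \in Z, y \in Z, 0 < del <= L, y = x + d * del :> nat &
    #|Z| <= 2 * del * (#|resid Z| * (w %/ (d * L)).+1)].
Proof.
move=> L0 ltZ; have dL0 : 0 < d * L by rewrite muln_gt0.
pose f (x : 'I_w.+1) : 'I_d * 'I_(w %/ (d * L)).+1 := (inZp (val x), inord (x %/ (d * L))).
have Z0 : 0 < #|Z| by apply: leq_ltn_trans ltZ.
have fB x : x \in Z -> f x \in setX (resid Z) setT by move=> xZ; rewrite !inE mem_resid.
case: (pigeonhole fB Z0) => -[b i] bB; rewrite cardsX cardsT card_ord.
set S := [set x in Z | _] => le.
have S2 : 1 < #|S|.
  rewrite ltnNge; apply/negP => S1; move: (leq_trans ltZ le).
  by rewrite ltnNge -[leqRHS]muln1 leq_mul2l S1 orbT.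
have Sb x : x \in S -> [/\ x \in Z, inZp (val x) = b & x %/ (d * L) = i].
  rewrite inE => /andP[xZ /eqP[-> <-]]; split=> //; rewrite inordK // ltnS leq_div2r // -ltnS.
  by [].
case/card_gt0P: (ltnW S2) => x0 x0S.
case: (arg_minnP (fun x : 'I_w.+1 => val x) x0S) => x xS xmin.
case: (arg_maxnP (fun x : 'I_w.+1 => val x) x0S) => y yS ymax.
have SZ : S \subset Z by apply/subsetP => z /Sb[].
have modS z t : z \in S -> t \in S -> z = t %[mod d].
  by move=> /Sb[_ zb _] /Sb[_ tb _]; move: (etrans zb (esym tb)) => /(congr1 val).
have [xZ xb xi] := Sb _ xS; have [yZ yb yi] := Sb _ yS.
have xy : x <= y := xmin _ yS.
have dxy : d %| y - x by rewrite -eqn_mod_dvd //; apply/eqP/modS.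
exists x, y, ((y - x) %/ d).
have e : y = x + d * ((y - x) %/ d) :> nat by rewrite mulnC divnK // subnKC.
have cS : #|S| <= ((y - x) %/ d).+1.
  apply: (@fiber_card Z S x) => //.
  by move=> z /ymax /= zy; rewrite mulnS; apply: leq_ltn_trans zy _; rewrite [X in X < _]e; lia.
have lt : y - x < d * L.
  have := ltn_ceil y dL0; rewrite yi -xi; have := leq_divM x (d * L); lia.
split=> //.
- by rewrite -ltnS (leq_trans S2 cS) /= ltnW // ltn_divLR // mulnC.
- apply: leq_trans le _; rewrite mulnC leq_mul2r; apply/orP; right; lia.
Qed.
End Residues.

Section Coset.
Variables (w l g r d' : nat) (Y : {set 'I_w.+1}).
Notation d := d'.+1.
Hypotheses (l0 : 0 < l) (g0 : 0 < g) (gd : g %| d)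
  (Yr : forall x, x \in Y -> x %% g = r)
  (Ystar : forall h r', 1 < h ->
       4 * l * #|[set x in Y | x %% (g * h) == r']| < (4 * l - 1) * #|Y|).

Definition mult_set : {set 'I_d} := [set z : 'I_d | g %| z].

Lemma card_mult_set : #|mult_set| = d %/ g.
Proof.
have h0 : 0 < d %/ g by rewrite divn_gt0 // dvdn_leq.
rewrite -[RHS]card_ord; apply/eqP; rewrite eqn_leq; apply/andP; split.
  have inj : {in mult_set &, injective (fun x : 'I_d => (insubd (Ordinal h0) (x %/ g)) : 'I_(d %/ g))}.
    move=> x y; rewrite !inE => gx gy /(congr1 val) /=.
    rewrite !val_insubd !ltn_divRL // !divnK // !ltn_ord => e.
    by apply: val_inj; rewrite /= -(divnK gx) e divnK.
  by rewrite -(card_in_imset inj) subset_leq_card //; apply/subsetP.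
pose f (i : 'I_(d %/ g)) : 'I_d := inord (g * i).
have fi (i : 'I_(d %/ g)) : f i = g * i :> nat.
  by rewrite inordK // mulnC -ltn_divRL.
have inj : injective f.
  move=> i j /(congr1 val); rewrite /= !fi => /eqP.
  by rewrite eqn_pmul2l // => /eqP e; apply: val_inj.
rewrite -(card_imset _ inj) subset_leq_card //; apply/subsetP => _ /imsetP[i _ ->].
by rewrite inE fi dvdn_mulr.
Qed.

Definition ample (Z : {set 'I_w.+1}) := (Z \subset Y) && ((8 * l - 1) * #|Y| <= 8 * l * #|Z|).

(** The translations that preserve [Q'] are those by the multiples of some [e], which is a multiple
    of [g], and [Z] lies in one class mod [e]. As [Z] misses at most a fraction 1/(8l) of [Y],
    extremality leaves only [e = g]. *)
Lemma ample_gen Z : 0 < #|Y| -> ample Z -> forall Q : {set 'I_d}, 0%R \in Q ->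
  (forall q x y, q \in Q -> x \in resid d' Z -> y \in resid d' Z -> (q + (x - y))%R \in Q) ->
  mult_set \subset Q.
Proof.
move=> Y0 /andP[ZY cZ] Q Q0 Qcl.
(* The intersection forces every translation that preserves [Q'] to be by a multiple of [g], because
   it moves 0 into [Q']. *)
pose Q' := Q :&: mult_set.
pose S n := [forall q in Q', (q + inZp n)%R \in Q'].
have zpD a b : (inZp (a + b) = inZp a + inZp b :> 'I_d)%R.
  by apply: val_inj; rewrite /= modnDm.
have SP n : reflect (forall q, q \in Q' -> (q + inZp n)%R \in Q') (S n) by apply: forall_inP.
have SD a b : S a -> S b -> S (a + b).
  by move=> /SP Sa /SP Sb; apply/SP => q qQ; rewrite zpD GRing.addrA; apply/Sb/Sa.
have S_mod a b : a = b %[mod d] -> S a -> S b.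
  by move=> e /SP Sa; apply/SP => q /Sa; rewrite (_ : inZp a = inZp b) //; apply: val_inj.
have S0 : S 0.
  apply/SP => q; rewrite (_ : inZp 0 = 0%R) ?GRing.addr0 //; apply: val_inj => /=; exact: mod0n.
have SM n a : S a -> S (n * a) by move=> Sa; elim: n => // n IH; rewrite mulSn SD.
(* Modulo [d], adding [a] another [d'] times amounts to subtracting it. *)
have SB a b : S (a + b) -> S a -> S b.
  move=> Sab Sa; apply: (S_mod (a + b + d' * a)); last by rewrite SD ?SM.
  by rewrite -addnA (addnC b) addnA -mulSn mulnC modnMDl.
have Sd : exists n, (0 < n) && S n.
  by exists d; rewrite /=; apply: S_mod S0; rewrite modnn mod0n.
case: (ex_minnP Sd) => e /andP[e0 Se] emin.
have Sdvd n : S n -> e %| n.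
  move=> Sn; have Sm : S (n %% e).
    by apply: (@SB (n %/ e * e)); rewrite -?divn_eq ?SM.
  apply/eqP; case: (posnP (n %% e)) => // n0.
  by have := emin _ (introT andP (conj n0 Sm)); rewrite leqNgt ltn_mod e0.
have gval x : g %| x %% d = (g %| x) by rewrite /dvdn modn_dvdm.
have Q'0 : 0%R \in Q' by rewrite !inE Q0 dvdn0.
have ge : g %| e.
  have := SP _ Se _ Q'0; rewrite GRing.add0r !inE => /andP[_]; by rewrite gval.
have Sdiff (x y : 'I_w.+1) : x \in Z -> y \in Z -> x <= y -> S (y - x).
  move=> xZ yZ xy; apply/SP => q; rewrite !inE => /andP[qQ gq].
  have gyx : g %| y - x by rewrite -eqn_mod_dvd // !Yr ?(subsetP ZY).
  have eyx : inZp (y - x) = (inZp (val y) - inZp (val x))%R :> 'I_d.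
    by apply/eqP; rewrite eq_sym GRing.subr_eq -zpD subnK.
  apply/andP; split; first by rewrite eyx Qcl ?mem_resid.
  by rewrite /= gval dvdn_addr // gval.
have Zmod (x y : 'I_w.+1) : x \in Z -> y \in Z -> x = y %[mod e].
  move=> xZ yZ; case/orP: (leq_total x y) => xy.
    by apply/eqP; rewrite eq_sym eqn_mod_dvd // Sdvd ?Sdiff.
  by apply/eqP; rewrite eqn_mod_dvd // Sdvd ?Sdiff.
have Z0 : 0 < #|Z| by nia.
case/card_gt0P: Z0 => z0 z0Z.
have eg : e = g.
  case/dvdnP: ge e0 Zmod => -[|[|h]] -> // _ Zmod; first by rewrite mul1n.
  exfalso; have := Ystar (z0 %% (g * h.+2)) (isT : 1 < h.+2).
  have : #|Z| <= #|[set x in Y | x %% (g * h.+2) == z0 %% (g * h.+2)]|.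
    apply/subset_leq_card/subsetP => x xZ; rewrite inE (subsetP ZY) //= mulnC.
    by apply/eqP/Zmod.
  nia.
apply/subsetP => z; rewrite inE => gz.
have Sz : S z by rewrite -(divnK gz) SM // -eg.
have := SP _ Sz _ Q'0; rewrite GRing.add0r !inE => /andP[+ _].
by rewrite (_ : inZp z = z) //; apply: val_inj; rewrite /= modn_small.
Qed.

End Coset.

(** Turns the inequality of [olson] into the growth condition of [grow_until], with [a = 18] and
    [c = rho]. *)
Lemma olson_gain x R D rho : 0 < x -> 0 < rho -> x * R <= (12 * x + 6 * R) * D ->
  rho <= R -> minn x rho <= 18 * D.
Proof.
move=> x0 r0 le rR; case: (leqP x R) => xR.
  have : x * R <= 18 * D * R by apply: leq_trans le _; nia.
  rewrite leq_pmul2r; lia.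
have : R * x <= 18 * D * x by rewrite mulnC; apply: leq_trans le _; nia.
rewrite leq_pmul2r; lia.
Qed.

Lemma two_ample l y a b c i : (8 * l - 1) * y <= 8 * l * b -> (8 * l - 1) * y <= 8 * l * a ->
  0 < l -> c <= y -> c + i = a + b -> 3 * y <= 4 * i.
Proof.
move=> h1 h2 l0 cy e; rewrite -(leq_pmul2l (_ : 0 < 2 * l)); last by rewrite muln_gt0.
have h3 : (8 * l - 1) * y = 8 * l * y - y by rewrite mulnBl mul1n.
have : y <= l * y by rewrite leq_pmull.
have : 8 * l * c <= 8 * l * y by rewrite leq_mul2l cy orbT.
have : 8 * l * (c + i) = 8 * l * (a + b) by rewrite e.
rewrite h3 in h1 h2; move: h1 h2; clear; lia.
Qed.

Lemma boxes_le w D : 0 < D -> D <= w -> (w %/ D).+1 * D <= 2 * w.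
Proof. by move=> D0 Dw; rewrite mulSn; have := leq_divM w D; lia. Qed.

(** Turns the gap found by [box_pair] into the growth condition of [grow_until], with [c = w %/ d].
    The cases are whether a box of length [d * L] is shorter than the whole range, in which case the
    number of boxes enters, or covers it. *)
Lemma box_gain rho d w Th L z q del : 0 < d -> 0 < L -> w <= Th * z -> 0 < z -> 3 * z <= 4 * q ->
  q <= 2 * del * (rho * (w %/ (d * L)).+1) ->
  minn L (w %/ d) <= ((6 * rho * Th) %/ d).+1 * del.
Proof.
move=> d0 L0 wz z0 zq le; set a := (_ %/ d).+1.
have ad : 6 * rho * Th <= a * d by apply: ltnW; apply: ltn_ceil.
have dL0 : 0 < d * L by rewrite muln_gt0 d0.
have e4 : 6 * rho * Th * del <= a * d * del by rewrite leq_mul2r ad orbT.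
clearbody a; case: (leqP (d * L) w) => dL.
  have e1 := boxes_le dL0 dL.
  set X := (w %/ _).+1 in e1 le; set D := d * L in e1 dL0 dL *.
  have e2 : 3 * z * D <= 16 * del * rho * w.
    apply: leq_trans (_ : 4 * (2 * del * (rho * X)) * D <= _).
      by rewrite leq_mul2r; apply/orP; right; lia.
    have : 8 * del * rho * (X * D) <= 8 * del * rho * (2 * w) by rewrite leq_mul2l e1 orbT.
    clear; lia.
  have e3 : 3 * D <= 16 * del * rho * Th.
    rewrite -(leq_pmul2r z0); apply: leq_trans (_ : 16 * del * rho * (Th * z) <= _); last by clear; lia.
    apply: leq_trans (_ : 16 * del * rho * w <= _); last by rewrite leq_mul2l wz orbT.
    by apply: leq_trans e2; clear; lia.
  apply: leq_trans (geq_minl _ _) _; rewrite -(leq_pmul2l (_ : 0 < d)) //.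
  by move: e3 e4; rewrite /D; clear; lia.
rewrite divn_small // muln1 in le.
apply: leq_trans (geq_minr _ _) _; rewrite -(leq_pmul2r (_ : 0 < d)) //.
apply: leq_trans (leq_divM _ _) _.
have e5 : 3 * (Th * z) <= 8 * (rho * Th * del).
  have : Th * (3 * z) <= Th * (4 * (2 * del * rho)).
    by rewrite leq_mul2l (leq_trans zq) ?orbT // leq_mul2l le orbT.
  by clear; lia.
by move: e4 e5 wz; clear; lia.
Qed.

(** As long as the progression is shorter than the target length, there are more surviving values
    than combinations of a residue and a box, which is what [box_pair] requires. *)
Lemma box_room rho d w l Th L y z : 256 <= l -> 0 < rho -> rho <= d -> 0 < L -> 0 < y ->
  w <= Th * y -> 3 * y <= 4 * z -> 0 < Th -> l ^ 2 * Th <= L ->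
  L < ((37 * l * w) %/ rho).+1 -> rho * (w %/ (d * L)).+1 < z.
Proof.
move=> l256 rho0 rd L0 y0 wTh yz Th0 lL Lt; rewrite ltnNge; apply/negP => le.
have lT : 50 * l * Th + 1 <= L.
  apply: leq_trans lL; have : 256 * l <= l ^ 2 by rewrite leq_mul2r l256 orbT.
  move: Th0 l256; set q := l ^ 2 => h1 h2 h3.
  have : 256 * l * Th <= q * Th by rewrite leq_mul2r h3 orbT.
  have : 1 <= l * Th by rewrite muln_gt0 h1 andbT; lia.
  clear; lia.
have d0 : 0 < d by apply: leq_trans rd.
have dL0 : 0 < d * L by rewrite muln_gt0 d0.
case: (leqP (d * L) w) => dL.
  have e1 := boxes_le dL0 dL; set X := (w %/ _).+1 in e1 le.
  have e2 : z * L <= 2 * w.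
    rewrite -(leq_pmul2l d0); apply: leq_trans (_ : rho * (2 * w) <= _); last first.
      by rewrite leq_mul2r rd orbT.
    apply: leq_trans (_ : rho * (X * (d * L)) <= _); last by rewrite leq_mul2l e1 orbT.
    have : z * (d * L) <= rho * X * (d * L) by rewrite leq_mul2r le orbT.
    clear; lia.
  have e3 : 3 * y * L <= 4 * z * L by rewrite leq_mul2r yz orbT.
  have : 3 * L <= 8 * Th by rewrite -(leq_pmul2l y0); move: e3 e2 wTh; clear; lia.
  have : Th <= l * Th by rewrite leq_pmull //; lia.
  move: lT; clear; lia.
rewrite divn_small // muln1 in le.
have e1 : L * rho <= 37 * l * w.
  by apply: leq_trans (leq_divM (37 * l * w) rho); rewrite leq_mul2r -ltnS Lt orbT.
have : 3 * L <= 148 * l * Th.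
  rewrite -(leq_pmul2r rho0).
  have : 37 * l * w <= 37 * l * (Th * y) by rewrite leq_mul2l wTh orbT.
  have : 37 * l * Th * (3 * y) <= 37 * l * Th * (4 * rho).
    by rewrite leq_mul2l (leq_trans yz) ?leq_mul2l ?le ?orbT.
  move: e1; clear; lia.
move: lT; clear; lia.
Qed.

(** * Extending a progression of difference [d] to one of difference [g] *)

Section Extend.
Variables (w l g r d' m : nat) (Y : {set 'I_w.+1}).
Notation d := d'.+1.
Hypotheses (l256 : 256 <= l) (wl : w < 2 ^ l) (g0 : 0 < g) (gd : g %| d) (dw : d <= w)
  (Yr : forall x, x \in Y -> x %% g = r) (Y0 : 0 < #|Y|)
  (Ystar : forall h r', 1 < h ->
       4 * l * #|[set x in Y | x %% (g * h) == r']| < (4 * l - 1) * #|Y|).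

Let l0 : 0 < l. Proof. exact: leq_trans l256. Qed.

(** A value is exhausted only after [m] copies, so exhausting more than a fraction 1/(8l) of the
    values of [Y] would cost more than that fraction of the [#|Y| * m] copies. *)
Lemma ample_spare u : msize u * (8 * l) <= #|Y| * m -> 0 < m -> ample l Y (spare Y m u).
Proof.
move=> le m0; apply/andP; split; first by apply/subsetP => x; rewrite inE => /andP[].
have := card_spare Y m u; have := cardsID (spare Y m u) Y.
rewrite (setIidPr _); last by apply/subsetP => x; rewrite inE => /andP[].
set a := #|spare Y m u|; set b := #|Y :\: _| => e le2.
have : b * m * (8 * l) <= #|Y| * m by apply: leq_trans le; rewrite leq_mul2r le2 orbT.
rewrite -mulnA (mulnC m) mulnA leq_pmul2r // => le3.
nia.
Qed.

(** The bound on the weight itself, besides its residue, is needed later: this weight is subtracted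
    from a target, and the remainder must still fall within a progression. *)
Definition covers (u : 'I_w.+1 -> nat) n (B : {set 'I_d}) := forall b, b \in B ->
  exists c : 'I_w.+1 -> nat, [/\ mle c u, mweight c <= n * w & mweight c = val b %[mod d]].

Lemma covers_pair u n B (x y : 'I_w.+1) : covers u n B ->
  covers (madd u (madd (mcopies 1 x) (mcopies 1 y))) n.+1
    (translate B (inZp (val x)) :|: translate B (inZp (val y))).
Proof.
move=> cov b bB.
have [z [bz mz]] : exists z : 'I_w.+1, (b - inZp (val z))%R \in B /\
    mle (mcopies 1 z) (madd (mcopies 1 x) (mcopies 1 y)).
  move: bB; rewrite inE !mem_translate => /orP[] h; [exists x|exists y]; split=> // v.
    exact: leq_addr.
  exact: leq_addl.
have [c [cu cn cb]] := cov _ bz.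
exists (madd c (mcopies 1 z)); split; first exact: mle_add.
  by rewrite mweight_add mweight_copies mul1n mulSnr leq_add // -ltnS.
rewrite mweight_add mweight_copies mul1n -modnDml cb modnDml.
rewrite -[in RHS](GRing.subrK (inZp (val z)) b); move: (b - inZp (val z))%R => q.
by rewrite /= modn_mod modnDmr.
Qed.

Variable rho : nat.
Hypothesis rho0 : 0 < rho.
Hypothesis rhoP : forall Z, ample l Y Z -> rho <= #|resid d' Z|.
Let N := 18 * (l + (#|mult_set g d'| %/ 2).+1 %/ rho + 2).

(** Each step applies [olson] to the residues of the spare values and adds a pair of which exactly
    one member is chosen; thus all residues reached after [n] steps lie in the coset of [n * r].
    Half a coset is enough, because two such sets add up to a whole coset. *)
Lemma cover_half U : usable Y m U -> 0 < m -> (msize U + 2 * N) * (8 * l) <= #|Y| * m ->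
  exists u n B, [/\ usable Y m (madd U u), msize u = 2 * n, n <= N, covers u n B &
    #|mult_set g d'| < 2 * #|B|] /\ forall b, b \in B -> b = n * r %[mod g].
Proof.
move=> Uu m0 bud; set H := mult_set g d'.
pose good n x u B := [/\ usable Y m (madd U u), msize u = 2 * n, covers u n B & #|B| = x] /\
   forall b : 'I_d, b \in B -> b = n * r %[mod g].
(* Beyond [N] steps nothing is claimed, because the budget of copies covers only that many. *)
pose P n x := n <= N -> exists u B, good n x u B.
have gval x : x %% d %% g = x %% g by rewrite modn_dvdm.
have P0 : P 0 1.
  move=> _; exists (fun=> 0), [set 0%R]; split; last by move=> b; rewrite inE => /eqP ->.
  split.
  - by move=> v; rewrite /madd addn0.
  - by rewrite /msize big1.
  - move=> b; rewrite inE => /eqP ->; exists (fun=> 0); split=> //.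
      by rewrite /mweight big1.
    by rewrite /mweight big1.
  - by rewrite cards1.
have rl : rho <= 2 ^ l.
  apply: leq_trans (rhoP (Z := Y) _) _; first by rewrite /ample subxx leq_mul // leq_subr.
  apply: leq_trans (max_card _) _; rewrite card_ord ltnW //.
  exact: leq_ltn_trans dw wl.
have step n x : P n x -> 1 <= x -> x < (#|H| %/ 2).+1 ->
    exists x', P n.+1 x' /\ minn x rho <= 18 * (x' - x).
  move=> Px x1 xH; case: (ltnP n N) => nN; last first.
    exists (x + x); split; first by move=> h; exfalso; lia.
    by lia.
  have [u [B [[Uuu su cov cB] Br]]] := Px (ltnW nN).
  have amp : ample l Y (spare Y m (madd U u)).
    apply: ample_spare => //; apply: leq_trans bud.
    by rewrite leq_mul2r msize_add su leq_add2l leq_mul2l ltnW ?orbT.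
  have gen := ample_gen l0 g0 gd Yr Ystar Y0 amp.
  have R1 := rhoP amp; set R := resid d' _ in gen R1.
  have [||a [b [aR bR le]]] := olson (leq_trans rho0 R1) gen (B := B); first by rewrite cB.
    by rewrite cB mulnC -leq_divRL // -ltnS.
  case/imsetP: aR => xa xaS ea; case/imsetP: bR => xb xbS eb.
  set B' := translate B a :|: translate B b in le.
  exists #|B'|; split; last first.
    rewrite cB in le; exact: olson_gain le R1.
  move=> _; have xab : xa != xb.
    apply/eqP => e; move: le; rewrite /B' ea eb e setUid card_translate subnn muln0 leqn0 muln_eq0.
    rewrite cB => /orP[] /eqP z0; first by rewrite z0 in x1.
    by move: R1; rewrite z0 leqNgt rho0.
  exists (madd u (madd (mcopies 1 xa) (mcopies 1 xb))), B'; split; last first.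
    move=> z; rewrite inE !mem_translate.
    have sh (q : 'I_w.+1) : q \in Y -> (z - inZp (val q))%R \in B -> z = n.+1 * r %[mod g].
      move=> qY /Br; rewrite -[X in _ -> val X %% _ = _](GRing.subrK (inZp (val q)) z).
      set zz := (z - _)%R => e.
      by rewrite /= gval -modnDm e modn_dvdm // modnDm mulSnr -(Yr qY) modnDmr.
    by rewrite ea eb => /orP[] /sh -> //; move: xaS xbS; rewrite !inE => /andP[? _] /andP[].
  split=> //.
  - have := usable_copy2 Uuu xaS xbS xab; move=> h v; have := h v; rewrite /madd; lia.
  - by rewrite !msize_add !msize_copies su; lia.
  - by rewrite /B' ea eb; apply: covers_pair.
have [n [x [nN Px xH _]]] := grow_until (isT : 0 < 18) rho0 rl (isT : 0 < 1) P0 step.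
have [u [B [[h1 h2 h3 h4] h5]]] := Px nN.
exists u, n, B; split=> //; split=> //.
by rewrite h4 mulnC -ltn_divLR.
Qed.


Lemma card_coset (B : {set 'I_d}) t : (forall b, b \in B -> b = t %[mod g]) ->
  #|B| <= #|mult_set g d'|.
Proof.
move=> Bt; case: (posnP #|B|) => [-> //|/card_gt0P[b0 b0B]].
rewrite -(card_translate B (- b0)%R); apply/subset_leq_card/subsetP => z.
rewrite mem_translate GRing.opprK => /Bt; rewrite -(Bt _ b0B) inE /= modn_dvdm // => /eqP.
by rewrite -[X in _ == X %[mod _]]add0n eqn_modDr mod0n.
Qed.

Variable Th : nat.
Hypotheses (Th0 : 0 < Th) (wTh : w <= Th * #|Y|).
Let a := ((6 * rho * Th) %/ d).+1.
Let c := w %/ d.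
Let tau := ((37 * l * w) %/ rho).+1.
Let NB := a * (l + tau %/ c + 2).

Variable Z0 : {set 'I_w.+1}.
Hypotheses (Z0a : ample l Y Z0) (Z0r : #|resid d' Z0| = rho).

(** The pairs that lengthen the progression are taken from the values of [Z0] with spare copies:
    [Z0] meets only [rho] residues, so few classes compete for its values, and it still shares three
    quarters of [Y] with any ample set. *)
Lemma box_phase U0 s0 L0 : usable Y m U0 -> 0 < m -> apr U0 s0 d L0 -> l ^ 2 * Th <= L0 ->
  rho <= d -> (msize U0 + 2 * NB) * (8 * l) <= #|Y| * m ->
  exists U s L n, [/\ usable Y m U, apr U s d L, msize U = msize U0 + 2 * n, n <= NB & tau <= L].
Proof.
move=> U0u m0 ap0 LL0 rd bud.
pose P n x := n <= NB -> exists u s, [/\ usable Y m u, msize u = msize U0 + 2 * n & apr u s d x].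
have L00 : 0 < L0 by apply: leq_trans LL0; rewrite !muln_gt0 l0.
have P0 : P 0 L0 by move=> _; exists U0, s0; rewrite muln0 addn0.
have c0 : 0 < c by rewrite /c divn_gt0.
have cl : c <= 2 ^ l by apply: leq_trans (ltnW wl); apply: leq_div.
have step n x : P n x -> L0 <= x -> x < tau -> exists x', P n.+1 x' /\ minn x c <= a * (x' - x).
  move=> Px Lx xt; case: (ltnP n NB) => nN; last first.
    exists (x + x); split; first by move=> h; exfalso; lia.
    by rewrite addnK (leq_trans (geq_minl _ _)) // leq_pmull.
  have [u [s [uu su ap]]] := Px (ltnW nN).
  have amp : ample l Y (spare Y m u).
    apply: ample_spare => //; apply: leq_trans bud.
    by rewrite leq_mul2r su leq_add2l leq_mul2l ltnW ?orbT.
  set Z := Z0 :&: spare Y m u.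
  have cZ : 3 * #|Y| <= 4 * #|Z|.
    have := cardsUI Z0 (spare Y m u); rewrite -/Z.
    case/andP: amp => sY cs; case/andP: Z0a => zY cz.
    have : #|Z0 :|: spare Y m u| <= #|Y| by rewrite subset_leq_card // subUset zY.
    by move: cs cz l0; clear; apply: two_ample.
  have rZ : #|resid d' Z| <= rho.
    by rewrite -Z0r subset_leq_card //; apply: imsetS; apply: subsetIl.
  have x0 : 0 < x by apply: leq_trans Lx.
  have big : rho * (w %/ (d * x)).+1 < #|Z|.
    by apply: (box_room l256 rho0 rd x0 Y0 wTh cZ Th0 _ xt); apply: leq_trans Lx.
  have [|x1 [y1 [del [xZ yZ /andP[del0 delx] yx le]]]] := @box_pair _ d' Z x x0.
    by apply: leq_ltn_trans big; rewrite leq_mul2r rZ orbT.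
  exists (x + del); split.
    move=> _; exists (madd u (madd (mcopies 1 x1) (mcopies 1 y1))), (s + x1); split.
    - move: xZ yZ; rewrite !inE => /and3P[_ xY xm] /and3P[_ yY ym].
      apply: usable_copy2 => //; rewrite ?inE ?xY ?yY //; apply/eqP => e.
      move/eqP: yx; rewrite -e -[eqbLHS]addn0 eqn_add2l eq_sym muln_eq0 /= => /eqP e0.
      by rewrite e0 in del0.
    - by rewrite !msize_add !msize_copies su; lia.
    - by apply: apr_pair => //; lia.
  rewrite addKn; apply: (box_gain _ x0 wTh Y0 cZ) => //; apply: leq_trans le _.
  by rewrite leq_mul2l; apply/orP; right; rewrite leq_mul2r rZ orbT.
have [n [x [nN Px xH _]]] := grow_until (isT : 0 < a) c0 cl L00 P0 step.
have [u [s [? ? ?]]] := Px nN.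
by exists u, s, x, n.
Qed.

End Extend.

(** The length [tau] divided by [c] is of order [l * d / rho], and each unit costs about
    [rho * Th / d] pairs, so the quotients cancel to [l * Th]; the rounding of the second factor is
    covered by [d <= 3 * rho * Th]. *)
Lemma extend_budget l rho d Th w :
  256 <= l -> 0 < rho -> rho <= d -> d <= 3 * rho * Th -> 0 < d -> d <= w -> 0 < Th ->
  2 * (((6 * rho * Th) %/ d).+1 * (l + ((37 * l * w) %/ rho).+1 %/ (w %/ d) + 2)) <=
    8 * l ^ 2 * Th.
Proof.
move=> l256 rho0 rd dT d0 dw Th0.
set a := ((6 * rho * Th) %/ d).+1.
set tau := ((37 * l * w) %/ rho).+1.
set c := w %/ d; set t := tau %/ c.
have c0 : 0 < c by rewrite divn_gt0.
have wc : w <= 2 * c * d.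
  have := ltn_ceil w d0; rewrite -/c mulSn; nia.
have ad : a.-1 * d <= 6 * rho * Th by apply: leq_divM.
have tr : tau.-1 * rho <= 37 * l * w by apply: leq_divM.
have tc : t * c <= tau by apply: leq_divM.
have e1 : t * rho <= 75 * l * d.
  rewrite -(leq_pmul2r c0).
  have : t * c * rho <= tau * rho by rewrite leq_mul2r tc orbT.
  have : 37 * l * w <= 37 * l * (2 * c * d) by rewrite leq_mul2l wc orbT.
  have : tau = tau.-1.+1 by [].
  have : rho <= l * d * c by nia.
  nia.
have a_eq : a = a.-1.+1 by [].
have e2 : a * t <= 675 * l * Th.
  rewrite -(leq_pmul2r rho0) a_eq.
  have : a.-1.+1 * (t * rho) <= a.-1.+1 * (75 * l * d) by rewrite leq_mul2l e1 orbT.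
  have : l * (a.-1 * d) <= l * (6 * rho * Th) by rewrite leq_mul2l ad orbT.
  have : l * d <= l * (3 * rho * Th) by rewrite leq_mul2l dT orbT.
  nia.
have e3 : a <= 7 * Th.
  suff : a.-1 <= 6 * Th by rewrite a_eq; lia.
  rewrite -(leq_pmul2r d0); apply: leq_trans ad _; nia.
have e4 : a * (l + 2) <= 7 * Th * (l + 2) by rewrite leq_mul2r e3 orbT.
have e5 : 7 * (l + 2) + 675 * l <= 4 * l ^ 2 by clear -l256; nia.
have : (7 * (l + 2) + 675 * l) * Th <= 4 * l ^ 2 * Th by rewrite leq_mul2r e5 orbT.
have -> : a * (l + t + 2) = a * (l + 2) + a * t by lia.
lia.
Qed.

Lemma ample_card l y z : 0 < l -> (8 * l - 1) * y <= 8 * l * z -> 7 * y <= 8 * z.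
Proof.
move=> l0; rewrite mulnBl mul1n => h; rewrite -(leq_pmul2l l0).
have : y <= l * y by rewrite leq_pmull.
move: h; clear; lia.
Qed.

(** An ample set has about [#|Y|], hence at least about [w / Th] values, but each of its [rho]
    residues contains at most [w %/ d + 1] of them; so [d] cannot be much larger than [rho * Th]. *)
Lemma modulus_bound l y z rho d w Th : 0 < l -> 0 < y -> 0 < d -> d <= w ->
  (8 * l - 1) * y <= 8 * l * z -> z <= rho * (w %/ d).+1 -> w <= Th * y ->
  d <= 3 * rho * Th.
Proof.
move=> l0 y0 d0 dw h1 h2 wTh.
have e1 := boxes_le d0 dw; set X := (w %/ d).+1 in e1 h2.
have e2 : z * d <= rho * (2 * w).
  apply: leq_trans (_ : rho * (X * d) <= _); last by rewrite leq_mul2l e1 orbT.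
  by rewrite mulnA leq_mul2r h2 orbT.
have e3 := ample_card l0 h1.
have e4 : 7 * y * d <= 8 * z * d by rewrite leq_mul2r e3 orbT.
have e5 : rho * w <= rho * (Th * y) by rewrite leq_mul2l wTh orbT.
have : 7 * d <= 16 * rho * Th by rewrite -(leq_pmul2l y0); move: e2 e4 e5; clear; lia.
clear; lia.
Qed.

Lemma cover_budget l rho d Th h : 256 <= l -> 0 < rho -> rho <= d -> d <= 3 * rho * Th -> 0 < Th ->
  h <= d -> 4 * (18 * (l + (h %/ 2).+1 %/ rho + 2)) <= 8 * l ^ 2 * Th.
Proof.
move=> l256 rho0 rd dT Th0 hd.
have e1 : (h %/ 2).+1 %/ rho * rho <= (h %/ 2).+1 by apply: leq_divM.
have e2 : (h %/ 2).+1 %/ rho <= 4 * Th.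
  rewrite -(leq_pmul2r rho0); apply: leq_trans e1 _; have := leq_divM h 2; nia.
nia.
Qed.

(** The progression of difference [d] has to bridge the spread of the covering weights, the rounding
    to a multiple of [g], and the range [g * w] of the targets. *)
Lemma cover_room l rho d w g L h : 256 <= l -> 0 < rho -> g * h <= d -> rho <= h -> 0 < g -> 0 < w ->
  37 * l * w < rho * L ->
  2 * (18 * (l + (h %/ 2).+1 %/ rho + 2)) * w + g + g * w <= d * L.
Proof.
move=> l256 rho0 ghd rh g0 w0 big; set N := 18 * _.
have e1 : (h %/ 2).+1 %/ rho * rho <= (h %/ 2).+1 by apply: leq_divM.
have hd : h <= d by nia.
have e2 : rho * (2 * N + 2 * g) <= 37 * l * d.
  have : rho * g <= d by nia.
  have : rho * l <= d * l by rewrite leq_mul2r (leq_trans rh hd) orbT.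
  have := leq_divM h 2.
  have : 256 * d <= l * d by rewrite leq_mul2r l256 orbT.
  have : 1 <= d by apply: leq_trans (leq_trans rh hd).
  rewrite /N; lia.
rewrite -(leq_pmul2l rho0).
have : rho * (2 * N + 2 * g) * w <= 37 * l * d * w by rewrite leq_mul2r e2 orbT.
have : d * (37 * l * w) <= d * (rho * L) by rewrite leq_mul2l ltnW // orbT.
have : rho * g <= rho * g * w by rewrite leq_pmulr.
lia.
Qed.

(* [rho] is the least number of residues mod [d] met by a subset of [Y] that
   misses only few values: it bounds the residues that survive while copies of
   values are used up, and some almost full subset meets no more. *)
Lemma apr_extend w l g r d m (Y : {set 'I_w.+1}) Th U0 s0 L0 :
  256 <= l -> w < 2 ^ l -> 0 < g -> g %| d -> 0 < d -> d <= w ->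
  (forall x, x \in Y -> x %% g = r) -> 0 < #|Y| ->
  (forall h r', 1 < h ->
       4 * l * #|[set x in Y | x %% (g * h) == r']| < (4 * l - 1) * #|Y|) ->
  0 < Th -> w <= Th * #|Y| -> usable Y m U0 -> apr U0 s0 d L0 -> l ^ 2 * Th <= L0 ->
  (msize U0 + l ^ 3 * Th) * (8 * l) <= #|Y| * m ->
  exists U s, [/\ usable Y m U, apr U s g w & msize U <= msize U0 + l ^ 3 * Th].
Proof.
case: d => // d' l256 wl g0 gd _ dw Yr Y0 Ystar Th0 wTh U0u ap0 LL0 bud.
set d := d'.+1 in gd dw ap0.
have l0 : 0 < l by apply: leq_trans l256.
have w0 : 0 < w by apply: leq_trans dw.
have m0 : 0 < m.
  by case: (posnP m) bud => // ->; rewrite muln0 leqNgt muln_gt0 addn_gt0 !muln_gt0 l0 Th0 orbT.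
have ampY : ample l Y Y by rewrite /ample subxx leq_mul // leq_subr.
have ex : exists k, [exists Z : {set 'I_w.+1}, ample l Y Z && (#|resid d' Z| == k)].
  by exists #|resid d' Y|; apply/existsP; exists Y; rewrite ampY /=.
case: (ex_minnP ex) => rho /existsP[Z0 /andP[Z0a /eqP Z0r]] rmin.
have rhoP Z : ample l Y Z -> rho <= #|resid d' Z|.
  by move=> aZ; apply: rmin; apply/existsP; exists Z; rewrite aZ /=.
have [Z0Y cZ0] := andP Z0a.
have Z0pos : 0 < #|Z0| by have := ample_card l0 cZ0; move: Y0; clear; lia.
have rho0 : 0 < rho.
  rewrite -Z0r; case/card_gt0P: Z0pos => z zZ; apply/card_gt0P; exists (inZp (val z)).
  exact: mem_resid.
have HE := card_mult_set g0 gd; set h := #|mult_set g d'| in HE.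
have rh : rho <= h.
  rewrite -Z0r; apply: (card_coset gd (t := r)) => b /imsetP[x xZ ->] /=.
  by rewrite modn_dvdm // -(Yr x) ?(subsetP Z0Y) // modn_mod.
have gh : g * h = d by rewrite HE mulnC divnK.
have hd : h <= d by rewrite -gh leq_pmull.
have rd : rho <= d by apply: leq_trans hd.
have dT : d <= 3 * rho * Th.
  apply: (@modulus_bound l #|Y| #|Z0| rho d w Th) => //.
  by have := card_resid d' Z0; rewrite Z0r.
set a := ((6 * rho * Th) %/ d).+1.
set tau := ((37 * l * w) %/ rho).+1.
set NB := a * (l + tau %/ (w %/ d) + 2).
have bNB : 2 * NB <= 8 * l ^ 2 * Th by apply: extend_budget.
set N := 18 * (l + (h %/ 2).+1 %/ rho + 2).
have bN : 4 * N <= 8 * l ^ 2 * Th by apply: (@cover_budget l rho d).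
have lll : 16 * l ^ 2 * Th <= l ^ 3 * Th.
  by rewrite leq_mul2r (expnS l 2) leq_mul2r (leq_trans _ l256) ?orbT.
have room L : 37 * l * w < rho * L -> 2 * N * w + g + g * w <= d * L.
  exact: (cover_room l256 rho0 (eq_leq gh) rh g0 w0).
have coset B t := @card_coset g d' gd B t.
have box := box_phase l256 wl g0 gd dw Y0 rho0 Th0 wTh Z0a Z0r U0u m0 ap0 LL0 rd.
have cov U Uu := cover_half l256 wl g0 gd dw Yr Y0 Ystar rho0 rhoP (U := U) Uu m0.
rewrite -/d -/a -/tau -/NB in box; rewrite -/h -/N in cov; rewrite -/h in coset.
clearbody NB N h.
have [|U1 [s1 [L1 [n1 [U1u ap1 U1s n1N tauL]]]]] := box.
  apply: leq_trans bud; rewrite leq_mul2r; apply/orP; right; rewrite leq_add2l.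
  by move: bNB lll; clear; lia.
have [|u1 [k1 [B1 [[u1u u1s k1N c1 B1h] B1r]]]] := cov _ U1u.
  apply: leq_trans bud; rewrite leq_mul2r; apply/orP; right; rewrite U1s.
  by move: n1N bN bNB lll; clear; lia.
have [|u2 [k2 [B2 [[u2u u2s k2N c2 B2h] B2r]]]] := cov _ u1u.
  apply: leq_trans bud; rewrite leq_mul2r; apply/orP; right; rewrite msize_add u1s U1s.
  by move: k1N n1N bN bNB lll; clear; lia.
have big : 37 * l * w < rho * L1.
  apply: leq_trans (ltn_ceil (37 * l * w) rho0) _.
  by rewrite mulnC leq_mul2l tauL orbT.
have {}room := room _ big.
set k := k1 + k2; have kN : k <= 2 * N by rewrite /k; move: k1N k2N; clear; lia.
have rw : r <= w.
  case/card_gt0P: Y0 => y /Yr <-; apply: leq_trans (leq_mod _ _) _; by rewrite -ltnS.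
(* The least [j] with [k * r + g * j > k * w]: from this start on, every target exceeds [s1] plus
   any sum of two covering weights. *)
pose j := ((k * (w - r)) %/ g).+1.
have j1 : k * w <= k * r + g * j.
  have := ltn_ceil (k * (w - r)) g0; rewrite -/j mulnBr (mulnC j).
  have : k * r <= k * w by rewrite leq_mul2l rw orbT.
  clear; lia.
have j2 : k * r + g * j <= k * w + g.
  have := leq_divM (k * (w - r)) g; rewrite /j mulnS mulnBr (mulnC g).
  have : k * r <= k * w by rewrite leq_mul2l rw orbT.
  clear; lia.
exists (madd (madd U1 u1) u2), (s1 + (k * r + g * j)); split=> //; last first.
  rewrite !msize_add u1s u2s U1s; move: k1N k2N n1N bN bNB lll.
  by clear; lia.
move=> t tw; set x := _ + g * t.
have gt : g * t <= g * w by rewrite leq_mul2l tw orbT.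
have kwN : k * w <= 2 * N * w by rewrite leq_mul2r kN orbT.
have x1 : s1 + k * w <= x by rewrite /x; move: j1; clear; lia.
have x2 : x <= s1 + d * L1 by rewrite /x; move: j2 gt kwN room; clear; lia.
pose z : 'I_d := inZp (x - s1).
have zg : z = k * r %[mod g].
  rewrite /= modn_dvdm //; have -> : x - s1 = k * r + g * (j + t) by rewrite /x mulnDr; clear; lia.
  by rewrite addnC mulnC modnMDl.
(* [B1] and [z - B2] lie in the same coset and each fills more than half of it, so they meet. *)
have [b1 b1B b2B] : exists2 b1, b1 \in B1 & (z - b1)%R \in B2.
  pose B2' : {set 'I_d} := [set (z - b)%R | b in B2].
  have cB2' : #|B2'| = #|B2|.
    by apply: card_imset => p q /GRing.addrI /GRing.oppr_inj.
  have le : #|B1 :|: B2'| <= h.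
    apply: (coset _ (k1 * r)) => b; rewrite inE => /orP[/B1r //|/imsetP[q qB ->]].
    apply/eqP; rewrite -(eqn_modDr q); apply/eqP.
    have e : ((z - q)%R + q)%N = z %[mod g].
      rewrite -[in RHS](GRing.subrK q z); move: (z - q)%R => zq.
      by rewrite /= modn_dvdm.
    by rewrite e zg -modnDmr (B2r _ qB) modnDmr /k mulnDl.
  have : 0 < #|B1 :&: B2'|.
    move: (cardsUI B1 B2') B1h B2h le; rewrite cB2'.
    move: #|_ :|: _| #|_ :&: _| #|B1| #|B2| => c1' c2' c3' c4'; clear; lia.
  case/card_gt0P => b; rewrite inE => /andP[bB1 /imsetP[q qB e]].
  by exists b => //; rewrite e GRing.subKr.
have [e1 [e1u e1w e1b]] := c1 _ b1B.
have [e2 [e2u e2w e2b]] := c2 _ b2B.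
set v := mweight e1 + mweight e2.
have vk : v <= k * w by rewrite /v /k mulnDl leq_add.
have vx : v = x - s1 %[mod d].
  rewrite /v -modnDm e1b e2b modnDm addnC.
  transitivity (val z %% d); last by rewrite /= modn_mod.
  rewrite -[in RHS](GRing.subrK b1 z); move: (z - b1)%R => zq.
  by rewrite /= modn_mod.
have dv : d %| x - s1 - v by rewrite -eqn_mod_dvd; [rewrite eq_sym; apply/eqP | move: vk x1; clear; lia].
(* What the two covering weights leave of the target is a multiple of [d], which the long
   progression supplies. *)
have [|e0 [e0u e0w]] := ap1 ((x - s1 - v) %/ d).
  by rewrite leq_divLR //; rewrite [L1 * d]mulnC; move: x2; clear; lia.
exists (madd (madd e0 e1) e2); split; first by apply: mle_add => //; apply: mle_add.
by rewrite !mweight_add e0w mulnC divnK // -addnA -/v; move: vk x1; clear; lia.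
Qed.

Lemma pow_absorb l C a : C <= 256 -> 256 <= l -> C * l ^ a <= l ^ a.+1.
Proof. by move=> C256 l256; rewrite expnS leq_mul2r (leq_trans C256 l256) orbT. Qed.

Lemma pow_leq l a b : 256 <= l -> a <= b -> l ^ a <= l ^ b.
Proof. by move=> l256 ab; rewrite leq_pexp2l // (leq_trans _ l256). Qed.

Lemma usable_sub w (X Y : {set 'I_w.+1}) m u : Y \subset X -> usable Y m u -> usable X m u.
Proof.
move=> /subsetP YX uY v; apply: leq_trans (uY v) _; rewrite leq_mul2r; apply/orP; right.
by case: (boolP (v \in Y)) => // /YX ->.
Qed.

Lemma card_pos_le w (X : {set 'I_w.+1}) : (forall x, x \in X -> 0 < x) -> #|X| <= w.
Proof.
move=> X0; have : X \subset [set~ ord0].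
  by apply/subsetP => x /X0 x0; rewrite !inE -val_eqE /= -lt0n.
by move=> /subset_leq_card; rewrite cardsC1 card_ord.
Qed.

(** With this many copies, two values [x < y] alone give a first progression, of difference [y - x],
    by trading copies of [x] for copies of [y]; [apr_extend] then lowers the difference to [g]. If
    there is only one value, its multiples already form the progression. *)
Lemma apr_many_copies w l m (X : {set 'I_w.+1}) Th :
  256 <= l -> w < 2 ^ l -> 0 < #|X| -> (forall x, x \in X -> 0 < x) ->
  0 < Th -> w <= Th * #|X| -> l ^ 5 * Th <= m ->
  exists U s g, [/\ 0 < g, exists2 x, x \in X & g <= x, usable X m U,
     apr U s g w & msize U <= l ^ 4 * Th].
Proof.
move=> l256 wl X0 Xpos Th0 wTh mT.
have Thm : Th <= m by apply: leq_trans mT; rewrite leq_pmull // expn_gt0 (leq_trans _ l256).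
have p23 := pow_absorb 2 (isT : 8 <= 256) l256.
have p34 := pow_absorb 3 (isT : 64 <= 256) l256.
have p45 := pow_absorb 4 (isT : 64 <= 256) l256.
case: (leqP #|X| 1) => X1.
  case/card_gt0P: X0 => x xX; exists (mcopies w x), 0, x; split.
  - exact: Xpos.
  - by exists x.
  - move=> v; rewrite /mcopies; case: (eqVneq v x) => [->|//].
    rewrite xX !mul1n; apply: leq_trans wTh _; move: X1 Thm; case: #|X| => [|[|]] //; clear; lia.
  - move=> t tw; exists (mcopies t x); split; last by rewrite mweight_copies mulnC.
    by move=> v; rewrite /mcopies leq_mul2l tw orbT.
  - rewrite msize_copies; apply: leq_trans wTh _; rewrite mulnC leq_mul2r; apply/orP; right.
    by apply: leq_trans X1 _; rewrite expn_gt0 (leq_trans _ l256).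
have [g [r [Y [g0 YX cY Yr Ystar]]]] := extremal_class (leq_trans (isT : 0 < 256) l256) wl X1.
have Y1 : 1 < #|Y| by lia.
have [x [y [xY yY xy]]] : exists x y, [/\ x \in Y, y \in Y & x < y].
  case/card_gt1P: Y1 => x [y [xY yY]]; rewrite -val_eqE /= neq_ltn => /orP[] h.
    by exists x, y.
  by exists y, x.
set K := l ^ 2 * (2 * Th).
have Km : K <= m.
  apply: leq_trans mT; rewrite /K mulnCA mulnA leq_mul2r; apply/orP; right.
  by move: p23 p34 p45; clear; lia.
pose U0 := madd (mcopies K x) (mcopies K y).
have U0u : usable Y m U0.
  move=> v; rewrite /U0 /madd /mcopies; case: (eqVneq v x) => [->|vx].
    by rewrite xY -val_eqE /= (ltn_eqF xy); lia.
  by case: (eqVneq v y) => [->|//]; rewrite yY; lia.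
have ap0 : apr U0 (K * x) (y - x) K.
  move=> t tK; exists (madd (mcopies (K - t) x) (mcopies t y)); split.
    by apply: mle_add => v; rewrite /mcopies leq_mul2l ?tK ?leq_subr orbT.
  rewrite mweight_add !mweight_copies !mulnBl (mulnC y) (mulnC x t).
  have : t * x <= K * x by rewrite leq_mul2r tK orbT.
  have : t * x <= t * y by rewrite leq_mul2l ltnW ?orbT.
  clear; lia.
have gd : g %| y - x by rewrite -eqn_mod_dvd ?(ltnW xy) // !Yr.
have [||||||U [s [Uu ap sU]]] := @apr_extend w l g r (y - x) m Y (2 * Th) U0 (K * x) K
   l256 wl g0 gd _ _ Yr _ Ystar _ _ U0u ap0 (leqnn _).
- by rewrite subn_gt0.
- by apply: leq_trans (leq_subr _ _) _; rewrite -ltnS.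
- by apply: ltnW.
- by lia.
- by move: wTh cY; clear; nia.
- rewrite msize_add !msize_copies /K; apply: leq_trans (_ : #|Y| * (l ^ 5 * Th) <= _); last first.
    by rewrite leq_mul2l mT orbT.
  apply: leq_trans (_ : 2 * (l ^ 5 * Th) <= _); last by rewrite leq_mul2r Y1 orbT.
  have e5 : l ^ 5 = l ^ 4 * l by rewrite -expnSr.
  have e4 : l ^ 4 = l ^ 3 * l by rewrite -expnSr.
  have q1 : l ^ 2 * (2 * Th) + l ^ 2 * (2 * Th) + l ^ 3 * (2 * Th) <= 3 * l ^ 3 * Th.
    by move: (leq_mul p23 (leqnn Th)); clear; lia.
  have q2 : 48 * l ^ 4 * Th <= 2 * (l ^ 5 * Th).
    by move: (leq_mul p45 (leqnn Th)); clear; lia.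
  apply: leq_trans q2; apply: leq_trans (_ : 3 * l ^ 3 * Th * (8 * l) <= _).
    by rewrite leq_mul2r q1 orbT.
  by rewrite e4; clear; lia.
exists U, s, g; split=> //.
- exists y; first exact: (subsetP YX).
  by apply: leq_trans (dvdn_leq _ gd) _; [rewrite subn_gt0 | apply: leq_subr].
- exact: usable_sub Uu.
- apply: leq_trans sU _; rewrite msize_add !msize_copies /K.
  have q1 := leq_mul p23 (leqnn Th); have q2 := leq_mul p34 (leqnn Th).
  by move: q1 q2; clear; lia.
Qed.

(** * From differences of close values back to values *)

Section Pairs.
Variables (w m : nat).
Implicit Types (P : seq ('I_w.+1 * 'I_w.+1)).

Definition diff_count P e := count (fun p : 'I_w.+1 * 'I_w.+1 => p.2 - p.1 == e) P.

(** One copy of a difference [y - x] is simulated by one copy of [x] and one of [y], exactly one of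
    which is chosen. The base weight [b] is that of always choosing the smaller one. *)
Lemma lift_pairs w' P (u : 'I_w'.+1 -> nat) :
  uniq (unzip1 P ++ unzip2 P) -> (forall p, p \in P -> p.1 < p.2) ->
  (forall v, u v <= m * diff_count P v) ->
  exists U b, [/\ forall x, U x <= (x \in unzip1 P ++ unzip2 P) * m, msize U = 2 * msize u &
    forall c, mle c u -> exists c', mle c' U /\ mweight c' = b + mweight c].
Proof.
elim: P u => [|[x y] P IH] u uniP Plt uP.
  have u0 v : u v = 0 by apply/eqP; rewrite -leqn0; apply: leq_trans (uP v) _; rewrite muln0.
  exists (fun=> 0), 0; split=> //.
    by rewrite /msize !big1.
  move=> c cu; exists (fun=> 0); split=> //; rewrite /mweight !big1 // => v _.
  by have := cu v; rewrite u0 leqn0 => /eqP ->.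
have xy : x < y by apply: (Plt (x, y)); rewrite mem_head.
set e := y - x; pose v0 : 'I_w'.+1 := inord e.
(* As many copies of the difference [e] as the first pair can serve; the other copies are left to
   the remaining pairs. *)
pose k := if e < w'.+1 then minn (u v0) m else 0.
pose uf := mcopies k v0; pose u2 v := u v - uf v.
have ufu : mle uf u.
  move=> v; rewrite /uf /mcopies /k; case: ifP => _; last by rewrite muln0.
  by case: (eqVneq v v0) => [->|_]; rewrite ?mul1n ?geq_minl.
have kw : 0 < k -> v0 = e :> nat.
  by rewrite /k; case: ifP => // ew _; rewrite inordK.
have [|||U [b [Ux sU Uc]]] := IH u2.
- move: uniP; rewrite /= cat_uniq /= => /andP[_].
  rewrite negb_or => /and3P[h1 h2 /andP[_ h3]].
  by rewrite cat_uniq h1 h3; case/andP: h2 => _ ->.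
- by move=> p pP; apply: Plt; rewrite inE pP orbT.
- move=> v; have := uP v; rewrite /diff_count /= -/e /u2 /uf /mcopies /k.
  case: (eqVneq e v) => [ev|ev].
    have v0v : v0 = v by apply: val_inj; rewrite /v0 ev /= inordK.
    rewrite v0v ev ltn_ord eqxx mul1n mulnDr muln1; clear; lia.
  by rewrite add0n; apply: leq_trans; apply: leq_subr.
have km : k <= m by rewrite /k; case: ifP => // _; apply: geq_minr.
exists (madd U (madd (mcopies k x) (mcopies k y))), (b + k * x); split.
- have xy' : x == y = false by rewrite -val_eqE /= ltn_eqF.
  move: uniP; rewrite /= mem_cat inE negb_or => /andP[/andP[nx /norP[_ nx2]]].
  rewrite cat_uniq /= => /and3P[_ /norP[ny _] /andP[ny2 _]].
  move=> z; rewrite /madd /mcopies /=; have := Ux z; rewrite inE !mem_cat inE.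
  case: (eqVneq z x) => [->|zx].
    by rewrite (negPf nx) (negPf nx2) xy'; lia.
  case: (eqVneq z y) => [->|zy]; first by rewrite (negPf ny) (negPf ny2); lia.
  by rewrite /= !addn0.
- rewrite !msize_add !msize_copies sU.
  have -> : msize u = msize u2 + msize uf.
    by rewrite -msize_add; apply: eq_bigr => v _; rewrite /madd /u2 subnK ?ufu.
  by rewrite msize_copies; lia.
move=> c cu; pose cf v := minn (c v) (uf v); pose c2 v := c v - cf v.
have [|c' [c'U c'w]] := Uc c2.
  by move=> v; rewrite /c2 /u2 /cf; have := cu v; have := ufu v; lia.
have cfv v : cf v = (v == v0) * minn (c v0) k.
  by rewrite /cf /uf /mcopies; case: (eqVneq v v0) => [->|_]; rewrite ?mul1n ?minn0.
have kc : minn (c v0) k <= k by apply: geq_minr.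
set q := minn (c v0) k in cfv kc.
exists (madd c' (madd (mcopies (k - q) x) (mcopies q y))); split.
  apply: mle_add => //; apply: mle_add => v; rewrite /mcopies leq_mul2l ?leq_subr ?kc ?orbT //.
have -> : mweight c = mweight c2 + mweight (mcopies q v0).
  rewrite -mweight_add; apply: eq_bigr => v _; rewrite /madd /c2 /mcopies -cfv subnK //.
  by rewrite /cf geq_minl.
rewrite !mweight_add !mweight_copies c'w mulnBl.
have : q * v0 = q * e.
  by case: (posnP k) => k0; [move: kc; rewrite k0 leqn0 => /eqP -> | rewrite kw].
have : q * x <= k * x by rewrite leq_mul2r kc orbT.
have : q * y = q * e + q * x by rewrite -mulnDr subnK // ltnW.
lia.
Qed.

(** While more values are left than there are boxes of length [D], two of them share a box and can
    be paired. *)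
Lemma close_pairs (Y : {set 'I_w.+1}) D : 0 < D ->
  exists P, [/\ uniq (unzip1 P ++ unzip2 P), {subset unzip1 P ++ unzip2 P <= Y},
    forall p, p \in P -> p.1 < p.2 < p.1 + D & #|Y| <= (w %/ D).+1 + 2 * size P].
Proof.
move=> D0; have [n] := ubnP #|Y|; elim: n Y => // n IH Y Yn.
case: (leqP #|Y| (w %/ D).+1) => small.
  by exists [::]; split=> //; lia.
pose f (x : 'I_w.+1) : 'I_(w %/ D).+1 := inord (x %/ D).
have Y0 : 0 < #|Y| by apply: leq_ltn_trans small.
case: (pigeonhole (f := f) (B := setT) (fun x _ => in_setT _) Y0) => i _.
rewrite cardsT card_ord; set S := [set x in Y | _] => le.
have S1 : 1 < #|S|.
  rewrite ltnNge; apply/negP => S1; move: (leq_trans small le).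
  by rewrite ltnNge -[leqRHS]muln1 leq_mul2l S1 orbT.
have [x [y [xS yS xy]]] : exists x y, [/\ x \in S, y \in S & x < y].
  case/card_gt1P: S1 => x [y [xY yY]]; rewrite -val_eqE /= neq_ltn => /orP[] h.
    by exists x, y.
  by exists y, x.
have fv (z : 'I_w.+1) : f z = z %/ D :> nat.
  by rewrite inordK // ltnS leq_div2r // -ltnS.
move: xS yS; rewrite !inE => /andP[xY /eqP fx] /andP[yY /eqP fy].
have yx : y \in Y :\ x by rewrite !inE yY andbT -val_eqE /= gtn_eqF.
have c1 := cardsD1 x Y; have c2 := cardsD1 y (Y :\ x).
rewrite xY in c1; rewrite yx in c2.
have [|P [Pu Ps Pd Pc]] := IH (Y :\ x :\ y); first by lia.
have nin z : z \in unzip1 P ++ unzip2 P -> [/\ z \in Y, z != x & z != y].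
  by move/Ps; rewrite !inE => /and3P[].
exists ((x, y) :: P); split.
- have nx : x \notin unzip1 P ++ unzip2 P by apply/negP => /nin[_ /eqP].
  have ny : y \notin unzip1 P ++ unzip2 P by apply/negP => /nin[_ _ /eqP].
  rewrite /= -(cat1s y (unzip2 P)) uniq_catCA /= Pu ny.
  by move: nx; rewrite !mem_cat inE -val_eqE /= (ltn_eqF xy) => /negPf ->.
- by move=> z; rewrite /= inE mem_cat inE => /or4P[/eqP-> //|zP|/eqP-> //|zP];
   [case: (nin z) | case: (nin z)] => //; rewrite mem_cat zP ?orbT.
- move=> p; rewrite inE => /orP[/eqP -> /=|/Pd //]; rewrite xy /=.
  have e : x %/ D = y %/ D by rewrite -!fv fx fy.
  by have := ltn_ceil y D0; rewrite -e mulSn; have := leq_divM x D; lia.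
- by rewrite c1 c2 /= mulnS addnCA addnA leq_add2l.
Qed.
End Pairs.

(** A number below [2 ^ l] is at most the sum of the powers of 2 not exceeding it. Exchanging the
    sums leaves [l] contributions, one of which is at least the average. *)
Lemma dyadic_level (T : finType) (f : T -> nat) l : (forall x, f x < 2 ^ l) -> 0 < l ->
  exists2 j, j < l & \sum_x f x <= l * (2 ^ j * #|[set x | 2 ^ j <= f x]|).
Proof.
move=> fl l0.
have dy n k : minn n (2 ^ k - 1) <= \sum_(j < k) 2 ^ j * (2 ^ j <= n).
  elim: k => [|k IH]; first by rewrite big_ord0; lia.
  rewrite big_ord_recr /= expnS; move: IH; move: (\sum_(j < k) _) => S.
  have : 0 < 2 ^ k by rewrite expn_gt0.
  by case: (leqP (2 ^ k) n); move: (2 ^ k) => q; clear; lia.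
have le : \sum_x f x <= \sum_(j < l) 2 ^ j * #|[set x | 2 ^ j <= f x]|.
  apply: leq_trans (_ : \sum_x \sum_(j < l) 2 ^ j * (2 ^ j <= f x) <= _).
    by apply: leq_sum => x _; apply: leq_trans (dy _ _); have := fl x; lia.
  rewrite exchange_big /=; apply: leq_sum => j _; rewrite -big_distrr /= leq_mul2l.
  rewrite -sum1_card big_mkcond /= [leqRHS]big_mkcond /=; apply/orP; right.
  by apply: leq_sum => x _; rewrite inE; case: (2 ^ j <= f x).
case: (boolP [exists j : 'I_l, \sum_x f x <= l * (2 ^ j * #|[set x | 2 ^ j <= f x]|)]).
  by case/existsP => j h; exists j.
move=> /existsPn no; exfalso.
have : \sum_(j < l) (l * (2 ^ j * #|[set x | 2 ^ j <= f x]|)).+1 <= \sum_(j < l) \sum_x f x.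
  by apply: leq_sum => j _; have := no j; rewrite -ltnNge.
rewrite sum_nat_const card_ord (eq_bigr (fun j : 'I_l => l * (2 ^ j * #|[set x | 2 ^ j <= f x]|) + 1)); last first.
  by move=> j _; rewrite addn1.
rewrite big_split /= -big_distrr /= sum1_card card_ord.
move: le l0; move: (\sum_x _) (\sum_(j < l) _) => F S le l0.
by rewrite leqNgt (leq_ltn_trans (_ : _ <= l * S)) ?leq_mul2l ?le ?orbT // -[ltnLHS]addn0 ltn_add2l.
Qed.

Lemma pad_usable w (Y : {set 'I_w.+1}) m u q : usable Y m u -> msize u + q <= #|Y| * m ->
  exists v, usable Y m (madd u v) /\ msize v = q.
Proof.
elim: q => [|q IH] uu le.
  exists (fun=> 0); split; first by move=> v; rewrite /madd addn0.
  by rewrite /msize big1.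
have [|v [vu vs]] := IH uu; first by apply: leq_trans le; rewrite leq_add2l.
have [x xS] : exists x, x \in spare Y m (madd u v).
  case: (set_0Vmem (spare Y m (madd u v))) => [e|[x xS]]; last by exists x.
  exfalso; have := card_spare Y m (madd u v); rewrite e setD0 msize_add vs leqNgt.
  by apply/negP; rewrite negbK; apply: leq_trans le; rewrite addnS.
exists (madd v (mcopies 1 x)); split; last by rewrite msize_add vs msize_copies addn1.
move=> z; have := vu z; move: xS; rewrite !inE /madd /mcopies => /andP[xY lt].
by case: (eqVneq z x) => [->|_]; [rewrite xY; move: lt; clear; lia | rewrite mul0n addn0].
Qed.

Lemma class_card w g (Y : {set 'I_w.+1}) r : 0 < g -> (forall x, x \in Y -> x %% g = r) ->
  #|Y| <= (w %/ g).+1.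
Proof.
case: g => // g' _ Yr; apply: (@fiber_card w g' Y Y 0) => //.
- by move=> x y xY yY; rewrite !Yr.
- move=> x _; rewrite add0n mulnC; apply: leq_ltn_trans (_ : w < _); first by rewrite -ltnS.
  by rewrite ltn_ceil.
Qed.

Lemma chain_sub w (u : 'I_w.+1 -> nat) n : n <= msize u ->
  exists F : nat -> 'I_w.+1 -> nat, [/\ forall i, i <= n -> mle (F i) u,
    forall i, i <= n -> msize (F i) = i & forall i j, i <= j -> mle (F i) (F j)].
Proof.
elim: n => [|n IH] nu.
  exists (fun _ _ => 0); split=> // i; rewrite leqn0 => /eqP ->.
  by rewrite /msize big1.
have [F [F1 F2 F3]] := IH (ltnW nu).
have [x xu] : exists x, F n x < u x.
  apply/existsP; rewrite -[X in is_true X]negbK negb_exists; apply/negP => /forallP no.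
  have : msize u <= msize (F n) by apply: leq_sum => v _; rewrite leqNgt no.
  by rewrite F2 // leqNgt nu.
exists (fun i => if i <= n then F i else madd (F n) (mcopies 1 x)); split.
- move=> i; case: (leqP i n) => [/F1 //|_ _ v]; rewrite /madd /mcopies.
  by case: (eqVneq v x) => [->|_]; [rewrite addn1 | rewrite addn0; apply: F1].
- move=> i; case: (leqP i n) => [/F2 //|ni ni']; rewrite msize_add msize_copies F2 //.
  by move: ni ni'; clear; lia.
- move=> i j ij; case: (leqP j n) => jn; first by rewrite (leq_trans ij jn); apply: F3.
  case: (leqP i n) => i_n v; last by [].
  rewrite /madd; exact: leq_trans (F3 i n i_n v) (leq_addr _ _).
Qed.

(** Among [g + 1] nested submultisets of sizes 0 to [g], two have congruent weights mod [g]; their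
    difference is the block sought. *)
Lemma zero_sum w (u : 'I_w.+1 -> nat) g : 0 < g <= msize u ->
  exists v, [/\ mle v u, 0 < msize v <= g & g %| mweight v].
Proof.
case/andP => g0 gu; have [F [F1 F2 F3]] := chain_sub gu.
pose f (i : 'I_g.+1) : 'I_g := Ordinal (ltn_pmod (mweight (F i)) g0).
have [i [j [ij fij]]] : exists i j : 'I_g.+1, i < j /\ f i = f j.
  have /injectivePn[i [j ij e]] : ~~ injectiveb f.
    by apply/negP => /injectiveP/leq_card; rewrite !card_ord ltnn.
  move: ij; rewrite -val_eqE /= neq_ltn => /orP[] h; first by exists i, j.
  by exists j, i.
have le := F3 _ _ (ltnW ij).
have eF : F j =1 madd (F i) (fun v => F j v - F i v).
  by move=> v; rewrite /madd subnKC // le.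
have sF : msize (F j) = msize (F i) + msize (fun v => F j v - F i v).
  by rewrite -msize_add; apply: eq_bigr => v _; rewrite -eF.
have wF : mweight (F j) = mweight (F i) + mweight (fun v => F j v - F i v).
  by rewrite -mweight_add; apply: eq_bigr => v _; rewrite -eF.
exists (fun v => F j v - F i v); split.
- by move=> v; apply: leq_trans (leq_subr _ _) (F1 _ _ v); rewrite -ltnS.
- move: sF; rewrite !F2 -1?ltnS // => sF.
  by have := ltn_ord j; move: ij sF; clear; lia.
- rewrite -(addKn (mweight (F i)) (mweight _)) -wF -eqn_mod_dvd; last by rewrite wF leq_addr.
  by move/(congr1 val): fij => /= ->.
Qed.

Lemma mweight_ge w (u : 'I_w.+1 -> nat) : u ord0 = 0 -> msize u <= mweight u.
Proof.
move=> u0; apply: leq_sum => v _; case: (posnP v) => [v0|]; last exact: leq_pmulr.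
by rewrite (_ : v = ord0) ?u0 //; apply: val_inj.
Qed.

(* Zero-sum blocks mod [g] have weight at most [g * w], so weights of such
   unions approximate every target from above within [g * w]. *)
Lemma zero_sum_near w (u : 'I_w.+1 -> nat) g n : 0 < g -> 0 < w -> u ord0 = 0 ->
  n + g * w <= mweight u ->
  exists v, [/\ mle v u, g %| mweight v & n <= mweight v < n + g * w].
Proof.
move=> g0 w0 u0; elim: n => [|n IH] le.
  exists (fun=> 0); rewrite /mweight big1 //; split=> //.
  by rewrite add0n muln_gt0 g0.
have [|v [vu gv /andP[nv vn]]] := IH; first by apply: leq_trans le; rewrite leq_add2r.
case: (ltnP n (mweight v)) => lt.
  by exists v; split=> //; rewrite lt /= ltnW.
have ev : mweight v = n by apply/eqP; rewrite eqn_leq lt nv.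
pose r x := u x - v x.
have eu : mweight u = mweight v + mweight r.
  by rewrite -mweight_add; apply: eq_bigr => x _; rewrite /madd /r subnKC ?vu.
have gr : g <= msize r.
  rewrite -(leq_pmul2r w0); apply: leq_trans (mweight_le r).
  by move: le; rewrite eu ev addSn; clear; lia.
have [|b [br /andP[b0 bg] gb]] := @zero_sum w r g; first by rewrite g0.
exists (madd v b); split.
- by move=> x; rewrite /madd; have := br x; have := vu x; rewrite /r; clear; lia.
- by rewrite mweight_add dvdn_add.
- have bw : mweight b <= g * w by apply: leq_trans (mweight_le b) _; rewrite leq_mul2r bg orbT.
  have : 0 < mweight b.
    apply: leq_trans b0 _; apply: mweight_ge; apply/eqP; rewrite -leqn0.
    by apply: leq_trans (br _) _; rewrite /r u0.
  by rewrite mweight_add ev; move: bw; clear; lia.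
Qed.

Lemma sum_diff_count w N (P : seq ('I_w.+1 * 'I_w.+1)) :
  (forall p, p \in P -> p.2 - p.1 < N) -> \sum_(v < N) diff_count P v = size P.
Proof.
elim: P => [|p P IH] lt; first by rewrite big1.
rewrite (eq_bigr (fun v : 'I_N => (p.2 - p.1 == v) + diff_count P v)) // big_split /= IH; last first.
  by move=> q qP; apply: lt; rewrite inE qP orbT.
have pN : p.2 - p.1 < N by apply: lt; rewrite mem_head.
rewrite (bigD1 (Ordinal pN)) //= eqxx big1 ?addn0 // => v.
by rewrite -val_eqE /= eq_sym => /negPf ->.
Qed.

Lemma quad_bound p l Th : Th < p -> l < p -> 256 <= l -> l ^ 2 * (2 * Th) < p * p * p * p.
Proof.
move=> Tp lp l256; have p2 : 2 <= p by move: lp l256; clear; lia.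
have h1 : l ^ 2 <= p * p by rewrite mulnn leq_sqr ltnW.
have h2 : 2 * Th < p * p.
  by apply: leq_trans (leq_mul p2 Tp); rewrite mulnS addSn ltnS leq_addl.
rewrite -mulnA; apply: leq_ltn_trans (_ : p * p * (2 * Th) < _); first by rewrite leq_mul2r h1 orbT.
by rewrite ltn_pmul2l // muln_gt0 !(ltnW p2).
Qed.

Lemma progression_num1 l Th x y s k q m : 256 <= l -> l ^ 10 * Th <= x * m -> 3 * x <= 4 * y ->
  y <= 4 * s -> s <= l * (q * k) -> (4 * l) ^ 5 * (2 * (l ^ 2 * (2 * Th))) <= q * m * k.
Proof.
move=> l256 h1 h2 h3 h4; have l0 : 0 < 16 * l by rewrite muln_gt0 (leq_trans _ l256).
rewrite -(leq_pmul2l l0).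
have h5 : 3 * x <= 16 * l * (q * k) by move: h2 h3 h4; clear; lia.
have h6 : 3 * x * m <= 16 * l * (q * k) * m by rewrite leq_mul2r h5 orbT.
have p9 := pow_absorb 8 (leqnn 256) l256; have p10 := pow_absorb 9 (leqnn 256) l256.
have e : 16 * l * ((4 * l) ^ 5 * (2 * (l ^ 2 * (2 * Th)))) = 256 * (256 * l ^ 8) * Th.
  have -> : l ^ 8 = l * (l ^ 5 * l ^ 2) by rewrite -expnD -expnS.
  rewrite expnMn (_ : 4 ^ 5 = 4 * 256) //; move: (l ^ 5) (l ^ 2) => a b.
  rewrite (_ : 256 = 16 * 16) //; clear; lia.
rewrite e; apply: leq_trans (_ : 3 * x * m <= _); last by move: h6; clear; lia.
apply: leq_trans (_ : l ^ 10 * Th <= _); last by move: h1; clear; lia.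
rewrite leq_mul2r; apply/orP; right; apply: leq_trans p10.
by rewrite leq_mul2l p9 orbT.
Qed.

Lemma progression_num2 l Th x y c m : 256 <= l -> 0 < Th -> l ^ 10 * Th <= x * m -> 3 * x <= 4 * y ->
  c <= 2 * ((4 * l) ^ 4 * (2 * (l ^ 2 * (2 * Th)))) ->
  [/\ (c + l ^ 3 * (2 * Th)) * (8 * l) <= y * m, c + l ^ 3 * (2 * Th) <= l ^ 8 * Th &
      l ^ 8 * Th + 4 * Th <= y * m].
Proof.
move=> l256 Th0 h1 h2 h3.
have p7 := pow_absorb 6 (leqnn 256) l256; have p8 := pow_absorb 7 (leqnn 256) l256.
have p9 := pow_absorb 8 (leqnn 256) l256; have p10 := pow_absorb 9 (leqnn 256) l256.
have p36 : l ^ 3 <= l ^ 6 by apply: pow_leq.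
have e : (4 * l) ^ 4 * l ^ 2 = 256 * l ^ 6 by rewrite expnMn -mulnA -expnD.
have h4 : c <= 8 * (256 * l ^ 6 * Th).
  by apply: leq_trans h3 _; rewrite -e; clear; lia.
have h5 : c <= 8 * (l ^ 7 * Th).
  by apply: leq_trans h4 _; rewrite leq_mul2l leq_mul2r p7 orbT.
have h6 : l ^ 3 * (2 * Th) <= 2 * (l ^ 7 * Th).
  have : l ^ 3 * Th <= l ^ 7 * Th by rewrite leq_mul2r pow_leq ?orbT.
  by clear; lia.
have h7 : 256 * (l ^ 7 * Th) <= l ^ 8 * Th by rewrite mulnA leq_mul2r p8 orbT.
have h8 : 256 * (l ^ 8 * Th) <= l ^ 9 * Th by rewrite mulnA leq_mul2r p9 orbT.
have h9 : 256 * (l ^ 9 * Th) <= l ^ 10 * Th by rewrite mulnA leq_mul2r p10 orbT.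
have h10 : 3 * (l ^ 10 * Th) <= 4 * (y * m).
  apply: leq_trans (_ : 3 * x * m <= _); first by move: h1; clear; lia.
  by rewrite mulnA leq_mul2r h2 orbT.
have h11 : 4 * Th <= 4 * (l ^ 8 * Th) by rewrite leq_mul2l leq_pmull ?orbT // expn_gt0 (leq_trans _ l256).
split.
- apply: leq_trans (_ : 10 * (l ^ 7 * Th) * (8 * l) <= _).
    by rewrite leq_mul2r; apply/orP; right; move: h5 h6; clear; lia.
  have -> : 10 * (l ^ 7 * Th) * (8 * l) = 80 * (l ^ 8 * Th) by rewrite (expnS l 7); clear; lia.
  by move: h8 h9 h10; move: (l ^ 8 * Th) (l ^ 9 * Th) (l ^ 10 * Th) (y * m); clear; lia.
- by move: h5 h6 h7; move: (l ^ 7 * Th) (l ^ 8 * Th) (l ^ 3 * _); clear; lia.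
- by move: h8 h9 h10 h11; move: (l ^ 8 * Th) (l ^ 9 * Th) (l ^ 10 * Th) (y * m); clear; lia.
Qed.

(** Only the product of [#|X|] and [m] is large, so [m] alone may be too small for
    [apr_many_copies]. That lemma is therefore applied to the differences of close pairs: they are
    below [D], and a dyadic choice finds a set [K] of them, each occurring at least [2 ^ j] times,
    with [#|K| * 2 ^ j] large. The progression is lifted to values, and [apr_extend] brings it to
    length [w]. *)
Lemma homogeneous_progression w l m (X : {set 'I_w.+1}) Th :
  256 <= l -> w < 2 ^ l -> (forall x, x \in X -> 0 < x) -> 16 <= #|X| ->
  0 < Th -> Th < 2 ^ l -> w <= Th * #|X| -> l ^ 10 * Th <= #|X| * m ->
  exists U s g, [/\ 0 < g <= 4 * Th, g %| s, usable X m U,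
     apr U s g w & msize U <= (l ^ 8 + 4) * Th].
Proof.
move=> l256 wl Xpos X16 Th0 Thw wTh big.
have l0 : 0 < l by apply: leq_trans l256.
have w0 : 0 < w by apply: leq_trans (card_pos_le Xpos); apply: leq_trans X16.
have X1 : 1 < #|X| by apply: leq_trans X16.
have [g [r [Y [g0 YX cY Yr Ystar]]]] := extremal_class l0 wl X1.
have Y12 : 12 <= #|Y| by move: X16 cY; clear; lia.
have Y0 : 0 < #|Y| by apply: leq_trans Y12.
set Th1 := 2 * Th; have Th10 : 0 < Th1 by rewrite muln_gt0.
have wTh1 : w <= Th1 * #|Y|.
  apply: leq_trans wTh _; rewrite /Th1 -mulnA mulnCA leq_mul2l; apply/orP; right.
  by move: cY; clear; lia.
(* There are at most [#|Y| / 4 + 1] boxes of this length, so a constant fraction of [Y] gets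
   paired. *)
set D := 4 * Th1; have D0 : 0 < D by rewrite muln_gt0.
have [P [Pu PY Pd cP]] := close_pairs Y D0.
have Plt p : p \in P -> p.1 < p.2 by case/Pd/andP.
have PinY p : p \in P -> p.1 \in Y /\ p.2 \in Y.
  by move=> pP; split; apply: PY; rewrite mem_cat map_f ?orbT.
have cPY : #|Y| <= 4 * size P.
  have q4 : 4 * (w %/ D) <= #|Y|.
    rewrite -(leq_pmul2r Th10) (mulnC #|Y|); apply: leq_trans wTh1.
    by apply: leq_trans (leq_divM w D); rewrite mulnAC mulnC.
  by move: Y12 cP q4; move: (w %/ D) #|Y| (size P); clear; lia.
set w' := l ^ 2 * Th1.
have Dw' : D <= w'.
  rewrite leq_mul2r; apply/orP; right; apply: leq_trans (_ : l ^ 1 <= _).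
    by rewrite expn1 (leq_trans _ l256).
  exact: pow_leq.
pose f (v : 'I_w'.+1) := diff_count P v.
have fmem v : 0 < f v -> exists2 p, p \in P & p.2 - p.1 = v.
  by rewrite /f /diff_count -has_count => /hasP[p pP /eqP e]; exists p.
have sumf : \sum_v f v = size P.
  apply: sum_diff_count => p /Pd/andP[_ lt].
  by apply: leq_trans Dw'; move: lt D0; clear; lia.
have sP : size P < 2 ^ l.
  apply: leq_ltn_trans wl; have := card_uniqP Pu; rewrite size_cat !size_map => e.
  have := max_card (mem (unzip1 P ++ unzip2 P)); rewrite e card_ord.
  by move: w0; clear; lia.
have [j jl] := @dyadic_level _ f l (fun v => leq_ltn_trans (count_size _ _) sP) l0.
rewrite sumf; set K := [set v | _] => cK.
have KP v : v \in K -> exists2 p, p \in P & p.2 - p.1 = v.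
  by rewrite inE => h; apply: fmem; apply: leq_trans h; rewrite expn_gt0.
have Kpos v : v \in K -> 0 < v by case/KP => p /Plt lt <-; rewrite subn_gt0.
have K0 : 0 < #|K|.
  case: (posnP #|K|) cK => // ->; rewrite !muln0 leqn0 => /eqP e.
  by move: Y12 cPY; rewrite e; clear; lia.
have Kg v : v \in K -> v = 0 %[mod g].
  case/KP => p /[dup] /Plt lt /PinY[p1 p2] <-.
  by rewrite mod0n; apply/eqP; rewrite -/(dvdn g _) -eqn_mod_dvd ?(ltnW lt) // !Yr.
set ThK := (w' %/ #|K|).+1.
have ThK2 : ThK * #|K| <= 2 * w' := boxes_le K0 (card_pos_le Kpos).
have num1 := progression_num1 l256 big cY cPY cK; rewrite -/Th1 -/w' in num1.
(* The range [w'] of differences contains factors [l ^ 2] and [Th], so it is bounded only by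
   [2 ^ (4 * l)]; hence the parameter [4 * l] for differences. *)
have l4 : 256 <= 4 * l by apply: leq_trans l256 _; rewrite leq_pmull.
have w'l : w' < 2 ^ (4 * l).
  have ll : l < 2 ^ l by apply: ltn_expl.
  have -> : 4 * l = l + l + l + l by clear; lia.
  rewrite !expnD /w' /Th1; move: Thw ll l256.
  by move: (2 ^ l) => p; clear; apply: quad_bound.
have [|||U' [s' [g' [g'0 [x' x'K g'x] U'u ap' sU']]]] :=
  @apr_many_copies w' (4 * l) (2 ^ j * m) K ThK l4 w'l K0 Kpos.
- by [].
- by rewrite ltnW // ltn_ceil.
- rewrite -(leq_pmul2r K0) -mulnA; apply: leq_trans num1.
  by rewrite leq_mul2l ThK2 orbT.
have U'f v : U' v <= m * diff_count P v.
  apply: leq_trans (U'u v) _; case: (boolP (v \in K)) => // vK.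
  by rewrite mul1n mulnC leq_mul2l; move: vK; rewrite inE => ->; rewrite orbT.
have [UC [b [UCx sUC UCc]]] := lift_pairs Pu Plt U'f.
have UCu : usable Y m UC.
  move=> x; apply: leq_trans (UCx x) _; rewrite leq_mul2r; apply/orP; right.
  by case: (boolP (x \in _)) => // /PY ->.
have apC : apr UC (b + s') g' w'.
  move=> t tw; have [c [cU cw]] := ap' _ tw; have [c' [c'U c'w]] := UCc _ cU.
  by exists c'; split=> //; rewrite c'w cw addnA.
have gg' : g %| g'.
  have [|c0 [c0U c0w]] := ap' 0; first by [].
  have [|c1 [c1U c1w]] := ap' 1; first by apply: leq_trans Dw'.
  have := mweight_mod Kg (usable_le c0U U'u); have := mweight_mod Kg (usable_le c1U U'u).
  rewrite c0w c1w !muln0 muln1 addn0 => e1 e0.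
  by move: e1; rewrite -[X in _ = X]e0 => /eqP; rewrite -[X in _ == X %[mod _]]addn0 eqn_modDl mod0n.
have g'w : g' <= w.
  apply: leq_trans g'x _; case: (KP _ x'K) => p _ <-.
  by apply: leq_trans (leq_subr _ _) _; rewrite -ltnS.
have sC : msize UC <= 2 * ((4 * l) ^ 4 * (2 * (l ^ 2 * (2 * Th)))).
  rewrite sUC leq_mul2l /=; apply: leq_trans sU' _; rewrite leq_mul2l; apply/orP; right.
  by apply: leq_trans ThK2; rewrite leq_pmulr.
have [num2 num3 num4] := progression_num2 l256 Th0 big cY sC.
have [U [s [Uu ap sU]]] := @apr_extend w l g r g' m Y Th1 UC (b + s') w' l256 wl g0 gg' g'0 g'w
   Yr Y0 Ystar Th10 wTh1 UCu apC (leqnn _) num2.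
have g4 : g <= 4 * Th.
  have := class_card g0 Yr; case: #|Y| Y12 wTh1 => // y y11 wy yw.
  have y2 : 1 < y by move: y11; clear; lia.
  have h1 : y * g <= Th1 * y.+1 by apply: leq_trans wy; rewrite -leq_divRL.
  have h2 : Th * 2 <= Th * y by rewrite leq_mul2l y2 orbT.
  rewrite -(leq_pmul2l (ltnW y2)); apply: leq_trans h1 _.
  by rewrite /Th1 mulnS; move: h2; clear; lia.
have {}sU : msize U <= l ^ 8 * Th by apply: leq_trans sU num3.
have [|c0 [c0U c0w]] := ap 0; first by [].
(* All values of [Y] are congruent to [r] mod [g], so a weight depends mod [g] only on the number of
   elements. Padding [c0] to a size divisible by [g] makes the start of the progression divisible by
   [g]. *)
set q := g - msize c0 %% g.
have qg : q <= g by apply: leq_subr.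
have [|v [vu vs]] := @pad_usable w Y m U q Uu.
  apply: leq_trans num4; apply: leq_add => //; exact: leq_trans qg g4.
exists (madd U v), (s + mweight v), g; split.
- by rewrite g0.
- have -> : s + mweight v = mweight (madd c0 v) by rewrite mweight_add c0w muln0 addn0.
  have Ym x : x \in Y -> x = r %[mod g] by move=> xY; rewrite -(Yr _ xY) modn_mod.
  have cu : usable Y m (madd c0 v) by apply: usable_le vu; apply: mle_add.
  rewrite /dvdn (mweight_mod Ym cu) msize_add vs -/(dvdn _ _) dvdn_mulr //.
  rewrite {1}(divn_eq (msize c0) g) -addnA subnKC; last by rewrite ltnW // ltn_pmod.
  by rewrite dvdn_add ?dvdn_mull.
- exact: usable_sub vu.
- move=> t tw; have [c [cU cw]] := ap _ tw; exists (madd c v); split; first exact: mle_add.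
  by rewrite mweight_add cw addnAC.
- rewrite msize_add vs mulnDl leq_add //; exact: leq_trans qg g4.
Qed.

(* Condition and conclusion only differ by polylogarithmic factors from the
   dense subset sum theorem: [Th] stands for [w / #|X|]. *)
Lemma common_subset_sum w l m (X : {set 'I_w.+1}) Th (A : 'I_w.+1 -> nat) :
  256 <= l -> w < 2 ^ l -> (forall x, x \in X -> 0 < x) -> 16 <= #|X| ->
  0 < Th -> Th < 2 ^ l -> w <= Th * #|X| -> l ^ 10 * Th <= #|X| * m ->
  A ord0 = 0 -> l ^ 9 * Th * w <= mweight A ->
  exists c a, [/\ usable X m c, mle a A, mweight c = mweight a & 0 < mweight a].
Proof.
move=> l256 wl Xpos X16 Th0 Thw wTh big A0 Abig.
have [U [s [g [/andP[g0 g4] gs Uu ap sU]]]] :=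
  homogeneous_progression l256 wl Xpos X16 Th0 Thw wTh big.
have w0 : 0 < w by apply: leq_trans (card_pos_le Xpos); apply: leq_trans X16.
have sw : s <= (l ^ 8 + 4) * Th * w.
  have [|c [cU cw]] := ap 0; first by [].
  rewrite muln0 addn0 in cw; rewrite -cw; apply: leq_trans (mweight_le c) _.
  by rewrite leq_mul2r (leq_trans (mle_size cU) sU) orbT.
have [|a [aA ga /andP[sa as']]] := @zero_sum_near w A g s.+1 g0 w0 A0.
  apply: leq_trans Abig; have gw : g * w <= 4 * Th * w by rewrite leq_mul2r g4 orbT.
  have p := pow_absorb 8 (isT : 10 <= 256) l256.
  have : 1 <= l ^ 8 by rewrite expn_gt0 (leq_trans _ l256).
  have : 1 <= Th * w by rewrite muln_gt0 Th0.
  move: sw gw p; move: (l ^ 8) (l ^ 9) => p8 p9 h1 h2 h3 h4 h5.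
  have : 10 * p8 * (Th * w) <= p9 * (Th * w) by rewrite leq_mul2r h3 orbT.
  have : 1 * (Th * w) <= p8 * (Th * w) by rewrite leq_mul2r h5 orbT.
  by move: h1 h2 h4; clear; lia.
have [t e] : exists t, mweight a = s + g * t.
  exists ((mweight a - s) %/ g); rewrite mulnC divnK ?subnKC ?(ltnW sa) //.
  by rewrite dvdn_sub.
have [|c [cU cw]] := ap t.
  by move: as'; rewrite e addSn ltnS leq_add2l leq_pmul2l.
exists c, a; split=> //; first exact: usable_le cU Uu.
  by rewrite cw e.
by apply: leq_trans sa.
Qed.

(** * Proximity of an optimum to the greedy solution *)

Lemma mweight_diff w (a b : 'I_w.+1 -> nat) : mle a b ->
  mweight b = mweight a + mweight (fun x => b x - a x).
Proof.
by move=> ab; rewrite -mweight_add; apply: eq_bigr => x _; rewrite /madd subnKC ?ab.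
Qed.

Lemma msize_diff w (a b : 'I_w.+1 -> nat) : mle a b ->
  msize b = msize a + msize (fun x => b x - a x).
Proof.
by move=> ab; rewrite -msize_add; apply: eq_bigr => x _; rewrite /madd subnKC ?ab.
Qed.

(* Among [w + 1] nested pairs of prefixes whose weights differ by less than
   [w], two pairs have the same difference. *)
Lemma long_common_sum w (u v : 'I_w.+1 -> nat) : 0 < w -> u ord0 = 0 -> v ord0 = 0 ->
  w <= msize u -> w <= msize v ->
  exists c d, [/\ mle c u, mle d v, mweight c = mweight d & 0 < mweight c].
Proof.
move=> w0 u0 v0 wu wv.
have [F [F1 F2 F3]] := chain_sub wu; have [H [H1 H2 H3]] := chain_sub wv.
wlog le : u v F H u0 v0 wu wv F1 F2 F3 H1 H2 H3 / mweight (F w) <= mweight (H w).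
  move=> wl; case/orP: (leq_total (mweight (F w)) (mweight (H w))) => le.
    exact: (wl u v F H).
  have [c [d [cv du e c0]]] := wl v u H F v0 u0 wv wu H1 H2 H3 F1 F2 F3 le.
  by exists d, c; rewrite -e.
have mono (K : nat -> 'I_w.+1 -> nat) (K3 : forall i j, i <= j -> mle (K i) (K j)) i j :
    i <= j -> mweight (K i) <= mweight (K j).
  by move=> /K3 le'; rewrite (mweight_diff le') leq_addr.
have lastP (i : 'I_w.+1) : exists j : 'I_w.+1, mweight (H j) <= mweight (F i) < mweight (H j) + w.
  have ex : exists j : nat, (j <= w) && (mweight (H j) <= mweight (F i)).
    exists 0; rewrite /= (_ : mweight (H 0) = 0) //; apply/eqP; rewrite -leqn0.
    by apply: leq_trans (mweight_le _) _; rewrite H2.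
  have bd j : (j <= w) && (mweight (H j) <= mweight (F i)) -> j <= w by case/andP.
  case: (ex_maxnP ex bd) => j /andP[jw le1] jmax.
  exists (Ordinal (jw : j < w.+1)); rewrite /= le1 /=.
  move: jw; rewrite leq_eqVlt => /orP[/eqP ej|jw].
    rewrite ej; apply: leq_ltn_trans (_ : mweight (H w) < _); last by rewrite -addn1 leq_add2l.
    by apply: leq_trans le; apply: mono => //; rewrite -ltnS.
  rewrite ltnNge; apply/negP => le2.
  have : mweight (H j.+1) <= mweight (F i).
    apply: leq_trans le2; rewrite (mweight_diff (H3 _ _ (leqnSn j))) leq_add2l.
    apply: leq_trans (mweight_le _) _.
    have := msize_diff (H3 _ _ (leqnSn j)); rewrite !H2 ?(ltnW jw) // => /eqP.
    by rewrite -addn1 eqn_add2l => /eqP <-; rewrite mul1n.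
  move=> le3; have := jmax j.+1; rewrite jw le3 => /(_ isT).
  by rewrite ltnn.
pose J i := xchoose (lastP i).
have JP i : mweight (H (J i)) <= mweight (F i) < mweight (H (J i)) + w by apply: (xchooseP (lastP i)).
have flt (i : 'I_w.+1) : mweight (F i) - mweight (H (J i)) < w.
  by have /andP[h1 h2] := JP i; rewrite ltn_subLR.
have [i [i' [ii' e]]] : exists i i' : 'I_w.+1, i < i' /\
    mweight (F i) - mweight (H (J i)) = mweight (F i') - mweight (H (J i')).
  have /injectivePn[i [j ij e]] : ~~ injectiveb (fun i : 'I_w.+1 => Ordinal (flt i)).
    by apply/negP => /injectiveP/leq_card; rewrite !card_ord ltnn.
  move: ij; move/(congr1 val): e => /= e; rewrite -val_eqE /= neq_ltn => /orP[] h.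
    by exists i, j.
  by exists j, i.
have dF := mweight_diff (F3 _ _ (ltnW ii')).
have c0 : 0 < mweight (fun x => F i' x - F i x).
  have iw (j : 'I_w.+1) : j <= w by rewrite -ltnS.
  have dS := msize_diff (F3 _ _ (ltnW ii')); rewrite !F2 // in dS.
  have h : msize (fun x => F i' x - F i x) <= mweight (fun x => F i' x - F i x).
    apply: mweight_ge; by have := F1 i' (ltn_ord i') ord0; rewrite u0 leqn0 => /eqP ->.
  by apply: leq_trans h; move: ii' dS; clear; lia.
have /andP[a1 a2] := JP i; have /andP[b1 b2] := JP i'.
have JJ : J i <= J i'.
  rewrite leqNgt; apply/negP => lt; have := mono H H3 _ _ (ltnW lt).
  by move: e dF c0 a1 b1; clear; lia.
have dH := mweight_diff (H3 _ _ JJ).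
exists (fun x => F i' x - F i x), (fun x => H (J i') x - H (J i) x); split=> //.
- by move=> x; apply: leq_trans (leq_subr _ _) (F1 _ _ x); rewrite -ltnS.
- by move=> x; apply: leq_trans (leq_subr _ _) (H1 _ _ x); rewrite -ltnS.
- by move: e dF dH a1 b1; clear; lia.
Qed.

(** * Sets of items without common subset sums *)

Section Items.
Variables (n wm : nat) (w : 'I_n -> nat).
Hypotheses (w0 : forall i, 0 < w i) (wle : forall i, w i <= wm).
Implicit Types (I C D E R : {set 'I_n}).

Definition wt I := \sum_(i in I) w i.
Definition mult I v := #|[set i in I | w i == v]|.
Definition mult_of I : 'I_wm.+1 -> nat := fun v => mult I v.

Lemma wt_sub I C : I \subset C -> wt I <= wt C.
Proof.
by move=> IC; rewrite /wt [leqRHS](big_setID I) /= (setIidPr IC) leq_addr.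
Qed.

Lemma wtID I C : wt I = wt (I :&: C) + wt (I :\: C).
Proof. by rewrite /wt (big_setID C). Qed.

Lemma mult_of0 I : mult_of I ord0 = 0.
Proof.
apply/eqP; rewrite cards_eq0; apply/eqP/setP => i; rewrite !inE.
by rewrite (gtn_eqF (w0 i)) andbF.
Qed.

Lemma mweight_mult_of I : mweight (mult_of I) = wt I.
Proof.
rewrite /mweight /wt (partition_big (fun i => inord (w i) : 'I_wm.+1) predT) //=.
apply: eq_bigr => v _; rewrite /mult_of /mult -sum1_card big_distrl /=.
rewrite (eq_bigl (fun i => (i \in I) && ((inord (w i) : 'I_wm.+1) == v))); last first.
  by move=> i; rewrite inE -val_eqE /= inordK // ltnS.
by apply: eq_bigr => i /andP[_ /eqP <-]; rewrite inordK ?ltnS // mul1n.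
Qed.

Lemma msize_mult_of I : msize (mult_of I) = #|I|.
Proof.
rewrite -sum1_card /msize (partition_big (fun i => inord (w i) : 'I_wm.+1) predT) //=.
apply: eq_bigr => v _; rewrite /mult_of /mult -sum1_card; apply: eq_bigl => i.
by rewrite inE -val_eqE /= inordK // ltnS.
Qed.

Lemma realize I (a : 'I_wm.+1 -> nat) : mle a (mult_of I) ->
  exists2 C : {set 'I_n}, C \subset I & wt C = mweight a.
Proof.
move: {2}#|I| (leqnn #|I|) => k; elim: k I a => [|k IH] I a.
  rewrite leqn0 cards_eq0 => /eqP -> a0; exists set0; rewrite ?sub0set //.
  rewrite /wt big_set0 /mweight big1 // => v _; have := a0 v.
  by rewrite /mult_of /mult (_ : [set _ in _ | _] = set0) ?cards0 ?leqn0 => [/eqP ->|] //; apply/setP => i; rewrite !inE.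
case: (set_0Vmem I) => [->|[i iI]] cI aI.
  by apply: (IH set0 a) => //; rewrite cards0.
have cI' : #|I :\ i| <= k by move: cI; rewrite (cardsD1 i I) iI.
have m1 v : mult I v = (w i == v) + mult (I :\ i) v.
  rewrite /mult (cardsD1 i) inE iI /=; congr (_ + _); apply: eq_card => x.
  by rewrite !inE andbA.
pose v0 : 'I_wm.+1 := inord (w i); have v0w : v0 = w i :> nat by rewrite inordK // ltnS.
case: (posnP (a v0)) => av.
  have [|C CI e] := IH (I :\ i) a cI'.
    move=> v; have := aI v; rewrite /mult_of m1; case: eqP => // ev.
    by rewrite (_ : v = v0) ?av //; apply: val_inj; rewrite /= v0w.
  by exists C => //; apply: subset_trans CI (subsetDl _ _).
have [|C CI e] := IH (I :\ i) (fun v => a v - (v == v0)) cI'.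
  move=> v; have := aI v; rewrite /mult_of m1 -val_eqE /= v0w eq_sym.
  by case: (val v == w i); clear; lia.
have iC : i \notin C by apply/negP => /(subsetP CI); rewrite !inE eqxx.
exists (i |: C).
  by rewrite subUset sub1set iI (subset_trans CI (subsetDl _ _)).
rewrite /wt big_setU1 //= -/(wt C) e.
have -> : mweight a = mweight (madd (mcopies 1 v0) (fun v => a v - (v == v0))).
  apply: eq_bigr => v _; rewrite /madd /mcopies muln1; case: (eqVneq v v0) => [->|_].
    by rewrite subnKC.
  by rewrite subn0.
by rewrite mweight_add mweight_copies mul1n v0w.
Qed.

Definition no_common C D := forall U V : {set 'I_n}, U \subset C -> V \subset D -> wt U = wt V -> wt U = 0.

Lemma no_common_sym C D : no_common C D -> no_common D C.
Proof. by move=> h U V UD VC e; rewrite e; exact: (h V U VC UD (esym e)). Qed.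

Lemma no_common_dense l Th m C D (X : {set 'I_wm.+1}) : no_common C D ->
  256 <= l -> wm < 2 ^ l -> (forall x, x \in X -> 0 < x) -> 16 <= #|X| ->
  0 < Th -> Th < 2 ^ l -> wm <= Th * #|X| -> l ^ 10 * Th <= #|X| * m ->
  (forall x, x \in X -> m <= mult C x) -> wt D < l ^ 9 * Th * wm.
Proof.
move=> nc l256 wl Xpos X16 Th0 Thl wTh big Xm; rewrite ltnNge; apply/negP => le.
have [|c [a [cX aD e a0]]] := common_subset_sum l256 wl Xpos X16 Th0 Thl wTh big (mult_of0 D).
  by rewrite mweight_mult_of.
have cC : mle c (mult_of C).
  move=> v; apply: leq_trans (cX v) _; case: (boolP (v \in X)) => [/Xm|]; by rewrite ?mul1n.
have [U UC eU] := realize cC; have [V VD eV] := realize aD.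
have := nc U V UC VD; rewrite eU eV e => /(_ erefl) z.
by rewrite z in a0.
Qed.

(** If both sets had at least [wm] items, [long_common_sum] would give a common subset sum. So one
    of them has few items, and the other has nearly the same weight. *)
Lemma no_common_small C D : no_common C D -> 0 < wm -> wt C <= wt D + wm -> wt D <= wt C + wm ->
  wt C <= wm ^ 2 + wm /\ wt D <= wm ^ 2 + wm.
Proof.
move=> nc wm0 CD DC.
have sm I : #|I| < wm -> wt I <= wm ^ 2.
  move=> lt; rewrite -mweight_mult_of; apply: leq_trans (mweight_le _) _.
  by rewrite msize_mult_of -mulnn leq_mul2r ltnW ?orbT.
case: (ltnP #|C| wm) => [/sm h|hC].
  by split; [move: h; clear; lia | move: h DC; clear; lia].
case: (ltnP #|D| wm) => [/sm h|hD].
  by split; [move: h CD; clear; lia | move: h; clear; lia].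
have [||c [d [cC dD e c0]]] := long_common_sum wm0 (mult_of0 C) (mult_of0 D).
- by rewrite msize_mult_of.
- by rewrite msize_mult_of.
have [U UC eU] := realize cC; have [V VD eV] := realize dD.
have := nc U V UC VD; rewrite eU eV e => /(_ erefl) z.
by rewrite e z in c0.
Qed.

(** A weight frequent in [R] keeps half of its multiplicity in [D :&: R] or in [R :\: D], so one of
    the two contains half of the frequent weights. In the first case [E] is light, and with it [D];
    in the second case [D :\: R] is light. *)
Lemma outside_ring l Th k mu D E R : 256 <= l -> wm < 2 ^ l -> 0 < mu -> 
  0 < Th -> 2 * Th < 2 ^ l -> 32 <= k -> wm <= Th * k -> 8 * l ^ 10 * Th <= k * mu ->
  no_common (R :\: D) (D :\: R) -> no_common (D :&: R) E -> wt D <= wt E + wm ->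
  k <= #|[set v : 'I_wm.+1 | mu <= mult R v]| ->
  wt (D :\: R) <= (l ^ 9 * (2 * Th) + 1) * wm.
Proof.
move=> l256 wl mu0 Th0 Thl k32 wTh big nc1 nc2 DE kX.
set X := [set v | _] in kX; pose m2 := uphalf mu.
have m20 : 0 < m2 by rewrite /m2; move: mu0; clear; lia.
have mID v : mult R v = mult (D :&: R) v + mult (R :\: D) v.
  rewrite /mult -(cardsID D); congr (_ + _); apply: eq_card => i; rewrite !inE.
    by case: (i \in D); case: (i \in R); rewrite ?andbF ?andbT.
  by case: (i \in D); case: (i \in R); rewrite ?andbF ?andbT.
have pos I v : m2 <= mult I v -> 0 < v.
  case: v => // h; have := mult_of0 I; rewrite /mult_of /= => e.
  by rewrite e leqNgt m20 in h.
pose X1 := [set v : 'I_wm.+1 | m2 <= mult (D :&: R) v].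
pose X2 := [set v : 'I_wm.+1 | m2 <= mult (R :\: D) v].
have XX : X \subset X1 :|: X2.
  apply/subsetP => v; rewrite !inE mID /m2.
  by move: (mult _ v) (mult _ v); clear; lia.
have num (Y : {set 'I_wm.+1}) : k <= 2 * #|Y| -> [/\ 16 <= #|Y|, wm <= 2 * Th * #|Y| &
    l ^ 10 * (2 * Th) <= #|Y| * m2].
  move=> kY; split.
  - by move: k32 kY; clear; lia.
  - by apply: leq_trans wTh _; rewrite -mulnA mulnCA leq_mul2l kY orbT.
  - have h : k * mu <= (2 * #|Y|) * (2 * m2).
      by apply: leq_mul => //; rewrite /m2; clear; lia.
    by move: h big; move: (l ^ 10) => p; clear; lia.
have := leq_trans kX (subset_leq_card XX); rewrite cardsU => kk.
case: (leqP k (2 * #|X1|)) => [/num|h1].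
  case=> n1 n2 n3.
  have := no_common_dense nc2 l256 wl _ n1 _ Thl n2 n3 => h.
  have {}h : wt E < l ^ 9 * (2 * Th) * wm.
    apply: h.
    - by move=> v; rewrite inE => /pos.
    - by rewrite muln_gt0.
    - by move=> v; rewrite inE.
  apply: leq_trans (wt_sub (subsetDl _ _)) _; apply: leq_trans DE _.
  by rewrite mulnDl mul1n leq_add2r ltnW.
case: (leqP k (2 * #|X2|)) => [/num|h2]; last first.
  by exfalso; move: kk h1 h2; clear; lia.
case=> n1 n2 n3.
have := no_common_dense nc1 l256 wl _ n1 _ Thl n2 n3 => h.
rewrite mulnDl; apply: leq_trans (leq_addr _ _); apply: ltnW; apply: h.
- by move=> v; rewrite inE => /pos.
- by rewrite muln_gt0.
- by move=> v; rewrite inE.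
Qed.
End Items.

(** The number of weights to single out at level [j] on each side. The summand 32 guarantees that
    half of them are still the 16 values that the progression lemma requires. [lvl_mult] is just
    large enough for [outside_ring], and [window] refers to level [j + 1] because a weight of level
    [j] is known to be infrequent only there. *)
Definition lvl_size wm j := wm %/ 2 ^ j + 32.
Definition lvl_sparsity wm j := (wm %/ lvl_size wm j).+1.
Definition lvl_mult l wm j := ((8 * l ^ 10 * lvl_sparsity wm j) %/ lvl_size wm j).+1.
Definition window l wm j := l ^ 12 * lvl_sparsity wm j.+1 * wm.

Lemma lvl_sizeS wm j : lvl_size wm j <= 2 * lvl_size wm j.+1.
Proof.
rewrite /lvl_size expnSr divnMA; have := divn_eq (wm %/ 2 ^ j) 2.
by have := ltn_pmod (wm %/ 2 ^ j) (isT : 0 < 2); move: (_ %/ 2) (_ %% 2); clear; lia.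
Qed.

Lemma lvl_size_mono wm i j : i <= j -> lvl_size wm j <= lvl_size wm i.
Proof. by move=> ij; rewrite leq_add2r leq_div2l // ?expn_gt0 // leq_exp2l. Qed.

Lemma lvl_sparsity_mono wm i j : i <= j -> lvl_sparsity wm i <= lvl_sparsity wm j.
Proof.
by move=> ij; rewrite ltnS leq_div2l ?lvl_size_mono // /lvl_size addnS.
Qed.

Section Side.
Variables (n wm l J : nat) (w : 'I_n -> nat) (cls : nat -> nat).
Hypotheses (w0 : forall i, 0 < w i) (wle : forall i, w i <= wm).
Hypotheses (l256 : 256 <= l) (wl : wm + 4 < 2 ^ l) (Jl : J <= l).
Implicit Types (I C D E : {set 'I_n}).

(* [R t] is the set of the [t] items next to the greedy break on one side, of
   which there are [len]; [P] is the set of the first [k] weights that occur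
   [mu] times, going away from the break. *)
Definition ring_spec (R : nat -> {set 'I_n}) len k mu (P : pred nat) :=
  exists t, [/\ t <= len, forall v : 'I_wm.+1, P v = (mu <= mult w (R t) v),
    #|[set v : 'I_wm.+1 | P v]| <= k &
    t = len \/ #|[set v : 'I_wm.+1 | P v]| = k].

Lemma wt_bounded_mult I (V : {set 'I_wm.+1}) c : (forall x, x \in I -> inord (w x) \in V) ->
  (forall v, v \in V -> mult w I v <= c) -> wt w I <= #|V| * c * wm.
Proof.
move=> IV Vc; rewrite -(mweight_mult_of (wm := wm)) //; apply: leq_trans (mweight_le _) _.
rewrite leq_mul2r; apply/orP; right; rewrite /msize (bigID (mem V)) /= [X in _ + X]big1 ?addn0.
  by rewrite -sum_nat_const; apply: leq_sum => v /Vc.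
move=> v vV; apply/eqP; rewrite cards_eq0; apply/eqP/setP => x; rewrite !inE.
apply/negP => /andP[/IV xV /eqP e]; case/negP: vV; rewrite (_ : v = inord (w x)) //.
by apply: val_inj; rewrite /= inordK e.
Qed.

Variables (D E : {set 'I_n}) (R : nat -> {set 'I_n}) (len : nat) (P : nat -> pred nat).
Hypotheses (ncDE : no_common w D E)
  (ncR : forall t, no_common w (R t :\: D) (D :\: R t)) (Dlen : D \subset R len)
  (DE : wt w D <= wt w E + wm)
  (RP : forall j, 0 < j <= J -> ring_spec R len (lvl_size wm j) (lvl_mult l wm j) (P j))
  (clsP : forall j v, 0 < j <= J -> v <= wm -> P j v -> j <= cls v)
  (clsc : forall i, i < J ->
     #|[set v : 'I_wm.+1 | (0 < v) && (cls v == i)]| <= 2 * lvl_size wm i).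

(** Split the items of class [i] along the ring of level [i + 1]. Outside, either nothing is left,
    when the ring is the whole side, or [outside_ring] applies. Inside, each of the few weights of
    class [i] occurs fewer than [mu] times, as it is not singled out at level [i + 1]. *)
Lemma class_bound i : i < J ->
  wt w [set x in D | cls (w x) == i] <= l ^ 11 * lvl_sparsity wm i.+1 * wm.
Proof.
move=> iJ; have [t [tlen Pt cP ct]] := RP (j := i.+1) iJ.
set th := lvl_sparsity wm i.+1; set k := lvl_size wm i.+1 in cP ct *.
set mu := lvl_mult l wm i.+1 in Pt.
set Di := [set x in D | _].
have DiD : Di \subset D by apply/subsetP => x; rewrite inE => /andP[].
have k32 : 32 <= k by apply: leq_addl.
have th0 : 0 < th by [].
have wth : wm <= th * k by apply: ltnW; apply: ltn_ceil; apply: leq_trans k32.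
have muk : 8 * l ^ 10 * th <= k * mu.
  by rewrite mulnC mulnC [k * _]mulnC; apply: ltnW; apply: ltn_ceil; apply: leq_trans k32.
have kmu : k * mu.-1 <= 8 * l ^ 10 * th by rewrite mulnC; apply: leq_divM.
have th2 : 2 * th < 2 ^ l.
  apply: leq_ltn_trans wl; have : wm %/ k <= wm %/ 2 by apply: leq_div2l => //; apply: leq_trans k32.
  by rewrite /th /lvl_sparsity -/k; have := leq_divM wm 2; move: (wm %/ k) (wm %/ 2); clear; lia.
have out : wt w (D :\: R t) <= (l ^ 9 * (2 * th) + 1) * wm.
  case: ct => [et|ck].
    rewrite (_ : D :\: R t = set0); first by rewrite /wt big_set0.
    by rewrite et; apply/eqP; rewrite setD_eq0.
  apply: (@outside_ring n wm w w0 wle l th k mu D E (R t)) => //.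
  - by apply: leq_ltn_trans wl; apply: leq_addr.
  - move=> U V UD VE; apply: ncDE => //; exact: subset_trans UD (subsetIl _ _).
  - rewrite -ck subset_leq_card //; apply/subsetP => v; rewrite !inE => h.
    by rewrite -(Pt v).
have inn : wt w (Di :&: R t) <= 2 * lvl_size wm i * mu.-1 * wm.
  apply: leq_trans (wt_bounded_mult (V := [set v : 'I_wm.+1 | (0 < v) && (cls v == i)]) (c := mu.-1) _ _) _.
  - by move=> x; rewrite !inE => /andP[/andP[_ ci] _]; rewrite inordK ?ltnS // w0 ci.
  - move=> v; rewrite inE => /andP[v0 /eqP cv].
    have : ~~ P i.+1 v.
      by apply/negP => /(clsP (j := i.+1) iJ (ltn_ord v)); rewrite cv ltnn.
    rewrite (Pt v) -ltnNge -/mu => h.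
    apply: leq_trans (_ : mult w (R t) v <= _); last by rewrite -ltnS prednK // (leq_ltn_trans _ h).
    apply: subset_leq_card; apply/subsetP => x; rewrite !inE.
    by case/andP => /andP[_ ->] ->.
  - by rewrite !leq_mul2r clsc ?orbT.
rewrite (wtID w Di (R t)).
have out' : wt w (Di :\: R t) <= (l ^ 9 * (2 * th) + 1) * wm.
  by apply: leq_trans out; apply: wt_sub; apply: setSD.
have e1 : 2 * lvl_size wm i * mu.-1 <= 32 * l ^ 10 * th.
  have := leq_mul (lvl_sizeS wm i) (leqnn mu.-1); rewrite -/k; move: kmu.
  by move: (lvl_size wm i) (l ^ 10) => a b; clear; lia.
have e2 : 32 * l ^ 10 * th + (l ^ 9 * (2 * th) + 1) <= l ^ 11 * th.
  have p := pow_absorb 10 (isT : 35 <= 256) l256.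
  have q : l ^ 9 <= l ^ 10 by apply: pow_leq.
  have : 35 * l ^ 10 * th <= l ^ 11 * th by rewrite leq_mul2r p orbT.
  have : l ^ 9 * th <= l ^ 10 * th by rewrite leq_mul2r q orbT.
  have : 1 <= l ^ 10 * th by rewrite muln_gt0 th0 expn_gt0 (leq_trans _ l256).
  by move: (l ^ 9) (l ^ 10) (l ^ 11) => a b c; clear; lia.
apply: leq_trans (leq_add inn out') _; rewrite -mulnDl leq_mul2r; apply/orP; right.
by apply: leq_trans e2; rewrite leq_add2r.
Qed.

(** At most [l] classes contribute, each at most the bound for class [j] since the sparsity grows
    with the level; this raises the exponent of [l] from 11 to 12. *)
Lemma classes_bound j : j < J -> wt w [set x in D | cls (w x) <= j] <= window l wm j.
Proof.
move=> jJ; have : wt w [set x in D | cls (w x) <= j] <= j.+1 * (l ^ 11 * lvl_sparsity wm j.+1 * wm).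
  elim: j jJ => [|j IH] jJ.
    rewrite mul1n; apply: leq_trans (class_bound jJ); apply: wt_sub.
    by apply/subsetP => x; rewrite !inE leqn0.
  rewrite (wtID w _ [set x | cls (w x) == j.+1]) mulSn; apply: leq_add.
    apply: leq_trans (class_bound jJ); apply: wt_sub; apply/subsetP => x; rewrite !inE.
    by case/andP => /andP[-> _] ->.
  apply: leq_trans (leq_trans (IH (ltnW jJ)) _).
    apply: wt_sub; apply/subsetP => x; rewrite !inE => /andP[nc /andP[-> le]] /=.
    by rewrite -ltnS ltn_neqAle nc.
  by rewrite leq_mul2l leq_mul2r leq_mul2l lvl_sparsity_mono ?orbT.
move=> h; apply: leq_trans h _; rewrite /window (expnS l 11) -!mulnA leq_mul2r.
by rewrite (leq_trans jJ Jl) orbT.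
Qed.
End Side.

Section Proximity.
Variables (n wm l J W g : nat) (p w : 'I_n -> nat) (cls : nat -> nat).
Hypotheses (w0 : forall i, 0 < w i) (wle : forall i, w i <= wm).
Hypotheses (l256 : 256 <= l) (wl : wm + 4 < 2 ^ l) (Jl : J <= l) (wJ : wm < 2 ^ J).
Hypothesis ratio_dec : forall i j : 'I_n, i < j -> p j * w i < p i * w j.
Let prefix : {set 'I_n} := [set i : 'I_n | i < g].
Hypotheses (gn : g <= n) (fits : wt w prefix <= W)
  (breaks : forall i : 'I_n, i = g :> nat -> W < wt w prefix + w i).
Implicit Types (S U V : {set 'I_n}).

Definition ring_left t : {set 'I_n} := [set i : 'I_n | i < g <= i + t].
Definition ring_right t : {set 'I_n} := [set i : 'I_n | g <= i < g + t].

Variables PL PR : nat -> pred nat.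
Hypotheses
  (RL : forall j, 0 < j <= J ->
     ring_spec wm w ring_left g (lvl_size wm j) (lvl_mult l wm j) (PL j))
  (RR : forall j, 0 < j <= J ->
     ring_spec wm w ring_right (n - g) (lvl_size wm j) (lvl_mult l wm j) (PR j))
  (clsP : forall j v, 0 < j <= J -> v <= wm -> PL j v || PR j v -> j <= cls v)
  (clsJ : forall v, cls v <= J)
  (cls_ex : forall v, v <= wm -> 0 < cls v -> PL (cls v) v || PR (cls v) v).

Definition value S := \sum_(i in S) p i.

(** After multiplication by the common weight, both values become double sums over [U] and [V],
    which compare term by term through [ratio_dec]. *)
Lemma exchange U V : (forall u v, u \in U -> v \in V -> u < v) -> wt w U = wt w V ->
  0 < wt w U -> value V < value U.
Proof.
move=> UV e U0.
have ne (Z : {set 'I_n}) : 0 < wt w Z -> exists z, z \in Z.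
  by move=> h; case: (set_0Vmem Z) h => [->|[z zZ] _]; [rewrite /wt big_set0 | exists z].
have [u0 u0U] := ne _ U0; have [|v0 v0V] := ne V; first by rewrite -e.
rewrite -(ltn_pmul2r U0) {2}e /value /wt !big_distrlr /=.
rewrite exchange_big /= (bigD1 u0) //= [ltnRHS](bigD1 u0) //=.
rewrite -addSn; apply: leq_add; last first.
  apply: leq_sum => u /andP[uU _]; apply: leq_sum => v vV.
  by apply: ltnW; apply: ratio_dec; apply: UV.
rewrite (bigD1 v0) //= [leqRHS](bigD1 v0) //= -addSn; apply: leq_add.
  by apply: ratio_dec; apply: UV.
by apply: leq_sum => v /andP[vV _]; apply: ltnW; apply: ratio_dec; apply: UV.
Qed.

Lemma proximity : exists S, [/\ wt w S <= W,
   forall S', wt w S' <= W -> value S' <= value S,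
   forall j, j <= J -> wt w [set x in prefix :\: S | cls (w x) <= j] <= window l wm j &
   forall j, j <= J -> wt w [set x in S :\: prefix | cls (w x) <= j] <= window l wm j].
Proof.
have W0 : wt w set0 <= W by rewrite /wt big_set0.
(* Among the optima, one with the most items: otherwise an item of profit 0 might be left out
   although it fits, and the weight dropped from the prefix could not be bounded by the weight
   added. The factor [n + 1] lets the value decide first. *)
case: (arg_maxnP (P := fun S => wt w S <= W) (fun S : {set 'I_n} => value S * n.+1 + #|S|) W0).
move=> S SW Smax; have cS (Z : {set 'I_n}) : #|Z| < n.+1.
  by rewrite ltnS -[leqRHS]card_ord max_card.
have opt S' : wt w S' <= W -> value S' <= value S.
  move=> /Smax /= le; rewrite leqNgt; apply/negP => lt.
  have : (value S).+1 * n.+1 <= value S' * n.+1 by rewrite leq_mul2r lt orbT.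
  rewrite mulSn; move: le (cS S); move: (_ * n.+1) (_ * n.+1) #|S| #|S'| => a b c d; clear; lia.
have swap U V : U \subset ~: S -> V \subset S -> (forall u v, u \in U -> v \in V -> u < v) ->
    wt w U = wt w V -> wt w U = 0.
  move=> US VS UV e; apply/eqP; rewrite -leqn0 leqNgt; apply/negP => U0.
  have dU : [disjoint S :\: V & U].
    rewrite disjoint_sym; apply/pred0P => x /=; apply/negP => /andP[/(subsetP US)].
    by rewrite !inE => /negPf ->; rewrite andbF.
  have splitS f : \sum_(i in S) f i = \sum_(i in V) f i + \sum_(i in S :\: V) f i.
    by rewrite (big_setID V) /= (setIidPr VS).
  have splitS' f : \sum_(i in (S :\: V) :|: U) f i = \sum_(i in S :\: V) f i + \sum_(i in U) f i.
    rewrite -bigU //=; apply: eq_bigl => x; by rewrite !inE.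
  have := opt ((S :\: V) :|: U); rewrite /wt splitS' /value splitS' (splitS p).
  have := exchange UV e U0; rewrite /value => lt.
  have wS : wt w S = wt w V + wt w (S :\: V) by rewrite /wt splitS.
  move=> h; have : \sum_(i in S :\: V) w i + \sum_(i in U) w i <= W.
    by apply: leq_trans SW; rewrite wS -e addnC.
  by move=> /h; rewrite addnC leq_add2r leqNgt lt.
set A := prefix :\: S; set B := S :\: prefix.
have ncAB : no_common w A B.
  move=> U V UA VB; apply: swap.
  - by apply: subset_trans UA _; apply/subsetP => x; rewrite !inE => /andP[].
  - by apply: subset_trans VB _; apply: subsetDl.
  - move=> u v /(subsetP UA) + /(subsetP VB); rewrite !inE -leqNgt => /andP[_ ug] /andP[gv _].
    exact: leq_trans ug gv.
have eS : wt w S + wt w A = wt w prefix + wt w B.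
  rewrite (wtID w S prefix) (wtID w prefix S) setIC -/A -/B.
  by move: (wt w _) (wt w A) (wt w B); clear; lia.
have BA : wt w B <= wt w A + wm.
  move: gn; rewrite leq_eqVlt => /orP[/eqP eg|lt].
    rewrite (_ : B = set0); first by rewrite /wt big_set0.
    by apply/setP => x; rewrite !inE eg ltn_ord.
  have := breaks (i := Ordinal lt) erefl; have := wle (Ordinal lt).
  by move: eS SW; clear; lia.
have AB : wt w A <= wt w B + wm.
  case: (set_0Vmem A) => [->|[x xA]]; first by rewrite /wt big_set0.
  have xS : x \notin S by move: xA; rewrite inE => /andP[].
  have : W < wt w S + w x.
    rewrite ltnNge; apply/negP => le.
    have e1 : wt w (x |: S) = w x + wt w S by rewrite /wt big_setU1.
    have e2 : value (x |: S) = p x + value S by rewrite /value big_setU1.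
    have := Smax (x |: S); rewrite /= e1 addnC => /(_ le); rewrite e2 cardsU1 xS mulnDl /=.
    by move: (_ * n.+1) (_ * n.+1) #|S| => a b c; clear; lia.
  by move: eS fits (wle x); clear; lia.
have cP (Q : nat -> pred nat) (R : nat -> {set 'I_n}) len j :
   ring_spec wm w R len (lvl_size wm j) (lvl_mult l wm j) (Q j) ->
   #|[set v : 'I_wm.+1 | Q j v]| <= lvl_size wm j by case=> t [].
have clsc i : i < J -> #|[set v : 'I_wm.+1 | (0 < v) && (cls v == i)]| <= 2 * lvl_size wm i.
  case: i => [|i] iJ.
    apply: leq_trans (card_pos_le _) _; first by move=> v; rewrite inE => /andP[].
    by rewrite /lvl_size expn0 divn1; clear; lia.
  have iJ' : 0 < i.+1 <= J by exact: ltnW.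
  rewrite mul2n -addnn; apply: leq_trans (leq_add (cP _ _ _ _ (RL iJ')) (cP _ _ _ _ (RR iJ'))).
  apply: leq_trans (_ : #|[set v : 'I_wm.+1 | PL i.+1 v] :|: [set v : 'I_wm.+1 | PR i.+1 v]| <= _).
    apply: subset_leq_card; apply/subsetP => v; rewrite !inE => /andP[_ /eqP cv].
    by rewrite -cv; apply: cls_ex; rewrite ?cv // -ltnS.
  by rewrite cardsU leq_subr.
(* At the last level [wm < 2 ^ J] reduces the level size to 32, so the window is at least as large
   as the bound from [no_common_small]. *)
have last (C : {set 'I_n}) : wt w C <= wm ^ 2 + wm -> forall j, j = J ->
    wt w [set x in C | cls (w x) <= j] <= window l wm j.
  move=> le j ->; apply: leq_trans (wt_sub _ (_ : _ \subset C)) _.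
    by apply/subsetP => x; rewrite inE => /andP[].
  apply: leq_trans le _; rewrite /window (_ : wm ^ 2 + wm = wm.+1 * wm); last by rewrite mulSn mulnn addnC.
  rewrite leq_mul2r; apply/orP; right.
  have wJ1 : wm %/ 2 ^ J.+1 = 0 by rewrite divn_small // (leq_trans wJ) // leq_exp2l.
  rewrite /lvl_sparsity /lvl_size wJ1 add0n.
  apply: leq_trans (_ : 32 * (wm %/ 32).+1 <= _).
    by rewrite mulnC ltn_ceil.
  rewrite leq_mul2r; apply/orP; right; apply: leq_trans (_ : l ^ 1 <= _).
    by rewrite expn1 (leq_trans _ l256).
  exact: pow_leq.
case: (posnP wm) => [wm0|wm0].
  have wt0 (C : {set 'I_n}) : wt w C = 0.
    by apply/eqP; rewrite -leqn0 /wt big1 // => i _; apply/eqP; rewrite -leqn0 -[leqRHS]wm0.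
  by exists S; split=> // j _; rewrite wt0.
have [wtA wtB] := no_common_small w0 wle ncAB wm0 AB BA.
exists S; split=> // j; rewrite leq_eqVlt => /orP[/eqP ej|jJ].
- exact: last.
- apply: (@classes_bound n wm l J w cls w0 wle l256 wl Jl A B ring_left g PL) => //.
  (* Kept items of the left ring are nearer to the break, hence of smaller ratio, than dropped items
     outside of it; exchanging them at equal weight would gain profit. *)
  + move=> t U V UR VA; move=> e; rewrite e; apply: (swap V U) => //.
    * by apply: subset_trans VA _; apply/subsetP => x; rewrite !inE => /andP[_ /andP[]].
    * apply: subset_trans UR _; apply/subsetP => x; rewrite !inE.
      by case: (x \in S) => //=; case: (x < g); rewrite ?andbF.
    * move=> v u /(subsetP VA) + /(subsetP UR); rewrite !inE.
      by case: (v \in S); case: (u \in S); rewrite ?andbF //=; move: (val u) (val v); clear; lia.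
  + by apply/subsetP => x; rewrite !inE leq_addl => /andP[_ ->].
  + by move=> i v ij vw Pv; apply: clsP => //; rewrite Pv.
- exact: last.
- apply: (@classes_bound n wm l J w cls w0 wle l256 wl Jl B A ring_right (n - g) PR) => //.
  + exact: no_common_sym.
  + move=> t U V UR VB e; apply: (swap U V) => //.
    * apply: subset_trans UR _; apply/subsetP => x; rewrite !inE.
      by case: (x \in S) => //=; case: (ltnP x g); rewrite ?andbF.
    * by apply: subset_trans VB _; apply/subsetP => x; rewrite !inE => /andP[_ /andP[]].
    * move=> u v /(subsetP UR) + /(subsetP VB); rewrite !inE.
      by case: (v \in S); case: (u \in S); rewrite ?andbF //=; move: (val u) (val v); clear; lia.
  + by apply/subsetP => x; rewrite !inE subnKC // ltn_ord andbT -leqNgt => /andP[].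
  + by move=> i v ij vw Pv; apply: clsP => //; rewrite Pv orbT.
Qed.
End Proximity.

(** * Profit changes by weight *)

Section Concave.
Variables (F : nat -> nat) (M : nat).
Hypothesis conc : forall u, u.+2 <= M -> F u + F u.+2 <= 2 * F u.+1.

Lemma concave_inc i j : i <= j -> j < M -> F i + F j.+1 <= F j + F i.+1.
Proof.
move=> /subnKC <-; elim: (j - i) => [|k IH] iM; first by rewrite addn0.
rewrite addnS in iM *; have := IH (ltnW iM); have := conc iM.
by move: (F _) (F _) (F _) (F _) (F _); clear; lia.
Qed.

Lemma concave_shift i j t : i <= j -> j + t <= M -> F i + F (j + t) <= F j + F (i + t).
Proof.
move=> ij; elim: t => [|t IH] jM; first by rewrite !addn0 addnC.
rewrite addnS in jM; have := concave_inc (leq_add ij (leqnn t)) jM; have := IH (ltnW jM).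
by rewrite !addnS; move: (F _) (F _) (F _) (F _) (F _) (F _); clear; lia.
Qed.

Variables (old : nat -> nat) (K : nat).

(* The leftmost part of a row is dominated once a maximizer of an earlier row
   is known, and symmetrically: this is the monotonicity behind the
   divide-and-conquer evaluation of a convolution with a concave sequence. *)
Lemma argmax_left a1 a b o : a1 <= a -> b < o -> o <= K + a1 -> K + a <= M + b ->
  old b + F (K + a1 - b) <= old o + F (K + a1 - o) ->
  old b + F (K + a - b) <= old o + F (K + a - o).
Proof.
move=> a1a bo oK aM h; have := @concave_shift (K + a1 - o) (K + a1 - b) (a - a1).
have -> : K + a1 - b + (a - a1) = K + a - b by lia.
have -> : K + a1 - o + (a - a1) = K + a - o by lia.
have h1 : K + a1 - o <= K + a1 - b by lia.
have h2 : K + a - b <= M by lia.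
by move=> /(_ h1 h2); move: h; clear; lia.
Qed.

Lemma argmax_right a2 a b o : a <= a2 -> o < b -> b <= K + a -> K + a2 <= M + o ->
  old b + F (K + a2 - b) <= old o + F (K + a2 - o) ->
  old b + F (K + a - b) <= old o + F (K + a - o).
Proof.
move=> aa2 ob bK aM h; have := @concave_shift (K + a - b) (K + a - o) (a2 - a).
have -> : K + a - b + (a2 - a) = K + a2 - b by lia.
have -> : K + a - o + (a2 - a) = K + a2 - o by lia.
have h1 : K + a - b <= K + a - o by lia.
have h2 : K + a2 - o <= M by lia.
by move=> /(_ h1 h2); move: h; clear; lia.
Qed.
End Concave.

Lemma sum_nat_cond_le r (x : pred nat) : \sum_(0 <= i < r | x i) 1 <= r.
Proof.
have {2}-> : r = \sum_(0 <= i < r) 1 by rewrite sum_nat_const_nat subn0 muln1.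
by rewrite [leqRHS](bigID x) /= leq_addr.
Qed.

(** Induction on [r]: if the last position is chosen, its value is at most that of the next position
    in the initial segment. *)
Lemma sum_top_le (q : nat -> nat) r (x : pred nat) :
  (forall i j, i <= j -> j < r -> q j <= q i) ->
  \sum_(0 <= i < r | x i) q i <= \sum_(0 <= i < \sum_(0 <= i < r | x i) 1) q i.
Proof.
elim: r => [|r IH] dec; first by rewrite !big_geq.
have := IH (fun i j ij jr => dec i j ij (ltnW jr)).
have cr := sum_nat_cond_le r x.
move: cr; rewrite !(big_mkcond x) /= !(big_nat_recr r) //=.
case: (x r) => cr {}IH; last by rewrite !addn0.
by rewrite addn1 big_nat_recr //= leq_add // dec.
Qed.

(** * Items grouped by weight: only the number taken of each weight matters *)

Section Counts.
Variables (n wm g : nat) (p w : nat -> nat).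
Hypotheses (w0 : forall i, i < n -> 0 < w i) (wle : forall i, i < n -> w i <= wm).
Hypothesis gn : g <= n.
Hypothesis ratio_dec : forall i j, i < j -> j < n -> p j * w i < p i * w j.

Definition pos v := [seq i <- iota 0 n | w i == v].
Definition nitem v := size (pos v).
Definition nprefix v := count (fun i => w i == v) (iota 0 g).
Definition item v k := nth 0 (pos v) k.
Definition psum v m := \sum_(0 <= k < m) p (item v k).

Lemma item_mem v k : k < nitem v -> item v k < n /\ w (item v k) = v.
Proof.
move=> kr; have : item v k \in pos v by apply: mem_nth.
by rewrite mem_filter mem_iota add0n /= => /andP[/eqP ew kn].
Qed.

Lemma pos_sorted v : sorted ltn (pos v).
Proof. apply: sorted_filter; [exact: ltn_trans | exact: iota_ltn_sorted]. Qed.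

Lemma item_lt v i j : i < j -> j < nitem v -> item v i < item v j.
Proof.
move=> ij jr; apply: (sorted_ltn_nth ltn_trans 0 (pos_sorted v)) => //.
by rewrite inE; apply: ltn_trans jr.
Qed.

Lemma item_dec v i j : i <= j -> j < nitem v -> p (item v j) <= p (item v i).
Proof.
rewrite leq_eqVlt => /orP[/eqP -> //|ij] jr.
have [jn wj] := item_mem jr; have [in_ wi] := item_mem (ltn_trans ij jr).
have := ratio_dec (item_lt ij jr) jn; rewrite wi wj ltn_pmul2r; last by rewrite -wj w0.
exact: ltnW.
Qed.

Lemma pos_split v :
  pos v = [seq i <- iota 0 g | w i == v] ++ [seq i <- iota g (n - g) | w i == v].
Proof. by rewrite -filter_cat -[in iota g _](add0n g) -iotaD subnKC. Qed.

Lemma nprefix_le v : nprefix v <= nitem v.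
Proof.
by rewrite /nitem pos_split size_cat size_filter leq_addr.
Qed.

Lemma item_prefix v k : k < nitem v -> (k < nprefix v) = (item v k < g).
Proof.
move=> kr; rewrite /item pos_split nth_cat size_filter -/(nprefix v).
case: (ltnP k (nprefix v)) => kc.
  have : nth 0 [seq i <- iota 0 g | w i == v] k \in [seq i <- iota 0 g | w i == v].
    by apply: mem_nth; rewrite size_filter.
  by rewrite mem_filter mem_iota add0n /= => /andP[_ kg].
have kr' : k - nprefix v < size [seq i <- iota g (n - g) | w i == v].
  by rewrite ltn_subLR //; move: kr; rewrite /nitem pos_split size_cat (size_filter _ (iota 0 g)).
have := mem_nth 0 kr'; rewrite mem_filter mem_iota => /and3P[_ + _].
by rewrite leqNgt => /negPf.
Qed.

Lemma sum_by_weight (x : pred nat) (h : nat -> nat) :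
  \sum_(0 <= i < n | x i) h i =
  \sum_(v < wm.+1) \sum_(0 <= k < nitem v | x (item v k)) h (item v k).
Proof.
rewrite big_seq_cond.
rewrite (partition_big (fun i => inord (w i) : 'I_wm.+1) predT) //=.
apply: eq_bigr => v _.
transitivity (\sum_(i <- pos v | x i) h i).
  rewrite /pos big_filter_cond /index_iota subn0 [RHS]big_seq_cond.
  apply: eq_bigl => i; rewrite mem_iota /= add0n; case: (ltnP i n) => //= lin.
  rewrite -val_eqE /= inordK ?ltnS ?wle //.
  by case: (w i == v) => /=; rewrite ?andbT ?andbF.
by rewrite (big_nth 0).
Qed.

Definition chosen (x : pred nat) v := \sum_(0 <= k < nitem v | x (item v k)) 1.

Lemma chosen_le x v : chosen x v <= nitem v.
Proof.
exact: (sum_nat_cond_le (nitem v) (fun k => x (item v k))).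
Qed.

Lemma wt_chosen x v : \sum_(0 <= k < nitem v | x (item v k)) w (item v k) = v * chosen x v.
Proof.
rewrite /chosen big_distrr /= muln1 big_nat_cond [RHS]big_nat_cond; apply: eq_bigr => k /andP[/andP[_ kr] _].
by have [_ ->] := item_mem kr.
Qed.

Lemma chosen_weight x : \sum_(0 <= i < n | x i) w i = \sum_(v < wm.+1) v * chosen x v.
Proof. by rewrite sum_by_weight; apply: eq_bigr => v _; rewrite wt_chosen. Qed.

Lemma chosen_profit x : \sum_(0 <= i < n | x i) p i <= \sum_(v < wm.+1) psum v (chosen x v).
Proof.
rewrite sum_by_weight; apply: leq_sum => v _.
apply: (@sum_top_le (fun k => p (item v k)) _ (fun k => x (item v k))) => i j.
exact: item_dec.
Qed.

(** Converse of [chosen_profit]: counts are realized by the most profitable items of each weight, so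
    a legal table entry is the profit of an actual selection. *)
Lemma first_items (m : nat -> nat) : (forall v, m v <= nitem v) ->
  exists x : pred nat, \sum_(0 <= i < n | x i) w i = \sum_(v < wm.+1) v * m v /\
    \sum_(0 <= i < n | x i) p i = \sum_(v < wm.+1) psum v (m v).
Proof.
move=> mr; pose x : pred nat := fun i => index i (pos (w i)) < m (w i).
have xk v k : k < nitem v -> x (item v k) = (k < m v).
  move=> kr; have [_ wk] := item_mem kr; rewrite /x wk /item index_uniq //.
  by apply: filter_uniq; apply: iota_uniq.
have cut v h : \sum_(0 <= k < nitem v | x (item v k)) h k = \sum_(0 <= k < m v) h k.
  rewrite (@big_nat_widen _ _ _ 0 (m v) (nitem v)) //= big_nat_cond [RHS]big_nat_cond.
  by apply: eq_bigl => k; case: (ltnP k (nitem v)) => //= kr; rewrite xk.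
exists x; split.
  rewrite sum_by_weight; apply: eq_bigr => v _; rewrite wt_chosen /chosen cut.
  by rewrite sum_nat_const_nat subn0 muln1.
by rewrite sum_by_weight; apply: eq_bigr => v _; rewrite cut.
Qed.

Lemma chosen_prefix v : chosen (fun i => i < g) v = nprefix v.
Proof.
have -> : nprefix v = \sum_(0 <= k < nprefix v) 1 by rewrite sum_nat_const_nat subn0 muln1.
rewrite /chosen.
rewrite (@big_nat_widen _ _ _ 0 (nprefix v) (nitem v)) ?nprefix_le //=.
rewrite big_nat_cond [RHS]big_nat_cond; apply: eq_bigl => k.
by case: (ltnP k (nitem v)) => //= kr; rewrite item_prefix.
Qed.

Lemma psum_prefix : \sum_(0 <= i < g) p i = \sum_(v < wm.+1) psum v (nprefix v).
Proof.
rewrite (@big_nat_widen _ _ _ 0 g n) //= sum_by_weight; apply: eq_bigr => v _.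
rewrite /psum (@big_nat_widen _ _ _ 0 (nprefix v) (nitem v)) ?nprefix_le //=.
rewrite big_nat_cond [RHS]big_nat_cond; apply: eq_bigl => k.
by case: (ltnP k (nitem v)) => //= kr; rewrite item_prefix.
Qed.

Lemma psum_total : \sum_(0 <= i < n) p i = \sum_(v < wm.+1) psum v (nitem v).
Proof.
have := sum_by_weight predT p; rewrite /= => ->; by apply: eq_bigr.
Qed.

End Counts.

(** * The table of profits and its update by one weight *)

Section Table.
Variables (wm : nat) (r c : nat -> nat) (q : nat -> nat -> nat) (BIG CEN : nat).
Hypotheses (cr : forall v, c v <= r v)
  (qdec : forall v k, k.+1 < r v -> q v k.+1 <= q v k)
  (qBIG : forall v k, k < r v -> q v k <= BIG).

Definition ps v m := \sum_(0 <= k < m) q v k.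

Lemma psS v m : ps v m.+1 = ps v m + q v m.
Proof. by rewrite /ps big_nat_recr. Qed.

Lemma ps_mono v m m' : m <= m' -> ps v m <= ps v m'.
Proof.
move=> /subnKC <-; elim: (m' - m) => [|k IH]; first by rewrite addn0.
by rewrite addnS psS (leq_trans IH) ?leq_addr.
Qed.

Lemma ps_le v m : m <= r v -> ps v m <= BIG * m.
Proof.
elim: m => [|m IH] mr; first by rewrite /ps big_geq.
by rewrite psS mulnS addnC leq_add ?qBIG ?IH // ltnW.
Qed.

(* [gain v K OFF u] is [OFF] plus the change in profit when [u - K] items of
   weight [v] are added to the greedy solution; items that do not exist cost
   [BIG] each. *)
Definition gain v K OFF u :=
  if u + c v < K then OFF - ps v (c v) - BIG * (K - (u + c v))
  else let m := u + c v - K in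
    if m <= r v then OFF + ps v m - ps v (c v)
    else OFF + ps v (r v) - ps v (c v) - BIG * (m - r v).

Section Gain.
Variables (v K OFF : nat).
Hypothesis OFFK : BIG * K <= OFF.
Notation F := (gain v K OFF).

Lemma gain_low u : u + c v < K -> F u + ps v (c v) + BIG * (K - (u + c v)) = OFF.
Proof.
move=> h; rewrite /gain h; have := ps_le (cr v).
have : BIG * c v + BIG * (K - (u + c v)) <= BIG * K by rewrite -mulnDr leq_mul2l; apply/orP; right; lia.
by move: OFFK; move: (BIG * c v) (BIG * (K - _)) (ps v (c v)); clear; lia.
Qed.

Lemma gain_mid u m : m <= r v -> u + c v = K + m -> F u + ps v (c v) = OFF + ps v m.
Proof.
move=> mr e; rewrite /gain e ltnNge leq_addr /= addKn mr subnK //.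
have : ps v (c v) <= OFF + ps v m; last by [].
case: (leqP (c v) m) => cm; first by apply: leq_trans (ps_mono v cm) (leq_addl _ _).
have cK : c v <= K + m by rewrite -e leq_addl.
have : ps v (c v) <= ps v m + BIG * (c v - m).
  have: c v <= r v := cr v; move: (ltnW cm) => /subnKC <-; rewrite addKn.
  elim: (c v - m) => [|k IH] h; first by rewrite addn0 leq_addr.
  rewrite addnS psS mulnS; have := IH (ltnW _); rewrite -addnS => /(_ h).
  have := @qBIG v (m + k); rewrite addnS in h; move/(_ h).
  by move: (ps v _) (ps v _) (BIG * k); clear; lia.
have : BIG * (c v - m) <= BIG * K by rewrite leq_mul2l; apply/orP; right; lia.
by move: OFFK; move: (ps v _) (ps v _) (BIG * _) (BIG * K); clear; lia.
Qed.

Lemma gain_high u m : u <= 2 * K -> r v < m -> u + c v = K + m ->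
  F u + ps v (c v) + BIG * (m - r v) = OFF + ps v (r v).
Proof.
move=> u2 rm e; rewrite /gain e ltnNge leq_addr /= addKn leqNgt rm /=.
have h1 := ps_mono v (cr v).
have : BIG * (m - r v) <= BIG * K by rewrite leq_mul2l; apply/orP; right; have := cr v; lia.
by move: h1 OFFK; move: (ps v _) (ps v _) (BIG * _) (BIG * K); clear; lia.
Qed.

(** The increments decrease because [BIG] bounds all profits. This computation serves both concavity
    and the two recurrences by which the sequence is filled outward from [K]. *)
Lemma gain_inc u : u < 2 * K -> 
  [/\ u + c v < K -> F u.+1 = F u + BIG,
      forall m, u + c v = K + m -> m < r v -> F u.+1 = F u + q v m &
      forall m, u + c v = K + m -> r v <= m -> F u.+1 + BIG = F u].
Proof.
move=> u2; split.
- move=> h; have := gain_low h; move: (h); rewrite leq_eqVlt => /orP[/eqP e|h'].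
    have e1 : u.+1 + c v = K + 0 by lia.
    have := gain_mid (leq0n _) e1; rewrite (_ : ps v 0 = 0) ?addn0; last by rewrite /ps big_geq.
    have -> : K - (u + c v) = 1 by lia.
    by rewrite muln1; move: (F _) (F _) (ps v _); clear; lia.
  have := gain_low (_ : u.+1 + c v < K); rewrite addSn => /(_ h').
  have -> : K - (u + c v) = (K - (u + c v).+1).+1 by lia.
  by rewrite mulnS; move: (F _) (F _) (ps v _) (BIG * _); clear; lia.
- move=> m e mr; have e1 : u.+1 + c v = K + m.+1 by rewrite addSn e addnS.
  have := gain_mid (ltnW mr) e; have := gain_mid mr e1; rewrite psS.
  by move: (F _) (F _) (ps v _) (ps v _); clear; lia.
- move=> m e mr; have e1 : u.+1 + c v = K + m.+1 by rewrite addSn e addnS.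
  have := gain_high u2 (_ : r v < m.+1) e1; rewrite ltnS => /(_ mr).
  move: mr; rewrite leq_eqVlt => /orP[/eqP er|mr].
    have := gain_mid (_ : m <= r v) e; rewrite -er leqnn => /(_ isT).
    rewrite subSnn muln1.
    by move: (F _) (F _) (ps v _) (ps v _); clear; lia.
  have := gain_high (ltnW u2) mr e; rewrite subSn ?(ltnW mr) // mulnS.
  by move: (F _) (F _) (ps v _) (ps v _) (BIG * _); clear; lia.
Qed.

Lemma gain_up u : K <= u -> u < 2 * K ->
  F u.+1 = if u - K + c v < r v then F u + q v (u - K + c v) else F u - BIG.
Proof.
move=> Ku u2; have [_ h1 h2] := gain_inc u2.
have e : u + c v = K + (u - K + c v) by lia.
case: (ltnP (u - K + c v) (r v)) => mr; first exact: h1.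
by rewrite -(h2 _ e mr) addnK.
Qed.

Lemma gain_down u : u < K ->
  F u = if K <= u + c v then F u.+1 - q v (u + c v - K) else F u.+1 - BIG.
Proof.
move=> uK; have [|h1 h2 _] := @gain_inc u; first by lia.
case: (leqP K (u + c v)) => h; last by rewrite h1 // addnK.
by rewrite (h2 (u + c v - K)) ?addnK ?subnKC //; have := cr v; lia.
Qed.

Lemma gain_concave u : u.+2 <= 2 * K -> F u + F u.+2 <= 2 * F u.+1.
Proof.
move=> u2; have [a1 a2 a3] := gain_inc (ltnW u2); have [b1 b2 b3] := gain_inc u2.
case: (ltnP (u + c v) K) => h.
  rewrite (a1 h) in b1 b2 b3 *.
  case: (ltnP (u.+1 + c v) K) => h'; first by rewrite b1 //; clear; lia.
  have e : u.+1 + c v = K + 0 by lia.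
  case: (posnP (r v)) => r0; first by have := b3 _ e; rewrite r0 => /(_ isT); clear; lia.
  by rewrite (b2 _ e r0); have := qBIG r0; clear; lia.
have e : u + c v = K + (u + c v - K) by rewrite subnKC.
have e1 : u.+1 + c v = K + (u + c v - K).+1 by rewrite addSn {1}e addnS.
set m := u + c v - K in e e1; case: (ltnP m (r v)) => mr.
  rewrite (a2 _ e mr) in b1 b2 b3 *; case: (ltnP m.+1 (r v)) => mr'.
    by rewrite (b2 _ e1 mr'); have := qdec mr'; clear; lia.
  by have := b3 _ e1 mr'; clear; lia.
by have := a3 _ e mr; have := b3 _ e1 (leqW mr); clear; lia.
Qed.

(** Keeps counts of missing items recognizable: they lie a full [BIG] below what all items of this
    weight could contribute. *)
Lemma gain_out u : u <= 2 * K -> (forall m, m <= r v -> u + c v <> K + m) ->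
  F u + BIG <= OFF + ps v (r v).
Proof.
move=> u2 out; case: (ltnP (u + c v) K) => h.
  have := gain_low h; have : BIG * 1 <= BIG * (K - (u + c v)) by rewrite leq_mul2l subn_gt0 h orbT.
  by rewrite muln1; move: (BIG * _) (F _) (ps v _) (ps v _); clear; lia.
have e : u + c v = K + (u + c v - K) by rewrite subnKC.
case: (leqP (u + c v - K) (r v)) => mr; first by case: (out _ mr).
have := gain_high u2 mr e.
have : BIG * 1 <= BIG * (u + c v - K - r v) by rewrite leq_mul2l subn_gt0 mr orbT.
by rewrite muln1; move: (BIG * _) (F _) (ps v _) (ps v _); clear; lia.
Qed.
End Gain.

Definition sumw (V : pred nat) (f : nat -> nat) := \sum_(v < wm.+1 | V v) f v.

Lemma sumwU V v f : ~~ V v -> v <= wm -> sumw (fun u => V u || (u == v)) f = sumw V f + f v.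
Proof.
move=> nV vw; rewrite /sumw (bigD1 (Ordinal (vw : v < wm.+1))) /= ?eqxx ?orbT // addnC.
congr (_ + _); apply: eq_bigl => u; rewrite -val_eqE /=.
by case: (eqVneq (val u) v) => [->|]; rewrite ?orbF ?andbT // (negPf nV).
Qed.

Lemma eq_sumw (V V' : pred nat) f : (forall v, v <= wm -> V v = V' v) -> sumw V f = sumw V' f.
Proof. by move=> e; apply: eq_bigl => v; rewrite e // -ltnS. Qed.

(* Entries represent profit changes offset by [BIG]; index [x] represents the
   weight change [x - CEN]. *)
Definition upper_inv V (tab : nat -> nat) := forall x,
  tab x <= sumw V (fun v => ps v (r v)) \/
  exists m : nat -> nat, [/\ forall v, m v <= r v,
    CEN + sumw V (fun v => v * m v) = x + sumw V (fun v => v * c v) &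
    BIG + sumw V (fun v => ps v (m v)) = tab x + sumw V (fun v => ps v (c v))].

(** A single good entry suffices, the one at the weight change of the optimal counts [m]; entries
    elsewhere may be too small, which permits the restriction to windows. *)
Definition lower_inv V (tab m : nat -> nat) := exists x,
  x + sumw V (fun v => v * c v) = CEN + sumw V (fun v => v * m v) /\
  BIG + sumw V (fun v => ps v (m v)) <= tab x + sumw V (fun v => ps v (c v)).

Definition conv_step v K OFF lo hi (tab tab' : nat -> nat) :=
  (forall x, ~~ (lo <= x <= hi) -> tab' x = tab x) /\
  (forall x, lo <= x <= hi ->
    (exists y u, [/\ lo <= y <= hi, u <= 2 * K, x + v * K = y + v * u &
       tab' x + OFF = tab y + gain v K OFF u]) /\
    (forall y u, lo <= y <= hi -> u <= 2 * K -> x + v * K = y + v * u ->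
       tab y + gain v K OFF u <= tab' x + OFF)).

(** Using a missing item costs [BIG] and throws the entry into the first alternative of the
    invariant, at most the total profit of the handled weights. From there later updates cannot lift
    it to a legal looking gain, because they add at most the profit of all items of a weight. *)
Lemma upper_step V v K OFF lo hi tab tab' : BIG * K <= OFF -> ~~ V v -> v <= wm ->
  conv_step v K OFF lo hi tab tab' -> upper_inv V tab ->
  upper_inv (fun u => V u || (u == v)) tab'.
Proof.
move=> OFFK nV vw [out inn] up x.
rewrite !sumwU //.
have upd (m : nat -> nat) k V' f : (forall u, V' u = V u) ->
    sumw V' (fun u => f u (if u == v then k else m u)) = sumw V (fun u => f u (m u)).
  move=> e; rewrite /sumw; under eq_bigl => u do rewrite e.
  by apply: eq_bigr => u Vu; case: eqP => // uv; move: nV; rewrite -uv Vu.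
case: (boolP (lo <= x <= hi)) => [|nx]; last first.
  rewrite out //; case: (up x) => [le|[m [mr e1 e2]]]; first by left; apply: leq_trans le (leq_addr _ _).
  right; exists (fun u => if u == v then c v else m u); split.
  - by move=> u; case: eqP => [->|_].
  - rewrite sumwU // eqxx (upd m (c v) V (fun u k => u * k)) //.
    by move: e1; move: (sumw _ _) (sumw _ _); clear; lia.
  - rewrite sumwU // eqxx (upd m (c v) V ps) //.
    by move: e2; move: (sumw _ _) (sumw _ _) (ps _ _); clear; lia.
move=> /inn[[y [u [_ u2 exy e]]] _].
have gle : gain v K OFF u <= OFF + ps v (r v).
  case: (boolP [exists m : 'I_(r v).+1, u + c v == K + m]) => [/existsP[m /eqP em]|no].
    have := gain_mid OFFK (ltn_ord m : m <= r v) em; have := ps_mono v (ltn_ord m : m <= r v).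
    by move: (gain _ _ _ _) (ps _ _) (ps _ _) (ps _ _); clear; lia.
  have := @gain_out v K OFF OFFK u u2; move/existsPn: no => no.
  move=> h; apply: leq_trans (leq_addr BIG _) (h _) => m mr; apply/eqP.
  exact: (no (Ordinal (mr : m < (r v).+1))).
case: (up y) => [le|[m [mr e1 e2]]].
  by left; move: e gle le; move: (sumw _ _) (gain _ _ _ _) (ps _ _); clear; lia.
case: (boolP [exists k : 'I_(r v).+1, u + c v == K + k]) => [/existsP[k /eqP ek]|no].
  right; exists (fun u => if u == v then val k else m u); split.
  - by move=> z; case: eqP => [->|_]; [exact: (ltn_ord k) | exact: mr].
  - rewrite sumwU // eqxx (upd m (val k) V (fun u k => u * k)) //.
    have : v * u + v * c v = v * K + v * k by rewrite -!mulnDr ek.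
    by move: e1 exy; move: (sumw _ _) (sumw _ _) (v * u) (v * c v) (v * K) (v * k); clear; lia.
  - rewrite sumwU // eqxx (upd m (val k) V ps) //.
    have := gain_mid OFFK (ltn_ord k : k <= r v) ek.
    by move: e e2; move: (sumw _ _) (sumw _ _) (gain _ _ _ _) (ps _ _) (ps _ _); clear; lia.
left; have : gain v K OFF u + BIG <= OFF + ps v (r v).
  apply: gain_out => // k kr; apply/eqP; move/existsPn: no => no.
  exact: (no (Ordinal (kr : k < (r v).+1))).
have : sumw V (fun v => ps v (m v)) <= sumw V (fun v => ps v (r v)).
  by apply: leq_sum => z _; apply: ps_mono.
by move: e e2; move: (sumw _ _) (sumw _ _) (sumw _ _) (gain _ _ _ _) (ps _ _); clear; lia.
Qed.

(** The bound on weight changes holds for the handled weights with and without [v], so both the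
    source and the target cell of the optimal count lie in the window. Their distance is at most
    [2 * N <= v * K], hence the count is within reach of [gain]. *)
Lemma lower_step V v K OFF N tab tab' m : BIG * K <= OFF -> ~~ V v -> v <= wm -> 0 < v ->
  N <= CEN -> 2 * N <= v * K -> (forall v, m v <= r v) ->
  (forall V' : pred nat, (forall u, V' u -> V u || (u == v)) ->
     sumw V' (fun v => v * m v) <= sumw V' (fun v => v * c v) + N /\
     sumw V' (fun v => v * c v) <= sumw V' (fun v => v * m v) + N) ->
  conv_step v K OFF (CEN - N) (CEN + N) tab tab' -> lower_inv V tab m ->
  lower_inv (fun u => V u || (u == v)) tab' m.
Proof.
move=> OFFK nV vw v0 NC vK mr bnd [_ inn] [x [e1 e2]].
have [|b1 b2] := bnd V; first by move=> u ->.
have [|b3 b4] := bnd (fun u => V u || (u == v)); first by [].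
rewrite !sumwU // in b3 b4.
exists (x + v * m v - v * c v); rewrite !sumwU //.
have e3 : v * c v <= x + v * m v.
  by move: b1 b2 b3 b4 e1 NC; move: (sumw _ _) (sumw _ _) (v * _) (v * _); clear; lia.
split.
  by move: e3 e1; move: (sumw _ _) (sumw _ _) (v * _) (v * _); clear; lia.
have xw : CEN - N <= x <= CEN + N.
  by move: b1 b2 e1; move: (sumw _ _) (sumw _ _); clear; lia.
have x'w : CEN - N <= x + v * m v - v * c v <= CEN + N.
  by move: b3 b4 e1 e3; move: (sumw _ _) (sumw _ _) (v * _) (v * _); clear; lia.
have [_ h] := inn _ x'w.
have k1 : v * c v <= v * (m v + K).
  by rewrite mulnDr; move: vK xw x'w e3; move: (v * _) (v * _) (v * _); clear; lia.
have k2 : v * m v <= v * (c v + K).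
  by rewrite mulnDr; move: vK xw x'w e3; move: (v * _) (v * _) (v * _); clear; lia.
rewrite leq_pmul2l // in k1; rewrite leq_pmul2l // in k2.
have := h x (K + m v - c v) xw.
have -> : K + m v - c v <= 2 * K by move: k2; clear; lia.
have -> : x + v * m v - v * c v + v * K = x + v * (K + m v - c v).
  rewrite mulnBr mulnDr.
  have : v * c v <= v * (m v + K) by rewrite leq_mul2l k1 orbT.
  by rewrite mulnDr; move: e3; move: (v * _) (v * _) (v * _); clear; lia.
move=> /(_ isT erefl).
have := gain_mid OFFK (mr v) (_ : K + m v - c v + c v = K + m v).
rewrite subnK; last by rewrite addnC.
move=> /(_ erefl).
by move: e2; move: (sumw _ _) (sumw _ _) (gain _ _ _ _) (ps _ _) (ps _ _); clear; lia.
Qed.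
End Table.

Section Optimal.
Variables (n wm l J W g : nat) (p w cls : nat -> nat).
Hypotheses (w0 : forall i, i < n -> 0 < w i) (wle : forall i, i < n -> w i <= wm).
Hypotheses (l256 : 256 <= l) (wl : wm + 4 < 2 ^ l) (Jl : J <= l) (wJ : wm < 2 ^ J).
Hypothesis ratio_dec : forall i j, i < j -> j < n -> p j * w i < p i * w j.
Hypotheses (gn : g <= n) (fits : \sum_(0 <= i < g) w i <= W)
  (breaks : g < n -> W < \sum_(0 <= i < g) w i + w g).
Variables PL PR : nat -> pred nat.
Hypotheses
  (RL : forall j, 0 < j <= J -> ring_spec wm (fun i : 'I_n => w i) (ring_left n g) g
     (lvl_size wm j) (lvl_mult l wm j) (PL j))
  (RR : forall j, 0 < j <= J -> ring_spec wm (fun i : 'I_n => w i) (ring_right n g) (n - g)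
     (lvl_size wm j) (lvl_mult l wm j) (PR j))
  (clsP : forall j v, 0 < j <= J -> v <= wm -> PL j v || PR j v -> j <= cls v)
  (cls_ex : forall v, v <= wm -> 0 < cls v -> PL (cls v) v || PR (cls v) v).

Notation r := (nitem n w).
Notation c := (nprefix g w).
Notation ps := (psum n p w).

Lemma sum_set (S : {set 'I_n}) (x : pred nat) h : (forall i : 'I_n, x i = (i \in S)) ->
  \sum_(i in S) h (val i) = \sum_(0 <= i < n | x i) h i.
Proof. by move=> xS; rewrite big_mkord; apply: eq_bigl => i; rewrite xS. Qed.

Lemma sumw_chosen (V x : pred nat) :
  sumw wm V (fun v => v * chosen n w x v) = \sum_(0 <= i < n | x i && V (w i)) w i.
Proof.
rewrite (sum_by_weight wle) /sumw big_mkcond /=; apply: eq_bigr => v _.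
case: (boolP (V v)) => Vv.
  rewrite -wt_chosen big_nat_cond [RHS]big_nat_cond; apply: eq_bigl => k.
  case: (ltnP k (r v)) => //= kr; have [_ ->] := item_mem kr.
  by rewrite Vv andbT.
rewrite big_nat_cond big_pred0 // => k; case: (ltnP k (r v)) => //= kr.
by have [_ ->] := item_mem kr; rewrite (negPf Vv) andbF.
Qed.

(** The counts of an optimum near the greedy solution. Replacing its items by the most profitable
    ones of the same weight loses nothing, so from here on the optimum is represented by [m]
    alone. *)
Lemma optimal_counts : exists m : nat -> nat, [/\ forall v, m v <= r v,
   \sum_(v < wm.+1) v * m v <= W,
   forall x : pred nat, \sum_(0 <= i < n | x i) w i <= W ->
     \sum_(0 <= i < n | x i) p i <= \sum_(v < wm.+1) ps v (m v) &
   forall j (V : pred nat), j <= J -> (forall v, V v -> cls v <= j) ->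
     sumw wm V (fun v => v * m v) <= sumw wm V (fun v => v * c v) + window l wm j /\
     sumw wm V (fun v => v * c v) <= sumw wm V (fun v => v * m v) + window l wm j].
Proof.
pose w' (i : 'I_n) := w i; pose p' (i : 'I_n) := p i.
have pre x : \sum_(i in [set i : 'I_n | i < g]) x (val i) = \sum_(0 <= i < g) x i.
  rewrite (@big_nat_widen _ _ _ 0 g n) //=; apply: sum_set => i; by rewrite inE.
have [|i|i j ij||i ig|S [SW Sopt SA SB]] := @proximity n wm l J W g p' w' cls _ _ l256 wl Jl wJ _ gn _ _ PL PR RL RR clsP cls_ex.
- by move=> i; apply: w0.
- exact: wle.
- exact: ratio_dec.
- by rewrite /wt (pre w).
- by rewrite /wt (pre w) /w' ig; apply: breaks; rewrite -ig.
pose x : pred nat := fun i => if insub i is Some j then j \in S else false.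
have xS (i : 'I_n) : x i = (i \in S).
  by rewrite /x insubT // => h; congr (_ \in S); apply: val_inj.
have split_le (P Q : pred nat) :
    \sum_(0 <= i < n | P i) w i <= \sum_(0 <= i < n | Q i) w i + \sum_(0 <= i < n | P i && ~~ Q i) w i.
  rewrite !(big_mkcond _ w) -big_split /=; apply: leq_sum => i _.
  by case: (P i); case: (Q i); rewrite /= ?addn0 ?leq_addr.
have ecn v : c v = chosen n w (fun i => i < g) v by rewrite chosen_prefix.
have ec V : sumw wm V (fun v => v * c v) = \sum_(0 <= i < n | (i < g) && V (w i)) w i.
  rewrite -(sumw_chosen V (fun i => i < g)); apply: eq_bigr => v _; by rewrite ecn.
exists (chosen n w x); split.
- by move=> v; apply: chosen_le.
- rewrite -(chosen_weight wle); apply: leq_trans SW; rewrite /wt /w'.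
  by rewrite (sum_set w xS).
- move=> y yW; apply: leq_trans (chosen_profit w0 wle ratio_dec x).
  rewrite -(sum_set p xS); have yS (i : 'I_n) : y i = (i \in [set i : 'I_n | y i]) by rewrite inE.
  rewrite -(sum_set p yS); apply: Sopt; rewrite /wt /w'.
  by rewrite (sum_set w yS).
move=> j V jJ Vj; rewrite ec sumw_chosen; split.
  apply: leq_trans (split_le _ (fun i => (i < g) && V (w i))) _; rewrite leq_add2l.
  apply: leq_trans (SB _ jJ); rewrite /wt.
  rewrite big_mkord big_mkcond [leqRHS]big_mkcond /=; apply: leq_sum => i _.
  rewrite !inE xS; case: (boolP (V (w i))) => [/Vj|]; rewrite ?andbF //= => ->.
  by rewrite !andbT andbC.
apply: leq_trans (split_le _ (fun i => x i && V (w i))) _; rewrite leq_add2l.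
apply: leq_trans (SA _ jJ); rewrite /wt.
rewrite big_mkord big_mkcond [leqRHS]big_mkcond /=; apply: leq_sum => i _.
rewrite !inE xS; case: (boolP (V (w i))) => [/Vj|]; rewrite ?andbF //= => ->.
by rewrite !andbT andbC.
Qed.
End Optimal.

(** * Executions of programs *)

(* From here on, [mem] is the memory of a machine state. *)
Import Defs.

Declare Scope prog_scope.
Delimit Scope prog_scope with prog.
Notation "$ k" := (Reg k) (at level 5, k at level 4, format "$ k") : prog_scope.
Notation "x + y" := (Bin OpAdd x y) : prog_scope.
Notation "x - y" := (Bin OpSub x y) : prog_scope.
Notation "x * y" := (Bin OpMul x y) : prog_scope.
Notation "x %/ y" := (Bin OpDiv x y) : prog_scope.
Notation "x == y" := (Bin OpEq x y) : prog_scope.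
Notation "x < y" := (Bin OpLt x y) : prog_scope.
Notation "r ::= e" := (Assign r e%prog) (at level 72) : prog_scope.
Notation "c ;; d" := (Seq c d) (at level 75, right associativity) : prog_scope.
Bind Scope prog_scope with expr.
Bind Scope prog_scope with prog.

(* The bound is a register, so that it is a constant of the loop as soon as the
   body does not write that register. *)
Definition For r (lo : expr) q (body : prog) : prog :=
  (r ::= lo ;; While ($r < $q) (body ;; r ::= $r + Lit 1))%prog.

Fixpoint wregs (c : prog) : seq nat :=
  match c with
  | Assign r _ => [:: r]
  | Seq c d | If _ c d => wregs c ++ wregs d
  | While _ c => wregs c
  | _ => [::]
  end.

Fixpoint wbanks (c : prog) : seq nat :=
  match c with
  | Put a _ _ => [:: a]
  | Seq c d | If _ c d => wbanks c ++ wbanks d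
  | While _ c => wbanks c
  | _ => [::]
  end.

Definition frame (rs bs : seq nat) (s s' : state) :=
  (forall r, r \notin rs -> regs s' r = regs s r) /\
  (forall a, a \notin bs -> mem s' a = mem s a).

Lemma frame_trans rs bs s1 s2 s3 : frame rs bs s1 s2 -> frame rs bs s2 s3 -> frame rs bs s1 s3.
Proof.
by move=> [r1 m1] [r2 m2]; split=> x xn; [rewrite r2 ?r1 | rewrite m2 ?m1].
Qed.

Lemma frame_sub rs bs rs' bs' s s' : {subset rs <= rs'} -> {subset bs <= bs'} ->
  frame rs bs s s' -> frame rs' bs' s s'.
Proof.
move=> rsub bsub [fr fb]; split=> x xn; [apply: fr | apply: fb].
  by apply: contra xn => /rsub.
by apply: contra xn => /bsub.
Qed.

Lemma exec_frame b c s s' t : exec b c s s' t -> frame (wregs c) (wbanks c) s s'.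
Proof.
elim=> {c s s' t} //=.
- move=> r e s v _; split=> // x; rewrite inE /= /update => /negPf -> //.
- move=> a e1 e2 s i v _ _; split=> // x; rewrite inE /= /update => /negPf -> //.
- move=> c1 c2 s s1 s2 t1 t2 _ f1 _ f2.
  apply: (@frame_trans _ _ _ s1); [apply: frame_sub f1 | apply: frame_sub f2];
    by move=> x; rewrite mem_cat => ->; rewrite ?orbT.
- move=> e c1 c2 s s1 v t _ _ f; apply: frame_sub f;
    by move=> x; rewrite mem_cat; case: (v != 0) => ->; rewrite ?orbT.
- move=> e c s s1 s2 v t1 t2 _ _ _ f1 _ f2; exact: frame_trans f1 f2.
Qed.

(** Evaluation is split into a total value and, in [fits], the conditions on overflow and division,
    so that values are computed by simplification and the bounds are proved separately. *)
Fixpoint evaln (s : state) (e : expr) : nat :=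
  match e with
  | Lit k => k
  | Reg r => regs s r
  | Get a e1 => mem s a (evaln s e1)
  | Bin o e1 e2 => let x := evaln s e1 in let y := evaln s e2 in
     match o with
     | OpAdd => x + y | OpSub => x - y | OpMul => x * y
     | OpDiv => x %/ y | OpMod => x %% y
     | OpEq => x == y | OpLt => x < y
     end
  end.

Fixpoint fits (B : nat) (s : state) (e : expr) : Prop :=
  match e with
  | Lit k => k < B
  | Reg r => True
  | Get a e1 => fits B s e1
  | Bin o e1 e2 =>
     match o with
     | OpAdd => [/\ fits B s e1, fits B s e2 & evaln s e1 + evaln s e2 < B]
     | OpSub => [/\ fits B s e1, fits B s e2 & evaln s e1 < B]
     | OpMul => [/\ fits B s e1, fits B s e2 & evaln s e1 * evaln s e2 < B]
     | OpDiv | OpMod => [/\ fits B s e1, fits B s e2, 0 < evaln s e2 & evaln s e1 < B]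
     | OpEq | OpLt => fits B s e1 /\ fits B s e2
     end
  end.

(* A name for the word bound that arithmetic tactics treat as an atom. *)
Definition wsize (b : nat) := 2 ^ b.

Section Runs.
Variable b : nat.
Hypothesis b0 : 0 < b.
Notation B := (wsize b).

Let one : 1 < B. Proof. by rewrite /wsize -{1}(expn0 2) ltn_exp2l. Qed.

Lemma eval_fits s e : fits B s e -> eval b s e = Some (evaln s e).
Proof.
have B1 (x : bool) : as_word b x = Some (x : nat).
  by rewrite /as_word (leq_ltn_trans (leq_b1 x) one).
have W x : x < B -> as_word b x = Some x by rewrite /as_word => ->.
elim: e => [k|r|a e IH|o e1 IH1 e2 IH2] //=; first exact: W.
  by move=> /IH ->.
case: o.
- by case=> /IH1 -> /IH2 -> /= h; rewrite W.
- by case=> /IH1 -> /IH2 -> /= h; rewrite W // (leq_ltn_trans (leq_subr _ _) h).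
- by case=> /IH1 -> /IH2 -> /= h; rewrite W.
- case=> /IH1 -> /IH2 -> /= y0 h; rewrite (gtn_eqF y0) /= W //.
  exact: leq_ltn_trans (leq_div _ _) h.
- case=> /IH1 -> /IH2 -> /= y0 h; rewrite (gtn_eqF y0) /= W //.
  exact: leq_ltn_trans (leq_mod _ _) h.
- by case=> /IH1 -> /IH2 -> /=; rewrite B1.
- by case=> /IH1 -> /IH2 -> /=; rewrite B1.
Qed.

Definition runs (c : prog) (s : state) (Q : state -> nat -> Prop) :=
  exists s' t, exec b c s s' t /\ Q s' t.

Lemma runs_weaken c s (Q Q' : state -> nat -> Prop) : runs c s Q ->
  (forall s' t, frame (wregs c) (wbanks c) s s' -> Q s' t -> Q' s' t) -> runs c s Q'.
Proof.
case=> s' [t [ex q]] w; exists s', t; split=> //; apply: w q.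
exact: exec_frame ex.
Qed.

Lemma runs_skip s (Q : state -> nat -> Prop) : Q s 1 -> runs Skip s Q.
Proof. by move=> q; exists s, 1; split=> //; constructor. Qed.

Lemma runs_assign r e s (Q : state -> nat -> Prop) : fits B s e ->
  Q (set_reg s r (evaln s e)) (cost e).+1 -> runs (Assign r e) s Q.
Proof.
move=> f q; exists (set_reg s r (evaln s e)), (cost e).+1; split=> //.
by constructor; apply: eval_fits.
Qed.

Lemma runs_put a e1 e2 s (Q : state -> nat -> Prop) : fits B s e1 -> fits B s e2 ->
  Q (set_mem s a (evaln s e1) (evaln s e2)) (cost e1 + cost e2).+1 -> runs (Put a e1 e2) s Q.
Proof.
move=> f1 f2 q; exists (set_mem s a (evaln s e1) (evaln s e2)), (cost e1 + cost e2).+1.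
by split=> //; constructor; apply: eval_fits.
Qed.

Lemma runs_seq c d s (Q : state -> nat -> Prop) :
  runs c s (fun s1 t1 => runs d s1 (fun s2 t2 => Q s2 (t1 + t2))) -> runs (Seq c d) s Q.
Proof.
case=> s1 [t1 [e1 [s2 [t2 [e2 q]]]]]; exists s2, (t1 + t2); split=> //.
exact: ExecSeq e1 e2.
Qed.

Lemma runs_if e c d s (Q : state -> nat -> Prop) : fits B s e ->
  runs (if evaln s e != 0 then c else d) s (fun s' t => Q s' (cost e + t).+1) ->
  runs (If e c d) s Q.
Proof.
move=> f [s' [t [ex q]]]; exists s', (cost e + t).+1; split=> //.
exact: ExecIf (eval_fits f) ex.
Qed.

(** The 8 steps per round besides the body are the test (3), the increment (4) and the loop itself
    (1). The final 5 are the failing test (4) and the assignment of [lo] (1). *)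
Lemma runs_for r lo q body s0 (Inv : nat -> state -> nat -> Prop) (Q : state -> nat -> Prop) :
  fits B s0 lo -> evaln s0 lo <= regs s0 q -> regs s0 q < B ->
  r \notin wregs body -> q \notin wregs body -> q != r ->
  Inv (evaln s0 lo) (set_reg s0 r (evaln s0 lo)) 0 ->
  (forall i s t, evaln s0 lo <= i < regs s0 q ->
     frame (r :: wregs body) (wbanks body) s0 s -> regs s r = i -> Inv i s t ->
     runs body s (fun s' t' => Inv i.+1 (set_reg s' r i.+1) (t + t' + 8))) ->
  (forall s t, frame (r :: wregs body) (wbanks body) s0 s -> regs s r = regs s0 q ->
     Inv (regs s0 q) s t -> Q s (t + cost lo + 5)) ->
  runs (For r lo q body) s0 Q.
Proof.
move=> flo lohi hB rb qb qr inv0 step fin.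
set lov := evaln s0 lo in lohi inv0 step; set h := regs s0 q in lohi hB step fin.
have loop k i s t : h - i = k -> lov <= i <= h ->
    frame (r :: wregs body) (wbanks body) s0 s -> regs s r = i -> Inv i s t ->
    exists s' t', [/\ exec b (While ($r < $q) (body ;; r ::= $r + Lit 1))%prog s s' t',
      frame (r :: wregs body) (wbanks body) s0 s', regs s' r = h & Inv h s' (t + t' - 4)] /\ 4 <= t'.
  elim: k i s t => [|k IH] i s t hk /andP[loi ih] fr sr inv.
    have ei : i = h by apply/eqP; rewrite eqn_leq ih -subn_eq0 hk.
    rewrite ei in inv sr; exists s, 4; rewrite addnK; split=> //; split=> //.
    apply: ExecWhileF; rewrite eval_fits //=; congr (Some _).
    by rewrite sr (proj1 fr) ?inE ?negb_or ?qr // -/h ltnn.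
  have lt : i < h by rewrite -subn_gt0 hk.
  have [s1 [t1 [ex inv1]]] := step i s t (introT andP (conj loi lt)) fr sr inv.
  have fr1 : frame (r :: wregs body) (wbanks body) s0 s1.
    apply: frame_trans fr (frame_sub _ _ (exec_frame ex)) => // x xb.
    by rewrite inE xb orbT.
  have s1r : regs s1 r = i by rewrite (proj1 (exec_frame ex)).
  have fr2 : frame (r :: wregs body) (wbanks body) s0 (set_reg s1 r i.+1).
    split=> x xn; last exact: (proj2 fr1).
    have := (proj1 fr1) _ xn; move: xn; rewrite inE negb_or /= /update => /andP[/negPf -> _] //.
  have s2r : regs (set_reg s1 r i.+1) r = i.+1 by rewrite /= /update eqxx.
  have [||s' [t' [[ex' fr' s'r inv'] t'4]]] := IH i.+1 _ _ _ _ fr2 s2r inv1.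
  - by rewrite subnS hk.
  - by rewrite lt (leqW loi).
  exists s', (3 + (t1 + 4) + t').+1; split; last by apply: leq_trans t'4 (leq_trans (leq_addl _ _) (leqnSn _)).
  split=> //; last first.
    have -> : t + (3 + (t1 + 4) + t').+1 - 4 = t + t1 + 8 + t' - 4 by lia.
    exact: inv'.
  apply: (@ExecWhileT b _ _ s (set_reg s1 r i.+1) s' 1 (t1 + 4) t') => //.
    rewrite eval_fits //=; congr (Some _).
    by rewrite sr (proj1 fr) ?inE ?negb_or ?qr // -/h lt.
  apply: ExecSeq ex _; rewrite (_ : i.+1 = evaln s1 ($r + Lit 1)%prog); last by rewrite /= s1r addn1.
  apply: ExecAssign; apply: eval_fits; split=> //=.
  by rewrite s1r addn1; apply: leq_ltn_trans hB.
have fr0 : frame (r :: wregs body) (wbanks body) s0 (set_reg s0 r lov).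
  split=> x xn //=; move: xn; rewrite inE negb_or /update => /andP[/negPf -> _] //.
have [||s' [t' [[ex fr sr inv] t4]]] := loop _ _ _ _ erefl _ fr0 _ inv0.
- by rewrite leqnn.
- by rewrite /= /update eqxx.
exists s', ((cost lo).+1 + t'); split.
  apply: ExecSeq ex; apply: ExecAssign; exact: eval_fits.
have -> : (cost lo).+1 + t' = (0 + t' - 4) + cost lo + 5 by lia.
exact: fin.
Qed.

(* The common case of a loop whose body takes at most [tau] steps. *)
Lemma runs_for_const tau r lo q body s0 (Inv : nat -> state -> Prop) (Q : state -> nat -> Prop) :
  fits B s0 lo -> evaln s0 lo <= regs s0 q -> regs s0 q < B ->
  r \notin wregs body -> q \notin wregs body -> q != r ->
  Inv (evaln s0 lo) (set_reg s0 r (evaln s0 lo)) ->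
  (forall i s, evaln s0 lo <= i < regs s0 q ->
     frame (r :: wregs body) (wbanks body) s0 s -> regs s r = i -> Inv i s ->
     runs body s (fun s' t' => Inv i.+1 (set_reg s' r i.+1) /\ t' <= tau)) ->
  (forall s t, frame (r :: wregs body) (wbanks body) s0 s -> regs s r = regs s0 q ->
     Inv (regs s0 q) s -> t <= (regs s0 q - evaln s0 lo) * (tau + 8) + cost lo + 5 -> Q s t) ->
  runs (For r lo q body) s0 Q.
Proof.
move=> f lh hB rb qb qr i0 step fin.
apply: (runs_for (Inv := fun i s t => Inv i s /\ t <= (i - evaln s0 lo) * (tau + 8))) => //.
- move=> i s t /andP[li ih] fr sr [inv tb].
  apply: (runs_weaken (step i s _ fr sr inv)); first by rewrite li.
  move=> s' t' _ [inv' tt']; split=> //; rewrite subSn // mulSn.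
  by move: tb tt'; move: (_ * (tau + 8)); clear; lia.
- by move=> s t fr sr [inv tb]; apply: fin => //; rewrite !leq_add2r.
Qed.
End Runs.

(** * Parameters, sorting and the greedy prefix *)

(* Registers: 0 number of items, 1 budget, 2 maximal weight, 3 the logarithmic
   parameter [l], 4 one more than the total profit, 5, 6, 7 length, weight and
   profit of the greedy prefix; the others are scratch or local to a phase.
   Banks: 0, 1 input; 2 items by decreasing ratio, 3 merge buffer; 4, 5 sorted
   profits and weights; 6 counters, 7 levels of weights; 8 profits of the items
   of each weight, 9 and 10 the numbers of such items, overall and in the greedy
   prefix; 11 table; 12, 13 new values of a residue class and their maximizers;
   14 concave sequence of one weight. *)

Section Params.
Variable b : nat.
Hypothesis b0 : 0 < b.
Notation B := (wsize b).
Hypothesis B512 : 512 < B.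

Definition max_prog : prog :=
  (2 ::= Lit 0 ;; For 10 (Lit 0) 0 (If ($2 < Get 1 ($10)) (2 ::= Get 1 ($10)) Skip))%prog.

Lemma max_prog_ok s : regs s 0 < B -> runs b max_prog s (fun s' t =>
  regs s' 2 = \max_(0 <= i < regs s 0) mem s 1 i /\ t <= 30 * (regs s 0).+1).
Proof.
move=> nB; apply: runs_seq; apply: runs_assign => //=; first exact: leq_trans B512.
apply: (@runs_for_const _ b0 20 _ _ _ _ _
  (fun i s' => regs s' 2 = \max_(0 <= j < i) mem s 1 j)) => //=.
- exact: leq_trans B512.
- by rewrite big_geq.
- move=> i s1 ilt fr e10 inv; apply: runs_if => //=.
  rewrite e10 inv (proj2 fr 1 isT) /=.
  case: ltnP => h; [apply: runs_assign | apply: runs_skip] => //=; split=> //=; rewrite /update /=.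
    by rewrite e10 (proj2 fr 1 isT) /= big_nat_recr //= (maxn_idPr (ltnW h)).
  by rewrite inv big_nat_recr //= (maxn_idPl h).
- move=> s1 t fr _ inv tb; split; first by rewrite inv.
  by move: tb; rewrite /update /=; clear; lia.
Qed.

(** Starting from 1 makes register 4 exceed the total profit, as the penalty [BIG] of the dynamic
    program must. *)
Definition sum_prog : prog :=
  (4 ::= Lit 1 ;; For 10 (Lit 0) 0 (4 ::= $4 + Get 0 ($10)))%prog.

Lemma sum_prog_ok s : regs s 0 < B -> \sum_(0 <= i < regs s 0) mem s 0 i < B.-1 ->
  runs b sum_prog s (fun s' t =>
  regs s' 4 = (\sum_(0 <= i < regs s 0) mem s 0 i).+1 /\ t <= 30 * (regs s 0).+1).
Proof.
move=> nB sB; apply: runs_seq; apply: runs_assign => //=; first exact: leq_trans B512.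
apply: (@runs_for_const _ b0 20 _ _ _ _ _
  (fun i s' => regs s' 4 = (\sum_(0 <= j < i) mem s 0 j).+1)) => //=.
- exact: leq_trans B512.
- by rewrite big_geq.
- move=> i s1 ilt fr e10 inv; rewrite /update /= in ilt.
  have e : regs s1 4 + mem s1 0 (regs s1 10) = (\sum_(0 <= j < i.+1) mem s 0 j).+1.
    by rewrite inv e10 (proj2 fr 0 isT) /= big_nat_recr.
  apply: runs_assign => //=; rewrite /update /= e //; split=> //.
  apply: leq_trans (_ : (\sum_(0 <= j < regs s 0) mem s 0 j).+2 <= _); last first.
    by move: sB B512; clear; lia.
  by rewrite !ltnS (@big_cat_nat _ _ _ i.+1 _ (regs s 0)) //= leq_addr.
- move=> s1 t fr _ inv tb; rewrite inv; split=> //.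
  by move: tb; rewrite /update /=; clear; lia.
Qed.

(** Computes 256 plus the bit length of the maximal weight. Spending one round per unit of that
    weight is affordable within its square. *)
Definition log_prog : prog :=
  (3 ::= Lit 256 ;; 11 ::= Lit 1 ;;
   For 10 (Lit 0) 2 (If ($11 < $2 + Lit 1) (11 ::= $11 * Lit 2 ;; 3 ::= $3 + Lit 1) Skip))%prog.

Lemma log_prog_ok s : 2 * regs s 2 + 300 < B -> runs b log_prog s (fun s' t =>
  (exists k, [/\ regs s' 3 = 256 + k, regs s 2 < 2 ^ k & k = 0 \/ 2 ^ k.-1 <= regs s 2]) /\
  t <= 50 * (regs s 2).+1).
Proof.
move=> wB; set w := regs s 2 in wB *.
apply: runs_seq; apply: runs_assign => //=; first by lia.
apply: runs_seq; apply: runs_assign => //=; first by lia.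
apply: (@runs_for_const _ b0 20 _ _ _ _ _
  (fun i s' => exists k, [/\ regs s' 3 = 256 + k, regs s' 11 = 2 ^ k, k = 0 \/ 2 ^ k.-1 <= w &
     k = i \/ w < 2 ^ k])) => //=.
- by lia.
- by rewrite /update /= -/w; lia.
- by exists 0; split=> //; left.
- move=> i s1 ilt fr e10 [k [e3 e11 kw ki]]; rewrite /update /= -/w in ilt.
  have e2 : regs s1 2 = w by rewrite (proj1 fr 2 isT).
  apply: runs_if => //=; rewrite ?e2 ?e11; first by split=> //; split=> //; lia.
  rewrite addn1 ltnS eqb0 negbK; case: leqP => h; last first.
    apply: runs_skip; split=> //; exists k; split=> //=; right; exact: h.
  have k2 : 2 ^ k.+1 = 2 ^ k * 2 by rewrite expnSr.
  apply: runs_seq; apply: runs_assign => //=; rewrite ?e11.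
    split=> //; first by lia.
    by apply: leq_ltn_trans wB; move: h; move: (2 ^ k) => q; clear; lia.
  have kk : k < 2 ^ k by apply: ltn_expl.
  apply: runs_assign => //=; rewrite /update /= ?e3.
    by split=> //; move: kk h wB; move: (2 ^ k) => q; clear; lia.
  split=> //; exists k.+1; rewrite addn1 addnS k2; split=> //; first by right.
  case: ki => [-> |ki]; first by left.
  by exfalso; move: h ki; clear; lia.
- move=> s1 t fr _ [k [e3 e11 kw ki]] tb; split; last first.
    by move: tb; rewrite /update /= -/w; clear; lia.
  exists k; split=> //; case: ki => // ->; rewrite /update /= -/w; exact: ltn_expl.
Qed.
End Params.

Section Greedy.
Variable b : nat.
Hypothesis b0 : 0 < b.
Notation B := (wsize b).
Hypothesis B512 : 512 < B.

(** Equality of register 5 with the loop index encodes that every item so far has fitted: after the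
    first failure register 5 lags behind for good, and all later items are skipped. *)
Definition greedy_prog : prog :=
  (5 ::= Lit 0 ;; 6 ::= Lit 0 ;; 7 ::= Lit 0 ;;
   For 10 (Lit 0) 0
     (If ($5 == $10)
        (If ($6 + Get 5 ($10) < $1 + Lit 1)
           (6 ::= $6 + Get 5 ($10) ;; 7 ::= $7 + Get 4 ($10) ;; 5 ::= $5 + Lit 1) Skip)
        Skip))%prog.

Lemma sum_prefix_le (f : nat -> nat) i n : i <= n -> \sum_(0 <= j < i) f j <= \sum_(0 <= j < n) f j.
Proof. by move=> h; rewrite (@big_cat_nat _ _ _ i _ n) //= leq_addr. Qed.

Lemma greedy_prog_ok s (p := mem s 4) (w := mem s 5) (n := regs s 0) (W := regs s 1) :
  n < B -> W < B.-1 -> \sum_(0 <= i < n) p i < B -> \sum_(0 <= i < n) w i < B ->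
  runs b greedy_prog s (fun s' t => (exists g, [/\ regs s' 5 = g, g <= n,
     regs s' 6 = \sum_(0 <= i < g) w i, regs s' 7 = \sum_(0 <= i < g) p i &
     \sum_(0 <= i < g) w i <= W /\ (g < n -> W < \sum_(0 <= i < g) w i + w g)]) /\
     t <= 80 * n.+1).
Proof.
move=> nB WB pB wB.
do 3 (apply: runs_seq; apply: runs_assign => //=; first by lia).
apply: (@runs_for_const _ b0 60 _ _ _ _ _
  (fun i s' => exists g, [/\ regs s' 5 = g, g <= i,
     regs s' 6 = \sum_(0 <= i < g) w i, regs s' 7 = \sum_(0 <= i < g) p i &
     \sum_(0 <= i < g) w i <= W /\ (g < i -> W < \sum_(0 <= i < g) w i + w g)])) => //=.
- by lia.
- by exists 0; rewrite /update /= !big_geq.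
- move=> i s1 ilt fr e10 [g [e5 gi e6 e7 [gW gbr]]]; rewrite /update /= -/n in ilt.
  have m4 : mem s1 4 = p by rewrite (proj2 fr 4 isT).
  have m5 : mem s1 5 = w by rewrite (proj2 fr 5 isT).
  have r1 : regs s1 1 = W by rewrite (proj1 fr 1 isT).
  apply: runs_if => //=; rewrite e5 e10 eqb0 negbK.
  case: eqVneq => [egi|ne]; last first.
    apply: runs_skip; split=> //; exists g; split=> //=; first exact: leqW.
    split=> // gi1; apply: gbr; move: gi1; rewrite ltnS leq_eqVlt (negPf ne) //.
  rewrite {g}egi in e5 gi gW e6 e7 gbr *.
  have wS : \sum_(0 <= j < i.+1) w j = \sum_(0 <= j < i) w j + w i by rewrite big_nat_recr.
  have pS : \sum_(0 <= j < i.+1) p j = \sum_(0 <= j < i) p j + p i by rewrite big_nat_recr.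
  have wb : \sum_(0 <= j < i) w j + w i < B by rewrite -wS; apply: leq_ltn_trans wB; apply: sum_prefix_le.
  have pb : \sum_(0 <= j < i) p j + p i < B by rewrite -pS; apply: leq_ltn_trans pB; apply: sum_prefix_le.
  apply: runs_if => //=; rewrite ?r1 ?m5 ?e10 ?e6.
    by split=> //; split=> //; lia.
  rewrite addn1 ltnS eqb0 negbK; case: leqP => h; last first.
    by apply: runs_skip; split=> //; exists i; rewrite /update /=; split.
  apply: runs_seq; apply: runs_assign => //=; rewrite ?m5 ?e10 ?e6 //.
  apply: runs_seq; apply: runs_assign => //=; rewrite /update /= ?m4 ?e10 ?e7 //.
  apply: runs_assign => //=; rewrite /update /= ?e5.
    by split=> //; lia.
  split=> //; exists i.+1; rewrite /update /= addn1 wS pS; split=> //.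
  by rewrite ltnn.
- move=> s1 t fr _ inv tb; split=> //.
  by move: tb; rewrite /update /= -/n; clear; lia.
Qed.
End Greedy.

Lemma same_block d s x : 0 < d -> d %| s -> (x %/ d == s %/ d) = (s <= x < s + d).
Proof.
move=> d0 /dvdnP[q ->]; rewrite mulnK // [_ + d]addnC -mulSn.
by rewrite eqn_leq leq_divRL // -(ltnS (x %/ d)) ltn_divLR // andbC.
Qed.

(** * Bottom-up merge sort by ratio *)

Section MergeTheory.
Variables (p w : nat -> nat) (n : nat).
Hypothesis w0 : forall x, x < n -> 0 < w x.

Definition before x y := p y * w x <= p x * w y.

Lemma before_trans y x z : 0 < w y -> before x y -> before y z -> before x z.
Proof.
rewrite /before => wy h1 h2; rewrite -(leq_pmul2r wy).
have := leq_mul h1 (leqnn (w z)); have := leq_mul h2 (leqnn (w x)).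
by move: (p x) (p y) (p z) (w x) (w y) (w z); clear; lia.
Qed.

Definition sorted_blocks d (a : nat -> nat) := forall x y, x < y -> y < n ->
  x %/ d = y %/ d -> before (a x) (a y).

(* Equality of multisets, in the form in which it acts on sums. *)
Definition same_items (a a' : nat -> nat) := forall f : nat -> nat,
  \sum_(0 <= x < n) f (a x) = \sum_(0 <= x < n) f (a' x).

Lemma same_items_range a : same_items a id -> forall x, x < n -> a x < n.
Proof.
move=> sa x xn; have := sa (fun y => (n <= y : nat)).
rewrite [RHS]big_nat_cond [RHS]big1; last by move=> i; lia.
rewrite (@big_cat_nat _ _ _ x.+1) //= big_nat_recr //= ltnNge.
by case: (n <= a x) => //; rewrite addn1.
Qed.

(** State of a pass that has written [k] outputs: the current double block starts at [s], its halves
    meet at [m], and [i], [j] are the two read positions. [mg_rest] says that whatever the current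
    block has received precedes all that is still to be merged into it. *)
Record merging (len k s m i j hi : nat) (src dst : nat -> nat) : Prop := Merging {
  mg_s : 2 * len %| s; mg_sn : s < n; mg_m : m = minn (s + len) n;
  mg_hi : hi = minn (s + 2 * len) n;
  mg_si : s <= i; mg_im : i <= m; mg_mj : m <= j; mg_jhi : j <= hi; mg_k : i + j = k + m;
  mg_sum : forall f : nat -> nat, \sum_(0 <= x < k) f (dst x) =
     \sum_(0 <= x < i) f (src x) + \sum_(m <= x < j) f (src x);
  mg_sorted : forall a b, a < b -> b < k -> a %/ (2 * len) = b %/ (2 * len) ->
     before (dst a) (dst b);
  mg_rest : forall a x, s <= a < k -> (i <= x < m) || (j <= x < hi) -> before (dst a) (src x) }.

Variables (len : nat) (src : nat -> nat).
Hypotheses (len0 : 0 < len) (srcn : forall x, x < n -> src x < n)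
  (srt : sorted_blocks len src).

Let wsrc x : x < n -> 0 < w (src x). Proof. by move=> xn; apply/w0/srcn. Qed.

Lemma merge_start k dst : 2 * len %| k -> k < n ->
  (forall f : nat -> nat, \sum_(0 <= x < k) f (dst x) = \sum_(0 <= x < k) f (src x)) ->
  (forall a b, a < b -> b < k -> a %/ (2 * len) = b %/ (2 * len) -> before (dst a) (dst b)) ->
  merging len k k (minn (k + len) n) k (minn (k + len) n) (minn (k + 2 * len) n) src dst.
Proof.
move=> dk kn sm so; split=> //.
- by rewrite leq_min leq_addr ltnW.
- by move: (ltnW kn); lia.
- by move=> f; rewrite sm [X in _ + X]big_geq ?addn0.
- by move=> a x; case: ltngtP.
Qed.

Lemma merge_done len' k s m i j hi dst : merging len' k s m i j hi src dst -> k = hi ->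
  [/\ 2 * len' %| k \/ k = n,
     forall f : nat -> nat, \sum_(0 <= x < k) f (dst x) = \sum_(0 <= x < k) f (src x) &
     forall a b, a < b -> b < k -> a %/ (2 * len') = b %/ (2 * len') -> before (dst a) (dst b)].
Proof.
case=> ds sn em eh si im mj jh ek sm so _ kh; split=> //.
  rewrite kh eh; case: (leqP (s + 2 * len') n) => h; [left | by right].
  by rewrite dvdn_add.
move=> f; rewrite sm; have -> : i = m by lia.
have -> : j = k by lia.
have mk : m <= k by lia.
by rewrite [RHS](@big_cat_nat _ _ _ m).
Qed.

(** The element written precedes the rest of its own half because the half is sorted, and the rest
    of the other half by transitivity through the head of that half. *)
Lemma merge_left k s m i j hi dst : merging len k s m i j hi src dst -> k < hi -> i < m ->
  (j < hi -> before (src i) (src j)) ->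
  merging len k.+1 s m i.+1 j hi src (update dst k (src i)).
Proof.
case=> ds sn em eh si im mj jh ek sm so re kh im' cmp.
have ds' : len %| s by apply: dvdn_trans ds; apply: dvdn_mull.
have ksb : s <= k < s + 2 * len by move: si mj ek kh eh; clear; lia.
have kn : k < n by move: kh eh; clear; lia.
have in_ : i < n by move: im' em; clear; lia.
have dsti a : a < k -> update dst k (src i) a = dst a by rewrite /update => /ltn_eqF ->.
have dstk : update dst k (src i) k = src i by rewrite /update eqxx.
split=> //.
- exact: leqW.
- by move: ek; clear; lia.
- move=> f; rewrite !big_nat_recr //= dstk.
  rewrite (@eq_big_nat _ _ _ 0 k _ (fun x => f (dst x))); last by move=> x /dsti ->.
  by rewrite sm addnAC.
- move=> a b ab; rewrite ltnS leq_eqVlt => /orP[/eqP eb|bk] e; last first.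
    by rewrite !dsti // ?(ltn_trans ab) //; apply: so.
  rewrite eb in ab e *; rewrite dsti // dstk.
  have sk : k %/ (2 * len) == s %/ (2 * len) by rewrite same_block ?muln_gt0.
  have : a %/ (2 * len) == s %/ (2 * len) by rewrite e.
  rewrite same_block ?muln_gt0 // => /andP[sa _].
  by apply: re; rewrite ?sa ?leqnn ?im' ?ab.
- move=> a x /andP[sa]; rewrite ltnS leq_eqVlt => /orP[/eqP ->|ak] hx; last first.
    rewrite dsti //; apply: re; first by rewrite sa.
    by move: hx; clear; lia.
  rewrite dstk; case/orP: hx => /andP[h1 h2].
    apply: srt => //; first by move: h2 em; clear; lia.
    apply/eqP; rewrite (eqP (_ : i %/ len == s %/ len)) ?(eq_sym (s %/ len)) ?same_block //; move: h1 h2 si im mj em eh; clear; lia.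
  have jn : j < n by move: h1 h2 eh; clear; lia.
  apply: (@before_trans (src j)); [exact: wsrc | by apply: cmp; move: h1 h2; clear; lia |].
  move: (h1); rewrite leq_eqVlt => /orP[/eqP -> |jx].
    by rewrite /before.
  have ds2 : len %| s + len by rewrite dvdn_add.
  apply: srt => //; first by move: h2 eh; clear; lia.
  apply/eqP; rewrite (eqP (_ : j %/ len == (s + len) %/ len)) ?(eq_sym ((s + len) %/ len)) ?same_block //; move: h1 h2 si im mj em eh; clear; lia.
Qed.

Lemma merge_right k s m i j hi dst : merging len k s m i j hi src dst -> k < hi -> j < hi ->
  (i < m -> before (src j) (src i)) ->
  merging len k.+1 s m i j.+1 hi src (update dst k (src j)).
Proof.
case=> ds sn em eh si im mj jh ek sm so re kh jh' cmp.
have ds' : len %| s by apply: dvdn_trans ds; apply: dvdn_mull.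
have ksb : s <= k < s + 2 * len by move: si mj ek kh eh; clear; lia.
have kn : k < n by move: kh eh; clear; lia.
have jn : j < n by move: jh' eh; clear; lia.
have dsti a : a < k -> update dst k (src j) a = dst a by rewrite /update => /ltn_eqF ->.
have dstk : update dst k (src j) k = src j by rewrite /update eqxx.
split=> //.
- exact: leqW.
- by move: ek; clear; lia.
- move=> f; rewrite [LHS]big_nat_recr //= dstk [X in _ = _ + X]big_nat_recr //=.
  rewrite (@eq_big_nat _ _ _ 0 k _ (fun x => f (dst x))); last by move=> x /dsti ->.
  by rewrite sm addnA.
- move=> a b ab; rewrite ltnS leq_eqVlt => /orP[/eqP eb|bk] e; last first.
    by rewrite !dsti // ?(ltn_trans ab) //; apply: so.
  rewrite eb in ab e *; rewrite dsti // dstk.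
  have sk : k %/ (2 * len) == s %/ (2 * len) by rewrite same_block ?muln_gt0.
  have : a %/ (2 * len) == s %/ (2 * len) by rewrite e.
  rewrite same_block ?muln_gt0 // => /andP[sa _].
  by apply: re; rewrite ?sa ?leqnn ?jh' ?orbT ?ab.
- move=> a x /andP[sa]; rewrite ltnS leq_eqVlt => /orP[/eqP ->|ak] hx; last first.
    rewrite dsti //; apply: re; first by rewrite sa.
    by move: hx; clear; lia.
  have ds2 : len %| s + len by rewrite dvdn_add.
  rewrite dstk; case/orP: hx => /andP[h1 h2]; last first.
    apply: srt => //; first by move: h2 eh; clear; lia.
    apply/eqP; rewrite (eqP (_ : j %/ len == (s + len) %/ len)) ?(eq_sym ((s + len) %/ len)) ?same_block //; move: h1 h2 si im mj em eh; clear; lia.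
  have in_ : i < n by move: h1 h2 em; clear; lia.
  apply: (@before_trans (src i)); [exact: wsrc | by apply: cmp; move: h1 h2; clear; lia |].
  move: (h1); rewrite leq_eqVlt => /orP[/eqP -> |jx].
    by rewrite /before.
  apply: srt => //; first by move: h2 em; clear; lia.
  apply/eqP; rewrite (eqP (_ : i %/ len == s %/ len)) ?(eq_sym (s %/ len)) ?same_block //; move: h1 h2 si im mj em eh; clear; lia.
Qed.
End MergeTheory.

Section SortProg.
Variable b : nat.
Hypothesis b0 : 0 < b.
Notation B := (wsize b).
Hypothesis B512 : 512 < B.

Definition clamp r q : prog := If ($q < $r)%prog (r ::= $q)%prog Skip.

Lemma clamp_ok r q s : runs b (clamp r q) s (fun s' t => regs s' r = minn (regs s r) (regs s q) /\ t <= 6).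
Proof.
apply: runs_if => //=; rewrite eqb0 negbK; case: ltnP => h.
  by apply: runs_assign => //=; rewrite /update eqxx; split.
by apply: runs_skip; split.
Qed.

Definition block_setup : prog :=
  (13 ::= $10 + $11 ;; clamp 13 0 ;; 12 ::= $10 ;; 14 ::= $13 ;; 15 ::= $13 + $11 ;; clamp 15 0)%prog.

Lemma block_setup_ok s : regs s 10 + regs s 11 < B -> regs s 0 + regs s 11 < B ->
  runs b block_setup s (fun s' t => [/\ regs s' 12 = regs s 10,
    regs s' 13 = minn (regs s 10 + regs s 11) (regs s 0),
    regs s' 14 = minn (regs s 10 + regs s 11) (regs s 0),
    regs s' 15 = minn (regs s 10 + 2 * regs s 11) (regs s 0) & t <= 60]).
Proof.
move=> h1 h2; apply: runs_seq; apply: runs_assign => //=.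
apply: runs_seq; apply: (runs_weaken (clamp_ok _ _ _)) => s1 t1 [f1 _] [e1 b1].
apply: runs_seq; apply: runs_assign => //=; apply: runs_seq; apply: runs_assign => //=.
have r0 : regs s1 0 = regs s 0 by rewrite f1.
have r10 : regs s1 10 = regs s 10 by rewrite f1.
have r11 : regs s1 11 = regs s 11 by rewrite f1.
rewrite /= /update /= in e1.
apply: runs_seq; apply: runs_assign => //=; rewrite /update /= e1 ?r11.
  split=> //. by move: h2; clear; lia.
apply: (runs_weaken (clamp_ok _ _ _)) => s2 t2 [f2 _] [e2 b2].
rewrite /= /update /= r0 in e2.
rewrite e2 (f2 12) // (f2 13) // (f2 14) //= /update /= e1 r10; split=> //.
  by clear; lia.
by move: b1 b2; clear; lia.
Qed.

Definition choose_flag : prog :=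
  (16 ::= Lit 0 ;;
   If ($12 < $13)
     (If ($14 < $15)
        (16 ::= Get 0 (Get 2 ($14)) * Get 1 (Get 2 ($12)) <
                Get 0 (Get 2 ($12)) * Get 1 (Get 2 ($14)) + Lit 1)
        (16 ::= Lit 1))
     Skip)%prog.

Lemma choose_flag_ok s (p := mem s 0) (w := mem s 1) (src := mem s 2)
  (i := regs s 12) (m := regs s 13) (j := regs s 14) (hi := regs s 15) :
  (i < m -> j < hi -> p (src j) * w (src i) < B /\ p (src i) * w (src j) < B.-1) ->
  runs b choose_flag s (fun s' t => t <= 60 /\
    if regs s' 16 != 0 then i < m /\ (j < hi -> before p w (src i) (src j))
    else i < m -> j < hi /\ before p w (src j) (src i)).
Proof.
move=> bd; apply: runs_seq; apply: runs_assign => //=; first by lia.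
apply: runs_if => //=; rewrite eqb0 negbK /update /= -/i -/m; case: ltnP => im; last first.
  by apply: runs_skip; split.
apply: runs_if => //=; rewrite eqb0 negbK /update /= -/j -/hi; case: ltnP => jh; last first.
  apply: runs_assign => //=; first by lia.
have [b1 b2] := bd im jh.
apply: runs_assign => //=; rewrite /update /= -/i -/j -/p -/w -/src.
  by split=> //; split=> //; [split=> //; move: b2; clear; lia | lia | move: b2; clear; lia].
split=> //; rewrite addn1 ltnS eqb0 negbK; case: leqP => h; split=> //.
by rewrite /before ltnW.
Qed.

Definition merge_body : prog :=
  (If ($15 == $10) block_setup Skip ;; choose_flag ;;
   If ($16) (Put 3 ($10) (Get 2 ($12)) ;; 12 ::= $12 + Lit 1)
            (Put 3 ($10) (Get 2 ($14)) ;; 14 ::= $14 + Lit 1))%prog.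

Definition merge_pass : prog :=
  (15 ::= Lit 0 ;; For 10 (Lit 0) 0 merge_body ;; For 10 (Lit 0) 0 (Put 2 ($10) (Get 3 ($10))))%prog.

Section Pass.
Variables (p w : nat -> nat) (n len : nat).
Hypotheses (nB : 2 * n < B) (w0 : forall x, x < n -> 0 < w x)
  (pwB : forall x y, x < n -> y < n -> p x * w y < B.-1).

(** The first alternative is the start of a pass, when no block is open yet. Register 15, the end of
    the open block, equals the output index 0 there, and this equality makes the body open a
    block. *)
Definition pass_inv (src : nat -> nat) k s := [/\ regs s 0 = n, mem s 0 = p, mem s 1 = w, mem s 2 = src &
  (k = 0 /\ regs s 15 = 0) \/ exists st, merging p w n len k st (regs s 13) (regs s 12) (regs s 14) (regs s 15) src (mem s 3)].

Lemma merge_body_ok src k s : 0 < len -> len < n -> regs s 11 = len -> (forall x, x < n -> src x < n) ->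
  sorted_blocks p w n len src -> k < n -> regs s 10 = k -> pass_inv src k s ->
  runs b merge_body s (fun s' t => t <= 200 /\ exists st,
     merging p w n len k.+1 st (regs s' 13) (regs s' 12) (regs s' 14) (regs s' 15) src (mem s' 3)).
Proof.
move=> len0 lenn e11 srcn srt kn e10 [e0 m0 m1 m2 inv].
apply: runs_seq.
have setup : runs b (If ($15 == $10)%prog block_setup Skip) s (fun s' t => t <= 70 /\
    exists st, merging p w n len k st (regs s' 13) (regs s' 12) (regs s' 14) (regs s' 15) src (mem s' 3) /\
      k < regs s' 15).
  apply: runs_if => //=; rewrite eqb0 negbK e10; case: eqVneq => [e15|ne].
    have [dk sm so] : [/\ 2 * len %| k,
       forall f : nat -> nat, \sum_(0 <= x < k) f (mem s 3 x) = \sum_(0 <= x < k) f (src x) &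
       forall a b, a < b -> b < k -> a %/ (2 * len) = b %/ (2 * len) -> before p w (mem s 3 a) (mem s 3 b)].
      case: inv => [[k0 _]|[st0 mg]].
        by rewrite k0; split=> // f; rewrite !big_geq.
      have [[dk|kn'] sm so] := merge_done len0 mg (esym e15); first by split.
      by move: kn; rewrite kn' ltnn.
    apply: (runs_weaken (block_setup_ok _ _)); rewrite ?e10 ?e11 ?e0.
    - by move: nB kn lenn; clear; lia.
    - by move: nB lenn; clear; lia.
    move=> s' t [_ fm] [-> -> -> -> tb]; split; first by move: tb; clear; lia.
    exists k; rewrite (fm 3 isT); split; first exact: merge_start.
    by move: kn len0; clear; lia.
  apply: runs_skip; split=> //.
  case: inv => [[k0 e15]|[st0 mg]]; first by move: ne; rewrite e15 k0.
  exists st0; split=> //; rewrite ltn_neqAle eq_sym ne /=.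
  by case: mg => *; lia.
apply: (runs_weaken setup) => s1 t1 [fr fm] [b1 [st0 [mg k15]]].
have em0 : mem s1 0 = p by rewrite (fm 0 isT).
have em1 : mem s1 1 = w by rewrite (fm 1 isT).
have em2 : mem s1 2 = src by rewrite (fm 2 isT).
have er10 : regs s1 10 = k by rewrite (fr 10 isT).
apply: runs_seq; apply: (runs_weaken (choose_flag_ok _)).
  rewrite em0 em1 em2 => im jh; case: mg => _ _ em eh _ _ _ _ _ _ _ _.
  have h1 : regs s1 12 < n by move: im em; clear; lia.
  have h2 : regs s1 14 < n by move: jh eh; clear; lia.
  by split; [apply: leq_trans (pwB _ _) (leq_pred _) | apply: pwB]; apply: srcn.
move=> s2 t2 [fr2 fm2] [b2]; rewrite em0 em1 em2 => h.
have g12 : regs s2 12 = regs s1 12 by rewrite (fr2 12 isT).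
have g13 : regs s2 13 = regs s1 13 by rewrite (fr2 13 isT).
have g14 : regs s2 14 = regs s1 14 by rewrite (fr2 14 isT).
have g15 : regs s2 15 = regs s1 15 by rewrite (fr2 15 isT).
have g10 : regs s2 10 = k by rewrite (fr2 10 isT).
have gm2 : mem s2 2 = src by rewrite (fm2 2 isT).
have gm3 : mem s2 3 = mem s1 3 by rewrite (fm2 3 isT).
have bnd : regs s1 12 + 1 < B /\ regs s1 14 + 1 < B.
  case: mg => _ _ em eh _ im _ jh _ _ _ _.
  by move: em eh im jh nB lenn; clear; lia.
apply: runs_if => //=; move: h; case: ifP => _ h.
  have mg' := merge_left w0 len0 srcn srt mg k15 h.1 h.2.
  apply: runs_seq; apply: runs_put => //=; apply: runs_assign => //=; rewrite ?g12.
    by split=> //; [lia | case: bnd].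
  split; first by move: b1 b2; clear; lia.
  exists st0; rewrite /= /update /= ?g13 ?g14 ?g15 ?gm2 ?gm3 ?g10 ?g12 addn1.
  exact: mg'.
have jh : regs s1 14 < regs s1 15.
  case: (ltnP (regs s1 12) (regs s1 13)) => im; first by case: (h im).
  by case: mg => *; lia.
have mg' := merge_right w0 len0 srcn srt mg k15 jh (fun im => (h im).2).
apply: runs_seq; apply: runs_put => //=; apply: runs_assign => //=; rewrite ?g14.
  by split=> //; [lia | case: bnd].
split; first by move: b1 b2; clear; lia.
exists st0; rewrite /= /update /= ?g13 ?g14 ?g15 ?gm2 ?gm3 ?g10 ?g12 addn1.
exact: mg'.
Qed.

Lemma merge_pass_ok s (src := mem s 2) : 0 < len -> len < n -> regs s 0 = n -> regs s 11 = len ->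
  mem s 0 = p -> mem s 1 = w -> (forall x, x < n -> src x < n) -> sorted_blocks p w n len src ->
  runs b merge_pass s (fun s' t => [/\ same_items n (mem s' 2) src,
    sorted_blocks p w n (2 * len) (mem s' 2) & t <= 300 * n.+1]).
Proof.
move=> len0 lenn e0 e11 m0 m1 srcn srt.
have nB' : n < B by move: nB; clear; lia.
apply: runs_seq; apply: runs_assign => //=; first by lia.
apply: runs_seq; apply: (@runs_for_const _ b0 200 _ _ _ _ _ (fun i s' => pass_inv src i s')) => //=.
- by lia.
- by rewrite /update /= e0.
- by split=> //; left.
- move=> i s1 ilt fr e10 inv; rewrite /update /= e0 in ilt.
  have r11 : regs s1 11 = len by rewrite (proj1 fr 11 isT).
  apply: (runs_weaken (merge_body_ok len0 lenn r11 srcn srt ilt e10 inv)) => s2 t2 [fr2 fm2] [b2 mg].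
  case: inv => e0' m0' m1' m2' _; split=> //; split=> /=.
  + by rewrite /update /= (fr2 0 isT).
  + by rewrite (fm2 0 isT).
  + by rewrite (fm2 1 isT).
  + by rewrite (fm2 2 isT).
  + by right; rewrite /update /=.
move=> s1 t1 fr _; rewrite /update /= e0 => -[e0' m0' m1' m2' mg] tb1.
set dst := mem s1 3 in mg.
apply: (@runs_for_const _ b0 10 _ _ _ _ _ (fun i s' => mem s' 3 = dst /\ forall x, x < i -> mem s' 2 x = dst x)) => //=.
- by lia.
- by rewrite /update /= e0'.
- move=> i s2 ilt fr2 e10 [i1 i2]; rewrite /update /= e0' in ilt.
  apply: runs_put => //=; split=> //; split=> // x; rewrite /= /update /= ltnS leq_eqVlt e10 i1.
  by case: eqVneq => [->|_ /= /i2].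
move=> s2 t2 fr2 _; rewrite /update /= e0' => -[_ ed] tb2.
have [sm so] : (forall f : nat -> nat, \sum_(0 <= x < n) f (dst x) = \sum_(0 <= x < n) f (src x)) /\
   forall a b, a < b -> b < n -> a %/ (2 * len) = b %/ (2 * len) -> before p w (dst a) (dst b).
  case: mg => [[n0 _]|[st mg]]; first by move: lenn; rewrite n0.
  have e : n = regs s1 15 by case: mg => *; lia.
  by case: (merge_done len0 mg e).
split.
- move=> f; rewrite -sm; apply: eq_big_nat => x /andP[_ xn]; by rewrite ed.
- move=> x y xy yn e; rewrite !ed // ?(ltn_trans xy) //; exact: so.
- by move: tb1 tb2; clear; lia.
Qed.
End Pass.

(** The outer loop has [n] rounds, but only the roughly [log n] rounds with a block length below [n]
    perform a pass; the others cost a constant each. *)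
Definition sort_prog : prog :=
  (For 10 (Lit 0) 0 (Put 2 ($10) ($10)) ;; 11 ::= Lit 1 ;;
   For 17 (Lit 0) 0 (If ($11 < $0) (merge_pass ;; 11 ::= $11 * Lit 2) Skip))%prog.

Lemma sort_prog_ok s (p := mem s 0) (w := mem s 1) (n := regs s 0) :
  2 * n < B -> (forall x, x < n -> 0 < w x) -> (forall x y, x < n -> y < n -> p x * w y < B.-1) ->
  runs b sort_prog s (fun s' t => [/\ same_items n (mem s' 2) id,
    forall x y, x < y -> y < n -> before p w (mem s' 2 x) (mem s' 2 y) &
    t <= 400 * n.+1 * (trunc_log 2 n + 3)]).
Proof.
move=> nB w0 pwB; have nB' : n < B by move: nB; clear; lia.
apply: runs_seq; apply: (@runs_for_const _ b0 10 _ _ _ _ _ (fun i s' => forall x, x < i -> mem s' 2 x = x)) => //=.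
- by lia.
- move=> i s2 ilt fr2 e10 i2; rewrite /update /= -/n in ilt.
  apply: runs_put => //=; split=> // x; rewrite /= /update /= ltnS leq_eqVlt e10.
  by case: eqVneq => [->|_ /= /i2].
move=> s1 t1 fr _; rewrite /update /= -/n => e2 tb1.
have r0 : regs s1 0 = n by rewrite (proj1 fr 0 isT).
apply: runs_seq; apply: runs_assign => //=; first by lia.
apply: (@runs_for _ b0 _ _ _ _ _ (fun i s' t => exists e, [/\ regs s' 11 = 2 ^ e,
   same_items n (mem s' 2) id, sorted_blocks p w n (2 ^ e) (mem s' 2),
   (e = 0 \/ 2 ^ e.-1 < n) /\ (e = i \/ n <= 2 ^ e) & t <= 30 * i + e * (320 * n.+1)])) => //=.
- by lia.
- by rewrite /update /= r0.
- exists 0; split=> //.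
  + move=> f; apply: eq_big_nat => x /andP[_ xn]; by rewrite /= e2.
  + move=> x y xy yn; rewrite expn0 !divn1 => e; by rewrite e ltnn in xy.
  + by split; left.
- move=> i s2 t2 ilt fr2 e17 [e [e11 si so [e0 en] tb2]]; rewrite /update /= r0 in ilt.
  have f0 : regs s2 0 = n by rewrite (proj1 fr2 0 isT).
  have fm0 : mem s2 0 = p by rewrite (proj2 fr2 0 isT) /= (proj2 fr 0 isT).
  have fm1 : mem s2 1 = w by rewrite (proj2 fr2 1 isT) /= (proj2 fr 1 isT).
  apply: runs_if => //=; rewrite eqb0 negbK e11 f0; case: ltnP => h; last first.
    apply: runs_skip; exists e; split=> //=; first by split=> //; right.
    by move: tb2; clear; lia.
  have len0 : 0 < 2 ^ e by rewrite expn_gt0.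
  have range x : x < n -> mem s2 2 x < n by apply: same_items_range.
  apply: runs_seq; apply: (runs_weaken (merge_pass_ok nB w0 pwB len0 h f0 e11 fm0 fm1 range so)).
  move=> s3 t3 [fr3 _] [si3 so3 tb3].
  have g11 : regs s3 11 = 2 ^ e by rewrite (fr3 11 isT).
  apply: runs_assign => //=; rewrite ?g11.
    by split=> //; [lia | move: nB h; rewrite mulnC; clear; lia].
  exists e.+1; rewrite /= /update /= -expnSr expnS; split=> //.
  - by move=> f; rewrite si3 si.
  - split; first by right.
    case: en => [-> |en]; first by left.
    by move: h; rewrite ltnNge en.
  - by rewrite mulnDl mul1n || rewrite mulSn; move: tb2 tb3; clear; lia.
move=> s2 t2 fr2 _; rewrite /update /= r0 => -[e [e11 si so [e0 en] tb2]].
have ne : n <= 2 ^ e by case: en => // ->; apply: ltnW; apply: ltn_expl.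
split=> //.
- move=> x y xy yn; apply: so => //; have yN : y < 2 ^ e by apply: leq_trans ne.
  by rewrite !divn_small //; apply: ltn_trans yN.
- have : e <= trunc_log 2 n + 1.
    case: e0 => [-> //|h]; have n0 : 0 < n by apply: leq_ltn_trans h.
    have := trunc_log_max (isT : 1 < 2) (ltnW h); lia.
  move=> el; have : e * (320 * n.+1) <= (trunc_log 2 n + 1) * (320 * n.+1) by rewrite leq_mul2r el orbT.
  by move: tb1 tb2; move: (trunc_log 2 n) => q; clear; lia.
Qed.
End SortProg.

(** * The sorted items, copied and distributed by weight *)

Section Buckets.
Variable b : nat.
Hypothesis b0 : 0 < b.
Notation B := (wsize b).
Hypothesis B512 : 512 < B.

Definition copy_prog : prog :=
  (For 10 (Lit 0) 0 (Put 4 ($10) (Get 0 (Get 2 ($10))) ;; Put 5 ($10) (Get 1 (Get 2 ($10)))))%prog.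

Lemma copy_prog_ok s (n := regs s 0) : n < B -> runs b copy_prog s (fun s' t =>
  [/\ forall x, x < n -> mem s' 4 x = mem s 0 (mem s 2 x),
      forall x, x < n -> mem s' 5 x = mem s 1 (mem s 2 x) & t <= 30 * n.+1]).
Proof.
move=> nB; apply: (@runs_for_const _ b0 20 _ _ _ _ _ (fun i s' =>
  (forall x, x < i -> mem s' 4 x = mem s 0 (mem s 2 x)) /\
  (forall x, x < i -> mem s' 5 x = mem s 1 (mem s 2 x)))) => //=.
- by lia.
- move=> i s1 ilt fr e10 [i1 i2]; rewrite -/n in ilt.
  have m0 : mem s1 0 = mem s 0 by rewrite (proj2 fr 0 isT).
  have m1 : mem s1 1 = mem s 1 by rewrite (proj2 fr 1 isT).
  have m2 : mem s1 2 = mem s 2 by rewrite (proj2 fr 2 isT).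
  apply: runs_seq; apply: runs_put => //=; apply: runs_put => //=; split=> //.
  rewrite /update /= m0 m1 m2 e10; split=> x; rewrite ltnS leq_eqVlt.
    by case: eqVneq => [->|_ /= /i1].
  by case: eqVneq => [->|_ /= /i2].
- move=> s1 t fr _ [i1 i2]; rewrite -/n => tb; split=> //.
  by move: tb; clear; lia.
Qed.

Lemma pos_rec i w v : pos i.+1 w v = pos i w v ++ (if w i == v then [:: i] else [::]).
Proof. by rewrite /pos -addn1 iotaD filter_cat /= add0n; case: (w i == v). Qed.

Lemma nitem_rec i w v : nitem i.+1 w v = nitem i w v + (w i == v).
Proof. by rewrite /nitem pos_rec size_cat; case: (w i == v). Qed.

Lemma nitem_le i w v : nitem i w v <= i.
Proof. by rewrite /nitem /pos size_filter (leq_trans (count_size _ _)) // size_iota. Qed.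

Lemma item_rec i w v k : k < nitem i.+1 w v ->
  item i.+1 w v k = if k < nitem i w v then item i w v k else i.
Proof.
rewrite nitem_rec /item pos_rec nth_cat -/(nitem i w v); case: (ltnP k (nitem i w v)) => // h.
case: (w i == v) => k1 /=.
  by rewrite (_ : k - nitem i w v = 0) //; move: (k1 : k < nitem i w v + 1) h; clear; lia.
by move: (k1 : k < nitem i w v + 0) h; clear; lia.
Qed.

Lemma nprefix_rec i w v : nprefix i.+1 w v = nprefix i w v + (w i == v).
Proof. by rewrite /nprefix -addn1 iotaD count_cat /= add0n addn0. Qed.

(** Weight [v] owns the row of bank 8 that starts at [v * n]. Rows are filled at the position given
    by the counter and never cleared, so the time is linear in [n] although the addresses reach
    about [wm * n]. *)
Definition bucket_prog : prog :=
  (For 10 (Lit 0) 0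
    (11 ::= Get 5 ($10) ;;
     Put 8 ($11 * $0 + Get 9 ($11)) (Get 4 ($10)) ;;
     Put 9 ($11) (Get 9 ($11) + Lit 1) ;;
     If ($10 < $5) (Put 10 ($11) (Get 10 ($11) + Lit 1)) Skip))%prog.

Lemma bucket_prog_ok s (n := regs s 0) (p := mem s 4) (w := mem s 5) (g := regs s 5) M :
  n < B -> (forall i, i < n -> w i <= M) -> M * n + n < B -> g <= n ->
  (forall v, mem s 9 v = 0) -> (forall v, mem s 10 v = 0) ->
  runs b bucket_prog s (fun s' t =>
  [/\ forall v, mem s' 9 v = nitem n w v, forall v, mem s' 10 v = nprefix g w v,
      forall v k, k < nitem n w v -> mem s' 8 (v * n + k) = p (item n w v k) & t <= 60 * n.+1]).
Proof.
move=> nB wM MB gn z9 z10.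
apply: (@runs_for_const _ b0 50 _ _ _ _ _ (fun i s' =>
  [/\ forall v, mem s' 9 v = nitem i w v, forall v, mem s' 10 v = nprefix (minn i g) w v &
      forall v k, k < nitem i w v -> mem s' 8 (v * n + k) = p (item i w v k)])) => //=.
- by lia.
- by split=> // v; rewrite ?z9 ?z10 // min0n.
- move=> i s1 ilt fr e10 [i9 i10 i8]; rewrite -/n in ilt.
  have m4 : mem s1 4 = p by rewrite (proj2 fr 4 isT).
  have m5 : mem s1 5 = w by rewrite (proj2 fr 5 isT).
  have r0 : regs s1 0 = n by rewrite (proj1 fr 0 isT).
  have r5 : regs s1 5 = g by rewrite (proj1 fr 5 isT).
  apply: runs_seq; apply: runs_assign => //=; rewrite e10 m5.
  have wn : w i * n <= M * n by rewrite leq_mul2r wM ?orbT.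
  have ni := nitem_le i w (w i).
  apply: runs_seq; apply: runs_put => //=; rewrite /= /update /= ?e10 ?r0 ?m4 ?i9.
    by split=> //; [split=> //; move: wn MB; clear; lia | move: wn ni MB ilt; clear; lia].
  apply: runs_seq; apply: runs_put => //=; rewrite /= /update /= ?i9.
    by split=> //; [lia | move: ni ilt nB; clear; lia].
  have e9 v : (if v == w i then nitem i w (w i) + 1 else mem s1 9 v) = nitem i.+1 w v.
    by rewrite nitem_rec eq_sym; case: eqVneq => [<- //|ne]; rewrite i9 addn0.
  have e8 v k : k < nitem i.+1 w v ->
     (if v * n + k == w i * n + nitem i w (w i) then p i else mem s1 8 (v * n + k)) = p (item i.+1 w v k).
    move=> ki; rewrite item_rec //; have kn : k < n by apply: leq_trans ki (leq_trans (nitem_le _ _ _) ilt).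
    have nn : nitem i w (w i) < n by apply: leq_ltn_trans ni ilt.
    case: eqP => [e|ne].
      have ev : v = w i.
        have := congr1 (fun x => x %/ n) e; rewrite !divnMDl ?(leq_trans _ kn) //.
        by rewrite !divn_small // !addn0.
      have ek : k = nitem i w (w i) by move: e; rewrite ev => /addnI.
      by rewrite ev ek ltnn.
    case: ltnP => h; first by rewrite i8.
    move: ki; rewrite nitem_rec; case: eqVneq => [ev|_] ki.
      by case: ne; rewrite -ev; congr (_ + _); move: ki h; rewrite ev; clear; lia.
    by move: ki h; clear; lia.
  apply: runs_if => //=; rewrite /= /update /= e10 r5 eqb0 negbK; case: (ltnP i g) => ig.
    apply: runs_put => //=; rewrite /= /update /= i10.
      have h : nprefix (minn i g) w (w i) <= i.
        by rewrite (minn_idPl (ltnW ig)) /nprefix (leq_trans (count_size _ _)) // size_iota.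
      by split=> //; [lia | move: h nB ilt; clear; lia].
    split=> //; split=> // v; rewrite (minn_idPl ig) nprefix_rec.
    rewrite eq_sym; case: eqVneq => [<- //|ne]; first by rewrite (minn_idPl (ltnW ig)).
    by rewrite i10 (minn_idPl (ltnW ig)) addn0.
  apply: runs_skip; split=> //; split=> // v; rewrite /= /update /= i10.
  by rewrite (minn_idPr ig) (minn_idPr (leqW ig)).
- move=> s1 t fr _ [i9 i10 i8]; rewrite -/n in i9 i10 i8 *; rewrite (minn_idPr gn) in i10.
  by move=> tb; split=> //; move: tb; clear; lia.
Qed.
End Buckets.

(** * Levels of weights *)

Section Rings.
Variable wm : nat.
Implicit Types (loc : nat -> nat) (k mu t : nat).

Definition nheavy loc mu t := #|[set v : 'I_wm.+1 | mu <= nprefix t loc v]|.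

(** A weight becomes frequent exactly when its counter hits [mu], so one equality test per item
    maintains the number of frequent weights. *)
Lemma nheavyS loc mu t : 0 < mu -> loc t <= wm ->
  nheavy loc mu t.+1 = nheavy loc mu t + (nprefix t loc (loc t) + 1 == mu).
Proof.
move=> mu0 aw; pose a : 'I_wm.+1 := inord (loc t); have ea : val a = loc t by rewrite /= inordK.
rewrite /nheavy; case: eqP => e.
  rewrite (_ : [set v : 'I_wm.+1 | mu <= nprefix t.+1 loc v] =
               a |: [set v : 'I_wm.+1 | mu <= nprefix t loc v]).
    by rewrite cardsU1 inE ea -ltnNge -e addn1 ltnSn addnC.
  apply/setP => v; rewrite !inE nprefix_rec -val_eqE ea [loc t == _]eq_sym.
  by case: eqVneq => [->|_] /=; rewrite ?addn0 // -e leqnn.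
rewrite addn0; apply: eq_card => v; rewrite !inE nprefix_rec eq_sym.
case: eqVneq => [->|_]; last by rewrite addn0.
by move: e; rewrite addn1; move: (nprefix _ _ _) => x; clear; lia.
Qed.

(* The scan stops as soon as [k] weights have occurred [mu] times. *)
Fixpoint stop loc k mu i :=
  if i is i'.+1 then let t := stop loc k mu i' in if nheavy loc mu t < k then t.+1 else t else 0.

Lemma stop_spec loc k mu i : 0 < k -> 0 < mu -> (forall x, x < i -> loc x <= wm) ->
  [/\ stop loc k mu i <= i, nheavy loc mu (stop loc k mu i) <= k &
      stop loc k mu i = i \/ nheavy loc mu (stop loc k mu i) = k].
Proof.
move=> k0 mu0; elim: i => [|i IH] aw.
  split=> //; last by left.
  rewrite /nheavy (_ : [set _ | _] = set0) ?cards0 //; apply/setP => v.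
  by rewrite !inE /nprefix /= leqNgt mu0.
have [si sk st] := IH (fun x h => aw x (ltnW h)).
rewrite /=; case: (ltnP (nheavy loc mu (stop loc k mu i)) k) => h.
  have e : stop loc k mu i = i by case: st => // e; move: h; rewrite e ltnn.
  rewrite e in h *; split=> //; last by left.
  by rewrite nheavyS ?aw //; move: h; case: (_ == mu); move: (nheavy _ _ _); clear; lia.
split=> //; first exact: leqW.
by right; apply/eqP; rewrite eqn_leq sk.
Qed.

Definition heavy loc k mu len v := mu <= nprefix (stop loc k mu len) loc v.

Lemma heavy_ring n (w : 'I_n -> nat) R loc k mu len : 0 < k -> 0 < mu ->
  (forall x, x < len -> loc x <= wm) ->
  (forall t v, t <= len -> mult w (R t) v = nprefix t loc v) ->
  ring_spec wm w R len k mu (heavy loc k mu len).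
Proof.
move=> k0 mu0 aw Rat; have [si sk st] := stop_spec k0 mu0 aw.
by exists (stop loc k mu len); split=> // v; rewrite Rat.
Qed.
End Rings.

Section Sides.
Variables (n g : nat) (w : nat -> nat).
Hypothesis gn : g <= n.
Let w' (i : 'I_n) := w i.

Lemma mult_add (R : {set 'I_n}) (i : 'I_n) v : i \notin R ->
  mult w' (i |: R) v = mult w' R v + (w i == v).
Proof.
move=> iR; rewrite /mult; case: (eqVneq (w i) v) => [e|ne].
  rewrite (_ : [set x in i |: R | w' x == v] = i |: [set x in R | w' x == v]).
    by rewrite cardsU1 inE (negPf iR) /= addnC.
  apply/setP => x; rewrite !inE; case: (eqVneq x i) => [->|_] //=.
  by rewrite /w' e eqxx.
rewrite addn0; apply: eq_card => x; rewrite !inE; case: (eqVneq x i) => [->|_] //=.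
by rewrite /w' (negPf ne) andbF.
Qed.

Lemma mult_left t v : t <= g ->
  mult w' (ring_left n g t) v = nprefix t (fun i => w (g - 1 - i)) v.
Proof.
elim: t => [|t IH] tg.
  rewrite /mult (_ : [set _ in _ | _] = set0) ?cards0 //; apply/setP => x.
  by rewrite !inE addn0 ltnNge; case: (_ <= _).
have h : g - 1 - t < n by move: tg gn; clear; lia.
rewrite nprefix_rec -(IH (ltnW tg)) -(mult_add (i := Ordinal h)) /=.
  congr (mult _ _ _); apply/setP => x; rewrite !inE -val_eqE /=.
  by move: tg gn; clear; lia.
by rewrite inE /=; move: tg; clear; lia.
Qed.

Lemma mult_right t v : t <= n - g ->
  mult w' (ring_right n g t) v = nprefix t (fun i => w (g + i)) v.
Proof.
elim: t => [|t IH] tg.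
  rewrite /mult (_ : [set _ in _ | _] = set0) ?cards0 //; apply/setP => x.
  by rewrite !inE addn0; case: leqP.
have h : g + t < n by move: tg gn; clear; lia.
rewrite nprefix_rec -(IH (ltnW tg)) -(mult_add (i := Ordinal h)) /=.
  congr (mult _ _ _); apply/setP => x; rewrite !inE -val_eqE /=.
  by move: tg gn; clear; lia.
by rewrite inE /=; move: tg; clear; lia.
Qed.
End Sides.

Section Levels.
Variables (n g wm l : nat) (w : nat -> nat).

Definition heavy_left j :=
  heavy wm (fun i => w (g - 1 - i)) (lvl_size wm j) (lvl_mult l wm j) g.
Definition heavy_right j :=
  heavy wm (fun i => w (g + i)) (lvl_size wm j) (lvl_mult l wm j) (n - g).
(** Mirrors the program, where a higher level overwrites a lower one. *)
Fixpoint level_upto j v :=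
  if j is j'.+1 then if heavy_left j v || heavy_right j v then j else level_upto j' v else 0.

Lemma level_upto_le j v : level_upto j v <= j.
Proof. by elim: j => //= j IH; case: ifP => // _; apply: leqW. Qed.

Lemma level_upto_ge j i v : 0 < i <= j -> heavy_left i v || heavy_right i v -> i <= level_upto j v.
Proof.
elim: j => [|j IH]; first by case: i.
case/andP=> i0; rewrite leq_eqVlt => /orP[/eqP ->|ij] hv; first by rewrite [level_upto _ _]/= hv.
rewrite /=; case: ifP => _; first exact: ltnW.
by apply: IH; rewrite // i0.
Qed.

Lemma level_upto_ex j v : 0 < level_upto j v ->
  heavy_left (level_upto j v) v || heavy_right (level_upto j v) v.
Proof. by elim: j => //= j IH; case: ifP. Qed.
End Levels.

Section Scan.
Variable b : nat.
Hypothesis b0 : 0 < b.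
Notation B := (wsize b).
Hypothesis B512 : 512 < B.

Definition clear_prog : prog := For 10 (Lit 0) 25 (Put 6 ($10)%prog (Lit 0)).

Lemma clear_prog_ok s : regs s 25 < B -> runs b clear_prog s (fun s' t =>
  (forall v, v < regs s 25 -> mem s' 6 v = 0) /\ t <= 20 * (regs s 25).+1).
Proof.
move=> hB; apply: (@runs_for_const _ b0 10 _ _ _ _ _ (fun i s' => forall v, v < i -> mem s' 6 v = 0)) => //=.
- by lia.
- move=> i s1 ilt fr e10 inv; apply: runs_put => //=; first by lia.
  split=> // v; rewrite /= /update /= e10 ltnS leq_eqVlt; case: eqP => //= _; exact: inv.
- by move=> s1 t fr _ inv tb; split=> //; move: tb; clear; lia.
Qed.

Definition scan_prog (e : expr) q : prog :=
  (22 ::= Lit 0 ;;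
   For 10 (Lit 0) q
     (If ($22 < $20)
        (11 ::= e ;; Put 6 ($11) (Get 6 ($11) + Lit 1) ;;
         If (Get 6 ($11) == $21) (Put 7 ($11) ($18) ;; 22 ::= $22 + Lit 1) Skip)
        Skip))%prog.

Lemma scan_prog_ok s e q wm loc (k := regs s 20) (mu := regs s 21) (len := regs s q) :
  cost e <= 10 -> q \notin [:: 10; 11; 22] -> 0 < k -> 0 < mu -> k + wm + 1 < B -> len.+1 < B ->
  (forall x, x < len -> loc x <= wm) -> (forall v, v < wm.+1 -> mem s 6 v = 0) ->
  (forall i s', i < len -> frame [:: 10; 11; 22] [:: 6; 7] s s' -> regs s' 10 = i ->
     fits B s' e /\ evaln s' e = loc i) ->
  runs b (scan_prog e q) s (fun s' t =>
    (forall v, mem s' 7 v = if heavy wm loc k mu len v then regs s 18 else mem s 7 v) /\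
    t <= 70 * len.+1).
Proof.
move=> ce qn k0 mu0 kB lB aw z6 ev.
have fr0 : frame [:: 10; 11; 22] [:: 6; 7] s (set_reg s 22 0).
  by split=> // x; rewrite !inE !negb_or /= /update => /and3P[_ _ /negPf->].
have lenE : regs (set_reg s 22 0) q = len.
  by move: qn; rewrite /= /update !inE !negb_or => /and3P[_ _ /negPf->].
apply: runs_seq; apply: runs_assign => //=; first by lia.
apply: (@runs_for_const _ b0 55 _ _ _ _ _ (fun i s' => let t := stop wm loc k mu i in
  [/\ regs s' 22 = nheavy wm loc mu t, forall v, v <= wm -> mem s' 6 v = nprefix t loc v &
      forall v, mem s' 7 v = if mu <= nprefix t loc v then regs s 18 else mem s 7 v])); rewrite ?lenE //=.
- by lia.
- by lia.
- by move: qn; rewrite !inE !negb_or => /and3P[_ -> ->].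
- by move: qn; rewrite !inE !negb_or => /and3P[].
- rewrite /update /=; split=> //.
    rewrite /nheavy (_ : [set _ | _] = set0) ?cards0 //; apply/setP => v.
    by rewrite !inE /nprefix /= leqNgt mu0.
  by move=> v; rewrite /nprefix /= leqNgt mu0.
- move=> i s1 ilt fr e10; set t := stop wm loc k mu i => -[i22 i6 i7].
  have fr1 : frame [:: 10; 11; 22] [:: 6; 7] s s1.
    by apply: frame_trans fr0 (frame_sub _ _ fr) => x; rewrite !inE //=.
  have r20 : regs s1 20 = k by rewrite (proj1 fr1 20 isT).
  have r21 : regs s1 21 = mu by rewrite (proj1 fr1 21 isT).
  have r18 : regs s1 18 = regs s 18 by rewrite (proj1 fr1 18 isT).
  have [f1 e1] := ev i s1 ilt fr1 e10.
  have [tl tk tt] := @stop_spec wm loc k mu i k0 mu0 (fun x h => aw x (ltn_trans h ilt)).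
  rewrite -/t in tl tk tt.
  have tl' : nprefix t loc (loc t) <= i.
    by rewrite /nprefix (leq_trans (count_size _ _)) // size_iota.
  apply: runs_if => //; rewrite /= r20 i22 eqb0 negbK -/t.
  case: (ltnP (nheavy wm loc mu t) k) => h; last first.
    by apply: runs_skip; split=> //; move: ce; clear; lia.
  have eti : t = i by case: tt => // e'; move: h; rewrite e' ltnn.
  rewrite eti in i22 i6 i7 tl' h *.
  apply: runs_seq; apply: runs_assign => //=; rewrite e1.
  have ai := aw i ilt.
  apply: runs_seq; apply: runs_put => //=; rewrite /update /= ?i6 //.
    by split=> //; [lia | move: tl' ilt lB; clear; lia].
  apply: runs_if => //=; rewrite /= /update /= eqxx r21 eqb0 negbK.
  have nS : nprefix i.+1 loc (loc i) = nprefix i loc (loc i) + 1 by rewrite nprefix_rec eqxx.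
  have n6 v : v <= wm -> (if v == loc i then nprefix i loc (loc i) + 1 else mem s1 6 v) = nprefix i.+1 loc v.
    by move=> vw; rewrite nprefix_rec eq_sym; case: eqVneq => [<- //|_]; rewrite i6 // addn0.
  have n7 v : v <> loc i -> nprefix i.+1 loc v = nprefix i loc v.
    by rewrite nprefix_rec eq_sym => /eqP/negPf->; rewrite addn0.
  case: eqVneq => hm.
    apply: runs_seq; apply: runs_put => //=; apply: runs_assign => //=; rewrite /update /= ?i22.
      by split=> //; [lia | move: h kB; clear; lia].
    split; last by move: ce; clear; lia.
    rewrite /= /update /= ?eti nheavyS ?aw // hm eqxx; split=> // v; first by rewrite -hm; apply: n6.
    by rewrite r18 i7; case: eqP => [->|/n7 ->]; rewrite ?nS ?hm ?leqnn.
  apply: runs_skip; split; last by move: ce; clear; lia.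
  rewrite /= /update /= ?eti nheavyS ?aw // (negPf hm) addn0; split=> // v.
  rewrite i7; case: (eqVneq v (loc i)) => [->|/eqP/n7 -> //]; rewrite nS.
  by move: hm; rewrite addn1 [in RHS]leq_eqVlt eq_sym => /negPf->; rewrite ltnS.
- move=> s1 t fr _ [_ _ i7]; rewrite ?lenE => tb; split=> //.
  by move: tb; clear; lia.
Qed.

(** Register 26 becomes [l ^ 10] as the square of [l ^ 5], and register 19 is halved in each round
    to hold the maximal weight divided by [2 ^ j]. The counters are cleared before each of the two
    scans, left and right of the break. *)
Definition level_prog : prog :=
  (24 ::= $3 + Lit 1 ;; 25 ::= $2 + Lit 1 ;; 23 ::= $0 - $5 ;; 19 ::= $2 ;;
   26 ::= $3 * $3 ;; 26 ::= $26 * $26 * $3 ;; 26 ::= $26 * $26 ;;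
   For 18 (Lit 1) 24
     (19 ::= $19 %/ Lit 2 ;; 20 ::= $19 + Lit 32 ;;
      21 ::= (Lit 8 * $26 * ($2 %/ $20 + Lit 1)) %/ $20 + Lit 1 ;;
      clear_prog ;; scan_prog (Get 5 ($5 - Lit 1 - $10)) 5 ;;
      clear_prog ;; scan_prog (Get 5 ($5 + $10)) 23))%prog.

Lemma level_prog_ok s (n := regs s 0) (wm := regs s 2) (l := regs s 3) (g := regs s 5)
    (w := mem s 5) :
  g <= n -> 0 < l -> (forall i, i < n -> w i <= wm) -> 8 * l ^ 10 * (wm + 1) + n + wm + l + 512 < B ->
  (forall v, mem s 7 v = 0) ->
  runs b level_prog s (fun s' t =>
    (forall v, mem s' 7 v = level_upto n g wm l w l v) /\ t <= 1000 * l * (n + wm + 1)).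
Proof.
move=> gn l0 ww hB z7.
have l10 : l * l * (l * l) * l * (l * l * (l * l) * l) = l ^ 10 by rewrite !expnS expn0; clear; lia.
have lB : l * l * (l * l) * l * (l * l * (l * l) * l) <= 8 * l ^ 10 * (wm + 1).
  by rewrite l10; move: (l ^ 10); clear; nia.
have l2 : l * l <= l * l * (l * l) * l by rewrite -mulnA leq_pmulr // !muln_gt0 l0.
have l4 : l * l * (l * l) <= l * l * (l * l) * l by rewrite leq_pmulr.
have l5 : l * l * (l * l) * l <= l * l * (l * l) * l * (l * l * (l * l) * l).
  by rewrite leq_pmulr // !muln_gt0 l0.
have sB x : x <= 8 * l ^ 10 * (wm + 1) -> x < B by move: hB; clear; lia.
have [B1 Bl Bw Bn] : [/\ 1 < B, l + 1 < B, wm + 1 < B & n < B].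
  by move: hB B512; move: (8 * _ * _) => q; clear; split; lia.
have Bk : 2 * wm + 40 < B.
  apply: leq_ltn_trans hB; have : 1 <= l ^ 10 by rewrite expn_gt0 l0.
  by move: (l ^ 10) => q q0; have := leq_pmull (wm + 1) q0; move: (q * _) (mulnA 8 q (wm + 1)) => r; clear; lia.
apply: runs_seq; apply: runs_assign => //.
apply: runs_seq; apply: runs_assign => //.
apply: runs_seq; apply: runs_assign => //.
apply: runs_seq; apply: runs_assign => //; rewrite /= /update /=.
apply: runs_seq; apply: runs_assign => //; rewrite /= /update /= -/l.
  by split=> //; apply: sB; apply: leq_trans l2 (leq_trans l5 lB).
apply: runs_seq; apply: runs_assign => //; rewrite /= /update /= -/l.
  by split=> //; [split=> // |]; apply: sB; apply: leq_trans (leq_trans l5 lB).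
apply: runs_seq; apply: runs_assign => //; rewrite /= /update /= -/l.
  by split=> //; apply: sB.
rewrite l10.
apply: (@runs_for_const _ b0 (900 * (n + wm + 1)) _ _ _ _ _ (fun j s' =>
  regs s' 19 = wm %/ 2 ^ j.-1 /\ forall v, mem s' 7 v = level_upto n g wm l w j.-1 v)) => //=;
  rewrite /= /update //=; rewrite -?/n -?/g -?/l -?/wm.
- by rewrite addn1.
- by rewrite divn1.
- move=> j s1; rewrite -/l => /andP[j1 jl] fr e18 [e19 e7].
  have r0 : regs s1 0 = n by rewrite (proj1 fr 0 isT).
  have r2 : regs s1 2 = wm by rewrite (proj1 fr 2 isT).
  have r5 : regs s1 5 = g by rewrite (proj1 fr 5 isT).
  have r23 : regs s1 23 = n - g by rewrite (proj1 fr 23 isT).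
  have r25 : regs s1 25 = wm + 1 by rewrite (proj1 fr 25 isT).
  have r26 : regs s1 26 = l ^ 10 by rewrite (proj1 fr 26 isT).
  have m5 : mem s1 5 = w by rewrite (proj2 fr 5 isT).
  have ej : wm %/ 2 ^ j.-1 %/ 2 = wm %/ 2 ^ j by rewrite -divnMA -expnSr prednK.
  have dw x : wm %/ x <= wm by apply: leq_div.
  apply: runs_seq; apply: runs_assign => //=; rewrite ?e19.
    by split=> //; have := dw (2 ^ j.-1); move: hB B512; clear; lia.
  rewrite ej; apply: runs_seq; apply: runs_assign => //=; rewrite /update /=.
    by split=> //; have := dw (2 ^ j); move: hB B512; clear; lia.
  rewrite -/(lvl_size wm j); set k := lvl_size wm j.
  have k32 : 32 <= k by apply: leq_addl.
  have kw : k <= wm + 32 by rewrite leq_add2r dw.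
  have kB : 8 * l ^ 10 * (wm %/ k + 1) <= 8 * l ^ 10 * (wm + 1) by rewrite leq_mul2l leq_add2r dw orbT.
  have kB' : 8 * l ^ 10 <= 8 * l ^ 10 * (wm + 1) by rewrite leq_pmulr // addn1.
  have kB'' : (8 * l ^ 10 * (wm %/ k + 1)) %/ k <= 8 * l ^ 10 * (wm + 1) by apply: leq_trans (leq_div _ _) kB.
  apply: runs_seq; apply: runs_assign => //=; rewrite /update /= ?r2 ?r26.
    have k0 : 0 < k by apply: leq_trans k32.
    have c1 : wm %/ k + 1 < B by apply: leq_ltn_trans Bw; rewrite leq_add2r dw.
    have c2 : (8 * l ^ 10 * (wm %/ k + 1)) %/ k + 1 < B.
      apply: leq_ltn_trans (leq_add kB'' (leqnn 1)) _.
      by move: hB B512; move: (8 * l ^ 10 * (wm + 1)) => y; clear; lia.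
    have c3 : wm < B by apply: leq_trans Bw; rewrite addn1.
    have c4 : 8 < B by apply: leq_trans B512.
    by repeat split=> //; apply: sB.
  rewrite !addn1 -/(lvl_sparsity wm j) -/(lvl_mult l wm j); set mu := lvl_mult l wm j.
  apply: runs_seq; apply: runs_weaken (clear_prog_ok _) _; rewrite /= /update /= r25.
    by move: hB; clear; lia.
  move=> s2 t2 fr2 [z6 tb2]; rewrite addn1 in z6 tb2.
  have q5 : regs s2 5 = g by rewrite (proj1 fr2 5 isT).
  have q20 : regs s2 20 = k by rewrite (proj1 fr2 20 isT).
  have q21 : regs s2 21 = mu by rewrite (proj1 fr2 21 isT).
  have q18 : regs s2 18 = j by rewrite (proj1 fr2 18 isT).
  have p5 : mem s2 5 = w by rewrite (proj2 fr2 5 isT).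
  have p7 : mem s2 7 = mem s1 7 by rewrite (proj2 fr2 7 isT).
  apply: runs_seq; apply: (runs_weaken (@scan_prog_ok s2 (Get 5 ($5 - Lit 1 - $10))%prog 5 wm
    (fun i => w (g - 1 - i)) _ _ _ _ _ _ _ _ _)); rewrite ?q5 ?q20 ?q21 //.
  - by apply: leq_trans k32.
  - by move: kw Bk; clear; lia.
  - by move: gn hB; clear; lia.
  - by move=> x xg; apply: ww; move: xg gn; clear; lia.
  - move=> i s' ig fr' e10 /=; rewrite e10 (proj1 fr' 5 isT) q5 (proj2 fr' 5 isT) p5; split=> //.
    by repeat split; move: gn hB B512; clear; lia.
  move=> s3 t3 fr3 []; rewrite q18 => e3 tb3.
  have u5 : regs s3 5 = g by rewrite (proj1 fr3 5 isT).
  have u20 : regs s3 20 = k by rewrite (proj1 fr3 20 isT).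
  have u21 : regs s3 21 = mu by rewrite (proj1 fr3 21 isT).
  have u18 : regs s3 18 = j by rewrite (proj1 fr3 18 isT).
  have u23 : regs s3 23 = n - g by rewrite (proj1 fr3 23 isT) (proj1 fr2 23 isT).
  have u25 : regs s3 25 = wm + 1 by rewrite (proj1 fr3 25 isT) (proj1 fr2 25 isT).
  have v5 : mem s3 5 = w by rewrite (proj2 fr3 5 isT).
  apply: runs_seq; apply: runs_weaken (clear_prog_ok _) _; rewrite u25.
    by move: hB; clear; lia.
  move=> s4 t4 fr4 [y6 tb4]; rewrite addn1 in y6 tb4.
  have x5 : regs s4 5 = g by rewrite (proj1 fr4 5 isT).
  have x20 : regs s4 20 = k by rewrite (proj1 fr4 20 isT).
  have x21 : regs s4 21 = mu by rewrite (proj1 fr4 21 isT).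
  have x18 : regs s4 18 = j by rewrite (proj1 fr4 18 isT).
  have x23 : regs s4 23 = n - g by rewrite (proj1 fr4 23 isT).
  have y5 : mem s4 5 = w by rewrite (proj2 fr4 5 isT).
  have y7 : mem s4 7 = mem s3 7 by rewrite (proj2 fr4 7 isT).
  apply: (runs_weaken (@scan_prog_ok s4 (Get 5 ($5 + $10))%prog 23 wm
    (fun i => w (g + i)) _ _ _ _ _ _ _ _ _)); rewrite ?x23 ?x20 ?x21 //.
  - by apply: leq_trans k32.
  - by move: kw Bk; clear; lia.
  - by move: gn hB; clear; lia.
  - by move=> x xg; apply: ww; move: xg gn; clear; lia.
  - move=> i s' ig fr' e10 /=; rewrite e10 (proj1 fr' 5 isT) x5 (proj2 fr' 5 isT) y5; split=> //.
    by repeat split; move: ig gn hB B512; clear; lia.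
  move=> s5 t5 fr5 []; rewrite x18 => e5 tb5.
  split; last by move: gn tb2 tb3 tb4 tb5; clear; lia.
  split; first by rewrite (proj1 fr5 19 isT) (proj1 fr4 19 isT) (proj1 fr3 19 isT) (proj1 fr2 19 isT).
  move=> v; rewrite e5 y7 e3 p7 [mem _ 7 v]e7 -(prednK j1) /= prednK // /heavy_left /heavy_right.
  by rewrite -/k -/mu orbC; case: (heavy _ _ _ _ (n - g) v); case: (heavy _ _ _ _ g v).
- move=> s1 t fr _ [_ e7]; rewrite -/l addn1 => tb; split; first by move=> v; rewrite e7 -/l addn1.
  by move: tb l0; rewrite subn1 /=; clear; nia.
Qed.
End Scan.

(** * One step of the dynamic program *)

Lemma gain_le r c q BIG v K OFF u : gain r c q BIG v K OFF u <= OFF + ps q v (r v).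
Proof.
rewrite /gain; case: ifP => _; first by lia.
case: ifP => [h|_]; last by lia.
by apply: leq_trans (leq_subr _ _) _; rewrite leq_add2l ps_mono.
Qed.

(** * The concave sequence of one weight *)

Section Fill.
Variable b : nat.
Hypothesis b0 : 0 < b.
Notation B := (wsize b).

(** The sequence is filled outward from index [K], the unchanged greedy count, whose value is the
    offset. The offset is so large that no subtraction truncates. *)
Definition fill_prog : prog :=
  (Put 14 ($31) ($32) ;; 33 ::= Lit 2 * $31 ;;
   For 10 ($31) 33
     (If ($10 - $31 + Get 10 ($30) < Get 9 ($30))
        (Put 14 ($10 + Lit 1) (Get 14 ($10) + Get 8 ($30 * $0 + ($10 - $31 + Get 10 ($30)))))
        (Put 14 ($10 + Lit 1) (Get 14 ($10) - $4))) ;;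
   For 10 (Lit 0) 31
     (11 ::= $31 - Lit 1 - $10 ;;
      If ($31 < $11 + Get 10 ($30) + Lit 1)
        (Put 14 ($11) (Get 14 ($11 + Lit 1) - Get 8 ($30 * $0 + ($11 + Get 10 ($30) - $31))))
        (Put 14 ($11) (Get 14 ($11 + Lit 1) - $4))))%prog.

Lemma fill_prog_ok s r c q (n := regs s 0) (BIG := regs s 4) (v := regs s 30) (K := regs s 31)
    (OFF := regs s 32) :
  (forall v, c v <= r v) -> (forall v k, k < r v -> q v k <= BIG) ->
  r v <= n -> mem s 9 v = r v -> mem s 10 v = c v ->
  (forall k, k < r v -> mem s 8 (v * n + k) = q v k) ->
  BIG * K <= OFF -> v * n + n < B -> 2 * K + n + 2 < B -> OFF + ps q v (r v) < B ->
  runs b fill_prog s (fun s' t =>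
    (forall u, u <= 2 * K -> mem s' 14 u = gain r c q BIG v K OFF u) /\ t <= 100 * (K + 1)).
Proof.
move=> cr qBIG rn e9 e10 e8 OFFK vB KB GB.
set F := gain r c q BIG v K OFF.
have FB u : F u < B by apply: leq_ltn_trans (gain_le _ _ _ _ _ _ _ _) GB.
have FK : F K = OFF.
  have := @gain_mid r c q BIG cr qBIG v K OFF OFFK K (c v) (cr v) erefl.
  by rewrite -/F; move: (F K) (ps _ _ _); clear; lia.
have cv := cr v.
have [B2 B1] : 2 < B /\ 1 < B by move: KB; clear; lia.
apply: runs_seq; apply: runs_put => //=; apply: runs_seq; apply: runs_assign => //=; rewrite -?/K -?/OFF.
  by split=> //; move: KB; clear; lia.
apply: runs_seq; apply: (@runs_for_const _ b0 35 _ _ _ _ _ (fun i s' =>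
  forall u, K <= u <= i -> mem s' 14 u = F u)) => //=; rewrite /= /update /= -/K.
- by move: KB; clear; lia.
- by move: KB; clear; lia.
- move=> u /andP[h1 h2]; have -> : u = K by move: h1 h2; clear; lia.
  by rewrite eqxx FK.
- move=> i s1; rewrite -?/K => /andP[Ki i2] fr g10 inv.
  have r0 : regs s1 0 = n by rewrite (proj1 fr 0 isT).
  have r4 : regs s1 4 = BIG by rewrite (proj1 fr 4 isT).
  have r30 : regs s1 30 = v by rewrite (proj1 fr 30 isT).
  have r31 : regs s1 31 = K by rewrite (proj1 fr 31 isT).
  have m8 : mem s1 8 = mem s 8 by rewrite (proj2 fr 8 isT).
  have m9 : mem s1 9 v = r v by rewrite (proj2 fr 9 isT) /= -e9.
  have m10 : mem s1 10 v = c v by rewrite (proj2 fr 10 isT) /= -e10.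
  have up := @gain_up r c q BIG cr qBIG v K OFF OFFK i Ki i2; rewrite -/F in up.
  apply: runs_if => //=; rewrite r30 r31 m10 ?m9 g10.
    by repeat split=> //; move: cv rn KB i2; clear; lia.
  have iF : mem s1 14 i = F i by apply: inv; rewrite Ki leqnn.
  have inv' x : x = F i.+1 -> forall u, K <= u <= i.+1 -> (if u == i + 1 then x else mem s1 14 u) = F u.
    move=> -> u /andP[Ku]; rewrite addn1 leq_eqVlt; case: eqVneq => [->|_ /=] // ui.
    by apply: inv; rewrite Ku.
  rewrite eqb0 negbK; case: ltnP up => h up; apply: runs_put => //=; rewrite /update /= ?r30 ?r31 ?r0 ?r4 ?m10 ?g10 ?iF.
  - by split=> //; move: i2 KB; clear; lia.
  - rewrite m8 e8 // -up; repeat split=> //.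
    + by move: vB; clear; lia.
    + by move: i2 KB; clear; lia.
    + by move: h rn i2 KB cv; clear; lia.
    + by move: h rn vB; clear; lia.
  - by rewrite m8 e8 // -up; split=> //; apply: inv'.
  - by split=> //; move: i2 KB; clear; lia.
  - by repeat split=> //; move: i2 KB; clear; lia.
  - by rewrite -up; split=> //; apply: inv'.
- move=> s1 t1 fr1 _; rewrite -/K => inv1 tb1.
  have q0 : regs s1 0 = n by rewrite (proj1 fr1 0 isT).
  have q4 : regs s1 4 = BIG by rewrite (proj1 fr1 4 isT).
  have q30 : regs s1 30 = v by rewrite (proj1 fr1 30 isT).
  have q31 : regs s1 31 = K by rewrite (proj1 fr1 31 isT).
  have p8 : mem s1 8 = mem s 8 by rewrite (proj2 fr1 8 isT).
  have p9 : mem s1 9 v = r v by rewrite (proj2 fr1 9 isT) /= -e9.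
  have p10 : mem s1 10 v = c v by rewrite (proj2 fr1 10 isT) /= -e10.
  apply: (@runs_for_const _ b0 35 _ _ _ _ _ (fun i s' =>
    forall u, K <= u + i -> u <= 2 * K -> mem s' 14 u = F u)) => //=; rewrite ?q31.
  - by move: KB; clear; lia.
  - by move: KB; clear; lia.
  - by move=> u; rewrite addn0 => Ku u2; apply: inv1; rewrite Ku.
  - move=> i s2 iK fr g10 inv.
    have r0 : regs s2 0 = n by rewrite (proj1 fr 0 isT).
    have r4 : regs s2 4 = BIG by rewrite (proj1 fr 4 isT).
    have r30 : regs s2 30 = v by rewrite (proj1 fr 30 isT).
    have r31 : regs s2 31 = K by rewrite (proj1 fr 31 isT).
    have m8 : mem s2 8 = mem s 8 by rewrite (proj2 fr 8 isT).
    have m10 : mem s2 10 v = c v by rewrite (proj2 fr 10 isT).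
    apply: runs_seq; apply: runs_assign => //=; rewrite r31 ?g10.
      by repeat split=> //; move: KB; clear; lia.
    set u := K - 1 - i; have uK : u < K by rewrite /u; move: iK; clear; lia.
    have dn := @gain_down r c q BIG cr qBIG v K OFF OFFK u uK; rewrite -/F in dn.
    have iF : mem s2 14 (u + 1) = F u.+1.
      by rewrite addn1; apply: inv; rewrite /u; move: iK uK; clear; lia.
    have inv' x : x = F u -> forall y, K <= y + i.+1 -> y <= 2 * K ->
        (if y == u then x else mem s2 14 y) = F y.
      move=> -> y yi y2; case: eqVneq => [-> //|ne]; apply: inv => //.
      by move: ne yi uK iK; rewrite /u; clear; lia.
    apply: runs_if => //=; rewrite /update /= r30 ?r31 m10.
      by repeat split=> //; move: cv rn uK KB; clear; lia.
    rewrite addn1 ltnS eqb0 negbK; case: leqP dn => h dn; apply: runs_put => //=; rewrite /update /= ?r30 ?r31 ?r0 ?r4 ?m10 ?iF.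
    + repeat split=> //.
      * by move: uK KB; clear; lia.
      * by move: vB; clear; lia.
      * by move: uK KB cv rn; clear; lia.
      * by move: uK KB cv rn; clear; lia.
      * by move: uK vB cv rn; clear; lia.
    + rewrite m8 e8 -?dn; last by move: h uK cv; clear; lia.
      by split=> //; apply: inv'.
    + by repeat split=> //; move: uK KB; clear; lia.
    + by rewrite -dn; split=> //; apply: inv'.
  - move=> s2 t2 fr2 _; rewrite ?q31 => inv2 tb2; split.
      by move=> u u2; apply: inv2 => //; apply: leq_addl.
    by move: tb1 tb2; clear; lia.
Qed.
End Fill.

(** * Row maxima by halving strides *)

Section Best.
Variables (old F : nat -> nat) (K R : nat).
(** [a] and [x] number the cells of one residue class modulo the weight: going from cell [x] to cell
    [a] adds [a - x] items, a change stored at index [K + a - x]. *)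
Definition rowval a x := old x + F (K + a - x).
Definition best a o := o < R /\ forall x, x < R -> rowval a x <= rowval a o.
Hypotheses (conc : forall u, u.+2 <= 2 * K -> F u + F u.+2 <= 2 * F u.+1) (RK : R <= K).

(** A maximizer of an earlier row dominates all positions to its left in the present row, and one of
    a later row all positions to its right; only the interval between them must be searched. *)
Lemma best_between a1 a a2 o1 o2 o : a1 <= a -> a <= a2 -> a < R -> best a1 o1 ->
  (a2 < R -> best a2 o2) -> let hi := if a2 < R then o2.+1 else R in
  o1 <= o < hi -> (forall x, o1 <= x < hi -> rowval a x <= rowval a o) -> best a o.
Proof.
move=> a1a aa2 aR [o1R m1] b2 hi /andP[o1o ohi] mo.
have hiR : hi <= R by rewrite /hi; case: ifP => // /b2[].
split=> [|x xR]; first exact: leq_trans ohi hiR.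
have o1hi : o1 < hi by apply: leq_ltn_trans ohi.
case: (leqP o1 x) => xo1; last first.
  apply: leq_trans (_ : rowval a o1 <= _); last by apply: mo; rewrite leqnn.
  by apply: (argmax_left conc a1a xo1) (m1 _ xR); move: o1R RK aR; clear; lia.
case: (leqP hi x) => xhi; last by apply: mo; rewrite xo1.
move: xhi o1hi mo; rewrite /hi; case: ifP => [a2R xo2 o1o2 mo|_ xR']; last by rewrite ltnNge xR' in xR.
have [o2R m2] := b2 a2R.
apply: leq_trans (_ : rowval a o2 <= _); last by apply: mo; rewrite -ltnS o1o2 leqnn.
by apply: (argmax_right conc aa2 xo2) (m2 _ xR); move: xR a2R RK aR; clear; lia.
Qed.
End Best.

Section Rows.
Variable b : nat.
Hypothesis b0 : 0 < b.
Notation B := (wsize b).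
Hypothesis B512 : 512 < B.

Let old s x := mem s 11 (regs s 34 + x * regs s 30).
Let val s a x := rowval (old s) (mem s 14) (regs s 31) a x.

Definition row_prog : prog :=
  (38 ::= Get 11 ($34 + $36 * $30) + Get 14 ($31 + $35 - $36) ;; 39 ::= $36 ;;
   For 10 ($36) 37
     (11 ::= Get 11 ($34 + $10 * $30) + Get 14 ($31 + $35 - $10) ;;
      If ($38 < $11) (38 ::= $11 ;; 39 ::= $10) Skip) ;;
   Put 12 ($35) ($38 - $32) ;; Put 13 ($35) ($39))%prog.

Lemma row_prog_ok s (a := regs s 35) (lo := regs s 36) (hi := regs s 37) :
  lo < hi -> regs s 34 + hi * regs s 30 < B -> hi < B -> hi * regs s 30 < B -> regs s 31 + a < B ->
  (forall x, lo <= x < hi -> val s a x < B) ->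
  runs b row_prog s (fun s' t => exists o,
    [/\ lo <= o < hi, forall x, lo <= x < hi -> val s a x <= val s a o,
        mem s' 12 = update (mem s 12) a (val s a o - regs s 32),
        mem s' 13 = update (mem s 13) a o & t <= 100 * (hi - lo + 1)]).
Proof.
move=> lohi bB hB hvB KB vB.
have xb x : x < hi -> x * regs s 30 < B /\ regs s 34 + x * regs s 30 < B.
  move=> xh; have : x * regs s 30 <= hi * regs s 30 by rewrite leq_mul2r (ltnW xh) orbT.
  by move: bB hvB; move: (_ * _) (_ * _); clear; lia.
have [lb1 lb2] := xb lo lohi.
apply: runs_seq; apply: runs_assign => //=; rewrite -/lo -/a.
  by repeat split=> //; apply: (vB lo); rewrite leqnn.
apply: runs_seq; apply: runs_assign => //=; rewrite /update /= -/lo -/a.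
apply: runs_seq.
apply: (@runs_for_const _ b0 40 _ _ _ _ _ (fun i s' =>
  [/\ regs s' 38 = val s a (regs s' 39), lo <= regs s' 39 < hi &
      forall x, lo <= x < i -> val s a x <= regs s' 38])) => //=; rewrite /= /update /= -?/lo -?/hi.
- exact: ltnW.
- split=> //; first by rewrite leqnn.
  by move=> x; case: leqP.
- move=> i s1; rewrite -/lo -/hi => /andP[li ih] fr g10 [e38 ah mx].
  have r30 : regs s1 30 = regs s 30 by rewrite (proj1 fr 30 isT).
  have r31 : regs s1 31 = regs s 31 by rewrite (proj1 fr 31 isT).
  have r34 : regs s1 34 = regs s 34 by rewrite (proj1 fr 34 isT).
  have r35 : regs s1 35 = a by rewrite (proj1 fr 35 isT).
  have m11 : mem s1 11 = mem s 11 by rewrite (proj2 fr 11 isT).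
  have m14 : mem s1 14 = mem s 14 by rewrite (proj2 fr 14 isT).
  have [ib1 ib2] := xb i ih.
  apply: runs_seq; apply: runs_assign => //=; rewrite r30 r31 r34 r35 g10 ?m11 ?m14.
    by repeat split=> //; apply: (vB i); rewrite li ih.
  rewrite -/(old s i) -[old s i + _]/(val s a i).
  apply: runs_if => //=; rewrite /update /= eqb0 negbK e38; case: ltnP => h.
    apply: runs_seq; apply: runs_assign => //=; apply: runs_assign => //=.
    rewrite /update /= g10; split=> //; split=> //; first by rewrite li ih.
    move=> x /andP[lx]; rewrite ltnS leq_eqVlt => /orP[/eqP-> //|xi].
    by apply: ltnW; apply: leq_ltn_trans h; rewrite -e38; apply: mx; rewrite lx.
  apply: runs_skip; split=> //; rewrite /= /update /=; split=> // x /andP[lx].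
  rewrite ltnS leq_eqVlt => /orP[/eqP->|xi]; first by rewrite e38.
  by apply: mx; rewrite lx.
- move=> s1 t1 fr _; rewrite -/lo -/hi => -[e38 ah mx] tb.
  have r32 : regs s1 32 = regs s 32 by rewrite (proj1 fr 32 isT).
  have r35 : regs s1 35 = a by rewrite (proj1 fr 35 isT).
  have m12 : mem s1 12 = mem s 12 by rewrite (proj2 fr 12 isT).
  have m13 : mem s1 13 = mem s 13 by rewrite (proj2 fr 13 isT).
  apply: runs_seq; apply: runs_put => //=; first by rewrite e38; split=> //; exact: vB.
  apply: runs_put => //=; rewrite /update /= r32 r35 e38 m12 m13; exists (regs s1 39); split=> //.
    by move=> x xx; rewrite -e38; apply: mx.
  by move: tb lohi; clear; lia.
Qed.

(** After halving the stride to [h], the new rows are the odd multiples of [h];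
    [(R + h - 1) %/ (2 * h)] is the number of those below [R]. *)
Definition stride_prog : prog :=
  (41 ::= $41 %/ Lit 2 ;; 45 ::= ($40 + $41 - Lit 1) %/ (Lit 2 * $41) ;;
   For 46 (Lit 0) 45
     (35 ::= $41 + Lit 2 * $41 * $46 ;; 36 ::= Get 13 ($35 - $41) ;;
      If ($35 + $41 < $40) (37 ::= Get 13 ($35 + $41) + Lit 1) (37 ::= $40) ;;
      row_prog))%prog.

(* The rows that are multiples of [h] are known, and their maximizers increase. *)
Definition rows_done s0 h s := let R := regs s0 40 in
  (forall x, h * x < R -> best (old s0) (mem s0 14) (regs s0 31) R (h * x) (mem s 13 (h * x)) /\
     mem s 12 (h * x) = val s0 (h * x) (mem s 13 (h * x)) - regs s0 32) /\
  (forall x, h * x.+1 < R -> mem s 13 (h * x) <= mem s 13 (h * x.+1)).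

Definition rows_pre s (v := regs s 30) (K := regs s 31) (base := regs s 34) (R := regs s 40) :=
  [/\ 0 < R <= K, forall u, u.+2 <= 2 * K -> mem s 14 u + mem s 14 u.+2 <= 2 * mem s 14 u.+1,
      base + R * v < B, K + R < B & forall x u, x < R -> u <= 2 * K -> old s x + mem s 14 u < B].

Definition row_frame := frame [:: 10; 11; 35; 36; 37; 38; 39; 41; 44; 45; 46] [:: 12; 13].

Lemma stride_prog_ok s0 s h (R := regs s0 40) : rows_pre s0 -> row_frame s0 s ->
  0 < h -> regs s 41 = 2 * h -> R + 2 * h < B -> rows_done s0 (2 * h) s ->
  runs b stride_prog s (fun s' t => [/\ regs s' 41 = h, rows_done s0 h s' & t <= 700 * R]).
Proof.
case=> /andP[R0 RK] conc bB KB valB fr0 h0 e41 hB [done mono].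
have q30 : regs s 30 = regs s0 30 by rewrite (proj1 fr0 30 isT).
have q31 : regs s 31 = regs s0 31 by rewrite (proj1 fr0 31 isT).
have q32 : regs s 32 = regs s0 32 by rewrite (proj1 fr0 32 isT).
have q34 : regs s 34 = regs s0 34 by rewrite (proj1 fr0 34 isT).
have q40 : regs s 40 = R by rewrite (proj1 fr0 40 isT).
have p11 : mem s 11 = mem s0 11 by rewrite (proj2 fr0 11 isT).
have p14 : mem s 14 = mem s0 14 by rewrite (proj2 fr0 14 isT).
have vB a x : x < R -> a < R -> val s0 a x < B.
  by move=> xR aR; apply: valB => //; move: RK aR; clear; rewrite -/R; lia.
apply: runs_seq; apply: runs_assign => //=; first by rewrite e41; repeat split=> //; move: hB B512; clear; lia.
rewrite e41 mulKn //; apply: runs_seq; apply: runs_assign => //=; rewrite /update /= q40.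
  by repeat split=> //; rewrite ?muln_gt0 //; move: hB B512; clear; lia.
set Q := _ %/ (2 * h).
have Qp q : (q < Q) = (2 * h * q + h < R).
  rewrite /Q leq_divRL ?muln_gt0 // mulSn [q * _]mulnC; move: h0 R0; move: (2 * h * q) => z; rewrite -/R; clear.
  by move=> h0 R0; apply/idP/idP; lia.
have QR : Q <= R.
  move: Qp; clearbody Q; case: Q => // z Qp; have := Qp z; rewrite ltnSn => /esym.
  by have := leq_pmull z (_ : 0 < 2 * h); rewrite muln_gt0 /= => /(_ h0); move: (2 * h * z); clear; lia.
(* The search for the row between two known rows is confined to the interval
   between their maximizers; [pot] makes the lengths of these intervals telescope. *)
set pot := fun q => if 2 * h * q < R then mem s 13 (2 * h * q) else R.
have potR q : pot q <= R.
  by rewrite /pot; case: ifP => // /done[[/ltnW]].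
apply: (@runs_for _ b0 _ _ _ _ _ (fun q s' t =>
  [/\ forall x, 2 * h * x < R -> mem s' 13 (2 * h * x) = mem s 13 (2 * h * x) /\
        mem s' 12 (2 * h * x) = mem s 12 (2 * h * x),
      forall x, x < q -> let a := 2 * h * x + h in
        [/\ best (old s0) (mem s0 14) (regs s0 31) R a (mem s' 13 a),
            mem s' 12 a = val s0 a (mem s' 13 a) - regs s0 32,
            mem s 13 (2 * h * x) <= mem s' 13 a &
            2 * h * x.+1 < R -> mem s' 13 a <= mem s 13 (2 * h * x.+1)] &
      t <= 200 * (2 * q + pot q)])) => //=; rewrite /= /update //=.
- by move: hB B512; clear; lia.
- by apply: leq_ltn_trans QR _; move: hB; clear; lia.
- move=> q s1 t1 qQ fr g46 [sam new tb]; rewrite Qp in qQ.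
  have r30 : regs s1 30 = regs s0 30 by rewrite (proj1 fr 30 isT).
  have r31 : regs s1 31 = regs s0 31 by rewrite (proj1 fr 31 isT).
  have r32 : regs s1 32 = regs s0 32 by rewrite (proj1 fr 32 isT).
  have r34 : regs s1 34 = regs s0 34 by rewrite (proj1 fr 34 isT).
  have r40 : regs s1 40 = R by rewrite (proj1 fr 40 isT).
  have r41 : regs s1 41 = h by rewrite (proj1 fr 41 isT).
  have m11 : mem s1 11 = mem s0 11 by rewrite (proj2 fr 11 isT).
  have m14 : mem s1 14 = mem s0 14 by rewrite (proj2 fr 14 isT).
  have eold : old s1 = old s0 by rewrite /old r30 r34 m11.
  set a := 2 * h * q + h in qQ.
  have ea : h + 2 * h * q = a by rewrite addnC.
  have q2 : 2 * h * q < R by apply: leq_ltn_trans qQ; apply: leq_addr.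
  have eS : 2 * h * q.+1 = a + h by rewrite mulnS /a; clear; lia.
  have [[o1R m1] _] := done _ q2.
  have e1 := (sam _ q2).1.
  apply: runs_seq; apply: runs_assign => //=; rewrite r41 g46 ?ea.
    by repeat split=> //; move: qQ q2 hB B512; clear; lia.
  apply: runs_seq; apply: runs_assign => //=; rewrite /update /= ?r41.
    by repeat split=> //; move: qQ q2 hB B512; clear; lia.
  rewrite (_ : a - h = 2 * h * q) ?addnK // e1.
  set o1 := mem s 13 (2 * h * q) in m1 o1R e1 *.
  set a2 := 2 * h * q.+1 in eS; set o2 := mem s 13 a2.
  set hi := if a2 < R then o2.+1 else R.
  have hiR : hi <= R by rewrite /hi; case: ifP => // /done[[]].
  have o1hi : o1 < hi by rewrite /hi; case: ifP => // h2; rewrite ltnS; apply: mono.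
  apply: runs_seq; apply: (@runs_weaken _ _ _ (fun s' t' => regs s' 37 = hi /\ t' <= 20)).
    apply: runs_if => //=; rewrite /update /= ?r40 ?r41.
      by repeat split=> //; move: qQ hB; clear; lia.
    rewrite -eS eqb0 negbK /hi; case: ifP => h2; apply: runs_assign => //=; rewrite /update /= ?r40 ?r41 -?eS.
    - rewrite (sam _ h2).1; have B1 : 1 < B by apply: leq_trans B512.
      repeat split=> //; first by move: h2 hB; rewrite -/a2; clear; lia.
      + by have [[/= h3 _] _] := done _ h2; move: h3 hB; clear; lia.
    - by rewrite (sam _ h2).1 addn1.
  move=> s2 t2 fr2 [e37 tb2].
  have u30 : regs s2 30 = regs s0 30 by rewrite (proj1 fr2 30 isT).
  have u31 : regs s2 31 = regs s0 31 by rewrite (proj1 fr2 31 isT).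
  have u32 : regs s2 32 = regs s0 32 by rewrite (proj1 fr2 32 isT).
  have u34 : regs s2 34 = regs s0 34 by rewrite (proj1 fr2 34 isT).
  have u35 : regs s2 35 = a by rewrite (proj1 fr2 35 isT).
  have u36 : regs s2 36 = o1 by rewrite (proj1 fr2 36 isT).
  have u41 : regs s2 41 = h by rewrite (proj1 fr2 41 isT).
  have v11 : mem s2 11 = mem s0 11 by rewrite (proj2 fr2 11 isT).
  have v12 : mem s2 12 = mem s1 12 by rewrite (proj2 fr2 12 isT).
  have v13 : mem s2 13 = mem s1 13 by rewrite (proj2 fr2 13 isT).
  have v14 : mem s2 14 = mem s0 14 by rewrite (proj2 fr2 14 isT).
  have uold : old s2 = old s0 by rewrite /old u30 u34 v11.
  have uval y x : val s2 y x = val s0 y x by rewrite /val uold u31 v14.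
  have hv : hi * regs s0 30 <= R * regs s0 30 by rewrite leq_mul2r hiR orbT.
  rewrite -/R in bB KB.
  apply: (runs_weaken (row_prog_ok _ _ _ _ _ _)); rewrite ?u30 ?u31 ?u32 ?u34 ?u35 ?u36 ?e37 //.
  - by move: hv bB; move: (_ * _) (_ * _); clear; lia.
  - by move: hiR hB; clear; lia.
  - by move: hv bB; move: (_ * _) (_ * _); clear; lia.
  - by move: qQ KB; clear; lia.
  - by move=> x /andP[_ xh]; rewrite uval; apply: vB => //; apply: leq_trans hiR.
  move=> s3 t3 fr3 [o [oh mo e12 e13 tb3]].
  have na x : 2 * h * x <> a.
    by rewrite /a; move: h0; clear; move=> h0 e; have := congr1 (fun z => z %% (2 * h)) e; rewrite /= modnMr mulnC modnMDl modn_small; lia.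
  have bo : best (old s0) (mem s0 14) (regs s0 31) R a o.
    apply: (best_between conc RK (a1 := 2 * h * q) (a2 := a2) (o1 := o1) (o2 := o2)) => //.
    - by rewrite /a leq_addr.
    - by rewrite eS leq_addr.
    - by move=> h2; have [] := done _ h2.
    - by move=> x xh; have := mo x xh; rewrite !uval.
  split=> //.
  - move=> x xR; rewrite e12 e13 /update; case: eqP => [/na //|_].
    by rewrite v12 v13; apply: sam.
  - move=> x; rewrite ltnS leq_eqVlt => /orP[/eqP->|xq]; rewrite e12 e13 /update -/a.
      rewrite eqxx uval; split=> //; first by case/andP: oh.
      by rewrite -/a2 => h2; case/andP: oh => _; rewrite /hi h2 ltnS.
    have ne : 2 * h * x + h <> a.
      by rewrite /a => /addIn /eqP; rewrite eqn_pmul2l ?muln_gt0 ?h0 // => /eqP e; rewrite e ltnn in xq.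
    by case: eqP => [/ne //|_]; rewrite v12 v13; apply: new.
  - have ep : pot q = o1 by rewrite /pot q2.
    have ep' : hi <= (pot q.+1).+1 by rewrite /pot -/a2 /hi; case: ifP.
    by move: ep ep' tb tb2 tb3 o1hi; clear; lia.
- move=> s1 t1 fr g46 [sam new tb]; split.
  - by rewrite (proj1 fr 41 isT).
  - have od x : 2 * h * x + h < R -> x < Q by rewrite Qp.
    have ex x : h * x = if odd x then 2 * h * x./2 + h else 2 * h * x./2.
      by rewrite -{1}(odd_double_half x) -mul2n; case: (odd x); rewrite mulnDr ?muln1 ?muln0 mulnA [h * 2]mulnC ?add0n // addnC.
    split=> x; [rewrite ex | rewrite [h * x]ex [h * x.+1]ex].
      case: (odd x) => xR; first by have [] := new _ (od _ xR).
      by have [-> ->] := sam _ xR; apply: done.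
    rewrite /= uphalf_half; case: (odd x) => /= xR.
      have xR' : 2 * h * x./2 + h < R by apply: leq_ltn_trans xR; rewrite add1n mulnS; lia.
      by have [_ _ _] := new _ (od _ xR'); rewrite (sam _ xR).1; apply.
    rewrite add0n in xR *; have [_ _ h1 _] := new _ (od _ xR).
    by rewrite (sam _ _).1 //; apply: leq_ltn_trans xR; apply: leq_addr.
  - by have := potR Q; move: tb QR R0; clear; lia.
Qed.

(** For the initial stride [2 ^ E >= R] only row 0 has to be known, so it is searched in full.
    Results wait in bank 12 until all rows are finished, because every row reads the old table. *)
Definition res_prog : prog :=
  (41 ::= $43 ;; 35 ::= Lit 0 ;; 36 ::= Lit 0 ;; 37 ::= $40 ;; row_prog ;;
   For 44 (Lit 0) 42 stride_prog ;;
   For 10 (Lit 0) 40 (Put 11 ($34 + $10 * $30) (Get 12 ($10))))%prog.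

Lemma res_prog_ok s (R := regs s 40) (E := regs s 42) (cell := fun a => regs s 34 + a * regs s 30) :
  rows_pre s -> 0 < regs s 30 -> regs s 43 = 2 ^ E -> R <= 2 ^ E -> R + 2 ^ E < B -> E < B ->
  mem s 14 (regs s 31) = regs s 32 ->
  runs b res_prog s (fun s' t =>
  [/\ forall a, a < R -> (exists2 o, o < R & mem s' 11 (cell a) + regs s 32 = val s a o) /\
        forall x, x < R -> val s a x <= mem s' 11 (cell a) + regs s 32,
      forall y, (forall a, a < R -> y <> cell a) -> mem s' 11 y = mem s 11 y &
      t <= 1000 * E.+1 * R]).
Proof.
move=> pre v0 e43 RE EB hE FK; have [/andP[R0 RK] conc bB KB valB] := pre.
have B1 : 0 < B by apply: leq_trans B512.
do 4 (apply: runs_seq; apply: runs_assign => //=).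
rewrite /= /update /= -/R e43.
have vB a x : x < R -> a < R -> val s a x < B.
  by move=> xR aR; apply: valB => //; move: RK aR; clear; rewrite -/R; lia.
set s0 := set_reg _ _ _.
apply: runs_seq; apply: (runs_weaken (row_prog_ok (s := s0) _ _ _ _ _ _)) => //=; rewrite /= /update /=; rewrite -/R.
- by move: KB; clear; lia.
- by move: bB; rewrite -/R; move: (R * _); clear; lia.
- by move: KB; clear; lia.
- by move=> x xR; apply: vB.
move=> s1 t1 fr1 [o [oR mo e12 e13 tb1]].
have rf1 : row_frame s s1.
  split=> x xn; [rewrite (proj1 fr1 x) | rewrite (proj2 fr1 x)] => //.
  - by move: xn; rewrite !inE !negb_or /= /update => /and5P[_ _ /negPf-> /negPf-> /and5P[/negPf-> _ _ /negPf-> _]].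
  - by move: xn; rewrite !inE !negb_or /= => /and5P[-> -> _ _ /and5P[_ -> -> _ _]].
apply: runs_seq; apply: (@runs_for_const _ b0 (700 * R) _ _ _ _ _ (fun e s' =>
  [/\ regs s' 41 = 2 ^ (E - e), row_frame s s' & rows_done s (2 ^ (E - e)) s'])) => //=; rewrite /= /update /= ?(proj1 fr1 42 isT) -?/E //=.
- split.
  + by rewrite (proj1 fr1 41 isT) subn0.
  + case: rf1 => r1 r2; split=> // x xn; rewrite /= /update -r1 //.
    by move: xn; rewrite !inE !negb_or /= => /and5P[_ _ _ _ /and5P[_ _ _ _ /and3P[/negPf-> _ _]]].
  rewrite subn0; split=> x /=.
    have x0 : 2 ^ E * x < R -> x = 0.
      by case: x => // x xR; have := leq_trans xR RE; rewrite -[leqRHS]muln1 ltn_pmul2l ?expn_gt0.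
    move=> xR; rewrite (x0 xR) muln0 e12 e13 /= /update /=; split=> //; split=> // x' x'R.
  by move=> xR; have := leq_trans xR RE; rewrite -[leqRHS]muln1 ltn_pmul2l ?expn_gt0.
- move=> e s2 eE fr g44 [e41 rf2 rd].
  apply: runs_weaken (stride_prog_ok (h := 2 ^ (E - e.+1)) pre rf2 _ _ _ _) _.
  + by rewrite expn_gt0.
  + by rewrite e41 -expnS subnSK.
  + by rewrite -expnS subnSK //; apply: leq_ltn_trans EB; rewrite -/R leq_add2l; apply: leq_pexp2l; rewrite ?leq_subr.
  + by rewrite -expnS subnSK.
  move=> s3 t3 fr3 [e41' rd' tb3]; split=> //; split=> //.
  case: rf2 => r1 r2; split=> x xn /=; last by rewrite (proj2 fr3 x) ?r2.
  rewrite /update -r1 // -(proj1 fr3 x); last by move: xn; apply: contra; rewrite !inE; clear; lia.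
  by move: xn; rewrite !inE !negb_or => /and5P[_ _ _ _ /and5P[_ _ _ _ /and3P[/negPf-> _ _]]].
- move=> s2 t2 fr2 _ []; rewrite ?(proj1 fr1 42 isT) /= -?/E subnn expn0 => e41 rf2 [rd _] tb2.
  have r30 : regs s2 30 = regs s 30 by rewrite (proj1 rf2 30 isT).
  have r34 : regs s2 34 = regs s 34 by rewrite (proj1 rf2 34 isT).
  have r40 : regs s2 40 = R by rewrite (proj1 rf2 40 isT).
  have m11 : mem s2 11 = mem s 11 by rewrite (proj2 rf2 11 isT).
  have cinj x y : cell x = cell y -> x = y.
    by move/addnI/eqP; rewrite eqn_pmul2r // => /eqP.
  apply: (@runs_for_const _ b0 20 _ _ _ _ _ (fun i s' =>
    (forall x, x < i -> mem s' 11 (cell x) = mem s2 12 x) /\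
    (forall y, (forall a, a < i -> y <> cell a) -> mem s' 11 y = mem s 11 y))) => //=; rewrite ?r40.
  + by move: EB; clear; lia.
  + by split=> // y _; rewrite /= m11.
  + move=> i s3 iR fr g10 [i1 i2].
    have u30 : regs s3 30 = regs s 30 by rewrite (proj1 fr 30 isT).
    have u34 : regs s3 34 = regs s 34 by rewrite (proj1 fr 34 isT).
    have m12 : mem s3 12 = mem s2 12 by rewrite (proj2 fr 12 isT).
    apply: runs_put => //=; rewrite /= ?u30 ?u34 g10.
      have : i * regs s 30 <= R * regs s 30 by rewrite leq_mul2r (ltnW iR) orbT.
      by move=> h; repeat split=> //; move: h bB; rewrite -/R; move: (_ * _) (_ * _); clear; lia.
    rewrite -/(cell i) /update /= m12; split=> //; split.
      move=> x; rewrite ltnS leq_eqVlt => /orP[/eqP->|xi]; first by rewrite eqxx.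
      by case: eqP => [/cinj e|_]; [rewrite e ltnn in xi | apply: i1].
    move=> y yi; case: eqP => [e|_]; first by case: (yi i).
    by apply: i2 => a ai; apply: yi; apply: leqW.
  + move=> s3 t3 fr _ [i1 i2] tb3; split=> //.
      move=> a aR; have := rd a; rewrite mul1n -/R => /(_ aR)[[oR' mx] e].
      (* Adding no item is one of the candidates, so the maximum is at least the offset and
         subtracting it does not truncate. *)
      have OFFle : regs s 32 <= val s a (mem s2 13 a).
        by apply: leq_trans (mx a aR); rewrite /rowval addnK FK leq_addl.
      rewrite i1 // e subnK //; split=> //; first by exists (mem s2 13 a).
    have {}tb2 : t2 <= (E - 0) * (700 * R + 8) + 1 + 5 by exact: tb2.
    have := leq_pmulr E R0; move: tb1 tb2 tb3 R0; rewrite !subn0 -?/R [E * (_ + 8)]mulnDr [E * (700 * R)]mulnCA.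
    by rewrite -[1000 * _ * _]mulnA [E.+1 * R]mulSn; move: (E * R) => z; clear; lia.
Qed.
End Rows.

Section Item.
Variable b : nat.
Hypothesis b0 : 0 < b.
Notation B := (wsize b).
Hypothesis B512 : 512 < B.

(** Adding items of weight [v] preserves the residue of a cell modulo [v], so the window is treated
    one residue class at a time. Register 40 counts the cells of the class; [2 * N %/ v + 1] items
    suffice to cross the window. *)
Definition item_prog : prog :=
  (31 ::= (Lit 2 * $48) %/ $30 + Lit 1 ;; 32 ::= $4 * $31 ;; 53 ::= $49 - $48 ;; fill_prog ;;
   For 47 (Lit 0) 30
     (34 ::= $53 + $47 ;; 40 ::= (Lit 2 * $48 - $47) %/ $30 + Lit 1 ;; res_prog))%prog.

Variables (r c : nat -> nat) (q : nat -> nat -> nat) (n BIG : nat).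
Hypotheses (cr : forall v, c v <= r v)
  (qdec : forall v k, k.+1 < r v -> q v k.+1 <= q v k)
  (qBIG : forall v k, k < r v -> q v k <= BIG).

Lemma item_prog_ok s T (v := regs s 30) (N := regs s 48) (CEN := regs s 49) (E := regs s 42)
    (K := (2 * N) %/ v + 1) :
  regs s 0 = n -> regs s 4 = BIG -> r v <= n -> mem s 9 v = r v -> mem s 10 v = c v ->
  (forall k, k < r v -> mem s 8 (v * n + k) = q v k) ->
  0 < v -> v <= N -> N <= CEN -> regs s 43 = 2 ^ E -> 2 * N + 1 <= 2 ^ E ->
  (forall x, mem s 11 x <= T) ->
  E < B -> 2 ^ E + 2 ^ E < B -> CEN + N + v < B -> v * n + n < B -> 2 * K + n + 2 < B ->
  T + (BIG * K + ps q v (r v)) < B ->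
  runs b item_prog s (fun s' t =>
    conv_step r c q BIG v K (BIG * K) (CEN - N) (CEN + N) (mem s 11) (mem s' 11) /\
    t <= 4000 * E.+1 * N).
Proof.
move=> e0 e4 rn m9 m10 m8 v0 vN NC e43 NE tT EB EB2 CB vB KB TB.
have EBh : 2 ^ E < B by move: EB2; move: (2 ^ E); clear; lia.
have N2 : 2 * N < B by move: NE EBh; move: (2 ^ E); clear; lia.
apply: runs_seq; apply: runs_assign => //=; rewrite -?/N -?/v -?/K.
  by repeat split=> //; move: KB B512; clear; lia.
apply: runs_seq; apply: runs_assign => //=; rewrite /update /= -?/N -?/v -?/K ?e4.
  by repeat split=> //; move: TB; move: (BIG * K); clear; lia.
apply: runs_seq; apply: runs_assign => //=; rewrite /update /= -?/N -?/v -?/K -?/CEN.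
  by repeat split=> //; move: CB; clear; lia.
apply: runs_seq; apply: (runs_weaken (@fill_prog_ok b b0 _ r c q _ _ _ _ _ _ _ _ _ _));
  rewrite /= /update /= ?e0 ?e4 -?/v -?/K //; first by move: TB; move: (BIG * K) (ps _ _ _); clear; lia.
move=> s1 t1 fr1 [F1 tb1].
pose OFF := BIG * K.
have OFFK : BIG * K <= OFF by [].
have r30 : regs s1 30 = v by rewrite (proj1 fr1 30 isT).
have r31 : regs s1 31 = K by rewrite (proj1 fr1 31 isT).
have r32 : regs s1 32 = OFF by rewrite (proj1 fr1 32 isT).
have r48 : regs s1 48 = N by rewrite (proj1 fr1 48 isT).
have r53 : regs s1 53 = CEN - N by rewrite (proj1 fr1 53 isT).
have r42 : regs s1 42 = E by rewrite (proj1 fr1 42 isT).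
have r43 : regs s1 43 = 2 ^ E by rewrite (proj1 fr1 43 isT).
have p11 : mem s1 11 = mem s 11 by rewrite (proj2 fr1 11 isT).
set tab := mem s 11; set F := gain r c q BIG v K OFF in F1.
have FK : F K = OFF.
  have := @gain_mid r c q BIG cr qBIG v K OFF OFFK K (c v) (cr v) erefl.
  by rewrite -/F; move: (F K) (ps _ _ _); clear; lia.
have K2N : 2 * N < v * K by rewrite /K addn1 [v * _]mulnC; apply: ltn_ceil.
pose fin x z := (exists y u, [/\ CEN - N <= y <= CEN + N, u <= 2 * K, x + v * K = y + v * u &
     z + OFF = tab y + F u]) /\
  (forall y u, CEN - N <= y <= CEN + N -> u <= 2 * K -> x + v * K = y + v * u ->
     tab y + F u <= z + OFF).
pose done i x := (CEN - N <= x <= CEN + N) && ((x - (CEN - N)) %% v < i).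
apply: (@runs_for_const _ b0 (1000 * E.+1 * K + 50) _ _ _ _ _ (fun i s' =>
  [/\ forall x, done i x -> fin x (mem s' 11 x), forall x, ~~ done i x -> mem s' 11 x = tab x,
    forall u, u <= 2 * K -> mem s' 14 u = F u & True])) => //=; rewrite ?r30.
- by move: B512; clear; lia.
- by move: CB; clear; lia.
- split=> //=; last by move=> x _; rewrite p11.
  by move=> x; rewrite /done ltn0 andbF.
- move=> i s2 iv fr g47 [dn nd F2 _].
  have u30 : regs s2 30 = v by rewrite (proj1 fr 30 isT).
  have u31 : regs s2 31 = K by rewrite (proj1 fr 31 isT).
  have u32 : regs s2 32 = OFF by rewrite (proj1 fr 32 isT).
  have u48 : regs s2 48 = N by rewrite (proj1 fr 48 isT).
  have u53 : regs s2 53 = CEN - N by rewrite (proj1 fr 53 isT).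
  have u42 : regs s2 42 = E by rewrite (proj1 fr 42 isT).
  have u43 : regs s2 43 = 2 ^ E by rewrite (proj1 fr 43 isT).
  have i2N : i <= 2 * N by move: iv vN; clear; lia.
  apply: runs_seq; apply: runs_assign => //=; rewrite ?u53 ?g47.
    by split=> //; move: iv CB; clear; lia.
  apply: runs_seq; apply: runs_assign => //=; rewrite /update /= ?u48 ?u30 ?g47.
    repeat split=> //; try by move: B512; clear; lia.
      by move: N2; clear; lia.
    have := leq_div (2 * N - i) v; move: (_ %/ v) NE EBh; move: (2 ^ E) => x y; clear; lia.
  set R := (2 * N - i) %/ v + 1.
  have RK : R <= K by rewrite leq_add2r leq_div2r // leq_subr.
  have inR a : (a < R) = (i + a * v <= 2 * N).
    by rewrite /R addn1 ltnS leq_divRL // leq_subRL.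
  have cellw a : a < R -> CEN - N <= CEN - N + i + a * v <= CEN + N.
    by rewrite inR => h; move: NC h; move: (a * v); clear; lia.
  have cellm a : (CEN - N + i + a * v - (CEN - N)) %% v = i.
    by rewrite -addnA addKn addnC modnMDl modn_small.
  have tcell a : a < R -> mem s2 11 (CEN - N + i + a * v) = tab (CEN - N + i + a * v).
    by move=> aR; rewrite nd // /done cellw // cellm ltnn.
  have FB (u : nat) : F u <= OFF + ps q v (r v) by exact: gain_le.
  apply: (runs_weaken (res_prog_ok b0 B512 _ _ _ _ _ _ _)); rewrite /rows_pre /= /update /= ?u30 ?u31 ?u32 ?u42 ?u43 //.
  - split=> //.
    + by rewrite RK andbT /R addn1.
    + move=> u u2; rewrite !F2 //; [exact: (gain_concave cr qdec qBIG) | by move: u2; clear; lia | by move: u2; clear; lia].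
    + have : 0 < R by rewrite /R addn1.
      move=> R0; have := inR R.-1; rewrite prednK // leqnn => /esym h.
      rewrite -(prednK R0) mulSn; move: h CB NC; move: (R.-1 * v); clear; lia.
    + by move: RK KB; clear; lia.
    + move=> x u xR u2; rewrite tcell // F2 //.
      apply: leq_ltn_trans (leq_add (tT _) (FB u)) _; exact: TB.
  - apply: leq_trans NE; rewrite /R leq_add2r; apply: leq_trans (leq_div _ _) (leq_subr _ _).
  - have : R <= 2 ^ E by apply: leq_trans NE; rewrite /R leq_add2r; apply: leq_trans (leq_div _ _) (leq_subr _ _).
    by move: EB2; move: (2 ^ E); clear; lia.
  - by rewrite F2 //; move: (leq_addl K K); rewrite addnn mul2n.
  move=> s3 t3 fr3 [fz oth tb3]; split; last first.
    have : 1000 * E.+1 * R <= 1000 * E.+1 * K by rewrite leq_mul2l RK orbT.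
    by move: tb3; move: (1000 * _ * _) (1000 * _ * _); clear; lia.
  have m14 : mem s3 14 = mem s2 14 by rewrite (proj2 fr3 14 isT).
  split=> //=; last by move=> u u2; rewrite m14 F2.
  + move=> x; rewrite /done ltnS [_ %% _ <= i]leq_eqVlt andb_orr => /orP[/andP[xw /eqP xm]|dx]; last first.
      rewrite oth; first exact: dn.
      move=> a aR e; move: dx; rewrite /done e cellm ltnn andbF //.
    pose a := (x - (CEN - N)) %/ v.
    have ex : x = CEN - N + i + a * v.
      have := divn_eq (x - (CEN - N)) v; rewrite xm -/a; move: xw; move: (a * v); clear; lia.
    have aR : a < R by rewrite inR; move: xw ex NC; move: (a * v); clear; lia.
    have [[o oR eo] mx] := fz a aR; rewrite /rowval in eo mx.
    have toK o' : o' < R -> o' <= K + a by move=> h; move: (leq_trans (ltnW h) RK); clear; lia.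
    have fo o' : o' < R -> K + a - o' <= 2 * K by move=> h; rewrite mul2n -addnn (leq_trans (leq_subr _ _)) // leq_add2l (leq_trans (ltnW aR)).
    rewrite {1}ex; split.
      exists (CEN - N + i + o * v), (K + a - o); split; [exact: cellw | exact: fo | | ].
        by rewrite mulnBr mulnDr [o * v]mulnC [a * v]mulnC; have := leq_mul (leqnn v) (toK _ oR); rewrite mulnDr; move: (v * _) (v * _) (v * _); clear; lia.
      by rewrite ex eo tcell // F2 // fo.
    move=> y u yw u2; rewrite -ex => exy; pose d := (y - (CEN - N)) %/ v.
    have ym : (y - (CEN - N)) %% v = i.
      rewrite -(modnMDl u (y - (CEN - N)) v) -xm -(modnMDl K (x - (CEN - N)) v); congr (_ %% _).
      by move: exy xw yw; rewrite ![v * _]mulnC; move: (u * v) (K * v); clear; lia.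
    have ey : y = CEN - N + i + d * v.
      have := divn_eq (y - (CEN - N)) v; rewrite ym -/d; move: yw; move: (d * v); clear; lia.
    have dR : d < R by rewrite inR; move: yw ey NC; move: (d * v); clear; lia.
    have eu : K + a - d = u.
      have : v * (a + K) = v * (d + u) by move: exy; rewrite ex {1}ey !mulnDr [a * v]mulnC [d * v]mulnC; move: (v * _) (v * _) (v * _) (v * _); clear; lia.
      by move/eqP; rewrite eqn_pmul2l // => /eqP h; rewrite addnC h addKn.
    have := mx d dR; rewrite tcell // F2 ?fo // eu -ey -ex //.
  + move=> x; rewrite /done => nx; rewrite oth.
      by apply: nd; move: nx; apply: contra; rewrite /done => /andP[-> h]; apply: ltnW.
    by move=> a aR e; move: nx; rewrite e cellm cellw // ltnSn.
- move=> s2 t2 fr2 _; rewrite ?r30 => -[dn nd _ _] tb2; split.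
    split=> x xw; first by apply: nd; rewrite /done negb_and xw.
    by apply: dn; rewrite /done xw ltn_mod.
  (* There are [v] classes of at most [K] cells, and [v * K <= 2 * N + v <= 3 * N]; hence the time
     is linear in the window up to the number of strides. *)
  have vK : v * K <= 2 * N + v by rewrite /K mulnDr muln1 leq_add2r [v * _]mulnC leq_divM.
  have KN : K <= 2 * N + 1 by rewrite leq_add2r leq_div.
  have e : v * (1000 * E.+1 * K) <= 1000 * E.+1 * (3 * N).
    rewrite mulnCA leq_mul2l; apply/orP; right; apply: leq_trans vK _; move: vN; clear; lia.
  have EN : N <= E.+1 * N by rewrite leq_pmull.
  rewrite mulnACA in e; rewrite -[4000 * _ * _]mulnA; move: tb1 tb2 e EN vN v0 KN.
  rewrite subn0 -[_ + 50 + 8]addnA [v * (_ + _)]mulnDr; move: (E.+1 * N) (v * (1000 * _ * _)) => x y.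
  by clearbody K N v; clear; lia.
Qed.
End Item.

Lemma loop_time L e D wm t : 0 < wm -> 16 < e -> 0 < L ->
  t <= (L - 0) * (4000 * e * D + 40 * wm + 100 + 8) + 1 + 5 -> t <= 5000 * L * e * (D + wm).
Proof.
move=> wm0 e16 L0 tb; rewrite -mulnA.
have h : 4000 * e * D + 40 * wm + 114 <= 5000 * (e * (D + wm)).
  have := leq_pmulr e wm0; have := leq_pmull wm (ltn_trans (isT : 0 < 16) e16).
  rewrite [e * (D + wm)]mulnDr -[4000 * e * D]mulnA; move: (e * D) (e * wm) e16 wm0 => x y. clear; lia.
rewrite [5000 * L]mulnC -mulnA; apply: leq_trans (leq_mul (leqnn L) h).
by move: tb L0; rewrite subn0; move: (4000 * e * D + 40 * wm) => x; clear; lia.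
Qed.

(** * The dynamic program over all levels and weights *)

Section Loop.
Variable b : nat.
Hypothesis b0 : 0 < b.
Notation B := (wsize b).
Hypothesis B512 : 512 < B.

(** [CEN] bounds every window, so that indices to the left of the centre stay nonnegative. The
    stride [2 ^ (16 * l)] is at least the number of cells of any class. The only nonzero entry is
    [BIG] at the centre, the unchanged greedy solution. *)
Definition setup_prog : prog :=
  (42 ::= Lit 16 * $3 ;; 43 ::= Lit 1 ;; For 10 (Lit 0) 42 (43 ::= $43 * Lit 2) ;;
   54 ::= $3 * $3 ;; 54 ::= $54 * $54 * $54 ;; 54 ::= $54 * $54 ;;
   49 ::= $54 * ($2 + Lit 1) * $2 ;; Put 11 ($49) ($4) ;;
   51 ::= $3 + Lit 1 ;; 52 ::= $2 + Lit 1 ;; 19 ::= $2)%prog.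

Lemma setup_prog_ok s (wm := regs s 2) (l := regs s 3) (CEN := l ^ 12 * (wm + 1) * wm) :
  0 < l -> 0 < wm -> 2 ^ (16 * l + 1) < B -> CEN < B ->
  runs b setup_prog s (fun s' t =>
    [/\ [/\ regs s' 42 = 16 * l, regs s' 43 = 2 ^ (16 * l), regs s' 54 = l ^ 12 & regs s' 49 = CEN],
        [/\ regs s' 51 = l.+1, regs s' 52 = wm.+1 & regs s' 19 = wm],
        mem s' 11 = update (mem s 11) CEN (regs s 4) & t <= 400 * l + 100]).
Proof.
move=> l0 wm0 lB CB; have pB : 2 ^ (16 * l) * 2 < B by rewrite -expnSr -(addn1 (16 * l)).
have l12 : l ^ 12 <= CEN by rewrite /CEN -mulnA leq_pmulr // muln_gt0 addn1.
have l12w : l ^ 12 * (wm + 1) <= CEN by rewrite leq_pmulr.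
have le12 k : k <= 12 -> l ^ k < B.
  by move=> k12; apply: leq_ltn_trans CB; apply: leq_trans l12; apply: leq_pexp2l.
have w1 : wm + 1 < B.
  apply: leq_ltn_trans CB; rewrite /CEN; apply: leq_trans (_ : l ^ 12 * (wm + 1) <= _).
    by rewrite leq_pmull // expn_gt0 l0.
  exact: l12w.
have l16 : 16 * l < B.
  by have := ltn_expl (16 * l) (isT : 1 < 2); move: pB; move: (2 ^ _); clear; lia.
have B1 : 1 < B by apply: leq_trans B512.
have B2 : 2 < B by apply: leq_trans B512.
have lB1 : l + 1 < B by move: l16 l0 B512; clear; lia.
apply: runs_seq; apply: runs_assign => //=; first by split=> //; apply: leq_trans B512.
apply: runs_seq; apply: runs_assign => //=; rewrite /update /= -/l.
apply: runs_seq; apply: (@runs_for_const _ b0 6 _ _ _ _ _ (fun i s' => regs s' 43 = 2 ^ i)) => //=.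
- exact: ltnW.
- move=> i s1 il fr e10 e43; apply: runs_assign => //=; rewrite ?e43.
    split=> //; apply: leq_ltn_trans pB; rewrite leq_mul2r; apply/orP; right; apply: leq_pexp2l => //.
    exact: ltnW.
  by rewrite expnSr.
move=> s1 t1 fr1 _; rewrite /= /update /= -/l subn0 => e43 tb1.
have r2 : regs s1 2 = wm by rewrite (proj1 fr1 2 isT).
have r3 : regs s1 3 = l by rewrite (proj1 fr1 3 isT).
have r4 : regs s1 4 = regs s 4 by rewrite (proj1 fr1 4 isT).
have r42 : regs s1 42 = 16 * l by rewrite (proj1 fr1 42 isT).
have m11 : mem s1 11 = mem s 11 by rewrite (proj2 fr1 11 isT).
have x2 : l * l = l ^ 2 by [].
have x4 : l ^ 2 * l ^ 2 = l ^ 4 by rewrite -expnD.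
have x6 : l ^ 4 * l ^ 2 = l ^ 6 by rewrite -expnD.
have x12 : l ^ 6 * l ^ 6 = l ^ 12 by rewrite -expnD.
apply: runs_seq; apply: runs_assign => //=; rewrite ?r3 ?x2; first by split=> //; apply: le12.
apply: runs_seq; apply: runs_assign => //=; rewrite /update /= ?x4 ?x6.
  by repeat split=> //; apply: le12.
apply: runs_seq; apply: runs_assign => //=; rewrite /update /= ?x12.
  by repeat split=> //; apply: le12.
apply: runs_seq; apply: runs_assign => //=; rewrite /update /= ?r2.
  by repeat split=> //; apply: leq_ltn_trans CB.
apply: runs_seq; apply: runs_put => //=.
apply: runs_seq; apply: runs_assign => //=; rewrite /update /= ?r3; first by split.
apply: runs_seq; apply: runs_assign => //=; rewrite /update /= ?r2; first by split.
apply: runs_assign => //=; rewrite /update /= ?r2 ?r4 ?m11 ?addn1.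
rewrite e43 r42 /CEN addn1; split=> //.
by move: tb1; clear; lia.
Qed.

(** Levels are processed in increasing order: when a weight of level [j] is added, all weights
    handled before have level at most [j], so the joint weight change of the optimum is within the
    window of level [j]. *)
Definition loop_prog : prog :=
  (For 50 (Lit 0) 51
    (19 ::= $19 %/ Lit 2 ;; 48 ::= $54 * ($2 %/ ($19 + Lit 32) + Lit 1) * $2 ;;
     For 30 (Lit 1) 52 (If (Get 7 ($30) == $50) item_prog Skip)))%prog.

Variables (wm l n BIG : nat) (r c m cls : nat -> nat) (q : nat -> nat -> nat).
Hypotheses (cr : forall v, c v <= r v) (mr : forall v, m v <= r v)
  (qdec : forall v k, k.+1 < r v -> q v k.+1 <= q v k)
  (qBIG : forall v k, k < r v -> q v k <= BIG) (rn : forall v, r v <= n).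
Hypotheses (l32 : 32 <= l) (wm0 : 0 < wm) (clsl : forall v, cls v <= l).
Hypothesis near : forall j (V : pred nat), j <= l -> (forall v, V v -> cls v <= j) ->
     sumw wm V (fun v => v * m v) <= sumw wm V (fun v => v * c v) + window l wm j /\
     sumw wm V (fun v => v * c v) <= sumw wm V (fun v => v * m v) + window l wm j.
Let l0 : 0 < l. Proof. exact: leq_trans l32. Qed.
Let E := 16 * l.
Let CEN := l ^ 12 * (wm + 1) * wm.
Let P := sumw wm predT (fun v => ps q v (r v)).
Variable D : nat.
Hypothesis cost_bound : forall j, j <= l ->
  (\sum_(1 <= v < wm.+1) (cls v == j)) * window l wm j <= D.
Hypotheses (powB : 2 ^ (E + 1) < B) (CENE : 2 * CEN + 1 <= 2 ^ E) (wnB : wm * n + n < B)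
  (bigB : (BIG + P + n + wm + 2) * (4 * CEN + 8) < B).

(* The weights processed before weight [v] of level [j]. *)
Definition handled j v : pred nat := fun u => (0 < u) && ((cls u < j) || (cls u == j) && (u < v)).

Lemma window_CEN j : window l wm j <= CEN.
Proof.
by rewrite /window /CEN /lvl_sparsity leq_mul2r leq_mul2l addn1 ltnS leq_div !orbT.
Qed.

Lemma window_wm j : wm <= window l wm j.
Proof. by rewrite /window leq_pmull // muln_gt0 expn_gt0 l0. Qed.

Lemma sumw_sub (V : pred nat) f : sumw wm V f <= sumw wm predT f.
Proof. by rewrite [leqRHS](bigID (fun v : 'I_wm.+1 => V v)) leq_addr. Qed.

Lemma upper_inv_le V tab x : upper_inv wm r c q BIG CEN V tab -> tab x <= BIG + P.
Proof.
case/(_ x) => [h|[m' [m'r _ h]]].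
  by apply: leq_trans h (leq_trans (sumw_sub V _) (leq_addl _ _)).
apply: leq_trans (leq_addr _ _) (leq_trans (eq_leq (esym h)) _); rewrite leq_add2l.
apply: leq_trans (sumw_sub V (fun v => ps q v (r v))); apply: leq_sum => v _.
exact: ps_mono.
Qed.

Lemma upper_inv_ext V V' tab : (forall v, v <= wm -> V v = V' v) ->
  upper_inv wm r c q BIG CEN V tab -> upper_inv wm r c q BIG CEN V' tab.
Proof.
move=> e up x; case: (up x) => [h|[m' [m'r h1 h2]]]; [left | right; exists m'; split=> //];
  by rewrite -!(eq_sumw _ e).
Qed.

Lemma lower_inv_ext V V' tab : (forall v, v <= wm -> V v = V' v) ->
  lower_inv wm c q BIG CEN V tab m -> lower_inv wm c q BIG CEN V' tab m.
Proof. by move=> e [x [h1 h2]]; exists x; rewrite -!(eq_sumw _ e). Qed.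

Lemma handledS j v u : 0 < v -> cls v = j -> handled j v.+1 u = handled j v u || (u == v).
Proof.
move=> v0 cv; rewrite /handled ltnS [u <= v]leq_eqVlt; case: (eqVneq u v) => [->|_]; last by rewrite orbF.
by rewrite v0 cv eqxx !orbT.
Qed.

Lemma handled_skip j v u : cls v != j -> handled j v.+1 u = handled j v u.
Proof.
move=> cv; rewrite /handled ltnS [u <= v]leq_eqVlt; case: (eqVneq u v) => [->|//].
by rewrite (negPf cv).
Qed.

Lemma handled_next j u : u <= wm -> handled j wm.+1 u = handled j.+1 1 u.
Proof.
move=> uw; rewrite /handled ltnS uw andbT ltnS [cls u <= j]leq_eqVlt orbC.
by case: u uw => // u _; rewrite !andbF orbF.
Qed.

Lemma loop_prog_ok s : 
  [/\ regs s 0 = n, regs s 2 = wm, regs s 3 = l & regs s 4 = BIG] ->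
  [/\ regs s 42 = E, regs s 43 = 2 ^ E, regs s 54 = l ^ 12 & regs s 49 = CEN] ->
  [/\ regs s 51 = l.+1, regs s 52 = wm.+1 & regs s 19 = wm] ->
  [/\ forall v, mem s 7 v = cls v, forall v, mem s 9 v = r v, forall v, mem s 10 v = c v &
      forall v k, k < r v -> mem s 8 (v * n + k) = q v k] ->
  (forall x, mem s 11 x = if x == CEN then BIG else 0) ->
  runs b loop_prog s (fun s' t =>
    [/\ upper_inv wm r c q BIG CEN (fun v => 0 < v) (mem s' 11),
        lower_inv wm c q BIG CEN (fun v => 0 < v) (mem s' 11) m &
        t <= 5000 * l.+1 * E.+1 * (D + wm)]).
Proof.
case=> e0 e2 e3 e4 [e42 e43 e54 e49] [e51 e52 e19] [m7 m9 m10 m8] m11.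
pose inv V s' := upper_inv wm r c q BIG CEN V (mem s' 11) /\ lower_inv wm c q BIG CEN V (mem s' 11) m.
have [B1 B2 B32] : [/\ 1 < B, 2 < B & 32 < B] by move: B512; clear; split; lia.
have [CB wB nB BB] : [/\ 4 * CEN + n + wm + 8 < B, CEN + CEN + wm < B, 4 * CEN + n + 8 < B &
    BIG + P + (BIG * (2 * CEN + 1) + P) < B].
  have h1 : n + wm <= (n + wm) * (4 * CEN + 8) by rewrite leq_pmulr // addnS.
  have h2 : (BIG + P) * (2 * CEN + 2) <= (BIG + P) * (4 * CEN + 8) by rewrite leq_mul2l; apply/orP; right; clear; lia.
  have h3 : P <= P * (2 * CEN + 1) by rewrite leq_pmulr // addn1.
  have := bigB; rewrite -[_ + n + wm]addnA mulnDl [(_ + (n + wm)) * _]mulnDl => bigB'.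
  move: h1 h2 h3 bigB'; rewrite [_ * (2 * CEN + 2)]mulnDl ![_ * (2 * CEN + _)]mulnDr.
  by move: (P * (2 * CEN)) (BIG * (2 * CEN)) ((BIG + P) * _) ((n + wm) * _); clear; split; lia.
have EB : E < B by have := ltn_expl E (isT : 1 < 2); move: powB; rewrite expnD; move: (2 ^ E); clear; lia.
apply: (@runs_for_const _ b0 (4000 * E.+1 * D + 40 * wm + 100) _ _ _ _ _ (fun j s' =>
  regs s' 19 = wm %/ 2 ^ j /\ inv (handled j 1) s')) => //=; rewrite ?e51.
- exact: ltnW.
- by move: l0 EB B512; rewrite /E; clear; lia.
- split; first by rewrite /update /= e19 divn1.
  have z f : sumw wm (handled 0 1) f = 0.
    apply: big_pred0 => u; rewrite /handled ltn0 /=; case: (val u) => //= x; by rewrite andbF.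
  split=> [x|].
    rewrite /= m11; case: eqP => [->|_]; last by left.
    by right; exists c; rewrite !z.
  by exists CEN; rewrite /= m11 eqxx !z.
- move=> j s1 jl fr g50 [e19' [up low]].
  have r2 : regs s1 2 = wm by rewrite (proj1 fr 2 isT).
  have r54 : regs s1 54 = l ^ 12 by rewrite (proj1 fr 54 isT).
  have r52 : regs s1 52 = wm.+1 by rewrite (proj1 fr 52 isT).
  apply: runs_seq; apply: runs_assign => //=; rewrite ?e19'.
    by repeat split=> //; have := leq_div wm (2 ^ j); move: (_ %/ _) CB => x; clear; lia.
  have ej : wm %/ 2 ^ j %/ 2 = wm %/ 2 ^ j.+1 by rewrite -divnMA -expnSr.
  rewrite ej.
  set N := window l wm j; have NC : N <= CEN := window_CEN j.
  have wN : wm <= N := window_wm j.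
  have eN : l ^ 12 * (wm %/ (wm %/ 2 ^ j.+1 + 32) + 1) * wm = N by rewrite addn1.
  have le1 : l ^ 12 * (wm %/ (wm %/ 2 ^ j.+1 + 32) + 1) <= N by rewrite -eN leq_pmulr.
  have le2 : wm %/ (wm %/ 2 ^ j.+1 + 32) + 1 <= wm + 1 by rewrite leq_add2r leq_div.
  apply: runs_seq; apply: runs_assign => //=; rewrite /update /= ?r2 ?r54 ?eN.
    have lC : l <= CEN.
      rewrite /CEN -mulnA; apply: leq_trans (leq_pmulr (l ^ 12) _); last by rewrite muln_gt0 addn1.
      by rewrite -{1}(expn1 l); apply: leq_pexp2l.
    have c1 : wm %/ 2 ^ j.+1 + 32 < B by have := leq_div wm (2 ^ j.+1); move: (_ %/ _) CB lC l32 => x; clear; lia.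
    have c2 : 0 < wm %/ 2 ^ j.+1 + 32 by rewrite addn_gt0 orbT.
    have c3 : wm < B by move: CB; clear; lia.
    have c4 : wm %/ (wm %/ 2 ^ j.+1 + 32) + 1 < B by apply: leq_ltn_trans le2 _; move: CB; clear; lia.
    have c6 : N < B by move: NC CB; clear; lia.
    have c5 : l ^ 12 * (wm %/ (wm %/ 2 ^ j.+1 + 32) + 1) < B by apply: leq_ltn_trans le1 c6.
    by repeat split.
  (* Looking for the weights of level [j] costs a constant per weight; only those found pay for a
     window. *)
  apply: (@runs_for _ b0 _ _ _ _ _ (fun v s' t => inv (handled j v) s' /\
     t <= 30 * v + (\sum_(1 <= u < v) (cls u == j)) * (4000 * E.+1 * N))) => //=; rewrite /= /update /= ?r52 //=.
  - by move: CB; clear; lia.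
  - move=> v s2 t2 /andP[v0 vw] fr2 g30 [[up2 low2] tb2].
    have u0 : regs s2 0 = n by rewrite (proj1 fr2 0 isT) /= /update /= (proj1 fr 0 isT).
    have u4 : regs s2 4 = BIG by rewrite (proj1 fr2 4 isT) /= /update /= (proj1 fr 4 isT).
    have u42 : regs s2 42 = E by rewrite (proj1 fr2 42 isT) /= /update /= (proj1 fr 42 isT).
    have u43 : regs s2 43 = 2 ^ E by rewrite (proj1 fr2 43 isT) /= /update /= (proj1 fr 43 isT).
    have u48 : regs s2 48 = N by rewrite (proj1 fr2 48 isT).
    have u49 : regs s2 49 = CEN by rewrite (proj1 fr2 49 isT) /= /update /= (proj1 fr 49 isT).
    have u50 : regs s2 50 = j by rewrite (proj1 fr2 50 isT).
    have v7 : mem s2 7 = mem s 7 by rewrite (proj2 fr2 7 isT) /= /update /= (proj2 fr 7 isT).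
    have v8 : mem s2 8 = mem s 8 by rewrite (proj2 fr2 8 isT) /= /update /= (proj2 fr 8 isT).
    have v9 : mem s2 9 = mem s 9 by rewrite (proj2 fr2 9 isT) /= /update /= (proj2 fr 9 isT).
    have v10 : mem s2 10 = mem s 10 by rewrite (proj2 fr2 10 isT) /= /update /= (proj2 fr 10 isT).
    have sumS : \sum_(1 <= u < v.+1) (cls u == j) = \sum_(1 <= u < v) (cls u == j) + (cls v == j).
      by rewrite big_nat_recr.
    apply: runs_if => //=; rewrite g30 u50 v7 m7 eqb0 negbK.
    case: (eqVneq (cls v) j) => cv; last first.
      apply: runs_skip; split.
        by split; [apply: upper_inv_ext up2 | apply: lower_inv_ext low2] => u _; rewrite handled_skip.
      rewrite sumS (negPf cv) addn0; move: tb2; move: (_ * (4000 * _ * _)) => x; clear; lia.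
    have vN : v <= N by apply: leq_trans wN; rewrite -ltnS.
    have ps_le : ps q v (r v) <= P.
      by rewrite /P /sumw (bigD1 (Ordinal vw)) //= leq_addr.
    pose K := (2 * N) %/ v + 1.
    have KN : K <= 2 * CEN + 1 by rewrite leq_add2r (leq_trans (leq_div _ _)) // leq_mul2l NC.
    have BK : BIG * K <= BIG * (2 * CEN + 1) by rewrite leq_mul2l KN orbT.
    have vn : v * n <= wm * n by rewrite leq_mul2r -ltnS vw orbT.
    apply: runs_weaken (item_prog_ok b0 B512 cr qdec qBIG (T := BIG + P) u0 u4 (rn _) _ _ _ _ _ _ _ _ _ _ _ _ _ _ _) _;
      rewrite ?g30 ?u42 ?u43 ?u48 ?u49 //.
    + by rewrite v9 m9.
    + by rewrite v10 m10.
    + by move=> k kr; rewrite v8 m8.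
    + by apply: leq_trans CENE; rewrite leq_add2r leq_mul2l NC.
    + by move=> x; apply: upper_inv_le up2.
    + by move: powB; rewrite addn1 expnS mul2n -addnn.
    + by move: NC vw wB; clear; lia.
    + by move: vn wnB; move: (v * n) (wm * n); clear; lia.
    + by rewrite -/K; move: KN nB; clear; lia.
    + by rewrite -/K; move: BK ps_le BB; move: (ps _ _ _) (BIG * K) (BIG * _); clear; lia.
    move=> s3 t3 fr3 []; rewrite -/K => conv tb3.
    have nh : ~~ handled j v v by rewrite /handled cv !ltnn !(andbF, orbF).
    have ext u : u <= wm -> handled j v u || (u == v) = handled j v.+1 u by rewrite handledS.
    have hw : v <= wm by rewrite -ltnS.
    split.
      split; [apply: (upper_inv_ext ext) | apply: (lower_inv_ext ext)].
        exact: upper_step conv up2.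
      apply: lower_step conv low2 => //.
        by apply: ltnW; rewrite /K addn1 [v * _]mulnC; apply: ltn_ceil.
      move=> V' Vs; apply: near => // u /Vs /orP[|/eqP->]; last by rewrite cv.
      by rewrite /handled => /andP[_ /orP[/ltnW|/andP[/eqP->]]].
    rewrite sumS cv eqxx mulnDl mul1n; move: tb2 tb3; move: (4000 * _ * _) => y; move: (_ * y) => x; clear; lia.
  - move=> s2 t2 fr2 g30 [[up2 low2] tb2]; split; last first.
      have := cost_bound jl; rewrite -/N => /(leq_mul (leqnn (4000 * E.+1))).
      rewrite mulnCA in tb2; move: tb2; move: (4000 * _ * (_ * N)) (4000 * _ * D) => x y.
      by clear; lia.
    split; first by rewrite (proj1 fr2 19 isT).
    by split; [apply: upper_inv_ext up2 | apply: lower_inv_ext low2] => u uw; rewrite handled_next.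
- move=> s1 t1 fr _ [_ [up low]]; rewrite ?e51 => tb1.
  have ext u : u <= wm -> handled l.+1 1 u = (0 < u).
    by move=> _; rewrite /handled ltnS clsl orTb andbT.
  split; [exact: upper_inv_ext up | exact: lower_inv_ext low | ].
  by apply: loop_time tb1 => //; rewrite /E ltnS leq_pmulr.
Qed.
End Loop.

Section Final.
Variable b : nat.
Hypothesis b0 : 0 < b.
Notation B := (wsize b).
Hypothesis B512 : 512 < B.

(** The admissible weight changes are those up to the slack of the greedy solution, cut off at
    [CEN]; the added 1 turns the last admissible index into the exclusive bound of the loop. *)
Definition final_prog : prog :=
  (55 ::= $1 - $6 ;;
   If ($55 < $49) (55 ::= $49 + $55 + Lit 1) (55 ::= $49 + $49 + Lit 1) ;;
   56 ::= Lit 0 ;;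
   For 10 (Lit 0) 55 (If ($56 < Get 11 ($10)) (56 ::= Get 11 ($10)) Skip) ;;
   0 ::= $7 + $56 - $4)%prog.

Lemma final_prog_ok s T (CEN := regs s 49) :
  regs s 1 < B -> 2 * CEN + 1 < B -> (forall x, mem s 11 x <= T) -> regs s 7 + T < B ->
  runs b final_prog s (fun s' t =>
    regs s' 0 = regs s 7 + \max_(0 <= x < CEN + minn (regs s 1 - regs s 6) CEN + 1) mem s 11 x - regs s 4 /\
    t <= 60 * (CEN + 1)).
Proof.
move=> WB CB tT TB; set hi := CEN + minn (regs s 1 - regs s 6) CEN + 1.
have hiC : hi <= 2 * CEN + 1 by rewrite /hi leq_add2r mul2n -addnn leq_add2l geq_minr.
have B1 : 1 < B by apply: leq_trans B512.
apply: runs_seq; apply: runs_assign => //=.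
apply: runs_seq; apply: (@runs_weaken _ _ _ (fun s' t => regs s' 55 = hi /\ t <= 20)).
  apply: runs_if => //=; rewrite /update /= -/CEN eqb0 negbK.
  case: (ltnP (regs s 1 - regs s 6) CEN) => h; apply: runs_assign => //=; rewrite /update /= -/CEN /hi.
  - by repeat split=> //; move: h CB; clear; lia.
  - by rewrite (minn_idPl (ltnW h)).
  - by repeat split=> //; move: h CB; clear; lia.
  - by rewrite (minn_idPr h).
move=> s1 t1 fr1 [e55 tb1].
have r4 : regs s1 4 = regs s 4 by rewrite (proj1 fr1 4 isT).
have r7 : regs s1 7 = regs s 7 by rewrite (proj1 fr1 7 isT).
have m11 : mem s1 11 = mem s 11 by rewrite (proj2 fr1 11 isT).
apply: runs_seq; apply: runs_assign => //=; first exact: ltnW.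
have mT i : \max_(0 <= x < i) mem s 11 x <= T.
  rewrite big_mkord; apply/bigmax_leqP => x _; exact: tT.
apply: runs_seq; apply: (@runs_for_const _ b0 12 _ _ _ _ _
  (fun i s' => regs s' 56 = \max_(0 <= x < i) mem s 11 x)) => //=; rewrite /= /update /= ?e55.
- exact: ltnW.
- by apply: leq_ltn_trans hiC CB.
- by rewrite big_geq.
- move=> i s2 ih fr e10 inv.
  have v11 : mem s2 11 = mem s 11 by rewrite (proj2 fr 11 isT).
  apply: runs_if => //=; rewrite eqb0 negbK e10 v11 inv big_nat_recr //=.
  case: ltnP => h; [apply: runs_assign | apply: runs_skip] => //=; rewrite /= /update /=.
    by rewrite e10 v11.
- move=> s2 t2 fr2 _ e56 tb2.
  have u7 : regs s2 7 = regs s 7 by rewrite (proj1 fr2 7 isT).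
  have u4 : regs s2 4 = regs s 4 by rewrite (proj1 fr2 4 isT).
  apply: runs_assign => //=; rewrite /update /= ?e56 ?u7 ?u4 ?e55.
    have h : regs s 7 + \max_(0 <= x < hi) mem s 11 x < B.
      by apply: leq_ltn_trans TB; rewrite leq_add2l.
    by repeat split.
  split=> //; move: tb1 tb2 hiC; rewrite ?e55 subn0; move: (hi) => x; clear; lia.
Qed.
End Final.

Section Value.
Variables (n wm W g CEN N : nat) (p w m : nat -> nat).
Hypotheses (w0 : forall i, i < n -> 0 < w i) (wle : forall i, i < n -> w i <= wm).
Hypotheses (gn : g <= n) (fits : \sum_(0 <= i < g) w i <= W).
Let r := nitem n w.
Let c := nprefix g w.
Let q v k := p (item n w v k).
Let BIG := (\sum_(0 <= i < n) p i).+1.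
Hypotheses (mr : forall v, m v <= r v) (mW : \sum_(v < wm.+1) v * m v <= W)
  (mopt : forall x : pred nat, \sum_(0 <= i < n | x i) w i <= W ->
     \sum_(0 <= i < n | x i) p i <= \sum_(v < wm.+1) ps q v (m v))
  (NC : N <= CEN) (near : \sum_(v < wm.+1) v * m v <= \sum_(v < wm.+1) v * c v + N).

Lemma nitem0 : nitem n w 0 = 0.
Proof.
rewrite /nitem /pos; apply/eqP; rewrite size_eq0 -(negbK (_ == _)) -has_filter; apply/hasPn => i.
by rewrite mem_iota add0n /= => /w0; rewrite lt0n.
Qed.

Lemma sumw_pos (f : nat -> nat) : f 0 = 0 -> sumw wm (fun v => 0 < v) f = \sum_(v < wm.+1) f v.
Proof. by move=> f0; rewrite /sumw big_mkcond; apply: eq_bigr => -[[|v] h]. Qed.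

(** Upper bound: an entry not realized by counts is below [BIG], so it is worth less than the greedy
    solution, and a realized one is feasible because its weight change is within the slack. Lower
    bound: the optimal counts have an entry at an admissible index. *)
Lemma table_value tab (top := CEN + minn (W - \sum_(0 <= i < g) w i) CEN + 1) :
  upper_inv wm r c q BIG CEN (fun v => 0 < v) tab ->
  lower_inv wm c q BIG CEN (fun v => 0 < v) tab m ->
  \sum_(0 <= i < g) p i + \max_(0 <= x < top) tab x - BIG = \sum_(v < wm.+1) ps q v (m v).
Proof.
have c0 : c 0 = 0 by have := nprefix_le w gn 0; rewrite nitem0 leqn0 => /eqP.
have ps0 k : k <= r 0 -> ps q 0 k = 0 by rewrite /r nitem0 leqn0 => /eqP->; rewrite /ps big_geq.
have m0 := mr 0; have r00 := leqnn (r 0); have c00 : c 0 <= r 0 by rewrite c0.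
have cw : \sum_(v < wm.+1) v * c v = \sum_(0 <= i < g) w i.
  rewrite (@big_nat_widen _ _ _ 0 g n) //= (chosen_weight wle (fun i => i < g)).
  by apply: eq_bigr => v _; rewrite chosen_prefix.
have cp : \sum_(v < wm.+1) ps q v (c v) = \sum_(0 <= i < g) p i by rewrite (psum_prefix p wle gn).
have rp : \sum_(v < wm.+1) ps q v (r v) = \sum_(0 <= i < n) p i by rewrite (psum_total p wle).
move=> up [x [ex lx]]; rewrite !sumw_pos ?mul0n ?ps0 // in ex lx; rewrite cw in ex; have near' := near; rewrite cw in near'.
rewrite cp in lx.
have xtop : x < top.
  move: ex near' mW NC fits; rewrite /top addn1 ltnS addn_minr leq_min.
  by move: (\sum_(v < _) _) (\sum_(_ <= _ < _) _) => S1 S2; clear; lia.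
have xm : tab x <= \max_(0 <= x < top) tab x.
  by rewrite big_mkord (leq_bigmax (Ordinal xtop)).
apply/eqP; rewrite eqn_leq; apply/andP; split; last first.
  by move: lx xm; move: (\max_(_ <= _ < _) _) (\sum_(v < _) _) (\sum_(_ <= _ < _) _); clear; lia.
rewrite leq_subLR.
have valm : \sum_(0 <= i < g) p i <= \sum_(v < wm.+1) ps q v (m v).
  have e f : \sum_(0 <= i < n | i < g) f i = \sum_(0 <= i < g) f i by rewrite [RHS](@big_nat_widen _ _ _ 0 g n).
  by have := mopt (x := fun i => i < g); rewrite !e; apply.
rewrite -leq_subRL; last by apply: leq_trans valm (leq_addl _ _).
rewrite big_mkord; apply/bigmax_leqP => -[y /= yt] _.
rewrite leq_subRL; last by apply: leq_trans valm (leq_addl _ _).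
case: (up y) => [|[m' [m'r e1 e2]]].
  rewrite sumw_pos ?ps0 // rp => h; rewrite addnC leq_add //.
  exact: leqW.
rewrite !sumw_pos ?mul0n ?ps0 // ?cw ?cp in e1 e2.
rewrite addnC -e2 leq_add2l.
have [X [Xw Xp]] := @first_items n wm p w wle m' m'r.
rewrite -[leqLHS]Xp; apply: mopt; rewrite Xw.
have kW := geq_minl (W - \sum_(0 <= i < g) w i) CEN.
move: e1 yt fits kW; rewrite /top addn1 ltnS; set k := minn _ CEN.
by move: k (\sum_(v < _) _) (\sum_(_ <= _ < _) _); clear; lia.
Qed.
End Value.

(** * The algorithm *)

(** Stated for functions on [nat] and predicates, so that it applies to the sorted copy in memory as
    well as to the input. *)
Definition optimal_value n (p w : nat -> nat) W z :=
  (exists2 X : pred nat, \sum_(0 <= i < n | X i) w i <= W & \sum_(0 <= i < n | X i) p i = z) /\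
  (forall X : pred nat, \sum_(0 <= i < n | X i) w i <= W -> \sum_(0 <= i < n | X i) p i <= z).

Section Reorder.
Variables (n : nat) (a : nat -> nat).
Hypothesis sa : same_items n a id.

(** Compare the sums of the indicator of the common value: it would be hit twice on one side and
    once on the other. *)
Lemma same_items_inj x y : x < n -> y < n -> a x = a y -> x = y.
Proof.
move=> xn yn e; apply/eqP/negPn/negP => ne.
have := sa (fun z => (z == a x : nat)); rewrite !big_mkord (bigD1 (Ordinal xn)) //= eqxx.
rewrite (bigD1 (Ordinal yn)) /=; last by rewrite -val_eqE /= eq_sym.
rewrite -e eqxx [RHS](bigD1 (Ordinal (same_items_range sa xn))) //= eqxx [in RHS]big1; first by lia.
by move=> i; rewrite -val_eqE /= => /negPf->.
Qed.

Lemma optimal_value_reorder p w W z :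
  optimal_value n (fun x => p (a x)) (fun x => w (a x)) W z -> optimal_value n p w W z.
Proof.
have pull (X : pred nat) f : \sum_(0 <= i < n | X (a i)) f (a i) = \sum_(0 <= i < n | X i) f i.
  by rewrite big_mkcond [RHS]big_mkcond; apply: (sa (fun k => if X k then f k else 0)).
move=> [[X Xw Xp] mx]; split; last first.
  by move=> Y; rewrite -(pull Y w) -(pull Y p); apply: mx.
pose Y : pred nat := fun k => has (fun i => (a i == k) && X i) (iota 0 n).
have YX f : \sum_(0 <= i < n | Y (a i)) f (a i) = \sum_(0 <= i < n | X i) f (a i).
  rewrite big_nat_cond [RHS]big_nat_cond; apply: eq_bigl => i.
  case: (ltnP i n) => //= ilt; apply/hasP/idP => [[j]|Xi].
    by rewrite mem_iota => jn /andP[/eqP/(same_items_inj jn ilt) <-].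
  by exists i; rewrite ?mem_iota // eqxx.
by exists Y; rewrite -pull YX.
Qed.
End Reorder.

Section Count.
Variables (n g wm l : nat) (w : nat -> nat).
Hypotheses (gn : g <= n) (ww : forall i, i < n -> w i <= wm) (wm0 : 0 < wm) (l256 : 256 <= l).
Let w' (i : 'I_n) := w i.

Lemma left_spec j : ring_spec wm w' (ring_left n g) g (lvl_size wm j) (lvl_mult l wm j)
  (heavy_left g wm l w j).
Proof.
apply: heavy_ring => //; first by rewrite addn_gt0 orbT.
  by move=> x xg; apply: ww; move: xg gn; clear; lia.
by move=> t v tg; rewrite mult_left.
Qed.

Lemma right_spec j : ring_spec wm w' (ring_right n g) (n - g) (lvl_size wm j) (lvl_mult l wm j)
  (heavy_right n g wm l w j).
Proof.
apply: heavy_ring => //; first by rewrite addn_gt0 orbT.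
  by move=> x xg; apply: ww; move: xg gn; clear; lia.
by move=> t v tg; rewrite mult_right.
Qed.

Lemma level_count j : j <= l ->
  \sum_(1 <= v < wm.+1) (level_upto n g wm l w l v == j) <= 2 * lvl_size wm j.
Proof.
move=> jl; case: (posnP j) => [->|j0].
  apply: leq_trans (_ : \sum_(1 <= v < wm.+1) 1 <= _); first by apply: leq_sum => v _; exact: leq_b1.
  rewrite sum_nat_const_nat muln1 subn1 /= /lvl_size expn0 divn1; clear; lia.
have [t [_ _ c1 _]] := left_spec j; have [t' [_ _ c2 _]] := right_spec j.
rewrite mul2n -addnn; apply: leq_trans (leq_add c1 c2).
apply: leq_trans (leq_card_setU _ _); rewrite -sum1_card [leqRHS]big_mkcond /=.
apply: leq_trans (_ : \sum_(0 <= v < wm.+1) (level_upto n g wm l w l v == j) <= _).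
  by rewrite [leqRHS]big_ltn // leq_addl.
rewrite big_mkord; apply: leq_sum => v _; rewrite !inE.
case: eqP => // e; have := @level_upto_ex n g wm l w l v.
by rewrite e j0 => /(_ isT) ->.
Qed.

Lemma level_cost j : j <= l ->
  (\sum_(1 <= v < wm.+1) (level_upto n g wm l w l v == j)) * window l wm j <= l ^ 14 * wm ^ 2.
Proof.
move=> jl; apply: leq_trans (leq_mul (level_count jl) (leqnn _)) _.
have h1 := lvl_sizeS wm j; rewrite /window /lvl_sparsity; set k := lvl_size wm j.+1 in h1 *.
have h2 := leq_divM wm k; have h3 : k <= wm + 32 by rewrite leq_add2r leq_div.
(* With [d] for [wm %/ k], the product is at most [2 * k * d + 2 * k <= 2 * wm + 2 * (wm + 32)], and
   [wm >= 1]. *)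
have h4 : lvl_size wm j * (wm %/ k).+1 <= 68 * wm.
  apply: leq_trans (leq_mul h1 (leqnn _)) _; move: h2 h3 wm0; move: (wm %/ k) => d; clear; rewrite -mulnA mulnS mulnC.
  by rewrite [k * d]mulnC; move: (d * k); lia.
have -> : 2 * lvl_size wm j * (l ^ 12 * (wm %/ k).+1 * wm) =
    2 * l ^ 12 * (lvl_size wm j * (wm %/ k).+1) * wm.
  by move: (lvl_size _ _) (l ^ 12) (_.+1) => x y z; clear; lia.
apply: leq_trans (leq_mul (leq_mul (leqnn _) h4) (leqnn _)) _.
rewrite -[14]/(12 + 2) expnD -!mulnn; have : 136 <= l * l by rewrite (leq_trans _ (leq_mul l256 l256)).
move: (l ^ 12) (l * l) => x y h.
have := leq_mul (leqnn (x * (wm * wm))) h; clear; lia.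
Qed.
End Count.

(* All words are polynomial in [Z]; the exponent comes from [2 ^ l <= Z ^ 258]. *)
Lemma word_bounds Z l k wm B (CEN := l ^ 12 * (wm + 1) * wm) : wm + 2 <= Z -> 0 < wm ->
  l = 256 + k -> wm < 2 ^ k -> k = 0 \/ 2 ^ k.-1 <= wm -> Z ^ (258 * 20) <= B ->
  exists X, [/\ 512 <= X, l + 4 * (Z * Z) <= X, 2 ^ (16 * l + 1) <= X,
    (4 * (Z * Z)) * (4 * CEN + 8) <= X & 64 * X <= B] /\ 2 * CEN + 1 <= 2 ^ (16 * l).
Proof.
move=> wZ wm0 el wk kw ZB; set Y := 2 ^ l.
have Z3 : 3 <= Z by move: wZ wm0; clear; lia.
have YE : Y = 2 ^ 256 * 2 ^ k by rewrite /Y el expnD.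
have Zpos e : 0 < Z ^ e by rewrite expn_gt0 (leq_trans _ Z3).
have k2 : 2 ^ k <= Z ^ 2.
  rewrite -mulnn; case: kw => [->|]; first by rewrite expn0; move: Z3; clear; nia.
  case: (k) => [|k'] h; first by move: Z3; clear; nia.
  by rewrite expnS; apply: leq_mul; [exact: ltnW | apply: leq_trans h _; move: wZ; clear; lia].
set Q := Z ^ 258.
have YQ : Y <= Q.
  by rewrite YE /Q -[258]/(256 + 2) expnD leq_mul // leq_exp2r // ltnW.
have lY : l < Y by apply: ltn_expl.
have Y512 : 512 <= Y by rewrite -[512]/(2 ^ 9) leq_exp2l // el; clear; lia.
have wY : wm + 1 <= Y.
  by rewrite addn1; apply: leq_trans wk _; rewrite leq_exp2l // el leq_addl.
have CY : CEN <= Y ^ 14.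
  rewrite -[14]/(12 + 1 + 1) !expnD !expn1 /CEN; apply: leq_mul; last by apply: ltnW; rewrite -addn1.
  by apply: leq_mul => //; rewrite leq_exp2r // ltnW.
have Q3 : 3 <= Q by rewrite (leq_trans _ (leq_trans Y512 YQ)).
have Q1 : 0 < Q by apply: leq_trans Q3.
have Q512 : 512 <= Q by apply: leq_trans YQ.
have Z2 : 4 * (Z * Z) <= Q.
  rewrite mulnn /Q -[258]/(2 + 256) expnD mulnC leq_mul //; apply: leq_trans (_ : 2 ^ 2 <= _) => //.
  by apply: leq_trans (_ : 2 ^ 256 <= _); [rewrite leq_exp2l | rewrite leq_exp2r // ltnW].
(* Of the 20 factors [Q] available, 18 bound the words that occur, and [Q ^ 2] remains for the
   factor 64. *)
exists (Q ^ 18); split; last first.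
  have -> : 2 ^ (16 * l) = Y ^ 14 * Y ^ 2 by rewrite -expnD /Y -expnM mulnC.
  apply: leq_trans (_ : 2 * Y ^ 14 + 1 <= _); first by rewrite leq_add2r leq_mul2l CY.
  have y14 : 0 < Y ^ 14 by rewrite expn_gt0 (leq_trans _ Y512).
  have y2 : 3 <= Y ^ 2 by rewrite (leq_trans (leq_trans _ Y512)) // -mulnn leq_pmulr // (leq_trans _ Y512).
  by have := leq_mul (leqnn (Y ^ 14)) y2; move: y14; move: (Y ^ 14 * Y ^ 2) (Y ^ 14) => x y; clear; lia.
have QS e : Q ^ e.+1 = Q * Q ^ e by rewrite expnS.
have Qp e : 0 < Q ^ e by rewrite expn_gt0 Q1.
have Qle d e : d <= e -> Q ^ d <= Q ^ e by apply: leq_pexp2l.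
split.
- by apply: leq_trans Q512 _; rewrite -{1}(expn1 Q) Qle.
- apply: leq_trans (_ : Q ^ 2 <= _); last exact: Qle.
  rewrite -mulnn; apply: leq_trans (leq_add (ltnW (leq_trans lY YQ)) Z2) _.
  by have := leq_mul Q3 (leqnn Q); clear; lia.
- rewrite expnD expn1 [16 * l]mulnC expnM -/Y; apply: leq_trans (_ : Q ^ 16 * Q <= _).
    by rewrite leq_mul // ?leq_exp2r // (leq_trans _ Q3).
  by rewrite -expnSr Qle.
- have C8 : 4 * CEN + 8 <= Q ^ 15.
    apply: leq_trans (_ : Q * Q ^ 14 <= _); last by rewrite -expnS.
    have : CEN <= Q ^ 14 by apply: leq_trans CY _; rewrite leq_exp2r.
    by have := leq_mul Q512 (leqnn (Q ^ 14)); move: (Qp 14); move: (Q * Q ^ 14) (Q ^ 14) => x y; clear; lia.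
  apply: leq_trans (leq_mul Z2 C8) _; by rewrite -expnS Qle.
apply: leq_trans ZB; rewrite expnM -/Q (expnD Q 2 18) leq_mul //.
by rewrite -mulnn (leq_trans _ (leq_mul Q512 Q512)).
Qed.

(** [M] exceeds [l] and the logarithm of the sorting time. The exponent 20 is 14 for the total size
    of the windows, 5 for levels, strides and numerical factors, and 1 for adding up the phases. *)
Lemma time_bound n wm k t T (l := 256 + k) (M := trunc_log 2 T + 300) : 0 < n -> 0 < wm ->
  T = n + wm ^ 2 -> k = 0 \/ 2 ^ k.-1 <= wm ->
  t <= 300 * (n + 1) + 50 * (wm + 1) + 400 * (n + 1) * (trunc_log 2 n + 3) +
       1000 * l * (n + wm + 1) + 400 * l + 200 +
       5000 * l.+1 * (16 * l).+1 * (l ^ 14 * wm ^ 2 + wm) + 60 * (l ^ 12 * (wm + 1) * wm + 1) ->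
  t <= T * M ^ 20.
Proof.
move=> n0 wm0 eT kw tb.
have wT : wm <= wm ^ 2 by rewrite -mulnn leq_pmull.
have T0 : 0 < T by rewrite eT addn_gt0 n0.
have kM : k <= (trunc_log 2 T).+1.
  case: kw => [-> //|h]; case: k h {l tb} => [//|k' h]; rewrite ltnS.
  apply: trunc_log_max => //; apply: leq_trans h _; apply: leq_trans wT _; by rewrite eT leq_addl.
have lM : l.+1 <= M by rewrite /l /M; move: kM; clear; lia.
have nM : trunc_log 2 n + 3 <= M.
  rewrite /M; have : trunc_log 2 n <= trunc_log 2 T by apply: leq_trunc_log; rewrite eT leq_addr.
  clear; lia.
have M300 : 300 <= M by apply: leq_addl.
have M0 : 0 < M by apply: leq_trans M300.
have l12 : l ^ 12 <= M ^ 14.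
  by apply: leq_trans (_ : M ^ 12 <= _); [rewrite leq_exp2r // ltnW | apply: leq_pexp2l].
have l14 : l ^ 14 <= M ^ 14 by rewrite leq_exp2r // ltnW.
set A := M ^ 14 in l12 l14; set X := A * T.
have MA : M <= A by rewrite -{1}(expn1 M) /A; apply: leq_pexp2l.
have A0 : 0 < A by apply: leq_trans MA.
have wX : l ^ 12 * (wm + 1) * wm <= 2 * X.
  have h : (wm + 1) * wm <= 2 * T by move: wT; rewrite mulnDl mul1n mulnn eT; clear; lia.
  by rewrite -mulnA; apply: leq_trans (leq_mul l12 h) _; rewrite mulnCA.
have wX2 : l ^ 14 * wm ^ 2 + wm <= 2 * X.
  have h : wm ^ 2 <= T by rewrite eT leq_addl.
  have h2 : wm <= X by apply: leq_trans (leq_trans wT h) _; rewrite leq_pmull.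
  by have := leq_mul l14 h; rewrite -/X; move: h2; move: (l ^ 14 * _) => x; clear; lia.
have TX : M * T <= X by rewrite leq_mul2r MA orbT.
have M2 : 5000 <= M * M by apply: leq_trans (leq_mul M300 M300).
have a1 : 400 * (n + 1) * (trunc_log 2 n + 3) <= 800 * X.
  have h : n + 1 <= 2 * T by rewrite eT; move: n0; clear; lia.
  have := leq_mul (leq_mul (leqnn 400) h) nM; rewrite -!mulnA [T * M]mulnC => h'; apply: leq_trans h' _.
  by move: TX; move: (M * T) => x; clear; lia.
have a2 : 1000 * l * (n + wm + 1) <= 3000 * X.
  have h : n + wm + 1 <= 3 * T by rewrite eT; move: n0 wT; clear; lia.
  have := leq_mul (leq_mul (leqnn 1000) (ltnW lM)) h => h'; apply: leq_trans h' _.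
  rewrite -mulnA [M * _]mulnCA; by move: TX; move: (M * T) => x; clear; lia.
have a3 : 5000 * l.+1 * (16 * l).+1 * (l ^ 14 * wm ^ 2 + wm) <= M ^ 5 * X.
  have h : (16 * l).+1 <= 16 * M by move: lM; clear; lia.
  apply: leq_trans (leq_mul (leq_mul (leq_mul M2 lM) h) wX2) _.
  have -> : M * M * M * (16 * M) * (2 * X) = M ^ 4 * 32 * X.
    by rewrite !expnS expn0 muln1; move: (X) (M) => y m; clear; lia.
  rewrite leq_mul2r [M ^ 5]expnSr leq_mul2l; apply/orP; right; apply/orP; right; exact: leq_trans M300.
have XM : X <= M ^ 5 * X by rewrite leq_pmull // expn_gt0 M0.
have a4 : 5000 * X <= M ^ 5 * X.
  by rewrite leq_mul2r (leq_trans M2) ?orbT // mulnn leq_pexp2l.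
have e20 : T * M ^ 20 = M * (M ^ 5 * X).
  by rewrite /X /A -[20]/(1 + 5 + 14) !expnD expn1 mulnC -!mulnA.
have l1 : l <= X by apply: leq_trans (ltnW lM) (leq_trans _ TX); rewrite leq_pmulr.
have b1 : n <= X by apply: leq_trans (_ : T <= _); [rewrite eT leq_addr | rewrite leq_pmull].
have b2 : wm <= X.
  by apply: leq_trans wT (leq_trans (_ : _ <= T) _); [rewrite eT leq_addl | rewrite leq_pmull].
have X1 : 1 <= X by rewrite muln_gt0 A0.
have fin : t <= 2 * (5000 * X) + M ^ 5 * X.
  move: tb a1 a2 a3 wX b1 b2 l1 X1 n0 wm0.
  move: (400 * (n + 1) * _) (1000 * l * _) (5000 * l.+1 * _ * _) (l ^ 12 * _ * _) (M ^ 5 * X) (X) => c1 c2 c3 c4 c5 c6.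
  by clear; lia.
rewrite e20; apply: leq_trans fin _.
apply: leq_trans (_ : 3 * (M ^ 5 * X) <= _); last by rewrite leq_mul2r (leq_trans _ M300) ?orbT.
by move: a4; move: (5000 * X) (M ^ 5 * X) => x y; clear; lia.
Qed.

Lemma optimal_value_ext n p p' w w' W z : (forall x, x < n -> p x = p' x) ->
  (forall x, x < n -> w x = w' x) -> optimal_value n p w W z -> optimal_value n p' w' W z.
Proof.
have e f f' (X : pred nat) : (forall x, x < n -> f x = f' x) ->
    \sum_(0 <= i < n | X i) f i = \sum_(0 <= i < n | X i) f' i.
  by move=> h; rewrite !big_mkord; apply: eq_bigr => i _; apply: h.
move=> ep ew [[X Xw Xp] mx]; split=> [|Y]; first by exists X; rewrite -?(e _ _ _ ew) -?(e _ _ _ ep).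
by rewrite -(e _ _ _ ew) -(e _ _ _ ep); apply: mx.
Qed.

(** Without items the answer 0 already stands in register 0, which holds [n]. *)
Definition solve_prog : prog :=
  (If ($0)
     (max_prog ;; sum_prog ;; log_prog ;; sort_prog ;; copy_prog ;; greedy_prog ;;
      bucket_prog ;; level_prog ;; setup_prog ;; loop_prog ;; final_prog)
     Skip)%prog.

Lemma sum_le_const n Z (f : nat -> nat) : (forall x, x < n -> f x <= Z) -> \sum_(0 <= i < n) f i <= n * Z.
Proof.
move=> h; apply: leq_trans (_ : \sum_(0 <= i < n) Z <= _); last by rewrite sum_nat_const_nat subn0.
by rewrite !big_mkord; apply: leq_sum => i _; apply: h.
Qed.

Lemma solve_prog_ok b s n W p w Z (wm := \max_(0 <= i < n) w i) (T := n + wm ^ 2) :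
  0 < b -> Z ^ (258 * 20) <= wsize b ->
  regs s 0 = n -> regs s 1 = W -> mem s 0 = p -> mem s 1 = w ->
  (forall a x, 2 <= a -> mem s a x = 0) -> 0 < n ->
  (forall x, x < n -> 0 < w x) -> (forall x, x < n -> n + W + p x + wm + 2 <= Z) ->
  (forall x y, x < n -> y < n -> x != y -> p x * w y != p y * w x) ->
  runs b solve_prog s (fun s' t => optimal_value n p w W (regs s' 0) /\
    t <= T * (trunc_log 2 T + 300) ^ 20).
Proof.
move=> b0 ZB e0 e1 ep ew ez n0 w0 Zb dist; set B := wsize b in ZB.
have wle x : x < n -> w x <= wm.
  by move=> xn; rewrite /wm big_mkord (leq_bigmax (Ordinal xn)).
have wm0 : 0 < wm by apply: leq_trans (w0 0 n0) (wle 0 n0).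
have Z0 := Zb 0 n0.
have [nZ WZ wZ] : [/\ n <= Z, W <= Z & wm + 2 <= Z] by move: Z0; clear; split; lia.
have Z3 : 3 <= Z by move: wZ wm0; clear; lia.
have ZZ : Z + Z + Z <= Z * Z by have := leq_mul Z3 (leqnn Z); clear; lia.
have pZ x : x < n -> p x <= Z by move=> /Zb; clear; lia.
have wZ' x : x < n -> w x <= Z by move=> /wle; move: wZ; clear; lia.
have SpZ : \sum_(0 <= i < n) p i <= Z * Z by apply: leq_trans (sum_le_const pZ) _; rewrite leq_mul2r nZ orbT.
have SwZ : \sum_(0 <= i < n) w i <= Z * Z by apply: leq_trans (sum_le_const wZ') _; rewrite leq_mul2r nZ orbT.
have pwZ x y : x < n -> y < n -> p x * w y <= Z * Z by move=> xn yn; rewrite leq_mul ?pZ ?wZ'.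
have [B512 Z2B] : 512 < B /\ 64 * (Z * Z) < B.
  have [||X [[X1 X2 _ _ X5] _]] := @word_bounds Z (256 + (trunc_log 2 wm).+1) (trunc_log 2 wm).+1 wm B wZ wm0 erefl _ _ ZB.
  - exact: trunc_log_ltn.
  - by right; apply: trunc_logP.
  by move: X1 X2 X5; clear; split; lia.
have nB : n < B by move: nZ Z2B ZZ; clear; lia.
apply: runs_if => //=; rewrite e0 -lt0n n0.
apply: runs_seq; apply: (runs_weaken (max_prog_ok b0 B512 _)); rewrite ?e0 // => s1 t1 fr1 [].
rewrite ?e0 ew -/wm => a2 tb1.
have a0 : regs s1 0 = n by rewrite (proj1 fr1 0 isT).
have f0 : mem s1 0 = p by rewrite (proj2 fr1 0 isT).
apply: runs_seq; apply: (runs_weaken (sum_prog_ok b0 B512 _ _)); rewrite ?a0 ?f0 //.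
  by move: SpZ Z2B ZZ Z3; clear; lia.
move=> s2 t2 fr2 []; rewrite ?a0 ?f0 => b4 tb2.
have b2 : regs s2 2 = wm by rewrite (proj1 fr2 2 isT).
apply: runs_seq; apply: (runs_weaken (log_prog_ok b0 B512 _)); rewrite ?b2.
  by move: wZ Z2B ZZ B512; clear; lia.
move=> s3 t3 fr3 [[k [c3 wk kw]] tb3].
have c0 : regs s3 0 = n by rewrite (proj1 fr3 0 isT) (proj1 fr2 0 isT).
have g0 : mem s3 0 = p by rewrite (proj2 fr3 0 isT) (proj2 fr2 0 isT).
have g1 : mem s3 1 = w by rewrite (proj2 fr3 1 isT) (proj2 fr2 1 isT) (proj2 fr1 1 isT).
apply: runs_seq; apply: (runs_weaken (sort_prog_ok b0 B512 _ _ _)); rewrite ?c0 ?g0 ?g1 //.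
- by move: nZ Z2B ZZ; clear; lia.
- by move=> x y xn yn; apply: leq_ltn_trans (pwZ x y xn yn) _; move: Z2B ZZ Z3; clear; lia.
move=> s4 t4 fr4 [sa srt tb4]; set a := mem s4 2 in sa srt.
have ran := same_items_range sa.
have d0 : regs s4 0 = n by rewrite (proj1 fr4 0 isT).
have h0 : mem s4 0 = p by rewrite (proj2 fr4 0 isT).
have h1 : mem s4 1 = w by rewrite (proj2 fr4 1 isT).
apply: runs_seq; apply: (runs_weaken (copy_prog_ok b0 B512 _)); rewrite ?d0 //.
move=> s5 t5 fr5; rewrite ?h0 ?h1 -?/a => -[ep5 ew5 tb5].
set p' := mem s5 4 in ep5; set w' := mem s5 5 in ew5.
have i0 : regs s5 0 = n by rewrite (proj1 fr5 0 isT).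
have i1 : regs s5 1 = W.
  by rewrite (proj1 fr5 1 isT) (proj1 fr4 1 isT) (proj1 fr3 1 isT) (proj1 fr2 1 isT) (proj1 fr1 1 isT).
have Sp : \sum_(0 <= i < n) p' i = \sum_(0 <= i < n) p i.
  by rewrite -(sa p) !big_mkord; apply: eq_bigr => i _; rewrite ep5.
have Sw : \sum_(0 <= i < n) w' i = \sum_(0 <= i < n) w i.
  by rewrite -(sa w) !big_mkord; apply: eq_bigr => i _; rewrite ew5.
have w0' x : x < n -> 0 < w' x by move=> xn; rewrite ew5 // w0 // ran.
have wle' x : x < n -> w' x <= wm by move=> xn; rewrite ew5 // wle // ran.
(* Sorting yields only a weak inequality; it is strict because the ratios are distinct and [a]
   repeats no item. *)
have ratio_dec x y : x < y -> y < n -> p' y * w' x < p' x * w' y.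
  move=> xy yn; have xn := ltn_trans xy yn; rewrite !ep5 // !ew5 // ltn_neqAle.
  rewrite dist ?ran //; first exact: srt.
  by apply/eqP => e; rewrite (same_items_inj sa yn xn e) ltnn in xy.
apply: runs_seq; apply: (runs_weaken (greedy_prog_ok b0 B512 _ _ _ _)); rewrite ?i0 ?i1 ?Sp ?Sw //.
- by move: WZ Z2B ZZ Z3; clear; lia.
- by move: SpZ Z2B; clear; lia.
- by move: SwZ Z2B; clear; lia.
move=> s6 t6 fr6 [[g [j5 gn j6 j7 [gfit gbr]]] tb6].
have j0 : regs s6 0 = n by rewrite (proj1 fr6 0 isT).
have k4 : mem s6 4 = p' by rewrite (proj2 fr6 4 isT).
have k5 : mem s6 5 = w' by rewrite (proj2 fr6 5 isT).
have k9 v : mem s6 9 v = 0.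
  by rewrite (proj2 fr6 9 isT) (proj2 fr5 9 isT) (proj2 fr4 9 isT) (proj2 fr3 9 isT) (proj2 fr2 9 isT) (proj2 fr1 9 isT) ez.
have k10 v : mem s6 10 v = 0.
  by rewrite (proj2 fr6 10 isT) (proj2 fr5 10 isT) (proj2 fr4 10 isT) (proj2 fr3 10 isT) (proj2 fr2 10 isT) (proj2 fr1 10 isT) ez.
have wn : wm * n + n < B.
  have : wm * n <= Z * Z by rewrite leq_mul // (leq_trans _ wZ) // leq_addr.
  by move: nZ Z2B ZZ; clear; lia.
apply: runs_seq; apply: (runs_weaken (@bucket_prog_ok b b0 B512 s6 wm _ _ _ _ _ _)); rewrite ?j0 ?j5 ?k4 ?k5 //.
move=> s7 t7 fr7 [l9 l10 l8 tb7].
have [l el] : exists l, l = 256 + k by exists (256 + k).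
rewrite -el in c3.
have m0 : regs s7 0 = n by rewrite (proj1 fr7 0 isT).
have m2 : regs s7 2 = wm.
  by rewrite (proj1 fr7 2 isT) (proj1 fr6 2 isT) (proj1 fr5 2 isT) (proj1 fr4 2 isT) (proj1 fr3 2 isT).
have m3 : regs s7 3 = l.
  by rewrite (proj1 fr7 3 isT) (proj1 fr6 3 isT) (proj1 fr5 3 isT) (proj1 fr4 3 isT).
have m5 : regs s7 5 = g by rewrite (proj1 fr7 5 isT).
have n5 : mem s7 5 = w' by rewrite (proj2 fr7 5 isT).
have n7 v : mem s7 7 v = 0.
  by rewrite (proj2 fr7 7 isT) (proj2 fr6 7 isT) (proj2 fr5 7 isT) (proj2 fr4 7 isT) (proj2 fr3 7 isT) (proj2 fr2 7 isT) (proj2 fr1 7 isT) ez.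
have l256 : 256 <= l by rewrite el leq_addr.
have l0 : 0 < l by apply: leq_trans l256.
have [X [[X1 X2 X3 X4 X5] CENE]] := word_bounds wZ wm0 el wk kw ZB.
set CEN := l ^ 12 * (wm + 1) * wm in X4 CENE.
have C4 : 4 * CEN + 8 <= X.
  by apply: leq_trans X4; rewrite leq_pmull // !muln_gt0 /= (leq_trans _ Z3).
have lp10 : l ^ 10 * (wm + 1) <= CEN.
  rewrite -[l ^ 10 * _]muln1 /CEN leq_mul // leq_mul // leq_pexp2l //.
have nX : n + wm + l <= X by apply: leq_trans X2; move: Z0 ZZ; clear; lia.
apply: runs_seq; apply: (runs_weaken (level_prog_ok b0 B512 _ _ _ _ _)); rewrite ?m0 ?m2 ?m3 ?m5 ?n5 //.
  rewrite -mulnA; move: lp10 C4 nX X1 X5; move: (l ^ 10 * _) => y; clear; lia.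
move=> s8 t8 fr8 [e7 tb8]; set cls := level_upto n g wm l w' l in e7.
have p2 : regs s8 2 = wm by rewrite (proj1 fr8 2 isT).
have p3 : regs s8 3 = l by rewrite (proj1 fr8 3 isT).
apply: runs_seq; apply: (runs_weaken (setup_prog_ok b0 B512 _ _ _ _)); rewrite ?p2 ?p3 //.
- by move: X3 X1 X5; move: (2 ^ _) => y; clear; lia.
- by rewrite -/CEN; move: C4 X1 X5; clear; lia.
move=> s9 t9 fr9 [su1 su2 m11 tb9].
have q0 : regs s9 0 = n by rewrite (proj1 fr9 0 isT) (proj1 fr8 0 isT).
have q2 : regs s9 2 = wm by rewrite (proj1 fr9 2 isT).
have q3 : regs s9 3 = l by rewrite (proj1 fr9 3 isT).
have b8 : regs s8 4 = (\sum_(0 <= i < n) p' i).+1.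
  by rewrite Sp (proj1 fr8 4 isT) (proj1 fr7 4 isT) (proj1 fr6 4 isT) (proj1 fr5 4 isT) (proj1 fr4 4 isT) (proj1 fr3 4 isT).
have q4 : regs s9 4 = (\sum_(0 <= i < n) p' i).+1 by rewrite (proj1 fr9 4 isT).
have [r7 r8 r9 r10] : [/\ mem s9 7 = mem s8 7, mem s9 8 = mem s7 8, mem s9 9 = mem s7 9 & mem s9 10 = mem s7 10].
  by rewrite (proj2 fr9 7 isT) (proj2 fr9 8 isT) (proj2 fr9 9 isT) (proj2 fr9 10 isT)
     (proj2 fr8 8 isT) (proj2 fr8 9 isT) (proj2 fr8 10 isT).
have r11 x : mem s8 11 x = 0.
  by rewrite (proj2 fr8 11 isT) (proj2 fr7 11 isT) (proj2 fr6 11 isT) (proj2 fr5 11 isT) (proj2 fr4 11 isT)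
     (proj2 fr3 11 isT) (proj2 fr2 11 isT) (proj2 fr1 11 isT) ez.
have wl : wm + 4 < 2 ^ l.
  rewrite el expnD; apply: leq_trans (_ : 2 ^ 3 * 2 ^ k <= _); last by rewrite leq_mul2r leq_exp2l // orbT.
  by move: wk wm0; move: (2 ^ k) => y; rewrite -[2 ^ 3]/8; clear; lia.
have wJ : wm < 2 ^ l by apply: leq_ltn_trans wl; apply: leq_addr.
(* The number [J] of levels is taken to be [l], which is possible since [wm < 2 ^ l]. *)
have [m [mr mW mopt near]] := @optimal_counts n wm l l W g p' w' cls w0' wle' l256 wl (leqnn l) wJ
  ratio_dec gn gfit gbr (heavy_left g wm l w') (heavy_right n g wm l w')
  (fun j _ => left_spec l gn wle' j) (fun j _ => right_spec l gn wle' j)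
  (fun j v jl _ => @level_upto_ge n g wm l w' l j v jl) (fun v _ => @level_upto_ex n g wm l w' l v).
pose q v k := p' (item n w' v k).
have qdec v k' : k'.+1 < nitem n w' v -> q v k'.+1 <= q v k'.
  by apply: (item_dec w0' ratio_dec).
have p'le x : x < n -> p' x <= (\sum_(0 <= i < n) p' i).+1.
  by move=> xn; rewrite big_mkord (bigD1 (Ordinal xn)) //= -addnS leq_addr.
have qBIG v k' : k' < nitem n w' v -> q v k' <= (\sum_(0 <= i < n) p' i).+1.
  by move=> /item_mem[h _]; apply: p'le.
have cr v : nprefix g w' v <= nitem n w' v := nprefix_le w' gn v.
have PE : sumw wm predT (fun v => ps q v (nitem n w' v)) = \sum_(0 <= i < n) p' i.
  by rewrite (psum_total p' wle').
have bigB : ((\sum_(0 <= i < n) p' i).+1 + \sum_(0 <= i < n) p' i + n + wm + 2) * (4 * CEN + 8) < B.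
  apply: leq_ltn_trans (leq_mul (_ : _ <= 4 * (Z * Z)) (leqnn _)) _.
    by move: SpZ Z0 ZZ; rewrite Sp; move: (\sum_(_ <= _ < _) _) => y; clear; lia.
  by apply: leq_ltn_trans X4 _; move: X1 X5; clear; lia.
rewrite -{2}PE in bigB.
have l32 : 32 <= l by apply: leq_trans l256.
have pB : 2 ^ (16 * l + 1) < B by move: X3 X1 X5; move: (2 ^ _) => y; clear; lia.
have tabs : [/\ forall v, mem s9 7 v = cls v, forall v, mem s9 9 v = nitem n w' v,
    forall v, mem s9 10 v = nprefix g w' v &
    forall v k, k < nitem n w' v -> mem s9 8 (v * n + k) = q v k].
  by rewrite r7 r8 r9 r10.
have tab0 x : mem s9 11 x = if x == CEN then (\sum_(0 <= i < n) p' i).+1 else 0.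
  by rewrite m11 /update r11 b8.
have R := (loop_prog_ok b0 B512 cr mr qdec qBIG
  (nitem_le n w') l32 wm0 (level_upto_le n g wm l w' l) near (level_cost gn wle' wm0 l256)
  pB CENE wn bigB (And4 q0 q2 q3 q4) su1 su2 tabs tab0).
apply: runs_seq; apply: (runs_weaken R).
move=> s10 t10 fr10 [up low tb10].
have x1 : regs s10 1 = W.
  by rewrite (proj1 fr10 1 isT) (proj1 fr9 1 isT) (proj1 fr8 1 isT) (proj1 fr7 1 isT) (proj1 fr6 1 isT).
have x4 : regs s10 4 = (\sum_(0 <= i < n) p' i).+1 by rewrite (proj1 fr10 4 isT).
have x6 : regs s10 6 = \sum_(0 <= i < g) w' i.
  by rewrite (proj1 fr10 6 isT) (proj1 fr9 6 isT) (proj1 fr8 6 isT) (proj1 fr7 6 isT).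
have x7 : regs s10 7 = \sum_(0 <= i < g) p' i.
  by rewrite (proj1 fr10 7 isT) (proj1 fr9 7 isT) (proj1 fr8 7 isT) (proj1 fr7 7 isT).
have x49 : regs s10 49 = CEN by rewrite (proj1 fr10 49 isT); case: su1.
have valS : \sum_(0 <= i < g) p' i <= Z * Z by apply: leq_trans (sum_prefix_le p' gn) _; rewrite Sp.
apply: (runs_weaken (@final_prog_ok b b0 B512 s10
  ((\sum_(0 <= i < n) p' i).+1 + \sum_(0 <= i < n) p' i) _ _ _ _)); rewrite ?x1 ?x4 ?x6 ?x7 ?x49.
- by move: WZ Z2B ZZ; clear; lia.
- by move: C4 X1 X5; clear; lia.
- by move=> x; have := upper_inv_le x up; rewrite PE.
- by move: valS SpZ Z2B ZZ Z3; rewrite Sp; move: (\sum_(_ <= _ < n) _) => y; clear; lia.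
move=> s11 t11 _ [-> tb11].
have near' : \sum_(v < wm.+1) v * m v <= \sum_(v < wm.+1) v * nprefix g w' v + window l wm l.
  by have [] := near l predT (leqnn l) (fun v _ => level_upto_le n g wm l w' l v).
rewrite (table_value w0' wle' gn gfit mr mW mopt (window_CEN wm l l) near' up low); split; last first.
  apply: (@time_bound n wm k) => //; rewrite -el.
  rewrite -/CEN; move: tb1 tb2 tb3 tb4 tb5 tb6 tb7 tb8 tb9 tb10 tb11; move: (CEN) => y4.
  rewrite ?a0 ?b2 !addn1; move: (400 * _ * _) (1000 * _ * _) (5000 * _ * _ * _) => y1 y2 y3.
  by clear; lia.
apply: (optimal_value_reorder sa); apply: (optimal_value_ext ep5 ew5).
split; last exact: mopt.
have [Y [Yw Yp]] := @first_items n wm p' w' wle' m mr.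
by exists Y; rewrite ?Yw.
Qed.

(** For [T >= 2] the logarithm is at least 1, so the additive constants can be turned into
    factors. *)
Lemma softO_polylog c d e : softO_id (fun T => T * (trunc_log 2 T + c) ^ d + e).
Proof.
exists d, (c.+1 ^ d + e), 2 => T T2; set L := trunc_log 2 T.
have L0 : 0 < L by rewrite trunc_log_gt0.
have h : L + c <= c.+1 * L by rewrite mulSn leq_add2l leq_pmulr.
have : (L + c) ^ d <= c.+1 ^ d * L ^ d.
  by rewrite -expnMn; case: (posnP d) => [->|d0]; rewrite ?expn0 // leq_exp2r.
move=> /(leq_mul (leqnn T)) h1.
have h2 : e <= e * (T * L ^ d) by rewrite leq_pmulr // muln_gt0 expn_gt0 L0 (leq_trans _ T2).
rewrite mulnDl; apply: leq_add => //; apply: leq_trans h1 _; by rewrite mulnCA.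
Qed.

Section Knapsack.
Variable I : knapsack.
Notation n := (nitems I).

Lemma input_arrayE (f : 'I_n -> nat) (i : 'I_n) : input_array f i = f i.
Proof. by rewrite /input_array insubT // => h; congr f; apply: val_inj. Qed.

Lemma max_input (f : 'I_n -> nat) : \max_(0 <= i < n) input_array f i = \max_(i < n) f i.
Proof. by rewrite big_mkord; apply: eq_bigr => i _; rewrite input_arrayE. Qed.

Lemma optimal_value_opt z :
  optimal_value n (input_array (@profit I)) (input_array (@weight I)) (budget I) z ->
  z = knapsack_opt I.
Proof.
have sumE f (X : pred nat) (x : {ffun 'I_n -> bool}) : (forall i : 'I_n, X i = x i) ->
    \sum_(0 <= i < n | X i) input_array f i = \sum_(i < n) f i * x i.
  move=> Xx; rewrite big_mkord big_mkcond; apply: eq_bigr => i _.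
  by rewrite Xx input_arrayE; case: (x i); rewrite ?muln1 ?muln0.
case=> [[X Xw Xp] mx]; apply/eqP; rewrite eqn_leq; apply/andP; split.
  pose x := [ffun i : 'I_n => X i]; have Xx (i : 'I_n) : X i = x i by rewrite ffunE.
  rewrite -Xp (sumE _ _ _ Xx); apply: (bigmax_sup x) => //.
  by rewrite -(sumE _ _ _ Xx).
apply/bigmax_leqP => x xw; pose X' : pred nat := fun k => if insub k is Some i then x i else false.
have Xx (i : 'I_n) : X' i = x i by rewrite /X' insubT // => h; congr (x _); apply: val_inj.
by rewrite -(sumE _ _ _ Xx); apply: mx; rewrite (sumE _ _ _ Xx).
Qed.

Lemma ratio_eq (i j : 'I_n) : positive_weights I ->
  profit i * weight j = profit j * weight i -> ratio i = ratio j.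
Proof.
move=> pos e; apply/eqP; rewrite /ratio GRing.eqr_div; last first.
- by rewrite Num.Theory.pnatr_eq0 -lt0n pos.
- by rewrite Num.Theory.pnatr_eq0 -lt0n pos.
by rewrite -!GRing.natrM e.
Qed.
End Knapsack.

Theorem theorem7p1 :
  solvable_in_softO
    (fun I : knapsack => positive_weights I /\ distinct_ratios I)
    (fun I : knapsack => nitems I + wmax I ^ 2).
Proof.
(* The word length makes room for [Z ^ (258 * 20)], where [Z] bounds all input numbers. The summand
   3 pays for the instance without items, for which the time parameter is 0. *)
exists solve_prog, (258 * 20), (fun T => T * (trunc_log 2 T + 300) ^ 20 + 3).
split; first exact: softO_polylog.
move=> I b [pos dist] hb; set n := nitems I.
set Z := n + budget I + pmax I + wmax I + 2.
have Zb : Z <= 2 ^ input_bits I by apply: up_logP.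
have bits0 : 0 < input_bits I.
  by rewrite lt0n; apply/eqP => e; move: Zb; rewrite e expn0 /Z; clear; lia.
have b0 : 0 < b by apply: leq_trans hb; rewrite muln_gt0.
case: (posnP n) => [n0|n0].
  exists (init_state I), 3; split=> //; last by rewrite leq_addl.
    apply: (@ExecIf _ _ _ _ _ _ n) => //; rewrite n0 /=; exact: ExecSkip.
  rewrite /= -/n n0; apply/esym/eqP; rewrite -leqn0; apply/bigmax_leqP => x _.
  by rewrite big1 // => i _; case/negP: (negbT (ltn0 i)); rewrite -n0 ltn_ord.
have ZB : Z ^ (258 * 20) <= wsize b.
  apply: leq_trans (_ : 2 ^ (input_bits I * (258 * 20)) <= _).
    by rewrite (expnM 2) leq_exp2r.
  by rewrite /wsize leq_exp2l // mulnC.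
have [|x xn|x xn|x y xn yn xy|s [t [ex [opt tb]]]] :=
  @solve_prog_ok b (init_state I) n (budget I) (input_array (@profit I)) (input_array (@weight I)) Z b0 ZB erefl erefl erefl erefl _ n0.
- by case=> [|[|a]] x.
- by rewrite -[x]/(val (Ordinal xn)) input_arrayE.
- rewrite -[x]/(val (Ordinal xn)) input_arrayE max_input /Z -/(wmax I).
  have : profit (Ordinal xn) <= pmax I by apply: (leq_bigmax (Ordinal xn)).
  by rewrite -/n; clear; lia.
- rewrite -[x]/(val (Ordinal xn)) -[y]/(val (Ordinal yn)) !input_arrayE; apply/eqP => /(ratio_eq pos)/eqP.
  by apply/negP; apply: dist; rewrite -val_eqE.
exists s, t; split=> //; first exact: optimal_value_opt.
by rewrite max_input in tb; apply: leq_trans tb (leq_addr _ _).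
Qed.
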